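(* Let $(h,\omega)$ be a three-dimensional Einstein--Weyl structure with vanishing scalar curvature $W$. Then either $(h,\omega)$ is flat, or the signature is $(++-)$ and, for a suitable choice of representative $(h,\omega)$ (i.e. after a change $h\mapsto\phi^2h$, $\omega\mapsto\omega+2\,d\ln\phi$), there exist local coordinates $x^i=(y,x,t)$ such that $\omega=y\,dt$ and $h$ is given by one of the two solutions $$h_1=dy^2+2\,dx\,dt+\Big(x\big[R(t)-\tfrac{y}{2}\big]+\tfrac{1}{48}y^4+\tfrac{1}{12}R(t)y^3+S(t)y\Big)dt^2,$$ $$h_2=dy^2+2\,dx\,dt-\frac{4x}{y}\,dy\,dt+\Big(\frac{x^2}{y^2}+\frac{xy}{2}+\frac18y^4+R(t)y^2+S(t)y\Big)dt^2,$$ where $R(t)$ and $S(t)$ are arbitrary functions with continuous second derivatives.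
   Context: A Weyl structure on a 3-manifold consists of a torsion-free connection $D$ and a conformal class $[h]$ of (Riemannian or Lorentzian) metrics with $D_ih_{jk}=\omega_ih_{jk}$ for a one-form $\omega$; under $h\to\phi^2h$ one has $\omega\to\omega+2\,d\ln\phi$, and $(h,\omega)$ and $(\phi^2h,\omega+2\,d\ln\phi)$ represent the same structure. Indices are raised and lowered with $h$; $\nabla$ is the Levi-Civita connection of $h$ and $R_{ij}$ its Ricci tensor. The Ricci tensor of $D$ is $$W_{ij}=R_{ij}+\nabla_i\omega_j-\tfrac12\nabla_j\omega_i+\tfrac14\omega_i\omega_j+h_{ij}\big(-\tfrac14\omega_k\omega^k+\tfrac12\nabla_k\omega^k\big),$$ and the scalar curvature is $W=h^{ij}W_{ij}$; it is conformally invariant of weight $-2$, so the condition $W=0$ is well defined. The structure is Einstein--Weyl if $W_{(ij)}=\frac13Wh_{ij}$, where round brackets denote symmetrization. It is flat if the curvature of $D$ vanishes. Products such as $dx\,dt$ are symmetric products, so $2\,dx\,dt$ means $h_{xt}=h_{tx}=1$.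
   Formalization: The local coordinates are obtained around every point of an open set dense in the non-flat locus, not around every point: at flat points, and at points where the h_1 and h_2 regions meet, neither form exists. Structures (h, ω) are taken to be smooth. *)

(* Defs.v *)
(* MathComp-Analysis, over an arbitrary [R : realType]. *)
From HB Require Import structures.
From mathcomp Require Import all_boot all_order all_algebra.
From mathcomp Require Import all_classical all_reals all_analysis.

Set Implicit Arguments.
Unset Strict Implicit.
Unset Printing Implicit Defensive.

Import Order.TTheory GRing.Theory Num.Theory.
Import numFieldNormedType.Exports.
Local Open Scope classical_set_scope.
Local Open Scope ring_scope.

Section Calculus.
Context {R : realType}.
Local Notation E := 'rV[R]_3.
Implicit Types (U : set E) (f : E -> R) (x : E) (i j : 'I_3).

Definition partial i f x : R := 'D_(delta_mx 0 i) f x.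

(* On an open [U] this is C^oo: every iterated partial derivative exists and is
   continuous at every point of [U]. *)
Definition smooth_on U f : Prop :=
  forall (s : seq 'I_3) x, U x ->
    {for x, continuous (foldr partial f s)} /\
    forall i, derivable (foldr partial f s) x (delta_mx 0 i).

Definition C2_on (J : set R) (g : R -> R) : Prop :=
  forall t, J t ->
    [/\ derivable g t 1, derivable (derive1 g) t 1
      & {for t, continuous (derive1n 2 g)}].

Definition gradient f x : E := \row_i partial i f x.

(* [jacobian tau x i k] is the derivative of the k-th component in direction i. *)
Definition jacobian (tau : E -> E) x : 'M[R]_3 :=
  \matrix_(i, k) partial i (fun z => tau z 0 k) x.

End Calculus.

Section Manifold.
Variables (R : realType) (M : topologicalType).
Local Notation E := 'rV[R]_3.

(* Outside [chart_dom] and its image the two maps take junk values. *)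
Record chart := Chart {
  chart_dom : set M;
  chart_map : M -> E;
  chart_inv : E -> M;
  chart_open : open chart_dom;
  chart_img_open : open (chart_map @` chart_dom);
  chart_mapK : {in chart_dom, cancel chart_map chart_inv};
  chart_map_cont : {within chart_dom, continuous chart_map};
  chart_inv_cont : {within chart_map @` chart_dom, continuous chart_inv} }.

Definition chart_img (a : chart) : set E := chart_map a @` chart_dom a.

Definition transition (a b : chart) : E -> E := chart_map b \o chart_inv a.

Definition overlap (a b : chart) : set E :=
  chart_map a @` (chart_dom a `&` chart_dom b).

Definition chart_compatible (a b : chart) : Prop :=
  (forall k, smooth_on (overlap a b) (fun x => transition a b x 0 k)) /\
  (forall k, smooth_on (overlap b a) (fun x => transition b a x 0 k)).

(* [A] is a maximal smooth atlas, so that its members are all the local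
   coordinate systems of the 3-manifold [M]. *)
Definition smooth_3manifold (A : set chart) : Prop :=
  [/\ hausdorff_space M /\ @second_countable M,
      \bigcup_(a in A) chart_dom a = setT,
      (forall a b, A a -> A b -> chart_compatible a b) &
      (forall c, (forall a, A a -> chart_compatible a c) -> A c)].

End Manifold.

Section CoordinateFormulas.
Context {R : realType}.
Local Notation E := 'rV[R]_3.
Implicit Types (h : E -> 'M[R]_3) (omega : E -> 'rV[R]_3) (x : E).

(* Connection coefficients: [G k i j x] is Gamma^k_{ij}, i being the index of
   the direction of differentiation. *)
Definition connection := 'I_3 -> 'I_3 -> 'I_3 -> E -> R.

Definition levi_civita h : connection := fun k i j x =>
  2^-1 * \sum_l invmx (h x) k l *
    (partial i (fun z => h z j l) x + partial j (fun z => h z i l) x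
     - partial l (fun z => h z i j) x).

(* R^k_{lij} *)
Definition curvature (G : connection) (k l i j : 'I_3) x : R :=
  partial i (G k j l) x - partial j (G k i l) x
  + \sum_m (G k i m x * G m j l x - G k j m x * G m i l x).

(* Ricci tensor of the Levi-Civita connection, positive on round spheres. *)
Definition ricci h (i j : 'I_3) x : R :=
  \sum_k curvature (levi_civita h) k j k i x.

Definition nabla h omega (i j : 'I_3) x : R :=
  partial i (fun z => omega z 0 j) x
  - \sum_k levi_civita h k i j x * omega x 0 k.

Definition weyl_ricci h omega (i j : 'I_3) x : R :=
  ricci h i j x + nabla h omega i j x - 2^-1 * nabla h omega j i x
  + 4^-1 * (omega x 0 i * omega x 0 j)
  + h x i j *
    (- 4^-1 * (\sum_k \sum_l invmx (h x) k l * omega x 0 k * omega x 0 l)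
     + 2^-1 * (\sum_k \sum_l invmx (h x) k l * nabla h omega k l x)).

Definition weyl_scalar h omega x : R :=
  \sum_i \sum_j invmx (h x) i j * weyl_ricci h omega i j x.

Definition einstein_weyl_at h omega x : Prop :=
  forall i j, 2^-1 * (weyl_ricci h omega i j x + weyl_ricci h omega j i x)
              = 3^-1 * weyl_scalar h omega x * h x i j.

(* D_i h_jk = omega_i h_jk at [x], for the connection D with coefficients [G] *)
Definition weyl_compatible_at h omega (G : connection) x : Prop :=
  forall i j k,
    partial i (fun z => h z j k) x
    - \sum_l G l i j x * h x l k - \sum_l G l i k x * h x j l
    = omega x 0 i * h x j k.

Definition has_signature (d : 'rV[R]_3) (H : 'M[R]_3) : Prop :=
  exists P : 'M[R]_3, P \in unitmx /\ P *m H *m P^T = diag_mx d.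

Definition sig_riemannian : 'rV[R]_3 := const_mx 1.

(* (++-) *)
Definition sig_lorentzian : 'rV[R]_3 := \row_i (if i == ord_max then -1 else 1).

End CoordinateFormulas.

Arguments connection : clear implicits.

Section WeylStructures.
Variables (R : realType) (M : topologicalType) (A : set (chart R M)).
Local Notation E := 'rV[R]_3.
(* A tensor field is the family of its components in all charts of the maximal
   atlas, subject to the transformation law on overlaps. *)
Implicit Types (h : chart R M -> E -> 'M[R]_3)
  (omega : chart R M -> E -> 'rV[R]_3) (D : chart R M -> connection R).

Definition metric_of_signature (d : 'rV[R]_3) h : Prop :=
  forall a x, A a -> chart_img a x -> has_signature d (h a x).

Definition smooth_metric h : Prop :=
  [/\ (forall a x, A a -> chart_img a x -> (h a x)^T = h a x),
      (forall a i j, A a -> smooth_on (chart_img a) (fun x => h a x i j)),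
      (forall a b x, A a -> A b -> overlap a b x ->
         let J := jacobian (transition a b) x in
         h a x = J *m h b (transition a b x) *m J^T) &
      metric_of_signature sig_riemannian h
      \/ metric_of_signature sig_lorentzian h].

Definition smooth_one_form omega : Prop :=
  (forall a i, A a -> smooth_on (chart_img a) (fun x => omega a x 0 i)) /\
  (forall a b x, A a -> A b -> overlap a b x ->
     omega a x =
     omega b (transition a b x) *m (jacobian (transition a b) x)^T).

(* The last two conditions determine the coefficients of D uniquely from
   (h, omega); in particular their smoothness and their transformation law under
   changes of charts are automatic. *)
Definition weyl_structure h omega D : Prop :=
  [/\ smooth_metric h, smooth_one_form omega,
      (forall a x k i j, A a -> chart_img a x -> D a k i j x = D a k j i x) &
      (forall a x, A a -> chart_img a x ->
         weyl_compatible_at (h a) (omega a) (D a) x)].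

Definition einstein_weyl h omega : Prop :=
  forall a x, A a -> chart_img a x -> einstein_weyl_at (h a) (omega a) x.

Definition vanishing_scalar_curvature h omega : Prop :=
  forall a x, A a -> chart_img a x -> weyl_scalar (h a) (omega a) x = 0.

Definition flat_at D (p : M) : Prop :=
  forall a, A a -> chart_dom a p ->
    forall k l i j, curvature (D a) k l i j (chart_map a p) = 0.

Definition flat D : Prop := forall p, flat_at D p.

End WeylStructures.

Section NormalForms.
Context {R : realType}.
Local Notation E := 'rV[R]_3.

(* The coordinates are ordered (y, x, t). *)
Definition iy : 'I_3 := @Ordinal 3 0 isT.
Definition ix : 'I_3 := @Ordinal 3 1 isT.
Definition it : 'I_3 := @Ordinal 3 2 isT.
Definition dy : 'rV[R]_3 := delta_mx 0 iy.
Definition dx : 'rV[R]_3 := delta_mx 0 ix.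
Definition dt : 'rV[R]_3 := delta_mx 0 it.

Definition sym_prod (a b : 'rV[R]_3) : 'M[R]_3 :=
  2^-1 *: (a^T *m b + b^T *m a).

Definition omega_normal (q : E) : 'rV[R]_3 := q 0 iy *: dt.

Definition h1 (r s : R -> R) (q : E) : 'M[R]_3 :=
  let y := q 0 iy in let x := q 0 ix in let t := q 0 it in
  sym_prod dy dy + 2 *: sym_prod dx dt
  + (x * (r t - y / 2) + y ^+ 4 / 48 + r t * y ^+ 3 / 12 + s t * y)
    *: sym_prod dt dt.

(* Only meaningful where y <> 0. *)
Definition h2 (r s : R -> R) (q : E) : 'M[R]_3 :=
  let y := q 0 iy in let x := q 0 ix in let t := q 0 it in
  sym_prod dy dy + 2 *: sym_prod dx dt - (4 * x / y) *: sym_prod dy dt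
  + (x ^+ 2 / y ^+ 2 + x * y / 2 + y ^+ 4 / 8 + r t * y ^+ 2 + s t * y)
    *: sym_prod dt dt.

Definition t_range (U : set E) : set R := (fun q => q 0 it) @` U.

End NormalForms.

(* In the coordinates c, after the rescaling h -> phi^2 h,
   omega -> omega + 2 d ln phi on the domain of c, the structure is
   (h1, y dt) or (h2, y dt).  Neither form need be available on the boundary
   between the regions where h1 and where h2 applies: for lambda(t) vanishing at
   an isolated t0 there are structures of the same kind with dy dt coefficient
   - 4 lambda x / (1 + lambda y), of type h2 for t <> t0 and of neither type at
   t = t0.  Hence such charts can only be asked for around the points of an open
   set which is dense in the locus where D is not flat. *)
Definition in_normal_form (R : realType) (M : topologicalType)
    (h : chart R M -> 'rV[R]_3 -> 'M[R]_3)
    (omega : chart R M -> 'rV[R]_3 -> 'rV[R]_3) (c : chart R M) : Prop :=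
  exists (phi : 'rV[R]_3 -> R) (r s : R -> R),
    [/\ smooth_on (chart_img c) phi /\ (forall q, chart_img c q -> 0 < phi q),
        C2_on (t_range (chart_img c)) r /\ C2_on (t_range (chart_img c)) s,
        (forall q, chart_img c q ->
           omega c q + 2 *: gradient (fun z => ln (phi z)) q = omega_normal q) &
        (forall q, chart_img c q -> phi q ^+ 2 *: h c q = h1 r s q) \/
        (forall q, chart_img c q ->
           q 0 iy != 0 /\ phi q ^+ 2 *: h c q = h2 r s q)].

(* The pair (h, omega) of coordinate expressions is, at the point q, a
   Lorentzian Einstein-Weyl structure with vanishing scalar curvature. *)
Definition solution_at (R : realType) (h : 'rV[R]_3 -> 'M[R]_3)
    (omega : 'rV[R]_3 -> 'rV[R]_3) (q : 'rV[R]_3) : Prop :=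
  [/\ has_signature sig_lorentzian (h q), einstein_weyl_at h omega q
    & weyl_scalar h omega q = 0].

(* Main.v *)
(* Write F = d omega, n for the vector density dual to F and L = h(n, .). When the symmetrised Ricci tensor
   of D vanishes, dimension three forces the whole curvature of D to be an algebraic expression in n and h. The first
   Bianchi identity is then automatic, and the second one says dL = theta /\ L for a connection form theta on densities
   with d theta = - F / 2, so that d(dL) = 0 gives L(n) = 0: n is null. In Riemannian signature n = 0 and D is flat.
   In Lorentzian signature, where n <> 0, L is proportional to some dt, and F vanishes on the leaves of t; hence in a
   suitable gauge omega = y dt. In coordinates (y, x, t), with x any coordinate not constant along n, the metric is
   a dy^2 + 2 b dy dt + 2 c dx dt + e dt^2 with a = a(t), and a, c are normalised to 1. The remaining equations give
   b_xx = 0 and b_yx = b_x^2 / 2. Either b_x = 0 on an open set, where a shear x -> x + g(y, t) removes b and leads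
   to h1, or b_x = - 2 / (y + mu(t)) near some point, where a rescaling and two shears lead to h2. *)
Require Import Defs.
From HB Require Import structures.
From mathcomp Require Import all_boot all_order all_algebra.
From mathcomp Require Import all_classical all_reals all_analysis.
From mathcomp Require Import ring lra.
Set Implicit Arguments.
Unset Strict Implicit.
Unset Printing Implicit Defensive.
Import Order.TTheory GRing.Theory Num.Theory.
Import numFieldNormedType.Exports.
Local Open Scope classical_set_scope.
Local Open Scope ring_scope.


(** Why the curvature is algebraic: lower one index and trade the pair of form indices for a dual
    index p. The part symmetric in the two remaining indices is - n_p h_kl / 2, because D multiplies
    h by omega; the antisymmetric part is dual to a 3 by 3 matrix. The symmetrised Ricci tensor sees
    only the symmetric half of that matrix, and the cyclic identity expresses the other half by L.
    The leaves of t are integral surfaces of ker L. Since n lies in ker L, F restricts to zero on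
    them, so omega has a primitive along the leaves, and subtracting its differential leaves a
    multiple of dt. As F = dy /\ dt, the functions y and t are independent wherever F does not
    vanish. The relation b_yx = b_x^2 / 2 says that 1 / b_x has y-derivative - 1 / 2; this is where
    mu(t) comes from. The obstacle is a point where b_x vanishes without vanishing nearby. The base
    point is therefore allowed to move during the normalisations, while the charts stay inside a
    prescribed open set; the outcome is density of the good points, not a chart at each non-flat
    point. *)

(** * Continuity and derivatives of real-valued functions *)

Section Pointwise.
Context {R : realType}.

Lemma contD (T : topologicalType) (f g : T -> R) x : {for x, continuous f} ->
  {for x, continuous g} -> {for x, continuous (fun z => f z + g z)}.
Proof. move=> cf cg; exact: (@continuousD R R^o T f g x cf cg). Qed.

Lemma contN (T : topologicalType) (f : T -> R) x : {for x, continuous f} ->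
  {for x, continuous (fun z => - f z)}.
Proof. move=> cf; exact: (@continuousN R R^o T f x cf). Qed.

Lemma contM (T : topologicalType) (f g : T -> R) x : {for x, continuous f} ->
  {for x, continuous g} -> {for x, continuous (fun z => f z * g z)}.
Proof. move=> cf cg; exact: (@continuousM R T f g x cf cg). Qed.

Lemma contC (T : topologicalType) (c : R) (x : T) : {for x, continuous (fun _ : T => c)}.
Proof. exact: cvg_cst. Qed.

Lemma cont_comp (T U V : topologicalType) (f : T -> U) (g : U -> V) x :
  {for x, continuous f} -> {for f x, continuous g} -> {for x, continuous (fun z => g (f z))}.
Proof. by move=> cf cg; exact: (@continuous_comp T U V f g x cf cg). Qed.

(** The rules are stated for functions in applied form with values in the field itself, so that
    [is_derive_poly] can chain them by syntax alone. *)
Lemma isdD (V : normedModType R) (f g : V -> R) x v (a b : R) :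
  is_derive x v f a -> is_derive x v g b -> is_derive x v (fun z => f z + g z) (a + b).
Proof. move=> Hf Hg; exact: (@is_deriveD R V R^o f g x v a b Hf Hg). Qed.

Lemma isdN (V : normedModType R) (f : V -> R) x v (a : R) :
  is_derive x v f a -> is_derive x v (fun z => - f z) (- a).
Proof. move=> Hf; exact: (@is_deriveN R V R^o f x v a Hf). Qed.

Lemma isdB (V : normedModType R) (f g : V -> R) x v (a b : R) :
  is_derive x v f a -> is_derive x v g b -> is_derive x v (fun z => f z - g z) (a - b).
Proof. by move=> Hf Hg; apply: isdD => //; exact: isdN. Qed.

Lemma isdM (V : normedModType R) (f g : V -> R) x v (a b : R) :
  is_derive x v f a -> is_derive x v g b ->
  is_derive x v (fun z => f z * g z) (a * g x + f x * b).
Proof.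
move=> Hf Hg; rewrite addrC (mulrC a).
exact: (@is_deriveM R V f g x v a b Hf Hg).
Qed.

Lemma isdC (V : normedModType R) (c : R) (x v : V) : is_derive x v (fun _ => c) (0 : R).
Proof. exact: (@is_derive_cst R V R^o c x v). Qed.

Lemma isd_eq (V : normedModType R) (f : V -> R) x v (a b : R) :
  is_derive x v f a -> a = b -> is_derive x v f b.
Proof. by move=> H <-. Qed.

Lemma isd_id (s : R) : is_derive s 1 (fun u : R => u) (1 : R).
Proof. exact: is_derive_id. Qed.

Lemma isd_comp (f g : R -> R) (s a b : R) : is_derive (g s) 1 f a -> is_derive s 1 g b ->
  is_derive s 1 (fun u => f (g u)) (a * b).
Proof. move=> Hf Hg; exact: (@is_derive1_comp R f g s a b Hf Hg). Qed.

End Pointwise.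

(** * Coordinate lines, cubes and the mean value theorem *)

Section Lines.
Context {R : realType}.
Local Notation E := 'rV[R]_3.
Implicit Types (U : set E) (f : E -> R) (x : E) (i j : 'I_3).

Lemma ord3_ind (P : 'I_3 -> Prop) : P iy -> P ix -> P it -> forall i, P i.
Proof.
move=> P0 P1 P2 [[|[|[|//]]] Hi].
- by have -> : Ordinal Hi = iy by exact: val_inj.
- by have -> : Ordinal Hi = ix by exact: val_inj.
- by have -> : Ordinal Hi = it by exact: val_inj.
Qed.

Lemma sum3E (V : nmodType) (F : 'I_3 -> V) : \sum_i F i = F iy + F ix + F it.
Proof.
rewrite !big_ord_recl big_ord0 addr0 addrA.
by congr (F _ + F _ + F _); exact: val_inj.
Qed.

(** Lines in coordinate directions are parametrised by the value of the coordinate, so that a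
    partial derivative at [x] is an ordinary derivative at [x 0 i] ([is_derive_line]). *)
Definition upd x i (s : R) : E := \row_j (if j == i then s else x 0 j).

Lemma updE x i s j : upd x i s 0 j = if j == i then s else x 0 j.
Proof. by rewrite mxE. Qed.

Lemma upd_same x i s : upd x i s 0 i = s.
Proof. by rewrite updE eqxx. Qed.

Lemma upd_other x i s j : j != i -> upd x i s 0 j = x 0 j.
Proof. by rewrite updE => /negbTE ->. Qed.

Lemma upd_upd x i s t : upd (upd x i s) i t = upd x i t.
Proof. by apply/rowP => j; rewrite !updE; case: (j == i). Qed.

Lemma updC x i j s t : i != j -> upd (upd x i s) j t = upd (upd x j t) i s.
Proof.
move=> ij; apply/rowP => k; rewrite !updE.
by case: (eqVneq k j) => // ->; rewrite eq_sym (negbTE ij).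
Qed.

Lemma upd_id x i : upd x i (x 0 i) = x.
Proof. by apply/rowP => j; rewrite updE; case: eqP => // ->. Qed.

Lemma updDe x i s h : h *: delta_mx 0 i + upd x i s = upd x i (h + s).
Proof.
apply/rowP => j; rewrite !mxE eqxx /=.
by case: (j == i); rewrite ?mulr1 // mulr0 add0r.
Qed.

Local Opaque upd partial.

Lemma is_derive_upd f x i s d :
  is_derive (upd x i s) (delta_mx 0 i) f d <->
  is_derive s 1 (fun u => f (upd x i u)) d.
Proof.
have H : (fun h : R => h^-1 *: (f (h *: delta_mx 0 i + upd x i s) - f (upd x i s)))
       = (fun h : R => h^-1 *: (f (upd x i (h *: 1 + s)) - f (upd x i s))).
  by apply/funext => h; rewrite updDe [h *: 1]mulr1.
split=> -[H1 H2].
  by apply: DeriveDef; rewrite /derivable /derive /= -H.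
by apply: DeriveDef; rewrite /derivable /derive /= H.
Qed.

Lemma is_derive_line f x i d :
  is_derive x (delta_mx 0 i) f d <->
  is_derive (x 0 i) 1 (fun u => f (upd x i u)) d.
Proof. by rewrite -is_derive_upd upd_id. Qed.

Lemma derivable_partial f x i : derivable f x (delta_mx 0 i) ->
  is_derive x (delta_mx 0 i) f (partial i f x).
Proof. exact: derivableP. Qed.

(** The end points come in either order, which spares later mean value arguments a case distinction
    on the sign of [b - a]. *)
Definition between (a b s : R) : Prop := a <= s <= b \/ b <= s <= a.

Lemma between_le (a b s p r : R) : between a b s ->
  `|a - p| < r -> `|b - p| < r -> `|s - p| < r.
Proof.
move=> H; rewrite !ltr_norml => /andP[H1 H2] /andP[H3 H4].
by apply/andP; split; case: H => /andP[H5 H6]; lra.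
Qed.

Lemma is_derive_cont (F : R -> R) (s d : R) : is_derive s 1 F d -> {for s, continuous F}.
Proof.
by move=> [H _]; apply/differentiable_continuous; rewrite -derivable1_diffP.
Qed.

Lemma mvt_between (F dF : R -> R) (a b : R) :
  (forall s, between a b s -> is_derive s 1 F (dF s)) ->
  exists2 c, between a b c & F b - F a = dF c * (b - a).
Proof.
wlog ab : a b / a <= b.
  move=> W H; have [ab|ba] := leP a b; first exact: W.
  have [|c c1 c2] := W b a (ltW ba).
    by move=> s Hs; apply: H; case: Hs; [right|left].
  by exists c; [case: c1; [right|left]|rewrite -opprB c2 -mulrN opprB].
move=> H; have [||c c1 c2] := @MVT_segment R F dF a b ab.
- by move=> s; rewrite in_itv /= => /andP[s1 s2]; apply: H; left; rewrite !ltW.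
- apply: derivable_within_continuous => s; rewrite in_itv /= => Hs.
  by have [] := H s (or_introl Hs).
- by exists c => //; left; move: c1; rewrite in_itv.
Qed.

Lemma mvt_line f x i s :
  (forall u, between (x 0 i) s u -> derivable f (upd x i u) (delta_mx 0 i)) ->
  exists2 c, between (x 0 i) s c &
    f (upd x i s) - f x = partial i f (upd x i c) * (s - x 0 i).
Proof.
move=> H.
have [|c c1 c2] := @mvt_between (fun u => f (upd x i u))
   (fun u => partial i f (upd x i u)) (x 0 i) s.
  by move=> u /H /derivable_partial /is_derive_upd.
by exists c => //; rewrite -c2 upd_id.
Qed.

(** A ball of the maximum norm: one coordinate can be changed freely within its range without
    leaving the set ([cube_upd]). *)
Definition cube x (r : R) : set E := [set z | forall j, `|z 0 j - x 0 j| < r].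

Lemma cube_ball x r : 0 < r -> cube x r = ball x r.
Proof.
move=> r0; rewrite predeqE => z; split.
  by move=> H; split=> // i j; rewrite !ord1 /ball /= distrC.
by move=> [_ H] j; move: (H 0 j); rewrite /ball /= distrC.
Qed.

Lemma cube_open x r : open (cube x r).
Proof.
have [r0|r0] := ltP 0 r; first by rewrite cube_ball //; exact: ball_open.
rewrite (_ : cube x r = set0); first exact: open0.
by rewrite predeqE => z; split=> // /(_ 0); rewrite ltNge (le_trans r0) ?normr_ge0.
Qed.

Lemma cube_center x r : 0 < r -> cube x r x.
Proof. by move=> r0 j; rewrite subrr normr0. Qed.

Lemma nbhs_cube x r : 0 < r -> nbhs x (cube x r).
Proof. by move=> r0; rewrite cube_ball //; exact: nbhsx_ballx. Qed.

Lemma nbhs_cubeP x (A : set E) : nbhs x A <-> exists2 r : R, 0 < r & cube x r `<=` A.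
Proof.
split=> [/nbhs_ballP[r /= r0 rA]|[r r0 rA]].
  by exists r => //; rewrite cube_ball.
by apply/nbhs_ballP; exists r => //; rewrite -cube_ball.
Qed.

Lemma open_cube U x : open U -> U x -> exists2 r : R, 0 < r & cube x r `<=` U.
Proof. by move=> oU Ux; apply/nbhs_cubeP/open_nbhs_nbhs. Qed.

Lemma cont_eps f x : {for x, continuous f} ->
  forall e : R, 0 < e -> exists2 r : R, 0 < r & forall z, cube x r z -> `|f z - f x| < e.
Proof.
move=> cf e e0; have /cvgrPdist_lt /(_ e e0) /nbhs_cubeP[r r0 H] := cf.
by exists r => // z /H; rewrite distrC.
Qed.

Lemma eps_cont f x :
  (forall e : R, 0 < e -> exists2 r : R, 0 < r & forall z, cube x r z -> `|f z - f x| <= e) ->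
  {for x, continuous f}.
Proof.
move=> H; suff : f @ x --> f x by [].
apply/(@cvgrPdist_le R R^o E (nbhs x) (nbhs_filter x)) => e e0; have [r r0 Hr] := H e e0.
by apply/nbhs_cubeP; exists r => // z /Hr; rewrite distrC.
Qed.

Lemma cube_sub x r r' : r <= r' -> cube x r `<=` cube x r'.
Proof. by move=> rr z Hz j; exact: lt_le_trans (Hz j) rr. Qed.

Lemma cube_upd x r z i s : cube x r z -> `|s - x 0 i| < r -> cube x r (upd z i s).
Proof. by move=> Hz Hs j; rewrite updE; case: eqP => // ->. Qed.

Lemma filter_ord3 (T : Type) (F : set_system T) (FF : Filter F) (P : 'I_3 -> set T) :
  (forall j, F (P j)) -> F [set t | forall j, P j t].
Proof.
move=> H; move: (H iy) (H ix) (H it); apply: filterS3 => t h0 h1 h2 j.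
by elim/ord3_ind: j.
Qed.

Lemma cvg_cubeP (T : Type) (F : set_system T) (FF : Filter F) (u : T -> E) x :
  (forall j, (fun t => u t 0 j) @ F --> x 0 j) -> u @ F --> x.
Proof.
move=> H A /nbhs_cubeP[r r0 rA].
apply: filterS; first by move=> t; exact: rA.
have Hj j : \forall t \near F, `|u t 0 j - x 0 j| < r.
  have /cvgrPdist_lt /(_ r r0) := H j.
  by apply: filterS => t; rewrite distrC.
exact: filter_ord3.
Qed.

Lemma continuous_row (T : topologicalType) (u : T -> E) t :
  (forall j, {for t, continuous (fun s => u s 0 j)}) -> {for t, continuous u}.
Proof. by move=> H; apply: cvg_cubeP => j; exact: H. Qed.

Lemma upd_continuous x i s : {for s, continuous (upd x i)}.
Proof.
apply: continuous_row => j; rewrite /=.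
have [->|ji] := eqVneq j i.
  by rewrite (_ : (fun _ => _) = id); [exact: cvg_id|apply/funext => u; rewrite upd_same].
rewrite (_ : (fun _ => _) = cst (x 0 j)); first exact: cvg_cst.
by apply/funext => u; rewrite upd_other.
Qed.

Lemma sum3_le (e c0 c1 c2 p0 p1 p2 a0 a1 a2 : R) :
  `|c0 - p0| <= e -> `|c1 - p1| <= e -> `|c2 - p2| <= e ->
  `|c0 * a0 + c1 * a1 + c2 * a2 - (p0 * a0 + p1 * a1 + p2 * a2)|
    <= e * (`|a0| + `|a1| + `|a2|).
Proof.
move=> H0 H1 H2.
have -> : c0 * a0 + c1 * a1 + c2 * a2 - (p0 * a0 + p1 * a1 + p2 * a2) =
  (c0 - p0) * a0 + (c1 - p1) * a1 + (c2 - p2) * a2 by ring.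
rewrite !mulrDr.
apply: le_trans (ler_normD _ _) _; apply: lerD.
  by apply: le_trans (ler_normD _ _) _; apply: lerD; rewrite normrM ler_wpM2r.
by rewrite normrM ler_wpM2r.
Qed.

(** A path from [u] to [w] along three coordinate edges stays in the cube. On each edge the mean
    value theorem produces one partial derivative, within [eps] of its value at [x]. *)
Lemma strict_diff U f x : open U -> U x ->
  (forall i z, U z -> derivable f z (delta_mx 0 i)) ->
  (forall i, {for x, continuous (partial i f)}) ->
  forall eps : R, 0 < eps -> exists2 r : R, 0 < r & cube x r `<=` U /\
    forall u w, cube x r u -> cube x r w ->
    `|f w - f u - \sum_k partial k f x * (w 0 k - u 0 k)|
      <= eps * \sum_k `|w 0 k - u 0 k|.
Proof.
move=> oU Ux df cf e e0.
have Hk k : \forall z \near x, `|partial k f x - partial k f z| < e.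
  by have /cvgrPdist_lt /(_ e e0) := cf k.
have /nbhs_cubeP[r r0 rH] : \forall z \near x, U z /\ forall k, `|partial k f x - partial k f z| < e.
  by apply: filterI; [exact: open_nbhs_nbhs|exact: filter_ord3].
exists r => //; split; first by move=> z /rH [].
move=> u w Hu Hw.
have step z i : cube x r z -> exists2 c, `|c - partial i f x| <= e &
    f (upd z i (w 0 i)) - f z = c * (w 0 i - z 0 i).
  move=> Hz.
  have [|c c1 c2] := @mvt_line f z i (w 0 i).
    move=> c c1; apply: df; apply: (rH _ _).1; apply: cube_upd => //.
    exact: between_le c1 (Hz _) (Hw _).
  exists (partial i f (upd z i c)) => //; rewrite distrC ltW //.
  apply: (rH _ _).2; apply: cube_upd => //.
  exact: between_le c1 (Hz _) (Hw _).
have [u0 u0E] : exists u0, u0 = upd u iy (w 0 iy) by exists (upd u iy (w 0 iy)).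
have [u1 u1E] : exists u1, u1 = upd u0 ix (w 0 ix) by exists (upd u0 ix (w 0 ix)).
have Hu0 : cube x r u0 by rewrite u0E; exact: cube_upd.
have Hu1 : cube x r u1 by rewrite u1E; exact: cube_upd.
have wE : upd u1 it (w 0 it) = w.
  by rewrite u1E u0E; apply/rowP => j; elim/ord3_ind: j; rewrite !updE.
have := step u iy Hu; rewrite -u0E => -[c0 C0 D0].
have := step u0 ix Hu0; rewrite -u1E => -[c1 C1 D1].
have := step u1 it Hu1; rewrite wE => -[c2 C2 D2].
have E1 : u0 0 ix = u 0 ix by rewrite u0E upd_other.
have E2 : u1 0 it = u 0 it by rewrite u1E u0E !upd_other.
rewrite E1 in D1; rewrite E2 in D2.
rewrite !sum3E; apply: le_trans (sum3_le _ _ _ C0 C1 C2).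
have <- : f w - f u =
    c0 * (w 0 iy - u 0 iy) + c1 * (w 0 ix - u 0 ix) + c2 * (w 0 it - u 0 it).
  by rewrite -D0 -D1 -D2; move: (f w) (f u) (f u0) (f u1) => ? ? ? ?; ring.
exact: lexx.
Qed.

End Lines.

(** * The chain rule and the classes C^k *)

Section Chain.
Context {R : realType}.
Local Notation E := 'rV[R]_3.
Implicit Types (U : set E) (f : E -> R) (x : E) (i j : 'I_3).
Local Opaque upd partial.

Definition rV_dot (c v : E) : R := \sum_k c 0 k * v 0 k.

Lemma rV_dot_linear (c : E) : linear (rV_dot c).
Proof.
move=> a u v; rewrite /rV_dot scaler_sumr -big_split /=.
by apply: eq_bigr => k _; rewrite !mxE mulrDr mulrCA.
Qed.
HB.instance Definition _ (c : E) :=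
  GRing.isLinear.Build R E R _ (rV_dot c) (@rV_dot_linear c).

Lemma rV_dot_continuous (c : E) : continuous (rV_dot c).
Proof.
rewrite /rV_dot; under eq_fun do rewrite sum3E.
have H k (y : E) : {for y, continuous (fun v : E => c 0 k * v 0 k)}.
  by apply: contM; [exact: contC|exact: coord_continuous].
by move=> y; exact: (contD (contD (H iy y) (H ix y)) (H it y)).
Qed.

Lemma coord_norm_le (v : E) k : `|v 0 k| <= `|v|.
Proof.
rewrite /Num.norm /= mx_normrE; exact: (le_bigmax _ (fun ij => `|v ij.1 ij.2|) (0, k)).
Qed.

Lemma C1_littleo U f x : open U -> U x ->
  (forall i z, U z -> derivable f z (delta_mx 0 i)) ->
  (forall i, {for x, continuous (partial i f)}) ->
  f \o shift x = cst (f x) + rV_dot (gradient f x) +o_ (0:E) id.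
Proof.
move=> oU Ux df cf; apply/eqaddoP => e e0.
(* The bound sums three coordinate increments, each at most the norm. *)
have e30 : 0 < e / 3 by rewrite divr_gt0.
have [r r0 [_ H]] := strict_diff oU Ux df cf e30.
apply/nbhs_cubeP; exists r => // h Hh /=.
have := H x (h + x) (cube_center _ r0).
have -> : \sum_k partial k f x * ((h + x) 0 k - x 0 k) = rV_dot (gradient f x) h.
  by apply: eq_bigr => k _; rewrite !mxE addrK.
rewrite -addrA -opprD => HH.
rewrite -[X in `|X| <= _]/(f (h + x) - (f x + rV_dot (gradient f x) h)).
apply: le_trans (HH _) _.
  by move=> j; rewrite !mxE addrK; have := Hh j; rewrite mxE subr0.
rewrite -mulrA ler_pM2l // ler_pdivrMl //.
rewrite sum3E !mxE !addrK.
have := coord_norm_le h iy; have := coord_norm_le h ix; have := coord_norm_le h it.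
by move: `|_ _ iy| `|_ _ ix| `|_ _ it| `|h| => ? ? ? ?; lra.
Qed.

Lemma C1_differentiable U f x : open U -> U x ->
  (forall i z, U z -> derivable f z (delta_mx 0 i)) ->
  (forall i, {for x, continuous (partial i f)}) ->
  differentiable f x /\ 'd f x = rV_dot (gradient f x) :> (E -> R).
Proof.
move=> oU Ux df cf; have H := C1_littleo oU Ux df cf.
have Hd := diff_unique (@rV_dot_continuous (gradient f x)) H.
split=> //; apply/diff_locallyP; rewrite Hd; split=> //.
exact: rV_dot_continuous.
Qed.

Lemma is_derive_curve U f (g : R -> E) (s : R) (d : 'I_3 -> R) : open U -> U (g s) ->
  (forall i z, U z -> derivable f z (delta_mx 0 i)) ->
  (forall i, {for g s, continuous (partial i f)}) ->
  (forall k, is_derive s 1 (fun u => g u 0 k) (d k)) ->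
  is_derive s 1 (fun u => f (g u)) (\sum_k partial k f (g s) * d k).
Proof.
move=> oU Ux df cf dg.
have [Df dfE] := C1_differentiable oU Ux df cf.
have Dg : derivable g s 1.
  by apply/derivable_mxP => i j; rewrite ord1; have [] := dg j.
have Dg' : differentiable g s by apply/derivable1_diffP.
have Dfg : differentiable (f \o g) s by exact: differentiable_comp.
apply: DeriveDef; first by apply/derivable1_diffP.
rewrite (_ : (fun u => f (g u)) = f \o g) // deriveE // diff_comp //= dfE.
apply: eq_bigr => k _; rewrite mxE -deriveE // derive_mx // mxE.
by congr (_ * _); have [_ ->] := dg k.
Qed.

Lemma is_derive_partial f x i d : is_derive x (delta_mx 0 i) f d -> partial i f x = d.
Proof. by case=> _ <-. Qed.

(** Counting the order replaces the lists of directions of [smooth_on]: closure under an operation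
    is then an induction that uses its derivative formula once. *)
Fixpoint Ck U (n : nat) f : Prop :=
  (forall x, U x -> {for x, continuous f}) /\
  if n is m.+1 then
    forall i, (forall x, U x -> derivable f x (delta_mx 0 i)) /\ Ck U m (partial i f)
  else True.

Lemma Ck_cont U n f x : Ck U n f -> U x -> {for x, continuous f}.
Proof. by case: n => [|n] [H _]; exact: H. Qed.

Lemma Ck_der U n f i x : Ck U n.+1 f -> U x -> derivable f x (delta_mx 0 i).
Proof. by move=> [_ H]; exact: (H i).1. Qed.

Lemma Ck_is_derive U n f i x : Ck U n.+1 f -> U x ->
  is_derive x (delta_mx 0 i) f (partial i f x).
Proof. by move=> H Ux; apply: derivable_partial; exact: Ck_der H Ux. Qed.

Lemma Ck_partial U n f i : Ck U n.+1 f -> Ck U n (partial i f).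
Proof. by move=> [_ H]; exact: (H i).2. Qed.

Lemma Ck_mono U m n f : (m <= n)%N -> Ck U n f -> Ck U m f.
Proof.
elim: n m f => [|n IH] [|m] f //= mn [H1 H2]; split=> // i; have [H3 H4] := H2 i.
by split=> //; exact: IH.
Qed.

Lemma Ck_pred U n f : Ck U n.+1 f -> Ck U n f.
Proof. exact: Ck_mono. Qed.

Lemma Ck_sub U V n f : V `<=` U -> Ck U n f -> Ck V n f.
Proof.
move=> VU; elim: n f => [|n IH] f [H1 H2].
  by split=> // x /VU /H1.
split; first by move=> x /VU /H1.
by move=> i; have [H3 H4] := H2 i; split; [move=> x /VU /H3|exact: IH].
Qed.

Lemma smooth_Ck U f : smooth_on U f <-> forall n, Ck U n f.
Proof.
split=> [H n|H s x Ux].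
  elim: n f H => [|n IH] f H; first by split=> // x Ux; exact: (H [::] x Ux).1.
  split; first by move=> x Ux; exact: (H [::] x Ux).1.
  move=> i; split; first by move=> x Ux; exact: (H [::] x Ux).2.
  by apply: IH => s x Ux; have := H (rcons s i) x Ux; rewrite -cats1 foldr_cat.
(* [foldr] differentiates in the last listed direction first, so the list is taken apart from its
   end. *)
elim/last_ind: s f H => [|s i IH] f H.
  by split=> [|i]; [exact: (@Ck_cont U 0 f x (H 0%N) Ux)|exact: (@Ck_der U 0 f i x (H 1%N) Ux)].
rewrite -cats1 foldr_cat /=; apply: IH => n.
exact: Ck_partial (H n.+1).
Qed.

Lemma eq_on_near U f g x : open U -> U x -> (forall z, U z -> f z = g z) ->
  \forall z \near x, f z = g z.
Proof.
by move=> oU Ux H; apply: filterS (open_nbhs_nbhs (conj oU Ux)); exact: H.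
Qed.

Lemma cont_eq_on U f g x : open U -> U x -> (forall z, U z -> f z = g z) ->
  {for x, continuous f} -> {for x, continuous g}.
Proof.
move=> oU Ux H c; rewrite /prop_for /continuous_at -(H x Ux).
by move=> A /c; apply: (filterS2 _ _ (eq_on_near oU Ux H)) => z /= ->.
Qed.

Lemma partial_eq_on U f g i x : open U -> U x -> (forall z, U z -> f z = g z) ->
  partial i f x = partial i g x.
Proof. by move=> oU Ux H; apply: near_eq_derive; exact: eq_on_near H. Qed.

Lemma is_derive_eq_on U f g i x d : open U -> U x -> (forall z, U z -> f z = g z) ->
  is_derive x (delta_mx 0 i) f d -> is_derive x (delta_mx 0 i) g d.
Proof.
by move=> oU Ux H; apply: near_eq_is_derive; exact: eq_on_near H.
Qed.

Lemma Ck_eq U n f g : open U -> (forall z, U z -> f z = g z) -> Ck U n f -> Ck U n g.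
Proof.
move=> oU; elim: n f g => [|n IH] f g H Hf.
  by split=> // x Ux; exact: cont_eq_on H (Ck_cont Hf Ux).
split; first by move=> x Ux; exact: cont_eq_on H (Ck_cont Hf Ux).
move=> i; split.
  by move=> x Ux; have [] := is_derive_eq_on oU Ux H (Ck_is_derive i Hf Ux).
apply: IH (Ck_partial i Hf) => z Uz; exact: partial_eq_on H.
Qed.

Lemma CkS U n f (df : 'I_3 -> E -> R) : open U ->
  (forall i x, U x -> is_derive x (delta_mx 0 i) f (df i x)) ->
  (forall x, U x -> {for x, continuous f}) ->
  (forall i, Ck U n (df i)) -> Ck U n.+1 f.
Proof.
move=> oU H Hc Hd; split=> // i; split; first by move=> x Ux; have [] := H i x Ux.
apply: Ck_eq (Hd i) => // z Uz; symmetry; apply: is_derive_partial; exact: H.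
Qed.

Lemma C1_cont U f x : open U -> U x ->
  (forall i z, U z -> derivable f z (delta_mx 0 i)) ->
  (forall i, {for x, continuous (partial i f)}) -> {for x, continuous f}.
Proof.
move=> oU Ux H Hc; apply: differentiable_continuous.
by have [] := C1_differentiable oU Ux H Hc.
Qed.

(** Continuity of [f] comes for free from continuous partial derivatives, by [C1_cont]. Most
    regularity proofs below raise the order by this rule. *)
Lemma CkS' U n f (df : 'I_3 -> E -> R) : open U ->
  (forall i x, U x -> is_derive x (delta_mx 0 i) f (df i x)) ->
  (forall i, Ck U n (df i)) -> Ck U n.+1 f.
Proof.
move=> oU H Hd; apply: (CkS oU H _ Hd) => x Ux; apply: (C1_cont oU Ux).
  by move=> i z Uz; have [] := H i z Uz.
move=> i; have Hi : Ck U n (partial i f).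
  apply: Ck_eq (Hd i) => // z Uz; symmetry; apply: is_derive_partial; exact: H.
exact: Ck_cont Hi Ux.
Qed.

Lemma Ck_cst U n (c : R) : open U -> Ck U n (fun _ => c).
Proof.
move=> oU; elim: n c => [|n IH] c.
  by split=> // x _; exact: contC.
apply: (CkS' (df := fun _ _ => 0)) => // i x _; exact: isdC.
Qed.

Lemma is_derive_coord x i k : is_derive x (delta_mx 0 i) (fun z : E => z 0 k) ((i == k)%:R : R).
Proof.
apply/is_derive_line; have [->|ik] := eqVneq i k.
  rewrite (_ : (fun u : R => upd x k u 0 k) = id); first exact: isd_id.
  by apply/funext => u; rewrite upd_same.
rewrite (_ : (fun u : R => upd x i u 0 k) = cst (x 0 k)); first exact: isdC.
by apply/funext => u; rewrite upd_other // eq_sym.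
Qed.

Lemma partial_coord x i k : partial i (fun z : E => z 0 k) x = (i == k)%:R.
Proof. by apply: is_derive_partial; exact: is_derive_coord. Qed.

Lemma Ck_coord U n k : open U -> Ck U n (fun x : E => x 0 k).
Proof.
move=> oU; case: n => [|n].
  by split=> // x _; exact: coord_continuous.
apply: (CkS' (df := fun i _ => (i == k)%:R)) => // [i x _|i]; last exact: Ck_cst.
exact: is_derive_coord.
Qed.

Lemma Ck_add U n f g : open U -> Ck U n f -> Ck U n g -> Ck U n (fun x => f x + g x).
Proof.
move=> oU; elim: n f g => [|n IH] f g Hf Hg.
  split; last by []. move=> x Ux; exact: (contD (Ck_cont Hf Ux) (Ck_cont Hg Ux)).
apply: (CkS' (df := fun i x => partial i f x + partial i g x)) => // [i x Ux|i].
  by apply: isdD; [exact: Ck_is_derive Hf Ux|exact: Ck_is_derive Hg Ux].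
by apply: IH; exact: Ck_partial.
Qed.

Lemma Ck_opp U n f : open U -> Ck U n f -> Ck U n (fun x => - f x).
Proof.
move=> oU; elim: n f => [|n IH] f Hf.
  split; last by []. move=> x Ux; exact: (contN (Ck_cont Hf Ux)).
apply: (CkS' (df := fun i x => - partial i f x)) => // [i x Ux|i].
  by apply: isdN; exact: Ck_is_derive Hf Ux.
by apply: IH; exact: Ck_partial.
Qed.

Lemma Ck_mul U n f g : open U -> Ck U n f -> Ck U n g -> Ck U n (fun x => f x * g x).
Proof.
move=> oU; elim: n f g => [|n IH] f g Hf Hg.
  split; last by []. move=> x Ux; exact: (contM (Ck_cont Hf Ux) (Ck_cont Hg Ux)).
apply: (CkS' (df := fun i x => partial i f x * g x + f x * partial i g x)) => // [i x Ux|i].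
  by apply: isdM; [exact: Ck_is_derive Hf Ux|exact: Ck_is_derive Hg Ux].
apply: Ck_add => //; apply: IH; (try exact: Ck_partial); exact: Ck_pred.
Qed.

Lemma Ck_sum U (n : nat) (I : Type) (r : seq I) (P : pred I) (F : I -> E -> R) : open U ->
  (forall a, P a -> Ck U n (F a)) -> Ck U n (fun x => \sum_(a <- r | P a) F a x).
Proof.
move=> oU H; elim: r => [|a r IH].
  by rewrite (_ : (fun x => _) = fun=> 0); [exact: Ck_cst|apply/funext => x; rewrite big_nil].
rewrite (_ : (fun x => _) = fun x => (if P a then F a x else 0) + \sum_(b <- r | P b) F b x).
  apply: (Ck_add oU _ IH); case: (P a) (H a) => [/(_ isT)//|_]; exact: Ck_cst.
by apply/funext => x; rewrite big_cons; case: ifP => // _; rewrite add0r.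
Qed.

Lemma Ck_prod U (n : nat) (I : Type) (r : seq I) (P : pred I) (F : I -> E -> R) : open U ->
  (forall a, P a -> Ck U n (F a)) -> Ck U n (fun x => \prod_(a <- r | P a) F a x).
Proof.
move=> oU H; elim: r => [|a r IH].
  by rewrite (_ : (fun x => _) = fun=> 1); [exact: Ck_cst|apply/funext => x; rewrite big_nil].
rewrite (_ : (fun x => _) = fun x => (if P a then F a x else 1) * \prod_(b <- r | P b) F b x).
  apply: (Ck_mul oU _ IH); case: (P a) (H a) => [/(_ isT)//|_]; exact: Ck_cst.
by apply/funext => x; rewrite big_cons; case: ifP => // _; rewrite mul1r.
Qed.

End Chain.

(** * Primitives along a coordinate *)

Section Primitive.
Context {R : realType}.
Local Notation E := 'rV[R]_3.
Implicit Types (U : set E) (f F : E -> R) (x p : E) (i j : 'I_3) (r : R).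
Local Opaque upd partial.

Lemma antideriv1 (g : R -> R) (c M : R) : 0 < M -> continuous g ->
  exists2 G : R -> R, G c = 0 & forall s, `|s - c| < M -> is_derive s 1 G (g s).
Proof.
move=> M0 cg; set a := c - M; set u := c + M + 1.
have au : a < u by rewrite /a /u; lra.
have ig : (@lebesgue_measure R).-integrable `[a, u] (EFin \o g).
  apply: continuous_compact_integrable; first exact: segment_compact.
  exact: continuous_subspaceT.
pose F (v : R) := (\int[@lebesgue_measure R]_(t in [set` `[a, v]]) g t)%R.
(* The integral starts at the left end [c - M], so that the fundamental theorem applies at every
   later point; subtracting the value at [c] restores the base point. *)
exists (fun s => F s - F c); first by rewrite subrr.
move=> s; rewrite ltr_norml => /andP[s1 s2].
have su : s < u by rewrite /u; lra.
have as_ : a < s by rewrite /a; lra.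
have [H1 H2] := continuous_FTC1_closed su ig as_ (cg s).
rewrite -[g s]subr0; apply: (isdB _ (isdC _ _ _)).
by rewrite derive1E in H2; exact: (DeriveDef H1 H2).
Qed.

Lemma is_derive_eps (g : R -> R) (s d : R) :
  (forall e : R, 0 < e -> exists2 r : R, 0 < r & forall h : R, h != 0 -> `|h| < r ->
     `|h^-1 * (g (h + s) - g s) - d| <= e) -> is_derive s 1 g d.
Proof.
move=> H; have C : (fun h => h^-1 *: (g (h *: 1 + s) - g s)) @ 0^' --> d.
  apply/cvgrPdist_le => e e0; have [r r0 Hr] := H e e0.
  apply/nbhs_ballP; exists r => //= h; rewrite /ball /= sub0r normrN => hr h0.
  by rewrite distrC [h *: 1]mulr1; exact: Hr.
apply: DeriveDef; first by apply/cvg_ex; exists d.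
exact: cvg_lim C.
Qed.

(** By compactness of the segment one neighbourhood of [x] serves all [s]; [near_covering] states
    compactness in exactly this form. *)
Lemma segment_unif f i x (a b : R) :
  (forall s, between a b s -> {for upd x i s, continuous f}) ->
  forall e : R, 0 < e -> exists2 r : R, 0 < r & forall z s, cube x r z -> between a b s ->
    `|f (upd z i s) - f (upd x i s)| < e.
Proof.
move=> cf e e0.
wlog ab : a b cf / a <= b.
  move=> W; have [ab|ba] := leP a b; first exact: W.
  have [|r r0 Hr] := W b a _ (ltW ba).
    by move=> s Hs; apply: cf; case: Hs; [right|left].
  by exists r => // z s Hz Hs; apply: Hr => //; case: Hs; [right|left].
have Hc s (z : E) : {for (z, s), continuous (fun q : E * R => upd q.1 i q.2)}.
  apply: continuous_row => j.
  have [->|ji] := eqVneq j i.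
    rewrite (_ : (fun q => _) = snd); first exact: cvg_snd.
    by apply/funext => q; rewrite upd_same.
  rewrite (_ : (fun q => _) = (fun q : E * R => q.1 0 j)); last first.
    by apply/funext => q; rewrite upd_other.
  apply: (@cont_comp _ _ _ fst (fun y : E => y 0 j)); first exact: cvg_fst.
  exact: coord_continuous.
have cK : near_covering `[a, b].
  by apply/compact_near_coveringP; exact: segment_compact.
suff /nbhs_cubeP[r r0 Hr] : \forall z \near x, `[a, b] `<=` (fun s => `|f (upd z i s) - f (upd x i s)| < e).
  exists r => // z s Hz Hs; apply: (Hr z) => //=; rewrite in_itv /=; case: Hs => // /andP[H1 H2].
  by rewrite (le_trans ab H1) (le_trans H2 ab).
apply: (cK E (nbhs x) (fun z s => `|f (upd z i s) - f (upd x i s)| < e) (nbhs_filter x)).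
move=> s; rewrite /= in_itv /= => Hs.
  have cs := cf s (or_introl Hs).
  have e20 : 0 < e / 2 by rewrite divr_gt0.
  have H1 : \forall q \near (x, s), `|f (upd x i s) - f (upd q.1 i q.2)| < e / 2.
    have C : {for (x, s), continuous (fun q : E * R => f (upd q.1 i q.2))}.
      by apply: (@cont_comp _ _ _ (fun q : E * R => upd q.1 i q.2) f); [exact: Hc|exact: cs].
    by have /cvgrPdist_lt /(_ _ e20) := C.
  have H2 : \forall s' \near s, `|f (upd x i s) - f (upd x i s')| < e / 2.
    have C : {for s, continuous (fun s' : R => f (upd x i s'))}.
      by apply: (@cont_comp _ _ _ (upd x i) f); [exact: upd_continuous|exact: cs].
    by have /cvgrPdist_lt /(_ _ e20) := C.
  case: H1 => -[A B] /= [HA HB] HAB.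
  exists (B `&` [set s' | `|f (upd x i s) - f (upd x i s')| < e / 2], A).
    by split=> //=; apply: filterI.
  move=> -[s' z] /= [[Bs' Hs'] Az].
  have := HAB (z, s') (conj Az Bs') => /= Hzs.
  rewrite -[X in `|X|](subrKA (f (upd x i s))) (splitr e).
  apply: le_lt_trans (ler_normD _ _) _; apply: ltrD => //.
  by rewrite distrC.
Qed.

(** Vanishing on the hyperplane through the centre makes the primitive unique on the cube, so that
    derivatives and limits of primitives can be recognised as primitives again. *)
Definition is_primitive p r i f F : Prop :=
  (forall x, cube p r x -> x 0 i = p 0 i -> F x = 0) /\
  (forall x, cube p r x -> is_derive x (delta_mx 0 i) F (f x)).

(** A retraction onto the closed cube. Composing with it turns a function continuous on a larger
    cube into a globally continuous one. *)
Definition clamp p r x : E :=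
  \row_j Num.max (p 0 j - r) (Num.min (p 0 j + r) (x 0 j)).

Lemma clamp_continuous p r : continuous (clamp p r).
Proof.
move=> x; apply: continuous_row => j.
rewrite (_ : (fun s : E => _) = (fun s : E => Num.max (p 0 j - r) (Num.min (p 0 j + r) (s 0 j)))).
  apply: (@continuous_max _ _ (fun=> p 0 j - r) (fun s : E => Num.min (p 0 j + r) (s 0 j))).
    exact: contC.
  apply: (@continuous_min _ _ (fun=> p 0 j + r) (fun s : E => s 0 j)).
    exact: contC.
  exact: coord_continuous.
by apply/funext => s; rewrite mxE.
Qed.

Lemma clamp_cube p r r' x : 0 <= r' < r -> cube p r (clamp p r' x).
Proof.
move=> /andP[H0 H1] j; rewrite mxE; move: (p 0 j) (x 0 j) => a s.
have [m mE] : exists m, m = Num.max (a - r') (Num.min (a + r') s) by eexists.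
have H : a - r' <= m <= a + r'.
  by rewrite mE le_max lexx /= ge_max ge_min lexx /= andbT; lra.
by rewrite -mE; case/andP: H => H2 H3; rewrite ltr_norml; lra.
Qed.

Lemma clamp_id p r x : cube p r x -> clamp p r x = x.
Proof.
move=> H; apply/rowP => j; rewrite mxE; have := H j.
rewrite ltr_norml => /andP[]; move: (p 0 j) (x 0 j) => u v H1 H2.
rewrite min_r; last by lra.
by rewrite max_r //; lra.
Qed.

Lemma exists_primitive p r r' i f : 0 < r' -> r' < r ->
  (forall x, cube p r x -> {for x, continuous f}) ->
  exists F, is_primitive p r' i f F.
Proof.
move=> r0 rr cf.
pose fb x := f (clamp p r' x).
have cfb : continuous fb.
  move=> x; apply: (@cont_comp _ _ _ (clamp p r') f); first exact: clamp_continuous.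
  by apply: cf; apply: clamp_cube; rewrite ltW.
have Hl x : exists G : R -> R, G (p 0 i) = 0 /\
    forall s, `|s - p 0 i| < r' -> is_derive s 1 G (fb (upd x i s)).
  have [|G G0 HG] := @antideriv1 (fun s => fb (upd x i s)) (p 0 i) r' r0.
    by move=> s; apply: (@cont_comp _ _ _ (upd x i) fb); [exact: upd_continuous|exact: cfb].
  by exists G.
have [G HG] := choice Hl.
(* [upd x i 0] is one representative per line in direction [i]: all points of a line use the same
   antiderivative. *)
exists (fun x => G (upd x i 0) (x 0 i)); split.
  by move=> x _ ->; have [] := HG (upd x i 0).
move=> x Hx; apply/is_derive_line.
have [_ /(_ (x 0 i) (Hx i))] := HG (upd x i 0).
rewrite upd_upd upd_id /fb clamp_id //.
rewrite (_ : (fun u => _) = G (upd x i 0)) //.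
by apply/funext => u; rewrite upd_upd upd_same.
Qed.

Lemma line_bound (G dG : R -> R) (a b e : R) : G a = 0 ->
  (forall s, between a b s -> is_derive s 1 G (dG s)) ->
  (forall s, between a b s -> `|dG s| <= e) -> `|G b| <= e * `|b - a|.
Proof.
move=> G0 HG He; have [c c1] := mvt_between HG.
rewrite G0 subr0 => ->; rewrite normrM ler_wpM2r //; exact: He.
Qed.

Lemma primitive_line p r i f F x s : is_primitive p r i f F -> cube p r x ->
  `|s - p 0 i| < r -> is_derive s 1 (fun u => F (upd x i u)) (f (upd x i s)).
Proof. by move=> [_ H] Hx Hs; apply/is_derive_upd; apply: H; exact: cube_upd. Qed.

Lemma primitive_base p r i f F x : is_primitive p r i f F -> cube p r x -> 0 < r ->
  F (upd x i (p 0 i)) = 0.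
Proof.
move=> [H _] Hx r0; apply: H; last by rewrite upd_same.
by apply: cube_upd => //; rewrite subrr normr0.
Qed.

Lemma primitive_cont p r i f F x : is_primitive p r i f F ->
  (forall z, cube p r z -> {for z, continuous f}) -> cube p r x -> {for x, continuous F}.
Proof.
move=> HF cf Hx; have r0 : 0 < r by exact: le_lt_trans (Hx i).
have pi0 : `|p 0 i - p 0 i| < r by rewrite subrr normr0.
apply: eps_cont => e e0.
have B1 : 0 < e / 2 / r by rewrite !divr_gt0.
have [|r1 r10 H1] := @segment_unif f i x (p 0 i) (x 0 i) _ _ B1.
  by move=> s Hs; apply: cf; apply: cube_upd => //; exact: between_le Hs _ (Hx i).
have [r2 r20 H2] := cont_eps (cf x Hx) ltr01.
have [r3 r30 H3] := open_cube (@cube_open _ p r) Hx.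
have K0 : 0 < `|f x| + 1 by rewrite ltr_wpDl.
have B3 : 0 < e / 2 / (`|f x| + 1) by rewrite !divr_gt0.
have [rm [rm0 [m1 m2 m3 m4]]] : exists rm : R, 0 < rm /\
    [/\ rm <= r1, rm <= r2, rm <= r3 & rm <= e / 2 / (`|f x| + 1)].
  exists (Num.min r1 (Num.min r2 (Num.min r3 (e / 2 / (`|f x| + 1))))).
  by rewrite !lt_min r10 r20 r30 B3 !ge_min !lexx !orbT.
exists rm => // z Hz; have zc := H3 z (cube_sub m3 Hz).
(* One step along the line through [z], where the derivative [f] is bounded, and one across to the
   parallel line through [x], where the integrands are uniformly close. *)
have -> : F z - F x = (F z - F (upd z i (x 0 i))) + (F (upd z i (x 0 i)) - F x).
  by rewrite subrKA.
rewrite (splitr e); apply: le_trans (ler_normD _ _) _; apply: lerD.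
  have [|c c1 c2] := @mvt_line _ F z i (x 0 i).
    move=> u Hu; have [] := HF.2 (upd z i u) _ => //.
    by apply: cube_upd => //; exact: between_le Hu (zc i) (Hx i).
  rewrite distrC c2 normrM.
  have Hc : cube x rm (upd z i c).
    by apply: cube_upd => //; apply: between_le c1 (Hz i) _; rewrite subrr normr0.
  have Hc2 : `|f (upd z i c)| <= `|f x| + 1.
    rewrite -(subrK (f x) (f (upd z i c))) addrC.
    apply: le_trans (ler_normD _ _) _; rewrite lerD2l ltW //.
    exact: H2 (cube_sub m2 Hc).
  rewrite (is_derive_partial (HF.2 _ (H3 _ (cube_sub m3 Hc)))) distrC.
  apply: le_trans (ler_pM _ _ Hc2 (ltW (Hz i))) _ => //.
  by rewrite -ler_pdivlMl // mulrC.
have := @line_bound (fun s => F (upd z i s) - F (upd x i s))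
  (fun s => f (upd z i s) - f (upd x i s)) (p 0 i) (x 0 i) (e / 2 / r).
rewrite upd_id => HL; apply: le_trans (HL _ _ _) _.
- by rewrite !(primitive_base HF) // subrr.
- move=> s Hs; have Hs' := between_le Hs pi0 (Hx i).
  by apply: isdB; apply: primitive_line HF _ _.
- by move=> s Hs; rewrite ltW // H1 //; exact: cube_sub m1 _ Hz.
- by rewrite -mulrA ler_piMr ?divr_ge0 ?ltW // mulrC ltr_pdivrMr // mul1r.
Qed.

(* Differentiation under the integral sign. *)
Lemma primitive_der p r i j f g F G x : i != j ->
  is_primitive p r i f F -> is_primitive p r i g G ->
  (forall z, cube p r z -> is_derive z (delta_mx 0 j) f (g z)) ->
  (forall z, cube p r z -> {for z, continuous g}) ->
  cube p r x -> is_derive x (delta_mx 0 j) F (G x).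
Proof.
move=> ij HF HG df cg Hx; have r0 : 0 < r by exact: le_lt_trans (Hx i).
have pi0 : `|p 0 i - p 0 i| < r by rewrite subrr normr0.
apply/is_derive_line; apply: is_derive_eps => e e0.
have B1 : 0 < e / r by rewrite divr_gt0.
have [|r1 r10 H1] := @segment_unif g i x (p 0 i) (x 0 i) _ _ B1.
  by move=> s Hs; apply: cg; apply: cube_upd => //; exact: between_le Hs _ (Hx i).
have [r3 r30 H3] := open_cube (@cube_open _ p r) Hx.
exists (Num.min r1 r3); first by rewrite lt_min r10.
move=> h h0; rewrite lt_min => /andP[hr1 hr3].
have [y yE] : exists y, y = upd x j (h + x 0 j) by eexists.
have Hy : forall c, between (x 0 j) (h + x 0 j) c ->
    cube x r1 (upd x j c) /\ cube p r (upd x j c).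
  move=> c Hc; split; [|apply: H3]; apply: cube_upd; (try exact: cube_center);
    by apply: between_le Hc _ _; rewrite ?subrr ?normr0 // addrK.
have [_ Hyp] : cube x r1 y /\ cube p r y.
  rewrite yE; apply: Hy; have [h1|h1] := leP 0 h; [left|right]; rewrite lexx ?andbT /=.
    by rewrite lerDr.
  by rewrite gerDr ltW.
rewrite upd_id -yE.
have := @line_bound (fun s => h^-1 * (F (upd y i s) - F (upd x i s)) - G (upd x i s))
  (fun s => h^-1 * (f (upd y i s) - f (upd x i s)) - g (upd x i s)) (p 0 i) (x 0 i) (e / r).
rewrite upd_id.
have -> : upd y i (x 0 i) = y by rewrite yE -(updC _ _ _ ij) upd_id.
move=> HL; apply: le_trans (HL _ _ _) _.
- by rewrite (primitive_base HF Hyp r0) (primitive_base HF Hx r0) (primitive_base HG Hx r0) !subrr mulr0 subrr.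
- move=> s Hs; have Hs' := between_le Hs pi0 (Hx i).
  apply: (isdB _ (primitive_line HG Hx Hs')).
  apply: (@isd_eq _ _ _ _ _ (0 * (F (upd y i s) - F (upd x i s)) +
      h^-1 * (f (upd y i s) - f (upd x i s)))); last by rewrite mul0r add0r.
  apply: (isdM (isdC _ _ _)).
  exact: (isdB (primitive_line HF Hyp Hs') (primitive_line HF Hx Hs')).
- move=> s Hs; have Hs' := between_le Hs pi0 (Hx i).
  have [c c1 c2] : exists2 c, between (x 0 j) (h + x 0 j) c &
     f (upd y i s) - f (upd x i s) = g (upd (upd x j c) i s) * h.
    have [|c c1 c2] := @mvt_between _ (fun u => f (upd (upd x i s) j u))
       (fun u => g (upd (upd x i s) j u)) (x 0 j) (h + x 0 j).
      move=> c Hc; apply/is_derive_upd; apply: df; rewrite updC //.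
      by apply: cube_upd => //; have [] := Hy c Hc.
    by exists c => //; move: c2; rewrite addrK !(updC _ _ _ ij) upd_id -yE.
  rewrite c2 mulrC mulfK // ltW // H1 //; exact: (Hy c c1).1.
- by rewrite -mulrA ler_piMr ?ltW // mulrC ltr_pdivrMr // mul1r.
Qed.

Lemma Ck_local U n f : open U -> (forall x, U x -> exists V, [/\ open V, V x & Ck V n f]) ->
  Ck U n f.
Proof.
move=> oU; elim: n f => [|n IH] f H.
  by split=> // x Ux; have [V [_ Vx Hf]] := H x Ux; exact: Ck_cont Hf Vx.
split=> [x Ux|i]; first by have [V [_ Vx Hf]] := H x Ux; exact: Ck_cont Hf Vx.
split=> [x Ux|]; first by have [V [_ Vx Hf]] := H x Ux; exact: Ck_der Hf Vx.
apply: IH => x Ux; have [V [oV Vx Hf]] := H x Ux; exists V; split=> //.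
exact: Ck_partial.
Qed.

Lemma primitive_sub p r r' i f F : r' <= r -> is_primitive p r i f F -> is_primitive p r' i f F.
Proof. by move=> rr [H1 H2]; split=> x /(cube_sub rr); [exact: H1|exact: H2]. Qed.

Lemma cube_shrink p r x : cube p r x -> exists2 r' : R, 0 < r' < r & cube p r' x.
Proof.
move=> H; have r0 : 0 < r by exact: le_lt_trans (H 0).
have [m [m1 m2 m3]] : exists m : R, [/\ m < r, 0 < m & forall j, `|x 0 j - p 0 j| <= m].
  exists (Num.max (r / 2) (Num.max `|x 0 iy - p 0 iy| (Num.max `|x 0 ix - p 0 ix| `|x 0 it - p 0 it|))).
  split.
  - by rewrite !gt_max !H !andbT ltr_pdivrMr // ltr_pMr // ltrDr.
  - by rewrite lt_max divr_gt0.
  - by elim/ord3_ind; rewrite !le_max lexx ?orbT.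
exists ((m + r) / 2); first by rewrite divr_gt0 ?addr_gt0 //=; lra.
by move=> j; apply: le_lt_trans (m3 j) _; lra.
Qed.

(** A derivative in another direction is the primitive of the derivative. That primitive is only
    available on a slightly smaller cube, hence the argument near each point. *)
Lemma primitive_Ck p r i n f F : is_primitive p r i f F -> Ck (cube p r) n f ->
  Ck (cube p r) n F.
Proof.
elim: n r f F => [|n IH] r f F HF Hf.
  by split=> // x Hx; apply: primitive_cont HF _ Hx => z Hz; exact: Ck_cont Hf Hz.
apply: Ck_local; first exact: cube_open.
move=> x /cube_shrink[r' /andP[r'0 r'r] Hx]; exists (cube p r'); split=> //; first exact: cube_open.
have Hf' := Ck_sub (cube_sub (ltW r'r)) Hf.
have HF' := primitive_sub (ltW r'r) HF.
have HG j : exists G, is_primitive p r' i (partial j f) G.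
  apply: (@exists_primitive p r r' i) => // z Hz; exact: Ck_cont (Ck_partial j Hf) Hz.
have [G HG'] := choice HG.
apply: (CkS' (df := fun j => if j == i then f else G j)) => [|j z Hz|j].
- exact: cube_open.
- case: (eqVneq j i) => [->|ji]; first exact: HF'.2.
  apply: (primitive_der _ HF' (HG' j)) => //; first by rewrite eq_sym.
    by move=> w Hw; exact: Ck_is_derive Hf' Hw.
  by move=> w Hw; exact: Ck_cont (Ck_partial j Hf') Hw.
- case: (eqVneq j i) => _; first exact: Ck_pred.
  apply: IH (HG' j) _; exact: Ck_partial.
Qed.

(** The increment of [f] in direction [i] is the primitive of [partial i f]. Differentiating it
    under the integral in direction [j], and then along [i], gives the mixed derivative in the other
    order. *)
Lemma Schwarz U f i j x : open U -> U x -> Ck U 2 f ->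
  partial i (partial j f) x = partial j (partial i f) x.
Proof.
have [->//|ij] := eqVneq i j; move=> oU Ux Hf.
have [r r0 rU] := open_cube oU Ux.
have {}Hf := Ck_sub rU Hf.
have r20 : 0 < r / 2 by rewrite divr_gt0.
have r2r : r / 2 < r by rewrite ltr_pdivrMr // ltr_pMr // ltrDr.
have [G HG] : exists G, is_primitive x (r / 2) i (partial j (partial i f)) G.
  apply: (@exists_primitive x r) => // z Hz.
  exact: Ck_cont (Ck_partial j (Ck_partial i Hf)) Hz.
have {}Hf := Ck_sub (cube_sub (ltW r2r)) Hf.
have Hb z : cube x (r / 2) z -> cube x (r / 2) (upd z i (x 0 i)).
  by move=> Hz; apply: cube_upd => //; rewrite subrr normr0.
have HF : is_primitive x (r / 2) i (partial i f) (fun z => f z - f (upd z i (x 0 i))).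
  split=> [z Hz <-|z Hz]; first by rewrite upd_id subrr.
  apply: (isd_eq (isdB (Ck_is_derive i Hf Hz) _) (subr0 _)).
  apply/is_derive_line; rewrite (_ : (fun u => _) = fun=> f (upd z i (x 0 i))); first exact: isdC.
  by apply/funext => u; rewrite upd_upd.
have E z : cube x (r / 2) z -> partial j f z - partial j f (upd z i (x 0 i)) = G z.
  move=> Hz; have := @primitive_der _ _ _ j _ _ _ _ z ij HF HG _ _ Hz.
  case=> [w Hw|w Hw|].
  - exact: Ck_is_derive (Ck_partial i Hf) Hw.
  - exact: Ck_cont (Ck_partial j (Ck_partial i Hf)) Hw.
  move=> _ <-; symmetry; apply: is_derive_partial; apply: isdB.
    exact: Ck_is_derive Hf Hz.
  apply/is_derive_line.
  have := (is_derive_line f (upd z i (x 0 i)) j (partial j f (upd z i (x 0 i)))).1 (Ck_is_derive j Hf (Hb z Hz)).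
  rewrite upd_other; last by rewrite eq_sym.
  rewrite (_ : (fun u => f (upd (upd z i (x 0 i)) j u)) = fun u => f (upd (upd z j u) i (x 0 i))) //.
  by apply/funext => u; rewrite updC.
have Hx := cube_center x r20.
have H1 := HG.2 x Hx.
rewrite -(is_derive_partial H1).
have H2 : is_derive x (delta_mx 0 i)
    (fun z => partial j f z - partial j f (upd z i (x 0 i))) (partial i (partial j f) x).
  apply: (isd_eq (isdB (Ck_is_derive i (Ck_partial j Hf) Hx) _) (subr0 _)).
  apply/is_derive_line; rewrite (_ : (fun u => _) = fun=> partial j f (upd x i (x 0 i))); first exact: isdC.
  by apply/funext => u; rewrite upd_upd.
have [_ H3] := is_derive_eq_on (@cube_open _ x (r / 2)) Hx E H2.
by rewrite -H3.
Qed.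

Lemma is_derive_compE U n (g : E -> E) V f i x : open U -> open V -> U x -> V (g x) ->
  (forall k, Ck U n.+1 (fun z => g z 0 k)) -> Ck V 1 f ->
  is_derive x (delta_mx 0 i) (fun z => f (g z))
    (\sum_k partial k f (g x) * partial i (fun z => g z 0 k) x).
Proof.
move=> oU oV Ux Vx Hg Hf; apply/is_derive_line.
have := @is_derive_curve _ V f (fun u => g (upd x i u)) (x 0 i)
  (fun k => partial i (fun z => g z 0 k) x) oV.
rewrite upd_id; apply => //.
- by move=> k z Vz; exact: Ck_der Hf Vz.
- by move=> k; exact: Ck_cont (Ck_partial k Hf) Vx.
- by move=> k; apply: (is_derive_line (fun z => g z 0 k) x i _).1; exact: Ck_is_derive (Hg k) Ux.
Qed.

Lemma Ck_comp U n (g : E -> E) V f : open U -> open V -> (forall x, U x -> V (g x)) ->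
  (forall k, Ck U n (fun z => g z 0 k)) -> Ck V n f -> Ck U n (fun z => f (g z)).
Proof.
move=> oU oV UV; elim: n f => [|n IH] f Hg Hf.
  split=> // x Ux; apply: (@cont_comp _ _ _ g f).
    by apply: continuous_row => j; exact: Ck_cont (Hg j) Ux.
  exact: Ck_cont Hf (UV _ Ux).
apply: (CkS' (df := fun i x => \sum_k partial k f (g x) * partial i (fun z => g z 0 k) x)) => //.
  move=> i x Ux; apply: (is_derive_compE i oU oV Ux (UV _ Ux) Hg).
  by apply: Ck_mono Hf.
move=> i; apply: Ck_sum => // k _; apply: Ck_mul => //; last exact: Ck_partial.
by apply: IH; [move=> l; exact: Ck_pred|exact: Ck_partial].
Qed.

End Primitive.

(** * Local inverses *)

Section Elementary.
Context {R : realType}.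
Local Notation E := 'rV[R]_3.
Implicit Types (U : set E) (f F : E -> R) (x p : E) (i j k : 'I_3) (r : R).
Local Opaque upd partial.

(** Meant for [u] whose derivative is an expression in [u] and its argument, as for inverse,
    exponential and logarithm: the regularity already gained for [u (f x)] passes to the
    derivative. *)
Lemma Ck_comp1_self U n f (u du : R -> R) (W : set R) : open U ->
  (forall s, W s -> is_derive s 1 u (du s)) -> (forall x, U x -> W (f x)) ->
  (forall m, Ck U m f -> Ck U m (fun x => u (f x)) -> Ck U m (fun x => du (f x))) ->
  Ck U n f -> Ck U n (fun x => u (f x)).
Proof.
move=> oU Hu HW Hd; elim: n => [|n IH] Cf.
  split; last by [].
  move=> x Ux; apply: (@cont_comp _ _ _ f u); first exact: Ck_cont Cf Ux.
  exact: is_derive_cont (Hu _ (HW _ Ux)).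
have Cf' := Ck_pred Cf.
apply: (CkS' (df := fun i x => du (f x) * partial i f x)) => // [i x Ux|i].
  apply/is_derive_line; apply: (@isd_comp R u (fun s => f (upd x i s))).
    by rewrite upd_id; exact: Hu (HW _ Ux).
  by apply/is_derive_line; exact: Ck_is_derive Cf Ux.
by apply: Ck_mul => //; [apply: Hd => //; exact: IH|exact: Ck_partial].
Qed.

Lemma isd_inv (s : R) : s != 0 -> is_derive s 1 (fun u : R => u^-1) (- (s^-1 * s^-1)).
Proof.
move=> s0; have := @is_deriveV R id s 1 1 s0 (is_derive_id s 1).
by rewrite scaler1 -exprVn expr2.
Qed.

Lemma Ck_inv U n f : open U -> (forall x, U x -> f x != 0) -> Ck U n f ->
  Ck U n (fun x => (f x)^-1).
Proof.
move=> oU Hf; apply: (Ck_comp1_self (W := [set s | s != 0]) (u := GRing.inv) oU isd_inv) => //.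
by move=> m _ H; apply: Ck_opp => //; exact: Ck_mul.
Qed.

Lemma Ck_exp U n f : open U -> Ck U n f -> Ck U n (fun x => expR (f x)).
Proof.
move=> oU; apply: (Ck_comp1_self (W := setT) (du := expR) oU) => //.
Qed.

Lemma Ck_ln U n f : open U -> (forall x, U x -> 0 < f x) -> Ck U n f ->
  Ck U n (fun x => ln (f x)).
Proof.
move=> oU Hf; apply: (Ck_comp1_self (W := [set s | 0 < s]) (du := GRing.inv) oU) => //.
by move=> m H _; apply: Ck_inv => // x Ux; rewrite gt_eqF // Hf.
Qed.

Lemma Ck_sub2 U n f g : open U -> Ck U n f -> Ck U n g -> Ck U n (fun x => f x - g x).
Proof. by move=> oU Hf Hg; apply: Ck_add => //; exact: Ck_opp. Qed.

Lemma Ck_div U n f g : open U -> (forall x, U x -> g x != 0) -> Ck U n f -> Ck U n g ->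
  Ck U n (fun x => f x / g x).
Proof. by move=> oU H Hf Hg; apply: Ck_mul => //; exact: Ck_inv. Qed.

Lemma Ck_pow U n f m : open U -> Ck U n f -> Ck U n (fun x => f x ^+ m).
Proof.
move=> oU Hf; elim: m => [|m IH].
  rewrite (_ : (fun x => _) = fun=> 1); first exact: Ck_cst.
  by apply/funext => x; rewrite expr0.
rewrite (_ : (fun x => _) = fun x => f x * f x ^+ m); first exact: Ck_mul.
by apply/funext => x; rewrite exprS.
Qed.

Lemma Ck_det U n m (A : E -> 'M[R]_m) : open U ->
  (forall i j : 'I_m, Ck U n (fun x => A x i j)) -> Ck U n (fun x => \det (A x)).
Proof.
move=> oU HA; rewrite /determinant; apply: Ck_sum => // s _.
by apply: Ck_mul => //; [exact: Ck_cst|apply: Ck_prod].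
Qed.

(** Cramer's rule: the entries are cofactors over the determinant. *)
Lemma Ck_invmx U n m (A : E -> 'M[R]_m) : open U -> (forall x, U x -> A x \in unitmx) ->
  (forall i j : 'I_m, Ck U n (fun x => A x i j)) -> forall i j : 'I_m, Ck U n (fun x => invmx (A x) i j).
Proof.
move=> oU HU HA i j.
apply: (@Ck_eq _ U n (fun x => (\det (A x))^-1 * ((-1) ^+ (j + i) * \det (row' j (col' i (A x)))))) => //.
  by move=> x Ux; rewrite /invmx HU // !mxE.
apply: Ck_mul => //.
  apply: Ck_inv => //; last exact: Ck_det.
  by move=> x Ux; rewrite -unitfE; have := HU x Ux; rewrite unitmxE.
apply: Ck_mul => //; first exact: Ck_cst.
apply: Ck_det => // a b.
apply: (@Ck_eq _ U n (fun x => A x (lift j a) (lift i b))) => //.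
by move=> x Ux; rewrite !mxE.
Qed.

End Elementary.

Section Inverse.
Context {R : realType}.
Local Notation E := 'rV[R]_3.
Implicit Types (U : set E) (f F : E -> R) (x p u : E) (i j k : 'I_3) (r : R).
Local Opaque upd partial.

(** The error bound contains the unknown increment [D] of the inverse function. For [e <= 1 / 2] it
    can be absorbed: this gives |D| <= (2 |d| + 1) |h| and then an error proportional to |h|
    alone. *)
Lemma quotient_estimate (d h D e : R) : h != 0 -> 0 < e -> e <= 1 / 2 ->
  `|D - d * h| <= e * (`|h| + `|D|) -> `|h^-1 * D - d| <= e * (2 * `|d| + 2).
Proof.
move=> h0 e0 e1 H; have hp : 0 < `|h| by rewrite normr_gt0.
have H1 : `|D| <= `|d| * `|h| + `|D - d * h|.
  by rewrite -normrM -[X in `|X|](subrK (d * h)) addrC; exact: ler_normD.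
have H2 : `|D| <= (2 * `|d| + 1) * `|h|.
  have H3 : e * (`|h| + `|D|) <= 1 / 2 * (`|h| + `|D|).
    by rewrite ler_wpM2r // addr_ge0.
  by move: H H1 H3; move: `|D - _| `|D| => a b ? ? ?; lra.
rewrite -(ler_pM2r hp) -normrM mulrBl mulrAC mulVf // mul1r.
apply: le_trans H _; rewrite -mulrA ler_pM2l //.
by move: H2; move: `|D| (`|d|) => a b; lra.
Qed.

Lemma min_max_opposite (A B C : R) : (A - C) * (B - C) < 0 ->
  Num.min A B <= C <= Num.max A B.
Proof.
move=> H; rewrite ge_min le_max; have [h1|h1] := leP A C; have [h2|h2] := leP C B => //=.
- by rewrite orbT.
- by exfalso; nra.
- by exfalso; nra.
- by rewrite ltW //= ltW.
Qed.

Lemma sum_two i k (h D : R) (G : 'I_3 -> R) :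
  \sum_l G l * (if l == k then D else if l == i then h else 0) =
  G k * D + (if i == k then 0 else G i * h).
Proof.
rewrite (bigD1 k) //= eqxx; congr (_ + _).
have [->|ik] := eqVneq i k.
  by rewrite big1 // => l lk; rewrite (negbTE lk) mulr0.
rewrite (bigD1 i) //= (negbTE ik) eqxx big1 ?addr0 // => l /andP[lk li].
by rewrite (negbTE lk) (negbTE li) mulr0.
Qed.

(** Implicit differentiation of [w (upd x k (f x)) = x 0 k]. *)
Definition inverse_slope f k i x : R :=
  (if i == k then 1 else - partial i f x) / partial k f x.

(** The inverse function theorem for a map that changes one coordinate. Along each line in direction
    [k] the function [f] is strictly monotone, so injectivity is the mean value theorem and local
    surjectivity the intermediate value theorem. *)
Lemma replace_inverse U f k p : open U -> U p -> (forall n, Ck U n f) ->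
  partial k f p != 0 ->
  exists (r : R) (w : E -> R), let V := [set upd x k (f x) | x in cube p r] in
    [/\ 0 < r /\ cube p r `<=` U, forall x, cube p r x -> partial k f x != 0,
        open V, forall n, Ck V n w &
        (forall x, cube p r x -> w (upd x k (f x)) = x 0 k) /\
        forall i x, cube p r x -> is_derive (upd x k (f x)) (delta_mx 0 i) w (inverse_slope f k i x)].
Proof.
move=> oU Up Cf Dp0.
have D0 : 0 < `|partial k f p| by rewrite normr_gt0.
have [r1 r10 H1] := open_cube oU Up.
have [r2 r20 H2] := cont_eps (Ck_cont (Ck_partial k (Cf 1%N)) Up) D0.
have [r [r0 [rr1 rr2]]] : exists r : R, 0 < r /\ r <= r1 /\ r <= r2.
  by exists (Num.min r1 r2); rewrite lt_min r10 r20 !ge_min !lexx orbT.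
have rU : cube p r `<=` U by move=> z Hz; apply: H1; exact: cube_sub Hz.
(* On this cube [partial k f] differs from its value at [p] by less than the size of that value, so
   it keeps its sign. *)
have Hs x y : cube p r x -> cube p r y -> 0 < partial k f x * partial k f y.
  move=> Hx Hy; have := H2 x (cube_sub rr2 Hx); have := H2 y (cube_sub rr2 Hy).
  move: (partial k f x) (partial k f y) (partial k f p) => a b c.
  have [c0|c0] := leP 0 c.
    rewrite (ger0_norm c0) !ltr_norml => /andP[h1 _] /andP[h2 _].
    by apply: mulr_gt0; lra.
  rewrite (ltr0_norm c0) !ltr_norml => /andP[_ h1] /andP[_ h2].
  by rewrite nmulr_rgt0; lra.
have Hn x : cube p r x -> partial k f x != 0.
  by move=> Hx; apply/eqP => H; have := Hs x x Hx Hx; rewrite H mul0r ltxx.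
have Hk x s : cube p r x -> `|s - p 0 k| < r ->
    exists2 c, cube p r c & f (upd x k s) - f x = partial k f c * (s - x 0 k).
  move=> Hx Hs'; have [|c c1 c2] := @mvt_line _ f x k s.
    move=> u Hu.
    have HU : U (upd x k u) by apply: rU; apply: cube_upd => //; exact: between_le Hu (Hx k) Hs'.
    exact: (Ck_der (Cf 1%N) HU).
  exists (upd x k c) => //; apply: cube_upd => //; exact: between_le c1 (Hx k) Hs'.
have Hinj x y : cube p r x -> cube p r y -> upd x k (f x) = upd y k (f y) -> x = y.
  move=> Hx Hy /rowP E1.
  have yE : y = upd x k (y 0 k).
    apply/rowP => j; rewrite updE; case: eqP => [->//|/eqP jk].
    by have := E1 j; rewrite !upd_other.
  have [c Hc] := Hk x (y 0 k) Hx (Hy k); rewrite -yE.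
  have -> : f y = f x by have := E1 k; rewrite !upd_same.
  rewrite subrr => /esym /eqP; rewrite mulf_eq0 (negbTE (Hn _ Hc)) /= subr_eq0 => /eqP E2.
  by rewrite yE E2 upd_id.
pose V := [set upd x k (f x) | x in cube p r].
have [inv Hinv] : exists inv : E -> E, forall x, cube p r x -> inv (upd x k (f x)) = x.
  have : forall u, exists x, V u -> cube p r x /\ u = upd x k (f x).
    move=> u; have [[x Hx <-]|nV] := pselect (V u); first by exists x.
    by exists u => /nV.
  move=> /choice[inv Hi]; exists inv => x Hx.
  have Vx : V (upd x k (f x)) by exists x.
  by have [h1 h2] := Hi _ Vx; apply: Hinj.
(* Openness of the image and continuity of the inverse at once. *)
have key x (e : R) : cube p r x -> 0 < e -> exists2 d : R, 0 < d &
    forall u, cube (upd x k (f x)) d u -> exists y, [/\ cube p r y, u = upd y k (f y) & `|y 0 k - x 0 k| <= e].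
  move=> Hx e0; have [r3 r30 H3] := open_cube (@cube_open _ p r) Hx.
  wlog er : e e0 / e < r3.
    move=> W; have [er|er] := ltP e r3; first exact: W.
    have [||d d0 Hd] := W (r3 / 2); first by rewrite divr_gt0.
      by rewrite ltr_pdivrMr // ltr_pMr // ltrDr.
    exists d => // u /Hd[y [y1 y2 y3]]; exists y; split=> //.
    apply: le_trans y3 _; apply: le_trans er; rewrite ler_pdivrMr // ler_pMr // lerDl.
    by [].
  pose a := x 0 k - e; pose b := x 0 k + e.
  have Hab s : a <= s <= b -> `|s - x 0 k| < r3.
    by move=> /andP[h1 h2]; apply: le_lt_trans er; rewrite ler_norml; rewrite /a /b in h1 h2; lra.
  have ab : a <= b by rewrite /a /b; lra.
  have Hab' s : a <= s <= b -> `|s - p 0 k| < r.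
    move=> Hs'; have : cube p r (upd x k s) by apply: H3; apply: cube_upd; [exact: cube_center|exact: Hab].
    by move=> /(_ k); rewrite upd_same.
  have Ha : a <= a <= b by rewrite lexx.
  have Hb : a <= b <= b by rewrite lexx ab.
  (* Negative exactly when the target value lies strictly between the values of [f] at the two ends;
     by continuity this persists for nearby [u]. *)
  pose q u := (f (upd u k a) - u 0 k) * (f (upd u k b) - u 0 k).
  have q0 : q (upd x k (f x)) < 0.
    rewrite /q !upd_upd upd_same.
    have [c1 Hc1 ->] := Hk x a Hx (Hab' _ Ha); have [c2 Hc2 ->] := Hk x b Hx (Hab' _ Hb).
    have -> : a - x 0 k = - e by rewrite /a addrAC subrr add0r.
    have -> : b - x 0 k = e by rewrite /b addrAC subrr add0r.
    have := Hs _ _ Hc1 Hc2; move: (partial k f c1) (partial k f c2) => A B AB.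
    rewrite mulrN mulNr oppr_lt0 mulrACA; exact: mulr_gt0 AB (mulr_gt0 e0 e0).
  have cu s z : {for z, continuous (fun u : E => upd u k s)}.
    apply: continuous_row => j; have [->|jk] := eqVneq j k.
      rewrite (_ : (fun _ => _) = fun=> s); first exact: contC.
      by apply/funext => v; rewrite upd_same.
    rewrite (_ : (fun _ => _) = fun v : E => v 0 j); first exact: coord_continuous.
    by apply/funext => v; rewrite upd_other.
  have cq : {for upd x k (f x), continuous q}.
    have cc s : a <= s <= b -> {for upd x k (f x), continuous (fun u : E => f (upd u k s) - u 0 k)}.
      move=> Hs'; apply: contD; last by apply: contN; exact: coord_continuous.
      apply: (@cont_comp _ _ _ (fun u : E => upd u k s) f); first exact: cu.
      rewrite upd_upd; apply: (Ck_cont (Cf 0%N)); apply: rU.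
      by apply: cube_upd => //; exact: Hab'.
    exact: (contM (cc a Ha) (cc b Hb)).
  have q0' : 0 < - q (upd x k (f x)) by rewrite oppr_gt0.
  have [d1 d10 Hd1] := cont_eps cq q0'.
  exists (Num.min d1 r3); first by rewrite lt_min d10.
  move=> u Hu.
  have Hu1 : q u < 0.
    have := Hd1 u (cube_sub _ Hu); rewrite ge_min lexx => /(_ isT).
    by move: (q u) (q _) => A B; rewrite ltr_norml => /andP[_]; lra.
  have Hux s : a <= s <= b -> cube p r (upd u k s).
    move=> Hs'; apply: H3 => j; rewrite updE; case: eqP => [->|/eqP jk]; first exact: Hab.
    have := Hu j; rewrite upd_other // => /lt_le_trans; apply.
    by rewrite ge_min lexx orbT.
  have [||s] := @IVT R (fun s => f (upd u k s)) a b (u 0 k) ab.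
  - apply: continuous_in_subspaceT => s; rewrite inE /= in_itv /= => Hs'.
    apply: (@cont_comp _ _ _ (upd u k) f); first exact: upd_continuous.
    by apply: (Ck_cont (Cf 0%N)); apply: rU; exact: Hux.
  - exact: min_max_opposite Hu1.
  rewrite in_itv /= => Hs' fs; exists (upd u k s); split; first exact: Hux.
    by rewrite upd_upd fs upd_id.
  by rewrite upd_same ler_norml; move: Hs' => /andP[]; rewrite /a /b; lra.
have oV : open V.
  rewrite openE => u [x Hx <-]; have [d d0 Hd] := key x 1 Hx ltr01.
  apply/nbhs_cubeP; exists d => // v /Hd[y [Hy -> _]]; by exists y.
pose w u := inv u 0 k.
have wE x : cube p r x -> w (upd x k (f x)) = x 0 k by move=> Hx; rewrite /w Hinv.
have wcont u : V u -> {for u, continuous w}.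
  move=> [x Hx <-]; apply: eps_cont => e e0; have [d d0 Hd] := key x e Hx e0.
  by exists d => // v /Hd[y [Hy -> Hyx]]; rewrite !wE.
have wder i x : cube p r x -> is_derive (upd x k (f x)) (delta_mx 0 i) w (inverse_slope f k i x).
  move=> Hx; have [u0 u0E] : exists u0, u0 = upd x k (f x) by eexists.
  rewrite -u0E; apply/is_derive_line; apply: is_derive_eps => e e0.
  have [d dE] : exists d, d = inverse_slope f k i x by eexists.
  rewrite -dE; have Dx : 0 < `|partial k f x| by rewrite normr_gt0 Hn.
  have dp : 0 < 2 * `|d| + 2 by rewrite ltr_wpDl // mulr_ge0.
  have [e1 [e10 e11 e12]] : exists e1 : R, [/\ 0 < e1, e1 <= 1 / 2 & e1 * (2 * `|d| + 2) <= e].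
    exists (Num.min (1 / 2) (e / (2 * `|d| + 2))); split.
    - by rewrite lt_min !divr_gt0.
    - by rewrite ge_min lexx.
    - by rewrite -ler_pdivlMr // ge_min lexx orbT.
  have [r4 r40 [H4 H4']] := strict_diff oU (rU _ Hx) (fun j z Hz => Ck_der (i := j) (Cf 1%N) Hz)
      (fun j => Ck_cont (Ck_partial j (Cf 1%N)) (rU _ Hx)) (mulr_gt0 e10 Dx).
  have r420 : 0 < r4 / 2 by rewrite divr_gt0.
  have r42 : r4 / 2 < r4 by rewrite ltr_pdivrMr // ltr_pMr // ltrDr.
  have [d0 d00 Hd] := key x _ Hx r420.
  exists (Num.min d0 r4); first by rewrite lt_min d00.
  move=> h h0; rewrite lt_min => /andP[hd hr4].
  have [|y [Hy yE Hyx]] := Hd (upd u0 i (h + u0 0 i)).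
    by rewrite -u0E; apply: cube_upd; [exact: cube_center|rewrite addrK].
  rewrite upd_id yE u0E !wE //.
  have [D DE] : exists D, D = y 0 k - x 0 k by eexists.
  have Hyl l : y 0 l - x 0 l = if l == k then D else if l == i then h else 0.
    case: eqP => [->//|/eqP lk].
    have : upd u0 i (h + u0 0 i) 0 l = y 0 l by rewrite yE upd_other.
    rewrite updE; case: eqP => [li|_] <-; last by rewrite u0E upd_other // subrr.
    by rewrite -li u0E upd_other // addrK.
  have cy : cube x r4 y.
    move=> l; rewrite Hyl; case: eqP => _; first by rewrite DE; apply: le_lt_trans r42.
    by case: eqP; rewrite ?normr0.
  have fy : f y - f x = if i == k then h else 0.
    have : upd u0 i (h + u0 0 i) 0 k = f y by rewrite yE upd_same.
    rewrite updE eq_sym; case: eqP => [->|_] <-; last by rewrite u0E upd_same subrr.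
    by rewrite u0E upd_same addrK.
  rewrite -DE; apply: le_trans e12; apply: quotient_estimate => //.
  have := H4' x y (cube_center _ r40) cy; rewrite fy.
  under eq_bigr do rewrite Hyl.
  rewrite sum_two.
  have -> : \sum_l `|y 0 l - x 0 l| =
     \sum_l 1 * (if l == k then `|D| else if l == i then `|h| else 0).
    apply: eq_bigr => l _; rewrite Hyl mul1r; case: ifP => // _; case: ifP => // _; exact: normr0.
  rewrite sum_two dE /inverse_slope; have := Hn _ Hx.
  move: (partial k f x) (partial i f x) Dx => A B A0 An HH.
  rewrite -(ler_pM2l A0) -normrM.
  have -> : A * (D - (if i == k then 1 else - B) / A * h) =
            - ((if i == k then h else 0) - (A * D + (if i == k then 0 else B * h))).
    case: (i == k); field => //.
  rewrite normrN; apply: le_trans HH _.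
  rewrite -mulrA mulrCA; apply: ler_wpM2l => //; apply: ler_wpM2l; first exact: ltW.
  by rewrite addrC !mul1r; apply: lerD => //; case: (i == k).
exists r, w; split=> //.
(* The derivatives of [w] are smooth functions of [upd u k (w u)], so they are as regular as [w]
   itself and the order climbs by one each time. *)
elim=> [|n IH]; first by split.
apply: (CkS' (df := fun i u => inverse_slope f k i (upd u k (w u)))) => //.
  by move=> i u [x Hx <-]; rewrite upd_upd wE // upd_id; exact: wder.
move=> i.
apply: (@Ck_comp _ V n (fun u => upd u k (w u)) (cube p r)) => //.
- exact: cube_open.
- by move=> u [x Hx <-]; rewrite upd_upd wE // upd_id.
- move=> j; have [->|jk] := eqVneq j k.
    by apply: Ck_eq IH => // z _; rewrite upd_same.
  by apply: Ck_eq (Ck_coord n j oV) => // z _; rewrite upd_other.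
- have oc := @cube_open _ p r; apply: Ck_div => //; last exact: Ck_sub rU (Ck_partial k (Cf _)).
  case: eqP => _; first exact: Ck_cst.
  by apply: Ck_opp => //; exact: Ck_sub rU (Ck_partial i (Cf _)).
Qed.

End Inverse.

(** * Straightening a vector field *)

Section Flow.
Context {R : realType}.
Local Notation E := 'rV[R]_3.
Implicit Types (U : set E) (f F g Z : E -> R) (x p u : E) (i j k : 'I_3) (r : R).
Local Opaque upd partial.

Lemma curve_unif f (c : R -> E) (a b : R) :
  (forall s, between a b s -> {for s, continuous c}) ->
  (forall s, between a b s -> {for c s, continuous f}) ->
  forall e : R, 0 < e -> exists2 r : R, 0 < r & forall s z, between a b s -> cube (c s) r z ->
    `|f z - f (c s)| < e.
Proof.
move=> cc cf e e0.
wlog ab : a b cc cf / a <= b.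
  move=> W; have [ab|ba] := leP a b; first exact: W.
  have [||r r0 Hr] := W b a _ _ (ltW ba).
  - by move=> s Hs; apply: cc; case: Hs; [right|left].
  - by move=> s Hs; apply: cf; case: Hs; [right|left].
  by exists r => // s z Hs Hz; apply: Hr => //; case: Hs; [right|left].
have cK : near_covering `[a, b].
  by apply/compact_near_coveringP; exact: segment_compact.
pose P (r s : R) := forall z, cube (c s) r z -> `|f z - f (c s)| < e.
have H : \forall r \near 0^'+, `[a, b] `<=` P r.
  apply: (cK R (0^'+) P) => s; rewrite /= in_itv /= => Hs.
  have Hs' : between a b s by left.
  have e20 : 0 < e / 2 by rewrite divr_gt0.
  have [r0 r00 Hr0] := cont_eps (cf s Hs') e20.
  have r020 : 0 < r0 / 2 by rewrite divr_gt0.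
  have Hc : \forall s' \near s, cube (c s) (r0 / 2) (c s').
    by have := cc s Hs'; apply; exact: nbhs_cube.
  exists ([set s' | cube (c s) (r0 / 2) (c s')], [set r | r < r0 / 2]).
    by split=> //=; exact: nbhs_right_lt.
  move=> [s' r] /= [Hs1 Hr] z Hz.
  have h1 : `|f (c s') - f (c s)| < e / 2.
    by apply: Hr0; apply: cube_sub Hs1; rewrite ler_pdivrMr // ler_pMr // lerDl.
  have h2 : `|f z - f (c s)| < e / 2.
    apply: Hr0 => j; rewrite -(subrKA (c s' 0 j)) (splitr r0).
    apply: le_lt_trans (ler_normD _ _) _; apply: ltrD; last exact: Hs1.
    exact: lt_trans (Hz j) Hr.
  rewrite -(subrKA (f (c s))) (splitr e).
  by apply: le_lt_trans (ler_normD _ _) _; apply: ltrD => //; rewrite distrC.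
have [r [Hr r0]] : exists r : R, `[a, b] `<=` P r /\ 0 < r.
  have H' : \forall r \near 0^'+, `[a, b] `<=` P r /\ 0 < r.
    by apply: filterI H _; exact: nbhs_right_gt.
  by have [r [h1 h2]] := @filter_ex _ _ (at_right_proper_filter 0) _ H'; exists r.
exists r => // s z Hs Hz; apply: (Hr s) => //=; rewrite in_itv /=; case: Hs => // /andP[h1 h2].
by rewrite (le_trans ab h1) (le_trans h2 ab).
Qed.

(** At a maximum of |Q| the mean value theorem bounds |Q| by its initial value, the inhomogeneity
    and half of itself. Smallness of K |b - a| thus replaces the usual exponential. *)
Lemma gronwall (Q dQ : R -> R) (a b c K : R) :
  (forall s, between a b s -> is_derive s 1 Q (dQ s)) ->
  (forall s, between a b s -> `|dQ s| <= c + K * `|Q s|) ->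
  0 <= c -> 0 <= K -> K * `|b - a| <= 1 / 2 ->
  forall s, between a b s -> `|Q s| <= 2 * (`|Q a| + c * `|b - a|).
Proof.
move=> HQ Hd c0 K0 Kab.
have [m Hm Hmax] : exists2 m, between a b m & forall s, between a b s -> `|Q s| <= `|Q m|.
  have W (u v : R) : u <= v -> (forall s, u <= s <= v -> between a b s) ->
      exists2 m, between a b m & forall s, u <= s <= v -> `|Q s| <= `|Q m|.
    move=> uv Huv; have [|m Hm Hmax] := @EVT_max R (fun s => `|Q s|) u v uv.
      apply: continuous_in_subspaceT => s; rewrite inE /= in_itv /= => Hs.
      apply: (@cont_comp _ _ _ Q (fun y : R => `|y|)).
        exact: is_derive_cont (HQ s (Huv s Hs)).
      exact: norm_continuous.
    exists m; first by apply: Huv; move: Hm; rewrite in_itv.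
    by move=> s Hs; apply: Hmax; rewrite in_itv.
  have [ab|ba] := leP a b.
    have [|m m1 m2] := W a b ab; first by left.
    exists m => // s [Hs|/andP[h1 h2]]; apply: m2 => //.
    by rewrite (le_trans ab h1) (le_trans h2 ab).
  have [|m m1 m2] := W b a (ltW ba); first by right.
  exists m => // s [/andP[h1 h2]|Hs]; apply: m2 => //.
  by rewrite (le_trans (ltW ba) h1) (le_trans h2 (ltW ba)).
have Hsub s : between a m s -> between a b s.
  by case: Hm => /andP[m1 m2] [] /andP[s1 s2]; [left|left|right|right]; lra.
have [xi Hxi Exi] := mvt_between (fun s Hs => HQ s (Hsub s Hs)).
have Hma : `|m - a| <= `|b - a|.
  have [ab|ab] := leP a b.
    rewrite (ger0_norm (_ : 0 <= b - a)) ?subr_ge0 // ler_norml.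
    by case: Hm => /andP[m1 m2]; lra.
  rewrite (ltr0_norm (_ : b - a < 0)) ?subr_lt0 // ler_norml.
  by case: Hm => /andP[m1 m2]; lra.
have H1 : `|Q m| <= `|Q a| + (c + K * `|Q m|) * `|b - a|.
  rewrite -(subrK (Q a) (Q m)) addrC; apply: le_trans (ler_normD _ _) _.
  rewrite lerD2l (addrC (Q a)) subrK Exi normrM.
  apply: ler_pM => //; apply: le_trans (Hd _ (Hsub _ Hxi)) _.
  by rewrite lerD2l ler_wpM2l // Hmax //; exact: Hsub.
move=> s /Hmax Hs; apply: le_trans Hs _.
have H2 : K * `|b - a| * `|Q m| <= 1 / 2 * `|Q m| by rewrite ler_wpM2r.
by move: H1 H2; move: `|Q m| `|Q a| `|b - a| => A B C; nra.
Qed.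

Lemma geometric_small (c e : R) : 0 < e -> exists n, c * (1 / 2) ^+ n <= e.
Proof.
move=> e0; have H : (fun n : nat => c * (1 / 2) ^+ n) @ \oo --> c * 0.
  apply: (@cvgM R nat \oo _ (fun=> c) (fun n : nat => (1 / 2) ^+ n)); first exact: cvg_cst.
  by apply: cvg_expr; rewrite ger0_norm ?divr_ge0 // ltr_pdivrMr // mul1r ltrDr.
rewrite mulr0 in H; have /cvgrPdist_le /(_ e e0) [n _ Hn] := H.
exists n; apply: le_trans (ler_norm _) _.
by have := Hn n (leqnn n); rewrite sub0r normrN.
Qed.

(** The intervals of radius [g n] about [u n] are nested; the limit is the supremum of their left
    ends. *)
Lemma geometric_limit (u : nat -> R) (C : R) :
  (forall n, `|u n.+1 - u n| <= C * (1 / 2) ^+ n) ->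
  exists l, forall n, `|l - u n| <= 2 * C * (1 / 2) ^+ n.
Proof.
move=> H.
have C0 : 0 <= C by have := H 0%N; rewrite expr0 mulr1; apply: le_trans.
pose g n : R := 2 * C * (1 / 2) ^+ n.
have gS n : g n = 2 * g n.+1 by rewrite /g exprS; field.
have g0 n : 0 <= g n by rewrite /g !mulr_ge0 // exprn_ge0 // divr_ge0.
have Hg n : `|u n.+1 - u n| <= g n.+1.
  by apply: le_trans (H n) _; rewrite /g exprS; lra.
have inc m n : u m - g m <= u (m + n)%N - g (m + n)%N.
  elim: n => [|n IH]; first by rewrite addn0.
  apply: le_trans IH _; rewrite addnS; have := Hg (m + n)%N; have := gS (m + n)%N.
  by rewrite ler_norml => -> /andP[]; lra.
have dec m n : u (m + n)%N + g (m + n)%N <= u m + g m.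
  elim: n => [|n IH]; first by rewrite addn0.
  apply: le_trans IH; rewrite addnS; have := Hg (m + n)%N; have := gS (m + n)%N.
  by rewrite ler_norml => -> /andP[]; lra.
have Hmn m n : u m - g m <= u n + g n.
  apply: le_trans (inc m n) _; rewrite addnC; apply: le_trans (dec n m).
  by have := g0 (n + m)%N; lra.
pose S := [set u n - g n | n in setT].
have S0 : S !=set0 by exists (u 0%N - g 0%N); exists 0%N.
have Sub n : ubound S (u n + g n) by move=> _ [m _ <-].
exists (sup S) => n; rewrite ler_norml; apply/andP; split.
  have : u n - g n <= sup S by apply: ub_le_sup; [exists (u 0%N + g 0%N); exact: Sub|exists n].
  by rewrite -/(g n); lra.
by have := ge_sup S0 (Sub n); rewrite -/(g n); lra.
Qed.

End Flow.

Section Picard.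
Context {R : realType}.
Local Notation E := 'rV[R]_3.
Implicit Types (U : set E) (f F g Z : E -> R) (x p u : E) (i j k : 'I_3) (r : R).
Local Opaque upd partial.

Lemma graph_cont Z k x : {for x, continuous Z} -> {for x, continuous (fun z => upd z k (Z z))}.
Proof.
move=> cZ; apply: continuous_row => j; have [->|jk] := eqVneq j k.
  by rewrite (_ : (fun z => _) = Z) //; apply/funext => z; rewrite upd_same.
rewrite (_ : (fun z => _) = fun z : E => z 0 j); first exact: coord_continuous.
by apply/funext => z; rewrite upd_other.
Qed.

Lemma primitive_dist p r i f g F G x c : is_primitive p r i f F -> is_primitive p r i g G ->
  (forall z, cube p r z -> `|f z - g z| <= c) -> cube p r x -> 0 <= c -> `|F x - G x| <= c * r.
Proof.
move=> HF HG Hc Hx c0; have r0 : 0 < r by exact: le_lt_trans (Hx i).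
have pi0 : `|p 0 i - p 0 i| < r by rewrite subrr normr0.
have := @line_bound _ (fun s => F (upd x i s) - G (upd x i s))
  (fun s => f (upd x i s) - g (upd x i s)) (p 0 i) (x 0 i) c.
rewrite upd_id => H; apply: le_trans (H _ _ _) _.
- by rewrite (primitive_base HF Hx r0) (primitive_base HG Hx r0) subrr.
- move=> s Hs; have Hs' := between_le Hs pi0 (Hx i).
  exact: (isdB (primitive_line HF Hx Hs') (primitive_line HG Hx Hs')).
- by move=> s Hs; apply: Hc; apply: cube_upd => //; exact: between_le Hs pi0 (Hx i).
- by rewrite ler_wpM2l // ltW.
Qed.

Lemma is_primitive_eq p r i f g F : (forall z, cube p r z -> f z = g z) ->
  is_primitive p r i f F -> is_primitive p r i g F.
Proof. by move=> H [H1 H2]; split=> // z Hz; rewrite -H //; exact: H2. Qed.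

Lemma is_primitive_eq2 p r i f F G : (forall z, cube p r z -> F z = G z) ->
  is_primitive p r i f F -> is_primitive p r i f G.
Proof.
move=> H [H1 H2]; split=> z Hz; first by rewrite -H //; exact: H1.
exact: (is_derive_eq_on (@cube_open _ p r) Hz H (H2 z Hz)).
Qed.

(** [Z] follows the integral curves of the field d_i + G d_k that start on the hyperplane x_i = p_i.
    Since [K * d <= 1 / 2], each iteration halves the distance between consecutive iterates. The
    nested radii [d2 < d1 < d] leave room for clamping and for the primitive of the limit. *)
Lemma picard p i k (G : E -> R) (M K d d2 : R) : i != k ->
  (forall x, {for x, continuous G}) -> (forall x, `|G x| <= M) ->
  (forall x a b, `|G (upd x k a) - G (upd x k b)| <= K * `|a - b|) ->
  0 <= K -> K * d <= 1 / 2 -> 0 < d2 -> d2 < d ->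
  exists Z, (forall x, cube p d2 x -> {for x, continuous Z}) /\
    is_primitive p d2 i (fun x => G (upd x k (Z x))) (fun x => Z x - x 0 k).
Proof.
move=> ik cG GM GK K0 Kd d20 d2d.
have d0 : 0 < d by exact: lt_trans d2d.
have M0 : 0 <= M by exact: le_trans (GM p).
have [d1 [d21 d1d]] : exists d1 : R, d2 < d1 /\ d1 < d by exists ((d2 + d) / 2); lra.
have d10 : 0 < d1 by exact: lt_trans d21.
have cd1 x : cube p d (clamp p d1 x) by apply: clamp_cube; rewrite ltW.
(* The iteration step is stated for every [Z], with an arbitrary result when [Z] is not continuous,
   so that [choice] yields one operator to iterate. *)
have step Z : exists Z', (forall x, cube p d x -> {for x, continuous Z}) ->
    (forall x, cube p d x -> {for x, continuous Z'}) /\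
    is_primitive p d1 i (fun x => G (upd x k (Z x))) (fun x => Z' x - x 0 k).
  have [cZ|ncZ] := pselect (forall x, cube p d x -> {for x, continuous Z}); last by exists Z.
  pose f x := G (upd x k (Z (clamp p d1 x))).
  have cf x : {for x, continuous f}.
    apply: (@cont_comp _ _ _ (fun z : E => upd z k (Z (clamp p d1 z))) G); last exact: cG.
    apply: graph_cont; apply: (@cont_comp _ _ _ (clamp p d1) Z).
      exact: clamp_continuous.
    exact: cZ.
  have [||F HF] := @exists_primitive R p (d + 1) d i f d0; first by rewrite ltrDl.
    by move=> x _; exact: cf.
  exists (fun x => F x + x 0 k) => _; split.
    move=> x Hx; apply: contD; last exact: coord_continuous.
    by apply: primitive_cont HF _ Hx => z _; exact: cf.
  apply: (@is_primitive_eq2 _ _ _ _ F); first by move=> z _; rewrite addrK.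
  apply: (@is_primitive_eq _ _ _ f); first by move=> z Hz; rewrite /f clamp_id.
  by apply: primitive_sub HF; exact: ltW.
have [T HT] := choice step.
pose u n := iter n T (fun x : E => x 0 k).
have cu n : forall x, cube p d x -> {for x, continuous (u n)}.
  elim: n => [|n IH]; first by move=> x _; exact: coord_continuous.
  exact: (HT _ IH).1.
have pu n := (HT _ (cu n)).2.
have Hu n x : cube p d1 x -> `|u n.+1 x - u n x| <= M * d * (1 / 2) ^+ n.
  elim: n x => [|n IH] x Hx.
    rewrite expr0 mulr1 -[u 0%N x]addr0; have := @primitive_dist p d1 i _ (fun=> 0) _ (fun=> 0) x M (pu 0%N).
    rewrite opprD addrA => H; apply: le_trans (H _ _ Hx M0) _.
    - by split=> // z _; exact: isdC.
    - by move=> z _; rewrite subr0.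
    - by rewrite ler_wpM2l // ltW.
  have := @primitive_dist p d1 i _ _ _ _ x (K * (M * d * (1 / 2) ^+ n)) (pu n.+1) (pu n).
  rewrite opprB addrA subrK => H; apply: le_trans (H _ Hx _) _.
  - move=> z Hz; apply: le_trans (GK _ _ _) _; exact: ler_wpM2l (IH z Hz).
  - by rewrite !mulr_ge0 ?(ltW d0) // exprn_ge0 // divr_ge0.
  - rewrite mulrAC exprSr (mulrA (M * d)).
    rewrite [leRHS]mulrC; apply: ler_wpM2r.
      by rewrite !mulr_ge0 ?(ltW d0) // exprn_ge0 // divr_ge0.
    by apply: le_trans Kd; rewrite ler_wpM2l // ltW.
have HZ x : exists l, cube p d1 x -> forall n, `|l - u n x| <= 2 * (M * d) * (1 / 2) ^+ n.
  have [Hx|nHx] := pselect (cube p d1 x); last by exists 0.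
  by have [l Hl] := geometric_limit (fun n => Hu n x Hx); exists l.
have [Z {}HZ] := choice HZ.
have cZ x : cube p d1 x -> {for x, continuous Z}.
  move=> Hx; apply: eps_cont => e e0.
  have e30 : 0 < e / 3 by rewrite divr_gt0.
  have [n Hn] := geometric_small (2 * (M * d)) e30.
  have [r1 r10 H1] := cont_eps (cu n x (cube_sub (ltW d1d) Hx)) e30.
  have [r2 r20 H2] := open_cube (@cube_open _ p d1) Hx.
  exists (Num.min r1 r2); first by rewrite lt_min r10.
  move=> z Hz.
  have Hz1 : cube x r1 z by apply: cube_sub Hz; rewrite ge_min lexx.
  have Hz2 : cube p d1 z by apply: H2; apply: cube_sub Hz; rewrite ge_min lexx orbT.
  have a1 := le_trans (HZ z Hz2 n) Hn; have a2 := le_trans (HZ x Hx n) Hn.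
  have a3 := H1 z Hz1.
  have -> : Z z - Z x = (Z z - u n z) + (u n z - u n x) + (u n x - Z x).
    by rewrite subrKA subrKA.
  have -> : e = e / 3 + e / 3 + e / 3 by field.
  apply: le_trans (ler_normD _ _) _; apply: lerD; last by rewrite distrC.
  by apply: le_trans (ler_normD _ _) _; apply: lerD => //; exact: ltW.
exists Z; split; first by move=> x Hx; apply: cZ; exact: cube_sub (ltW d21) _ Hx.
(* [W] is the primitive that [Z x - x 0 k] ought to be; both are compared with the same iterate. *)
have [|W HW] := @exists_primitive R p d1 d2 i (fun x => G (upd x k (Z x))) d20 d21.
  move=> x Hx; apply: (@cont_comp _ _ _ (fun z : E => upd z k (Z z)) G); last exact: cG.
  by apply: graph_cont; exact: cZ.
apply: (is_primitive_eq2 _ HW) => x Hx; have Hx1 := cube_sub (ltW d21) Hx.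
apply/eqP; rewrite -subr_eq0 -normr_le0; apply/ler_addgt0Pl => e e0; rewrite addr0.
have [n Hn] := geometric_small (2 * (2 * (M * d))) e0.
apply: le_trans Hn.
have P2 : 0 <= M * d * (1 / 2) ^+ n by rewrite !mulr_ge0 ?(ltW d0) // exprn_ge0 // divr_ge0.
have := @primitive_dist p d2 i _ _ _ _ x (K * (2 * (M * d) * (1 / 2) ^+ n)) HW (primitive_sub (ltW d21) (pu n)).
move=> /(_ _ Hx _) H.
have B1 : `|W x - (u n.+1 x - x 0 k)| <= K * (2 * (M * d) * (1 / 2) ^+ n) * d2.
  apply: H; last by rewrite mulr_ge0 // -mulrA mulr_ge0.
  move=> z Hz; apply: le_trans (GK _ _ _) _; apply: ler_wpM2l => //.
  exact: HZ (cube_sub (ltW d21) Hz) n.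
have B2 := HZ x Hx1 n.+1.
have -> : W x - (Z x - x 0 k) = (W x - (u n.+1 x - x 0 k)) + (u n.+1 x - Z x).
  by move: (W x) (Z x) (u n.+1 x) (x 0 k) => *; ring.
apply: le_trans (ler_normD _ _) _; rewrite (distrC (u n.+1 x)).
apply: le_trans (lerD B1 B2) _.
have B3 : K * d2 <= 1 / 2 by apply: le_trans Kd; rewrite ler_wpM2l // ltW.
rewrite exprSr; move: P2 B3; move: (M * d) ((1 / 2) ^+ n) => A B AB B3.
have : K * d2 * (A * B) <= 1 / 2 * (A * B) by rewrite ler_wpM2r.
move=> H3; have -> : K * (2 * A * B) * d2 + 2 * A * (B * (1 / 2)) = 2 * (K * d2 * (A * B)) + A * B by field.
have -> : 2 * (2 * A) * B = 4 * (A * B) by ring.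
by move: AB H3; move: (K * d2 * (A * B)) (A * B) => C D; lra.
Qed.

End Picard.

Section FlowBox.
Context {R : realType}.
Local Notation E := 'rV[R]_3.
Implicit Types (U : set E) (f F g Z : E -> R) (x p u : E) (i j k : 'I_3) (r : R).
Local Opaque upd partial.

Definition graph Z k x : E := upd x k (Z x).

(** [u] and [v] differ in the coordinates [j] and [k] only, so two mean values suffice; for [j = k]
    there is a single edge. *)
Lemma two_step g p r u v j k h : Ck (cube p r) 1 g -> cube p r u -> cube p r v ->
  v = upd (if j == k then u else upd u j (u 0 j + h)) k (v 0 k) ->
  exists a b : E, [/\ cube p r a /\ cube p r b,
    forall l, `|a 0 l - u 0 l| <= `|h| + `|v 0 k - u 0 k|,
    forall l, `|b 0 l - u 0 l| <= `|h| + `|v 0 k - u 0 k| &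
    g v - g u = (if j == k then 0 else partial j g a * h) + partial k g b * (v 0 k - u 0 k)].
Proof.
move=> Cg Hu Hv vE.
have step z l s : cube p r z -> `|s - p 0 l| < r -> exists2 c, between (z 0 l) s c &
    cube p r (upd z l c) /\ g (upd z l s) - g z = partial l g (upd z l c) * (s - z 0 l).
  move=> Hz Hs; have [|c c1 c2] := @mvt_line _ g z l s.
    move=> w Hw; have Hc : cube p r (upd z l w).
      by apply: cube_upd => //; exact: between_le Hw (Hz l) Hs.
    exact: (Ck_der Cg Hc).
  by exists c => //; split=> //; apply: cube_upd => //; exact: between_le c1 (Hz l) Hs.
have btw (a b c : R) : between a b c -> `|c - a| <= `|b - a|.
  case=> /andP[h1 h2]; first by rewrite !ger0_norm ?subr_ge0 ?(le_trans h1 h2) ?lerD2r.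
  by rewrite !ler0_norm ?subr_le0 ?(le_trans h1 h2) // lerN2 lerD2r.
case: eqVneq vE => [jk|jk] vE.
  have [c c1 [c2 c3]] := step u k (v 0 k) Hu (Hv k).
  exists u, (upd u k c); split=> //.
  - by move=> l; rewrite subrr normr0 addr_ge0.
  - move=> l; rewrite updE; case: eqP => [->|_]; last by rewrite subrr normr0 addr_ge0.
    by apply: le_trans (btw _ _ _ c1) _; rewrite lerDr.
  - by rewrite add0r -c3 -vE.
have vj : v 0 j = u 0 j + h by rewrite vE upd_other // upd_same.
have [c c1 [c2 c3]] := step u j (v 0 j) Hu (Hv j).
have Hm : cube p r (upd u j (v 0 j)) by exact: cube_upd.
have [d d1 [d2 d3]] := step _ k (v 0 k) Hm (Hv k).
have kj : k != j by rewrite eq_sym.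
rewrite (upd_other _ _ kj) in d1 d3.
have hE : v 0 j - u 0 j = h by rewrite vj addrAC subrr add0r.
exists (upd u j c), (upd (upd u j (v 0 j)) k d); split=> //.
- move=> l; rewrite updE; case: eqP => [->|_]; last by rewrite subrr normr0 addr_ge0.
  by apply: le_trans (btw _ _ _ c1) _; rewrite hE lerDl.
- move=> l; rewrite updE; case: eqP => [->|_].
    by apply: le_trans (btw _ _ _ d1) _; rewrite lerDr.
  rewrite updE; case: eqP => [->|_]; last by rewrite subrr normr0 addr_ge0.
  by rewrite hE lerDl.
- have vE' : v = upd (upd u j (v 0 j)) k (v 0 k) by rewrite vj; exact: vE.
  rewrite -[h]hE -c3 -d3 -vE'; move: (g v) (g u) (g _) => *; ring.
Qed.

Lemma half_bound (a b c : R) : a <= 1 / 2 * b -> c <= b -> 2 * (c + a) <= 3 * b.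
Proof. by lra. Qed.

(** The defect of an increment in the linearised equation. The factor 4 is 1 + 3: one for the direct
    increment [h], three for the increment [q1], which is at most 3 |h|. *)
Lemma bracket_bound (b : bool) (pa pb pk q2 q1 h n e K : R) :
  `|pa - pb| < e -> `|pk - q2| < e -> `|q2| <= K -> `|q1| <= 3 * `|h| ->
  `|(if b then 0 else pa * h) + pk * q1 - h * (q2 * n + (if b then 0 else pb))|
    <= 4 * e * `|h| + K * `|q1 - h * n|.
Proof.
move=> b1 b2 b3 Qs; have e0 : 0 < e by exact: le_lt_trans b1.
have -> : (if b then 0 else pa * h) + pk * q1 - h * (q2 * n + (if b then 0 else pb)) =
    (if b then 0 else (pa - pb) * h) + (pk - q2) * q1 + q2 * (q1 - h * n).
  by case: b; ring.
apply: le_trans (ler_normD _ _) _; apply: lerD; last by rewrite normrM; exact: ler_wpM2r.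
apply: le_trans (ler_normD _ _) _.
have c1 : `|if b then 0 else (pa - pb) * h| <= e * `|h|.
  case: b; first by rewrite normr0 mulr_ge0 // ltW.
  by rewrite normrM; apply: ler_wpM2r => //; exact: ltW.
have c2 : `|(pk - q2) * q1| <= e * (3 * `|h|).
  by rewrite normrM; apply: ler_pM => //; exact: ltW.
apply: le_trans (lerD c1 c2) _.
by rewrite (_ : e * `|h| + e * (3 * `|h|) = 4 * e * `|h|) //; ring.
Qed.

Lemma graph_shift x i j k (s h z1 z2 : R) : j != i ->
  upd (upd (upd x j (h + x 0 j)) i s) k z2 =
  upd (if j == k then upd (upd x i s) k z1
       else upd (upd (upd x i s) k z1) j (upd (upd x i s) k z1 0 j + h)) k z2.
Proof.
move=> ji; apply/rowP => l; rewrite [LHS]updE [RHS]updE.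
have [//|lk] := eqVneq l k; have [jk|jk] := eqVneq j k.
  by rewrite !updE (negbTE lk) jk (negbTE lk).
rewrite !updE (negbTE lk) (negbTE jk) (negbTE ji).
by have [->|lj] := eqVneq l j; rewrite ?(negbTE ji) // addrC.
Qed.

(** The candidate derivative [N j] solves the linearised equation d_i N = a1 N + b_j, in closed form
    by an integrating factor. A first Gronwall estimate bounds the increments of [Z], a second one
    their distance from h N. [N k] is an exponential, hence positive, which makes [Z] invertible in
    the coordinate [k]. *)
Lemma flow_smooth p i k g Z (r K d d' : R) : i != k -> (forall n, Ck (cube p r) n g) ->
  (forall j x, cube p r x -> `|partial j g x| <= K) -> 0 <= K -> K * d <= 1 / 2 ->
  is_primitive p d i (fun x => g (graph Z k x)) (fun x => Z x - x 0 k) ->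
  (forall x, cube p d x -> {for x, continuous Z}) ->
  (forall x, cube p d x -> cube p r (graph Z k x)) -> 0 < d' -> d' < d ->
  exists N : 'I_3 -> E -> R,
    [/\ forall j x, j != i -> cube p d' x -> is_derive x (delta_mx 0 j) Z (N j x),
        forall x, cube p d' x -> is_derive x (delta_mx 0 i) Z (g (graph Z k x)),
        forall n, Ck (cube p d') n Z, forall x, cube p d' x -> 0 < N k x &
        forall j, j != k -> (forall x, cube p r x -> partial j g x = 0) ->
          forall x, cube p d' x -> N j x = 0].
Proof.
move=> ik Cg gK K0 Kd HZ cZ Hr d'0 d'd.
have d0 : 0 < d by exact: lt_trans d'd.
have [d1 [d'd1 d1d]] : exists d1 : R, d' < d1 /\ d1 < d by exists ((d' + d) / 2); lra.
have d10 : 0 < d1 by exact: lt_trans d'd1.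
have oc q := @cube_open R p q.
have cG x : cube p d x -> {for x, continuous (graph Z k)}.
  by move=> Hx; apply: graph_cont; exact: cZ.
have cpG j x : cube p d x -> {for x, continuous (fun z => partial j g (graph Z k z))}.
  move=> Hx; apply: (@cont_comp _ _ _ (graph Z k) (partial j g)); first exact: cG.
  exact: Ck_cont (Ck_partial j (Cg 1%N)) (Hr _ Hx).
pose a1 x := partial k g (graph Z k x).
have [A HA] := @exists_primitive R p d d1 i a1 d10 d1d (cpG k).
have cA x : cube p d1 x -> {for x, continuous A}.
  by move=> Hx; apply: primitive_cont HA _ Hx => z Hz; apply: cpG; exact: cube_sub (ltW d1d) _ Hz.
(* For [j = k] there is no inhomogeneity: along the curves [g] sees the coordinate [k] only through
   [Z], whose initial value has derivative 1 in that direction. *)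
pose bj j x := if j == k then 0 else partial j g (graph Z k x).
pose ib j x := expR (- A x) * bj j x.
have cE x : cube p d1 x -> {for x, continuous (fun z => expR (- A z))}.
  move=> Hx; apply: (@cont_comp _ _ _ (fun z : E => - A z) (@expR R)); last exact: continuous_expR.
  by apply: contN; exact: cA.
have cib j x : cube p d1 x -> {for x, continuous (ib j)}.
  move=> Hx; apply: contM; first exact: cE.
  rewrite /bj; case: eqP => _; first exact: contC.
  by apply: cpG; exact: cube_sub (ltW d1d) _ Hx.
have HB j : exists B, is_primitive p d' i (ib j) B.
  exact: (@exists_primitive R p d1 d' i (ib j) d'0 d'd1 (cib j)).
have [B {}HB] := choice HB.
pose N j x := expR (A x) * ((if j == k then 1 else 0) + B j x).
have HA' := primitive_sub (ltW d'd1) HA.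
have Ni j x : cube p d' x -> is_derive x (delta_mx 0 i) (N j) (a1 x * N j x + bj j x).
  move=> Hx; have H1 : is_derive x (delta_mx 0 i) (fun z => expR (A z)) (expR (A x) * a1 x).
    apply/is_derive_line; apply: (@isd_comp R (@expR R) (fun s => A (upd x i s))).
      by rewrite upd_id; exact: is_derive_expR.
    by apply/is_derive_line; exact: HA'.2.
  apply: (isd_eq (isdM H1 (isdD (isdC _ _ _) ((HB j).2 x Hx)))).
  have E0 : expR (A x) * expR (- A x) = 1 by rewrite expRN divff // gt_eqF // expR_gt0.
  rewrite /N /ib add0r [X in _ + X]mulrA E0 mul1r.
  by congr (_ + _); rewrite mulrCA mulrA.
have Nb j x : cube p d' x -> N j (upd x i (p 0 i)) = if j == k then 1 else 0.
  move=> Hx; rewrite /N (primitive_base (HB j) Hx d'0) (primitive_base HA' Hx d'0).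
  by rewrite expR0 mul1r addr0.
have dd' : `|p 0 i - p 0 i| < d' by rewrite subrr normr0.
have dd : `|p 0 i - p 0 i| < d by rewrite subrr normr0.
have HD j x : j != i -> cube p d' x -> is_derive x (delta_mx 0 j) Z (N j x).
  move=> ji Hx'; have ij : i != j by rewrite eq_sym.
  have Hx := cube_sub (ltW d'd) Hx'.
  apply/is_derive_line; apply: is_derive_eps => e e0.
  (* 8 is the factor 2 of [gronwall] times the factor 4 of [bracket_bound]. *)
  have e80 : 0 < e / (8 * d) by rewrite divr_gt0 // mulr_gt0.
  have Hcurve l : exists2 r : R, 0 < r & forall s z, between (p 0 i) (x 0 i) s ->
      cube (graph Z k (upd x i s)) r z -> `|partial l g z - partial l g (graph Z k (upd x i s))| < e / (8 * d).
    apply: (@curve_unif R (partial l g) (fun s => graph Z k (upd x i s))) => // s Hs.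
      apply: (@cont_comp _ _ _ (upd x i) (graph Z k)); first exact: upd_continuous.
      by apply: cG; apply: cube_upd => //; exact: between_le Hs dd (Hx i).
    apply: Ck_cont (Ck_partial l (Cg 1%N)) _; apply: Hr.
    by apply: cube_upd => //; exact: between_le Hs dd (Hx i).
  have [r1 r10 H1] := Hcurve j; have [r2 r20 H2] := Hcurve k.
  have [r3 r30 H3] := open_cube (oc d) Hx.
  exists (Num.min (Num.min r1 r2 / 4) r3); first by rewrite lt_min r30 divr_gt0 // lt_min r10.
  move=> h h0; rewrite lt_min => /andP[hr hr3].
  have hr1 : 4 * `|h| < r1.
    move: hr; rewrite ltr_pdivlMr // mulrC => /lt_le_trans; apply; by rewrite ge_min lexx.
  have hr2 : 4 * `|h| < r2.
    move: hr; rewrite ltr_pdivlMr // mulrC => /lt_le_trans; apply; by rewrite ge_min lexx orbT.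
  have [y yE] : exists y, y = upd x j (h + x 0 j) by eexists.
  have Hy : cube p d y.
    by rewrite yE; apply: H3; apply: cube_upd; [exact: cube_center|rewrite addrK].
  rewrite upd_id -yE.
  pose Q s := Z (upd y i s) - Z (upd x i s).
  pose dQ s := g (graph Z k (upd y i s)) - g (graph Z k (upd x i s)).
  have Hxs s : between (p 0 i) (x 0 i) s -> cube p d (upd x i s).
    by move=> Hs; apply: cube_upd => //; exact: between_le Hs dd (Hx i).
  have Hys s : between (p 0 i) (x 0 i) s -> cube p d (upd y i s).
    by move=> Hs; apply: cube_upd => //; exact: between_le Hs dd (Hx i).
  have Zl z s : cube p d z -> between (p 0 i) (x 0 i) s ->
      is_derive s 1 (fun w => Z (upd z i w)) (g (graph Z k (upd z i s))).
    move=> Hz Hs; have Hs' := between_le Hs dd (Hx i).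
    have := isdD (primitive_line HZ Hz Hs') (isdC (z 0 k) s 1).
    rewrite addr0 (_ : (fun w => _) = (fun w => Z (upd z i w))) //.
    by apply/funext => w; rewrite upd_other 1?eq_sym // subrK.
  have HQ s : between (p 0 i) (x 0 i) s -> is_derive s 1 Q (dQ s).
    by move=> Hs; exact: (isdB (Zl y s Hy Hs) (Zl x s Hx Hs)).
  have Qa : Q (p 0 i) = if j == k then h else 0.
    have Zb z : cube p d z -> Z (upd z i (p 0 i)) = z 0 k.
      move=> Hz; have := primitive_base HZ Hz d0.
      by rewrite upd_other 1?eq_sym // => /eqP; rewrite subr_eq0 => /eqP.
    rewrite /Q !Zb // yE updE eq_sym; case: eqP => [->|_]; last exact: subrr.
    by rewrite addrK.
  have step s : between (p 0 i) (x 0 i) s ->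
     exists a b : E, [/\ cube p r a /\ cube p r b,
       forall l, `|a 0 l - graph Z k (upd x i s) 0 l| <= `|h| + `|Q s|,
       forall l, `|b 0 l - graph Z k (upd x i s) 0 l| <= `|h| + `|Q s| &
       dQ s = (if j == k then 0 else partial j g a * h) + partial k g b * Q s].
    move=> Hs; have := @two_step g p r (graph Z k (upd x i s)) (graph Z k (upd y i s)) j k h
      (Cg 1%N) (Hr _ (Hxs s Hs)) (Hr _ (Hys s Hs)).
    by rewrite /graph !upd_same; apply; rewrite yE; exact: graph_shift.
  have hp : 0 <= `|h| by [].
  have xid : `|x 0 i - p 0 i| <= d by exact: ltW.
  have Kxi : K * `|x 0 i - p 0 i| <= 1 / 2 by apply: le_trans Kd; rewrite ler_wpM2l.
  (* The 3 is twice the sum of |h| from the start and |h| / 2 from the inhomogeneity. *)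
  have Qb s : between (p 0 i) (x 0 i) s -> `|Q s| <= 3 * `|h|.
    have := @gronwall R Q dQ (p 0 i) (x 0 i) (K * `|h|) K HQ.
    move=> H Hs; have := H _ _ K0 Kxi s Hs; rewrite Qa => {}H.
    apply: le_trans (H _ _) _.
    - move=> s' Hs'; have [a [b [[Ha Hb] _ _ ->]]] := step s' Hs'.
      apply: le_trans (ler_normD _ _) _; apply: lerD.
        case: eqP => _; first by rewrite normr0 mulr_ge0.
        by rewrite normrM ler_wpM2r // gK.
      by rewrite normrM ler_wpM2r // gK.
    - by rewrite mulr_ge0.
    - have : `|if j == k then h else 0| <= `|h| by case: eqP => // _; rewrite normr0.
      have : K * `|x 0 i - p 0 i| * `|h| <= 1 / 2 * `|h| by rewrite ler_wpM2r.
      rewrite (mulrAC K `|h|) => q1 q2.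
      exact: half_bound.
  have btx s : between (p 0 i) (x 0 i) s -> cube p d' (upd x i s).
    by move=> Hs; apply: cube_upd => //; exact: between_le Hs dd' (Hx' i).
  pose W s := Q s - h * N j (upd x i s).
  pose dW s := dQ s - h * (a1 (upd x i s) * N j (upd x i s) + bj j (upd x i s)).
  have HW s : between (p 0 i) (x 0 i) s -> is_derive s 1 W (dW s).
    move=> Hs; have HN := (is_derive_upd (N j) x i s _).1 (Ni j _ (btx s Hs)).
    apply: (isd_eq (isdB (HQ s Hs) (isdM (isdC h s 1) HN))).
    by rewrite mul0r add0r.
  have Wa : W (p 0 i) = 0.
    by rewrite /W Qa Nb //; case: eqP => _; rewrite ?mulr1 ?mulr0 subrr.
  have xin : between (p 0 i) (x 0 i) (x 0 i).
    by have [h1|h1] := leP (p 0 i) (x 0 i); [left|right]; rewrite lexx ?andbT // ltW.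
  have := @gronwall R W dW (p 0 i) (x 0 i) (4 * (e / (8 * d)) * `|h|) K HW _ _ K0 Kxi _ xin.
  have WE : W (x 0 i) = Z y - Z x - h * N j x.
    by rewrite /W /Q upd_id yE -(updC _ _ _ ij) upd_id.
  rewrite Wa normr0 add0r WE => H.
  have hn : 0 < `|h| by rewrite normr_gt0.
  rewrite -(ler_pM2l hn) -normrM mulrBr mulrA divff // mul1r.
  apply: le_trans (H _ _) _.
  - move=> s Hs; have [a [b [[Ha Hb] Ha' Hb' E1]]] := step s Hs.
    have Qs := Qb s Hs.
    have Qs4 : `|h| + `|Q s| <= 4 * `|h|.
      by have -> : 4 * `|h| = `|h| + 3 * `|h| by [ring]; rewrite lerD2l.
    have Hca : cube (graph Z k (upd x i s)) r1 a.
      by move=> l; exact: le_lt_trans (le_trans (Ha' l) Qs4) hr1.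
    have Hcb : cube (graph Z k (upd x i s)) r2 b.
      by move=> l; exact: le_lt_trans (le_trans (Hb' l) Qs4) hr2.
    have b1 := H1 s a Hs Hca; have b2 := H2 s b Hs Hcb.
    have b3 := gK k _ (Hr _ (Hxs s Hs)).
    rewrite /dW E1 /bj /a1.
    exact: bracket_bound b1 b2 b3 Qs.
  - by rewrite mulr_ge0 // mulr_ge0 // ltW.
  - have -> : `|h| * e = 2 * (4 * (e / (8 * d)) * `|h| * d) by field; rewrite gt_eqF.
    rewrite ler_pM2l //; apply: ler_wpM2l => //; rewrite mulr_ge0 // mulr_ge0 // ltW //.
have HZi x : cube p d' x -> is_derive x (delta_mx 0 i) Z (g (graph Z k x)).
  move=> Hx; have := isdD (HZ.2 x (cube_sub (ltW d'd) Hx)) (Ck_is_derive i (@Ck_coord R setT 1 k openT) (I : setT x)).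
  rewrite (_ : (fun z : E => Z z - z 0 k + z 0 k) = Z); last by apply/funext => z; rewrite subrK.
  by rewrite partial_coord (negbTE ik) addr0.
exists N; split=> //.
(* The right hand side of the equation and the formula for [N] are built from [graph Z k], so the
   partial derivatives of [Z] are as regular as [Z]. *)
- elim=> [|n IH].
    by split=> // x Hx; apply: cZ; exact: cube_sub (ltW d'd) _ Hx.
  have CG : forall l, Ck (cube p d') n (fun z => graph Z k z 0 l).
    move=> l; have [->|lk] := eqVneq l k.
      by apply: Ck_eq IH => // z _; rewrite upd_same.
    by apply: Ck_eq (Ck_coord n l (oc d')) => // z _; rewrite upd_other.
  have CgG q : (forall n, Ck (cube p r) n q) -> Ck (cube p d') n (fun z => q (graph Z k z)).
    move=> Hq; apply: (@Ck_comp R _ n (graph Z k) (cube p r)) => // x Hx.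
    by apply: Hr; exact: cube_sub (ltW d'd) _ Hx.
  have CgP l : Ck (cube p d') n (fun z => partial l g (graph Z k z)).
    by apply: CgG => m; exact: Ck_partial (Cg m.+1).
  have CA : Ck (cube p d') n A by exact: primitive_Ck HA' (CgP k).
  apply: (CkS' (df := fun j x => if j == i then g (graph Z k x) else N j x)) => [||j].
  + exact: oc.
  + by move=> j x Hx; case: eqVneq => [->|ji]; [exact: HZi|exact: HD].
  + case: eqVneq => [_|ji]; first exact: CgG.
    apply: Ck_mul; [exact: oc|exact: Ck_exp|apply: Ck_add; [exact: oc| |]].
      by case: eqP => _; exact: Ck_cst.
    apply: primitive_Ck (HB j) _; apply: Ck_mul; [exact: oc| |].
      by apply: Ck_exp; [exact: oc|exact: Ck_opp].
    by rewrite /bj; case: eqP => _; [exact: Ck_cst|exact: CgP].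
- have B0 j x : (forall z, cube p d' z -> ib j z = 0) -> cube p d' x -> B j x = 0.
    move=> H0 Hx; have := @primitive_dist R p d' i (ib j) (fun=> 0) (B j) (fun=> 0) x 0 (HB j).
    rewrite mul0r subr0 normr_le0 => H; apply/eqP; apply: H => //.
      by split=> // z _; exact: isdC.
    by move=> z Hz; rewrite H0 // subr0 normr0.
  move=> x Hx; rewrite /N eqxx B0 ?addr0 ?mulr1 ?expR_gt0 // => z Hz.
  by rewrite /ib /bj eqxx mulr0.
- have B0 j x : (forall z, cube p d' z -> ib j z = 0) -> cube p d' x -> B j x = 0.
    move=> H0 Hx; have := @primitive_dist R p d' i (ib j) (fun=> 0) (B j) (fun=> 0) x 0 (HB j).
    rewrite mul0r subr0 normr_le0 => H; apply/eqP; apply: H => //.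
      by split=> // z _; exact: isdC.
    by move=> z Hz; rewrite H0 // subr0 normr0.
  move=> j jk Hj x Hx; rewrite /N (negbTE jk) B0 ?addr0 ?mulr0 // => z Hz.
  by rewrite /ib /bj (negbTE jk) Hj ?mulr0 //; apply: Hr; exact: cube_sub (ltW d'd) _ Hz.
Qed.

Lemma clamp_upd p r x k (a : R) : clamp p r (upd x k a) =
  upd (clamp p r x) k (Num.max (p 0 k - r) (Num.min (p 0 k + r) a)).
Proof. by apply/rowP => j; rewrite mxE !updE; case: eqP => [->//|_]; rewrite mxE. Qed.

Lemma max_lip (c a b : R) : `|Num.max c a - Num.max c b| <= `|a - b|.
Proof.
have H (t : R) : t <= `|t| /\ - t <= `|t| by split; [exact: ler_norm|rewrite -normrN ler_norm].
have [h1 h2] := H (a - b); rewrite ler_norml.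
by case: (leP c a) => h3; case: (leP c b) => h4; apply/andP; split; lra.
Qed.

Lemma min_lip (c a b : R) : `|Num.min c a - Num.min c b| <= `|a - b|.
Proof.
have H (t : R) : t <= `|t| /\ - t <= `|t| by split; [exact: ler_norm|rewrite -normrN ler_norm].
have [h1 h2] := H (a - b); rewrite ler_norml.
by case: (leP c a) => h3; case: (leP c b) => h4; apply/andP; split; lra.
Qed.

(** [f] labels each integral curve of d_i + g d_k by its starting point: it inverts [Z] in the
    coordinate [k]. If [g] does not depend on x_j, neither does the label. *)
Lemma flow_box U p i k g : i != k -> open U -> U p -> (forall n, Ck U n g) ->
  exists (V : set E) (f : E -> R),
    [/\ open V /\ V p, V `<=` U, forall n, Ck V n f,
        forall x, V x -> partial i f x + g x * partial k f x = 0 /\ partial k f x != 0 &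
        forall j, j != i -> j != k -> (forall x, U x -> partial j g x = 0) ->
          forall x, V x -> partial j f x = 0].
Proof.
move=> ik oU Up Cg.
have [r1 r10 H1] := open_cube oU Up.
have [r2 r20 H2] := cont_eps (Ck_cont (Cg 0%N) Up) ltr01.
have H3 j : exists2 r : R, 0 < r & forall z, cube p r z -> `|partial j g z - partial j g p| < 1.
  exact: cont_eps (Ck_cont (Ck_partial j (Cg 1%N)) Up) _ ltr01.
have [r3 r30 H30] := H3 iy; have [r4 r40 H40] := H3 ix; have [r5 r50 H50] := H3 it.
have [r0 [r00 [m1 m2 m3 [m4 m5]]]] : exists r : R, 0 < r /\
    [/\ r <= r1, r <= r2, r <= r3 & r <= r4 /\ r <= r5].
  exists (Num.min r1 (Num.min r2 (Num.min r3 (Num.min r4 r5)))).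
  by rewrite !lt_min r10 r20 r30 r40 r50 !ge_min !lexx !orbT.
pose M := `|g p| + 1.
pose K := `|partial iy g p| + `|partial ix g p| + `|partial it g p| + 1.
have near1 (a b : R) : `|a - b| < 1 -> `|a| <= `|b| + 1.
  move=> H; rewrite -(subrK b a) addrC; apply: le_trans (ler_normD _ _) _.
  by rewrite lerD2l ltW.
have gM z : cube p r0 z -> `|g z| <= M by move=> Hz; apply: near1; exact: H2 (cube_sub m2 Hz).
have gK j z : cube p r0 z -> `|partial j g z| <= K.
  move=> Hz; rewrite /K; elim/ord3_ind: j.
  - apply: le_trans (near1 _ _ (H30 z (cube_sub m3 Hz))) _.
    by rewrite lerD2r -addrA lerDl addr_ge0.
  - apply: le_trans (near1 _ _ (H40 z (cube_sub m4 Hz))) _.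
    by rewrite lerD2r addrAC lerDr addr_ge0.
  - apply: le_trans (near1 _ _ (H50 z (cube_sub m5 Hz))) _.
    by rewrite lerD2r lerDr addr_ge0.
have K0 : 0 <= K by rewrite /K !addr_ge0.
have M0 : 0 <= M by rewrite /M addr_ge0.
have K1 : 0 < K + 1 by rewrite ltr_wpDl.
have M1 : 0 < M + 1 by rewrite ltr_wpDl.
have [r [rp rr0]] : exists r : R, 0 < r /\ r < r0.
  by exists (r0 / 2); rewrite divr_gt0 // ltr_pdivrMr // ltr_pMr // ltrDr.
have rU : cube p r0 `<=` U by move=> z Hz; apply: H1; exact: cube_sub Hz.
(* Cutting off by [clamp] makes [g] bounded and Lipschitz in x_k on the whole space, as [picard]
   requires; on the cube of radius [r] it is still [g]. *)
pose G z := g (clamp p r z).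
have cr z : cube p r0 (clamp p r z) by apply: clamp_cube; rewrite ltW.
have cG x : {for x, continuous G}.
  apply: (@cont_comp _ _ _ (clamp p r) g); first exact: clamp_continuous.
  exact: Ck_cont (Cg 0%N) (rU _ (cr _)).
have GK x (a b : R) : `|G (upd x k a) - G (upd x k b)| <= K * `|a - b|.
  rewrite /G !clamp_upd.
  have := cr (upd x k a); have := cr (upd x k b); rewrite !clamp_upd.
  have L : `|Num.max (p 0 k - r) (Num.min (p 0 k + r) a) - Num.max (p 0 k - r) (Num.min (p 0 k + r) b)|
      <= `|a - b| by exact: le_trans (max_lip _ _ _) (min_lip _ _ _).
  move: (Num.max _ (Num.min _ a)) (Num.max _ (Num.min _ b)) (clamp p r x) L => A B z L HB HA.
  have Hseg (u : R) : between B A u -> cube p r0 (upd z k u).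
    move=> Hu; rewrite -(upd_upd z k A u); apply: cube_upd => //.
    by apply: between_le Hu _ _; [have := HB k|have := HA k]; rewrite upd_same.
  have [|c c1 c2] := @mvt_line _ g (upd z k B) k A.
    rewrite upd_same => u Hu; rewrite upd_upd; have Hc := Hseg u Hu.
    exact: (Ck_der (Cg 1%N) (rU _ Hc)).
  move: c1 c2; rewrite !upd_upd upd_same => c1 ->; rewrite normrM.
  apply: ler_pM => //; apply: gK; exact: Hseg.
(* The first bound makes the iteration contract, the second keeps the curves in the cube where [g]
   is not cut off. *)
have [d [d0 Kd Md]] : exists d : R, [/\ 0 < d, K * d <= 1 / 2 & (M + 1) * d <= r].
  exists (Num.min (1 / 2 / (K + 1)) (r / (M + 1))); split.
  - by rewrite lt_min !divr_gt0.
  - apply: (@le_trans _ _ ((K + 1) * (1 / 2 / (K + 1)))).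
      apply: ler_pM => //; first by rewrite le_min !divr_ge0 // ltW.
        by rewrite lerDl.
      by rewrite ge_min lexx.
    by rewrite mulrC divfK // gt_eqF.
  - by rewrite mulrC -ler_pdivlMr // ge_min lexx orbT.
have [d2 [d20 d2d]] : exists d2 : R, 0 < d2 /\ d2 < d.
  by exists (d / 2); rewrite divr_gt0 // ltr_pdivrMr // ltr_pMr // ltrDr.
have [d' [d'0 d'd]] : exists d' : R, 0 < d' /\ d' < d2.
  by exists (d2 / 2); rewrite divr_gt0 // ltr_pdivrMr // ltr_pMr // ltrDr.
have [Z [cZ pZ]] := @picard R p i k G M K d d2 ik cG (fun z => gM _ (cr z)) GK K0 Kd d20 d2d.
have Hgr x : cube p d2 x -> cube p r (graph Z k x).
  move=> Hx; have Z1 : `|Z x - x 0 k| <= M * d2.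
    have := @primitive_dist R p d2 i _ (fun=> 0) _ (fun=> 0) x M pZ.
    rewrite subr0; apply => //; first by split=> // z _; exact: isdC.
    by move=> z _; rewrite subr0; exact: gM _ (cr _).
  have Md2 : (M + 1) * d2 < r by apply: lt_le_trans Md; rewrite ltr_pM2l.
  have d2r : d2 < r by apply: le_lt_trans Md2; rewrite ler_peMl ?lerDr // ltW.
  apply: cube_upd; first by apply: cube_sub Hx; exact: ltW.
  rewrite -(subrKA (x 0 k)); apply: le_lt_trans (ler_normD _ _) _.
  apply: lt_trans Md2; rewrite mulrDl mul1r; apply: ler_ltD => //; exact: Hx.
have pZ' : is_primitive p d2 i (fun x => g (graph Z k x)) (fun x => Z x - x 0 k).
  by apply: is_primitive_eq pZ => z Hz; rewrite /G clamp_id //; exact: Hgr.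
have Cg' n : Ck (cube p r) n g.
  by apply: Ck_sub (Cg n) => z Hz; apply: rU; exact: cube_sub (ltW rr0) _ Hz.
have gK' j x : cube p r x -> `|partial j g x| <= K.
  by move=> Hx; apply: gK; exact: cube_sub (ltW rr0) _ Hx.
have Kd2 : K * d2 <= 1 / 2 by apply: le_trans Kd; rewrite ler_wpM2l // ltW.
have [N [HN HZi CZ Npos N0]] := @flow_smooth p i k g Z r K d2 d' ik Cg' gK' K0 Kd2 pZ' cZ Hgr d'0 d'd.
have cc := cube_center p d'0; have ki : k != i by rewrite eq_sym.
have pk x : cube p d' x -> partial k Z x = N k x.
  by move=> Hx; apply: is_derive_partial; exact: HN.
have nz : partial k Z p != 0 by rewrite pk // gt_eqF // Npos.
have [r' [w [[r'0 r'sub] Hn oV Cw [wE wD]]]] := replace_inverse (@cube_open _ p d') cc CZ nz.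
have gp : graph Z k p = p.
  have := pZ'.1 p (cube_center p d20) erefl => /eqP; rewrite subr_eq0 => /eqP E1.
  by rewrite /graph E1 upd_id.
exists [set upd x k (Z x) | x in cube p r'], w; split=> //.
- by split=> //; exists p; [exact: cube_center|exact: gp].
- move=> _ [x Hx <-]; apply: rU; apply: cube_sub (ltW rr0) _ _; apply: Hgr.
  by apply: cube_sub (ltW d'd) _ _; exact: r'sub.
- move=> _ [x Hx <-]; have Hx' := r'sub _ Hx.
  have Nx : N k x != 0 by rewrite gt_eqF // Npos.
  rewrite (is_derive_partial (wD i x Hx)) (is_derive_partial (wD k x Hx)).
  rewrite /inverse_slope eqxx (negbTE ik) pk // (is_derive_partial (HZi x Hx')).
  split; last by rewrite mul1r invr_eq0.
  by rewrite /graph; move: (g _) (N k x) Nx => a b b0; field.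
- move=> j ji jk Hj _ [x Hx <-]; have Hx' := r'sub _ Hx.
  rewrite (is_derive_partial (wD j x Hx)) /inverse_slope (negbTE jk).
  rewrite (is_derive_partial (HN j x ji Hx')) N0 ?oppr0 ?mul0r // => z Hz.
  by apply: Hj; apply: rU; exact: cube_sub (ltW rr0) _ Hz.
Qed.

End FlowBox.

(** * The Weyl connection and its curvature *)

Lemma isdZ (R : realType) (V : normedModType R) (c : R) (f : V -> R) (x v : V) (a : R) :
  is_derive x v f a -> is_derive x v (fun z => c * f z) (c * a).
Proof. by move=> H; apply: (isd_eq (isdM (isdC _ _ _) H)); rewrite mul0r add0r. Qed.

Section Koszul.
Context {R : realType}.
Local Notation E := 'rV[R]_3.
Implicit Types (h : E -> 'M[R]_3) (omega : E -> E) (G : connection R) (x : E) (i j k l : 'I_3).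
Local Opaque partial.

Definition torsion_free G x : Prop := forall k i j, G k i j x = G k j i x.

(** Add two of the cyclically permuted compatibility equations and subtract the third, as for the
    Levi-Civita connection. *)
Lemma koszul h omega G x : torsion_free G x -> (h x)^T = h x ->
  (forall i j k, partial i (fun z => h z j k) x = partial i (fun z => h z k j) x) ->
  weyl_compatible_at h omega G x ->
  forall i j l, \sum_m G m i j x * h x m l = 2^-1 *
    (partial i (fun z => h z j l) x + partial j (fun z => h z i l) x
     - partial l (fun z => h z i j) x
     - omega x 0 i * h x j l - omega x 0 j * h x i l + omega x 0 l * h x i j).
Proof.
move=> Gs hs dhs HG i j l.
have hsE a b : h x a b = h x b a by rewrite -[in LHS]hs mxE.
have HC a b c : partial a (fun z => h z b c) x = omega x 0 a * h x b c
    + \sum_m G m a b x * h x m c + \sum_m G m a c x * h x m b.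
  have E1 : \sum_m G m a c x * h x b m = \sum_m G m a c x * h x m b.
    by apply: eq_bigr => m _; rewrite (hsE b m).
  have := HG a b c; rewrite E1 => <-.
  by rewrite -addrA addrC -!addrA; move: (partial a _ x) (\sum_m _) (\sum_m _) => *; ring.
rewrite (HC i j l) (HC j i l) (HC l i j).
have S a b c : \sum_m G m a b x * h x m c = \sum_m G m b a x * h x m c.
  by apply: eq_bigr => m _; rewrite Gs.
rewrite (S j i l) (S l i j) (S l j i).
move: (\sum_m G m i j x * h x m l) (\sum_m G m i l x * h x m j) (\sum_m G m j l x * h x m i) => a b c.
move: (omega x 0 i) (omega x 0 j) (omega x 0 l) (h x j l) (h x i l) (h x i j) => *.
by field.
Qed.

Lemma koszul_sum (F : fieldType) (K P w hi hj : 'I_3 -> F) (wi wj hij : F) :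
  \sum_l K l * (2^-1 * (P l - wi * hj l - wj * hi l + w l * hij)) =
  2^-1 * (\sum_l K l * P l) -
  2^-1 * ((\sum_l K l * hi l) * wj + (\sum_l K l * hj l) * wi - hij * \sum_l K l * w l).
Proof. by rewrite !sum3E; ring. Qed.

Lemma koszul_inv h omega G x : h x \in unitmx -> torsion_free G x -> (h x)^T = h x ->
  (forall i j k, partial i (fun z => h z j k) x = partial i (fun z => h z k j) x) ->
  weyl_compatible_at h omega G x ->
  forall k i j, G k i j x = levi_civita h k i j x - 2^-1 *
    ((k == i)%:R * omega x 0 j + (k == j)%:R * omega x 0 i
     - h x i j * \sum_l invmx (h x) k l * omega x 0 l).
Proof.
move=> hu Gs hs dhs HG k i j.
have K := koszul Gs hs dhs HG i j.
have hsE a b : h x a b = h x b a by rewrite -[in LHS]hs mxE.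
have KH a b : \sum_l invmx (h x) a l * h x b l = (a == b)%:R.
  have := mulVmx hu => /matrixP /(_ a b); rewrite !mxE => <-.
  by apply: eq_bigr => l _; rewrite (hsE b l).
have E1 : G k i j x = \sum_l invmx (h x) k l * \sum_m G m i j x * h x m l.
  under eq_bigr do rewrite mulr_sumr.
  rewrite exchange_big /= (eq_bigr (fun m => G m i j x * (k == m)%:R)); last first.
    move=> m _; rewrite -KH mulr_sumr; apply: eq_bigr => l _; exact: mulrCA.
  rewrite (bigD1 k) //= eqxx mulr1 big1 ?addr0 // => m mk.
  by rewrite eq_sym (negbTE mk) mulr0.
rewrite E1 /levi_civita -!KH; under eq_bigr do rewrite K.
exact: koszul_sum.
Qed.

End Koszul.

Section WeylRicciAlgebra.
Variable F : fieldType.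
Hypothesis two0 : (2 : F) != 0.
Variables (Gam : 'I_3 -> 'I_3 -> 'I_3 -> F) (dGam : 'I_3 -> 'I_3 -> 'I_3 -> 'I_3 -> F).
Variables (h : 'I_3 -> 'I_3 -> F) (v w : 'I_3 -> F) (dv dw : 'I_3 -> 'I_3 -> F).
Hypothesis Gs : forall k i j, Gam k i j = Gam k j i.
Hypothesis hs : forall i j, h i j = h j i.
Hypothesis wE : forall i, w i = \sum_m h i m * v m.

(** Twice the difference between the Levi-Civita connection and D, with v the vector obtained by
    raising w; [weyl_dC] is its formal derivative. *)
Definition weyl_C k i j : F := (k == i)%:R * w j + (k == j)%:R * w i - h i j * v k.
Definition weyl_dC (dh : 'I_3 -> 'I_3 -> 'I_3 -> F) a k i j : F :=
  (k == i)%:R * dw a j + (k == j)%:R * dw a i - (dh a i j * v k + h i j * dv a k).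

(** Once w, dw and dh are expressed through h, v, dv and the connection, no inverse metric is left,
    and each component is an identity in free jets. *)
Lemma weyl_ricci_algebra (dh : 'I_3 -> 'I_3 -> 'I_3 -> F) i j :
  (forall a i j, dh a i j = \sum_m Gam m a i * h m j + \sum_m Gam m a j * h i m) ->
  (forall a i, dw a i = \sum_m (dh a i m * v m + h i m * dv a m)) ->
  \sum_k (dGam k k i j - 2^-1 * weyl_dC dh k k i j - (dGam i k k j - 2^-1 * weyl_dC dh i k k j)
   + \sum_m ((Gam k k m - 2^-1 * weyl_C k k m) * (Gam m i j - 2^-1 * weyl_C m i j)
             - (Gam k i m - 2^-1 * weyl_C k i m) * (Gam m k j - 2^-1 * weyl_C m k j)))
  = \sum_k (dGam k k i j - dGam i k k j + \sum_m (Gam k k m * Gam m i j - Gam k i m * Gam m k j))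
    + (dw i j - \sum_m Gam m i j * w m) - 2^-1 * (dw j i - \sum_m Gam m j i * w m)
    + 4^-1 * (w i * w j)
    + h i j * (- 4^-1 * (\sum_k w k * v k) + 2^-1 * \sum_k (dv k k + \sum_m Gam k k m * v m)).
Proof.
move=> dhE dwE.
have c4 : 4^-1 = 2^-1 * 2^-1 :> F by rewrite -invfM -natrM.
rewrite c4 /weyl_dC /weyl_C.
rewrite !sum3E !dwE !sum3E !dhE !wE !sum3E.
have [h0 h1 h2] := And3 (hs ix iy) (hs it iy) (hs it ix).
have G0 k := Gs k ix iy; have G1 k := Gs k it iy; have G2 k := Gs k it ix.
elim/ord3_ind: i; elim/ord3_ind: j; rewrite /= ?mulr1n ?mulr0n ?h0 ?h1 ?h2 ?G0 ?G1 ?G2.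
all: by field; exact: two0.
Qed.
End WeylRicciAlgebra.

Lemma nabla_algebra (F : comPzRingType) (Gk h : 'I_3 -> 'I_3 -> F) (v dv : 'I_3 -> F) l :
  \sum_m ((\sum_p Gk p l * h p m + \sum_p Gk p m * h l p) * v m + h l m * dv m)
    - \sum_p Gk p l * \sum_m h p m * v m = \sum_m h l m * (dv m + \sum_p Gk m p * v p).
Proof. by rewrite !sum3E; ring. Qed.

Section WeylRicci.
Context {R : realType}.
Local Notation E := 'rV[R]_3.
Implicit Types (U : set E) (h : E -> 'M[R]_3) (omega : E -> E) (G : connection R) (x : E) (i j k l : 'I_3).
Local Opaque partial.

(** Regularity is asked of h and omega only; the Koszul formula then makes the coefficients of [G]
    of class C^(n+1) ([weyl_connC]). *)
Record weyl_on U h omega G (n : nat) : Prop := WeylOn {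
  weyl_open : open U;
  weyl_sym : forall x, U x -> (h x)^T = h x;
  weyl_unit : forall x, U x -> h x \in unitmx;
  weyl_hC : forall i j, Ck U n.+2 (fun x => h x i j);
  weyl_wC : forall i, Ck U n.+1 (fun x => omega x 0 i);
  weyl_tf : forall x, U x -> torsion_free G x;
  weyl_compat : forall x, U x -> weyl_compatible_at h omega G x }.

Definition raised h omega k x : R := \sum_l invmx (h x) k l * omega x 0 l.

Section Domain.
Variables (U : set E) (h : E -> 'M[R]_3) (omega : E -> E) (G : connection R) (n : nat).
Hypothesis W : weyl_on U h omega G n.
Let oU := weyl_open W.

Lemma weyl_symE x i j : U x -> h x i j = h x j i.
Proof. by move=> Ux; rewrite -[in LHS](weyl_sym W Ux) mxE. Qed.

Lemma weyl_dsym x i j k : U x ->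
  partial i (fun z => h z j k) x = partial i (fun z => h z k j) x.
Proof. by move=> Ux; apply: (partial_eq_on i oU Ux) => z Uz; exact: weyl_symE. Qed.

Lemma weyl_inv x a b : U x -> \sum_l invmx (h x) a l * h x l b = (a == b)%:R.
Proof. by move=> Ux; have := mulVmx (weyl_unit W Ux) => /matrixP /(_ a b); rewrite !mxE => <-. Qed.

Lemma weyl_inv' x a b : U x -> \sum_l h x a l * invmx (h x) l b = (a == b)%:R.
Proof. by move=> Ux; have := mulmxV (weyl_unit W Ux) => /matrixP /(_ a b); rewrite !mxE => <-. Qed.

Lemma weyl_connE x k i j : U x -> G k i j x = levi_civita h k i j x - 2^-1 *
    ((k == i)%:R * omega x 0 j + (k == j)%:R * omega x 0 i - h x i j * raised h omega k x).
Proof.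
move=> Ux; apply: koszul_inv (weyl_unit W Ux) (weyl_tf W Ux) (weyl_sym W Ux) _ (weyl_compat W Ux) _ _ _.
by move=> a b c; exact: weyl_dsym.
Qed.

Lemma weyl_invC i j : Ck U n.+2 (fun x => invmx (h x) i j).
Proof. apply: Ck_invmx => //; [exact: weyl_unit W|exact: weyl_hC W]. Qed.

Lemma levi_civitaC k i j : Ck U n.+1 (levi_civita h k i j).
Proof.
apply: Ck_mul => //; first exact: Ck_cst.
apply: Ck_sum => // l _; apply: Ck_mul => //; first exact: Ck_pred (weyl_invC k l).
have C a b c : Ck U n.+1 (partial a (fun z => h z b c)) by exact: Ck_partial (weyl_hC W b c).
by apply: Ck_sub2 => //; apply: Ck_add.
Qed.

Lemma raisedC k : Ck U n.+1 (raised h omega k).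
Proof.
apply: Ck_sum => // l _; apply: Ck_mul => //; last exact: weyl_wC W l.
exact: Ck_pred (weyl_invC k l).
Qed.

Lemma weyl_connC k i j : Ck U n.+1 (G k i j).
Proof.
apply: (@Ck_eq _ U _ (fun x => levi_civita h k i j x - 2^-1 *
    ((k == i)%:R * omega x 0 j + (k == j)%:R * omega x 0 i - h x i j * raised h omega k x))) => //.
  by move=> x Ux; rewrite -weyl_connE.
have C c : Ck U n.+1 (fun=> c : R) by exact: Ck_cst.
have Cw := weyl_wC W.
apply: Ck_sub2 => //; first exact: levi_civitaC.
apply: Ck_mul => //; apply: Ck_sub2 => //.
  by apply: Ck_add => //; apply: Ck_mul.
by apply: Ck_mul => //; [exact: Ck_pred (weyl_hC W i j)|exact: raisedC].
Qed.

Lemma levi_sym x k i j : U x -> levi_civita h k i j x = levi_civita h k j i x.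
Proof.
move=> Ux; rewrite /levi_civita; congr (_ * _); apply: eq_bigr => l _; congr (_ * _).
by rewrite (weyl_dsym l i j Ux) (addrC (partial i _ x)).
Qed.

Lemma levi_low x i j l : U x -> \sum_m levi_civita h m i j x * h x m l = 2^-1 *
  (partial i (fun z => h z j l) x + partial j (fun z => h z i l) x - partial l (fun z => h z i j) x).
Proof.
move=> Ux; rewrite /levi_civita.
pose P a := partial i (fun z => h z j a) x + partial j (fun z => h z i a) x - partial a (fun z => h z i j) x.
transitivity (\sum_a 2^-1 * (P a * \sum_m invmx (h x) m a * h x m l)).
  under eq_bigr do rewrite -mulrA mulr_suml mulr_sumr.
  rewrite exchange_big /=; apply: eq_bigr => a _; rewrite !mulr_sumr.
  apply: eq_bigr => m _; rewrite -/(P a); congr (_ * _).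
  by rewrite (mulrC (invmx (h x) m a)) mulrA.
rewrite (bigD1 l) //= [X in _ + X]big1 ?addr0.
  rewrite (eq_bigr (fun m => h x l m * invmx (h x) m l)); last first.
    by move=> m _; rewrite mulrC (weyl_symE l m Ux).
  by rewrite weyl_inv' // eqxx mulr1.
move=> a al; rewrite (eq_bigr (fun m => h x l m * invmx (h x) m a)); last first.
  by move=> m _; rewrite mulrC (weyl_symE l m Ux).
by rewrite weyl_inv' // eq_sym (negbTE al) !mulr0.
Qed.

Lemma levi_compat x a i j : U x -> partial a (fun z => h z i j) x =
  \sum_m levi_civita h m a i x * h x m j + \sum_m levi_civita h m a j x * h x i m.
Proof.
move=> Ux; rewrite (eq_bigr (fun m => levi_civita h m a j x * h x m i)
   (F1 := fun m => levi_civita h m a j x * h x i m)); last first.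
  by move=> m _; rewrite (weyl_symE i m Ux).
rewrite !levi_low // (weyl_dsym a j i Ux) (weyl_dsym j a i Ux) (weyl_dsym i a j Ux).
move: (partial a _ x) (partial j _ x) (partial i _ x) => u v w.
by field.
Qed.

Lemma weyl_conn_partial x a k i j : U x -> partial a (G k i j) x =
  partial a (levi_civita h k i j) x - 2^-1 *
  weyl_dC (h x) (fun l => raised h omega l x) (fun b l => partial b (raised h omega l) x)
    (fun b l => partial b (fun z => omega z 0 l) x) (fun b l m => partial b (fun z => h z l m) x) a k i j.
Proof.
move=> Ux; rewrite (@partial_eq_on _ U _ (fun x => levi_civita h k i j x - 2^-1 *
    ((k == i)%:R * omega x 0 j + (k == j)%:R * omega x 0 i - h x i j * raised h omega k x))) //; last first.
  by move=> z Uz; exact: weyl_connE.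
apply: is_derive_partial.
have dw l : is_derive x (delta_mx 0 a) (fun z => omega z 0 l) (partial a (fun z => omega z 0 l) x).
  exact: Ck_is_derive (weyl_wC W l) Ux.
have dh : is_derive x (delta_mx 0 a) (fun z => h z i j) (partial a (fun z => h z i j) x).
  exact: Ck_is_derive (weyl_hC W i j) Ux.
have dv : is_derive x (delta_mx 0 a) (raised h omega k) (partial a (raised h omega k) x).
  exact: Ck_is_derive (raisedC k) Ux.
have dl : is_derive x (delta_mx 0 a) (levi_civita h k i j) (partial a (levi_civita h k i j) x).
  exact: Ck_is_derive (levi_civitaC k i j) Ux.
exact: (isdB dl (isdZ _ (isdB (isdD (isdZ _ (dw j)) (isdZ _ (dw i))) (isdM dh dv)))).
Qed.

Lemma raised_low x l : U x -> \sum_m h x l m * raised h omega m x = omega x 0 l.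
Proof.
move=> Ux; rewrite /raised; under eq_bigr do rewrite mulr_sumr.
rewrite exchange_big /= (eq_bigr (fun m => (l == m)%:R * omega x 0 m)); last first.
  by move=> m _; rewrite -(weyl_inv' l m Ux) mulr_suml; apply: eq_bigr => q _; rewrite mulrA.
rewrite (bigD1 l) //= eqxx mul1r big1 ?addr0 // => m ml.
by rewrite eq_sym (negbTE ml) mul0r.
Qed.

Lemma raised_low_partial x a l : U x -> partial a (fun z => omega z 0 l) x =
  \sum_m (partial a (fun z => h z l m) x * raised h omega m x
          + h x l m * partial a (raised h omega m) x).
Proof.
move=> Ux; rewrite (@partial_eq_on _ U _ (fun z => \sum_m h z l m * raised h omega m z)) //; last first.
  by move=> z Uz; rewrite raised_low.
apply: is_derive_partial.
have H m : is_derive x (delta_mx 0 a) (fun z => h z l m * raised h omega m z)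
  (partial a (fun z => h z l m) x * raised h omega m x + h x l m * partial a (raised h omega m) x).
  exact: (isdM (Ck_is_derive a (weyl_hC W l m) Ux) (Ck_is_derive a (raisedC m) Ux)).
rewrite sum3E; rewrite (_ : (fun z => \sum_m _) = fun z => h z l iy * raised h omega iy z
  + h z l ix * raised h omega ix z + h z l it * raised h omega it z); last first.
  by apply/funext => z; rewrite sum3E.
exact: (isdD (isdD (H iy) (H ix)) (H it)).
Qed.

Lemma nabla_low x k l : U x -> nabla h omega k l x =
  \sum_m h x l m * (partial k (raised h omega m) x + \sum_p levi_civita h m k p x * raised h omega p x).
Proof.
move=> Ux; rewrite /nabla raised_low_partial //.
have := nabla_algebra (fun m p => levi_civita h m k p x) (fun i j => h x i j)
  (fun m => raised h omega m x) (fun m => partial k (raised h omega m) x) l.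
move=> <-; congr (_ - _); apply: eq_bigr => m _; last by rewrite raised_low.
by congr (_ * _ + _); exact: levi_compat.
Qed.

(** The bridge from the defining formula of W_ij to the connection: from here on the hypotheses on
    W_ij are used as statements about the curvature of [G]. *)
Lemma weyl_ricciE x i j : U x -> weyl_ricci h omega i j x = \sum_k curvature G k j k i x.
Proof.
move=> Ux.
have two0 : (2 : R) != 0 by [].
have H := weyl_ricci_algebra two0 (fun a k i j => partial a (levi_civita h k i j) x)
  (fun k i j => levi_sym k i j Ux) (fun i j => weyl_symE i j Ux) (fun l => esym (raised_low l Ux)) i j
  (fun a i j => levi_compat a i j Ux) (fun a l => raised_low_partial a l Ux).
transitivity (\sum_k (partial k (levi_civita h k i j) x - 2^-1 *
  weyl_dC (h x) (fun l => raised h omega l x) (fun b l => partial b (raised h omega l) x)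
    (fun b l => partial b (fun z => omega z 0 l) x) (fun b l m => partial b (fun z => h z l m) x) k k i j
   - (partial i (levi_civita h k k j) x - 2^-1 *
  weyl_dC (h x) (fun l => raised h omega l x) (fun b l => partial b (raised h omega l) x)
    (fun b l => partial b (fun z => omega z 0 l) x) (fun b l m => partial b (fun z => h z l m) x) i k k j)
   + \sum_m (G k k m x * G m i j x - G k i m x * G m k j x))); last first.
  by apply: eq_bigr => k _; rewrite /curvature !weyl_conn_partial.
transitivity (\sum_k (partial k (levi_civita h k i j) x - partial i (levi_civita h k k j) x +
    \sum_m (levi_civita h k k m x * levi_civita h m i j x - levi_civita h k i m x * levi_civita h m k j x))
    + (partial i (fun z => omega z 0 j) x - \sum_m levi_civita h m i j x * omega x 0 m)
    - 2^-1 * (partial j (fun z => omega z 0 i) x - \sum_m levi_civita h m j i x * omega x 0 m)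
    + 4^-1 * (omega x 0 i * omega x 0 j)
    + h x i j * (- 4^-1 * (\sum_k omega x 0 k * raised h omega k x) + 2^-1 * \sum_k (partial k (raised h omega k) x
      + \sum_m levi_civita h k k m x * raised h omega m x))); last first.
  rewrite -H; apply: eq_bigr => k _; congr (_ + _); apply: eq_bigr => m _.
  by rewrite !weyl_connE.
rewrite /weyl_ricci; congr (_ + _ * (_ + _)); congr (_ * _).
  apply: eq_bigr => k _; rewrite /raised mulr_sumr; apply: eq_bigr => l _.
  by rewrite (mulrC _ (omega x 0 k)) mulrA.
apply: eq_bigr => k _; under eq_bigr do rewrite nabla_low // mulr_sumr.
rewrite exchange_big /= (bigD1 k) //= [X in _ + X]big1 ?addr0.
  rewrite -[RHS]mul1r -[in RHS](_ : \sum_l invmx (h x) k l * h x l k = 1); last by rewrite weyl_inv // eqxx.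
  by rewrite mulr_suml; apply: eq_bigr => l _; rewrite mulrA.
move=> m mk; transitivity ((\sum_l invmx (h x) k l * h x l m) *
  (partial k (raised h omega m) x + \sum_p levi_civita h m k p x * raised h omega p x)).
  by rewrite mulr_suml; apply: eq_bigr => l _; rewrite mulrA.
by rewrite weyl_inv // eq_sym (negbTE mk) mul0r.
Qed.
End Domain.
End WeylRicci.

(** * The algebra of a Weyl curvature tensor in dimension three *)

Section CurvatureAlgebra.
Variable F : fieldType.
Hypothesis two0 : (2 : F) != 0.
Implicit Types (i j k l p q : 'I_3).

(** The cyclic order y, x, t. The pair [succ3 p], [prev3 p] is the oriented complement of [p], which
    turns two-forms into vector densities without a volume form. *)
Definition succ3 p : 'I_3 := if p == iy then ix else if p == ix then it else iy.
Definition prev3 p : 'I_3 := if p == iy then it else if p == ix then iy else ix.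

Definition det3 (m : 'I_3 -> 'I_3 -> F) : F :=
  m iy iy * (m ix ix * m it it - m ix it * m it ix)
  - m iy ix * (m ix iy * m it it - m ix it * m it iy)
  + m iy it * (m ix iy * m it ix - m ix ix * m it iy).

(** The cyclic indices absorb the signs of the cofactors. *)
Definition adj3 (m : 'I_3 -> 'I_3 -> F) i j : F :=
  m (succ3 j) (succ3 i) * m (prev3 j) (prev3 i) - m (succ3 j) (prev3 i) * m (prev3 j) (succ3 i).

Lemma det3_mul (a b : 'I_3 -> 'I_3 -> F) :
  det3 (fun i j => \sum_k a i k * b k j) = det3 a * det3 b.
Proof. by rewrite /det3 !sum3E; ring. Qed.

Lemma adj3_mul (m : 'I_3 -> 'I_3 -> F) i j : \sum_k adj3 m i k * m k j = (i == j)%:R * det3 m.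
Proof. by elim/ord3_ind: i; elim/ord3_ind: j; rewrite sum3E /adj3 /det3 /succ3 /prev3 /=; ring. Qed.

(* eps_{klq} M_q, for the totally antisymmetric eps with eps_{yxt} = 1 *)
Definition eps3 (M : 'I_3 -> F) k l : F :=
  if k == l then 0 else if succ3 k == l then M (prev3 k) else - M (prev3 l).

(** Raising with the adjugate instead of the inverse keeps everything polynomial. The trace part n
    and the antisymmetric part of M drop out of the symmetrised contraction, which depends on M +
    M^T alone. *)
Lemma ricci_poly (h M : 'I_3 -> 'I_3 -> F) (n : 'I_3 -> F) (c : F) i j :
  (forall i j, h i j = h j i) ->
  let S p k l := eps3 (M p) k l - c * n p * h k l in
  let Rp p k l := \sum_m adj3 h k m * S p m l in
  let Ric i j := Rp (succ3 i) (prev3 i) j - Rp (prev3 i) (succ3 i) j in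
  let s i j := M i j + M j i in
  Ric i j + Ric j i = h i j * (\sum_a \sum_b h a b * s a b) - \sum_a \sum_b h i a * s a b * h b j.
Proof.
move=> hs /=; rewrite !sum3E.
elim/ord3_ind: i; elim/ord3_ind: j; rewrite /eps3 /adj3 /succ3 /prev3 /=;
rewrite ?(hs ix iy) ?(hs it iy) ?(hs it ix); ring.
Qed.

(** The equation says s = t h^(-1) with t = tr(h s). Taking the trace in dimension three gives t = 3
    t, hence t = 0. *)
Lemma sym_zero (h K s : 'M[F]_3) : K *m h = 1%:M ->
  (forall i j, h i j * (\sum_a \sum_b h a b * s a b) = \sum_a \sum_b h i a * s a b * h b j) ->
  h^T = h -> s = 0.
Proof.
move=> Kh H hs; have hK := mulmx1C Kh.
have [t tE] : exists t, t = \sum_a \sum_b h a b * s a b by eexists.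
have H1 : t *: h = h *m s *m h.
  apply/matrixP => i j; rewrite !mxE mulrC tE H exchange_big /=; apply: eq_bigr => b _.
  by rewrite mxE mulr_suml.
have H2 : s = t *: K.
  have := congr1 (fun m => K *m m *m K) H1.
  rewrite !mulmxA Kh mul1mx -!mulmxA hK mulmx1 => <-.
  by rewrite -scalemxAl hK -scalemxAr mulmx1.
have H3 : t = t * 3.
  have Kt b a : h a b = h b a by rewrite -[in LHS]hs mxE.
  rewrite {1}tE H2 exchange_big /= (eq_bigr (fun b => t * (h *m K) b b)); last first.
    by move=> b _; rewrite mxE mulr_sumr; apply: eq_bigr => a _; rewrite mxE (Kt b a) mulrCA.
  by rewrite sum3E hK !mxE !eqxx !mulr1; ring.
have t0 : t = 0.
  have H4 : t * 2 = 0 by have <- : t * 3 - t = t * 2 by [ring]; rewrite -H3 subrr.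
  by apply/eqP; move/eqP: H4; rewrite mulf_eq0 (negbTE two0) orbF.
by rewrite H2 t0 scale0r.
Qed.

Lemma det3_neq0 (h K : 'M[F]_3) : K *m h = 1%:M -> det3 (fun i j => h i j) != 0.
Proof.
move=> Kh; have := det3_mul (fun i j => K i j) (fun i j => h i j).
have -> : det3 (fun i j => \sum_k K i k * h k j) = 1.
  have E i j : \sum_k K i k * h k j = (i == j)%:R.
    by have := congr1 (fun m : 'M[F]_3 => m i j) Kh; rewrite !mxE.
  by rewrite /det3 !E /=; ring.
by move=> H; apply/eqP => H0; move/eqP: H; rewrite H0 mulr0 oner_eq0.
Qed.

(** [Ha] fixes the part of the lowered tensor symmetric in k and l; the antisymmetric part is dual
    to the matrix [M]. The Ricci condition [Hc] kills M + M^T, and the cyclic identity [Hb] reads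
    off the three remaining entries as multiples of h n. *)
Lemma curvature_algebra (h K : 'M[F]_3) (Rp : 'I_3 -> 'I_3 -> 'I_3 -> F) (n : 'I_3 -> F) :
  K *m h = 1%:M -> h^T = h ->
  (forall p k l, \sum_m (h k m * Rp p m l + h l m * Rp p m k) = - n p * h k l) ->
  (forall k, \sum_p Rp p k p = 0) ->
  (forall i j, Rp (succ3 i) (prev3 i) j - Rp (prev3 i) (succ3 i) j
    + (Rp (succ3 j) (prev3 j) i - Rp (prev3 j) (succ3 j) i) = 0) ->
  forall p k l, \sum_m h k m * Rp p m l = - 2^-1 * n p * h k l
    - 4^-1 * ((k == p)%:R * (\sum_m h l m * n m) - (l == p)%:R * (\sum_m h k m * n m)).
Proof.
move=> Kh hs Ha Hb Hc.
have hsE i j : h i j = h j i by rewrite -[in LHS]hs mxE.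
pose S p k l := \sum_m h k m * Rp p m l.
have Sa p k l : S p k l + S p l k = - n p * h k l by rewrite -Ha big_split.
pose M p q := S p (succ3 q) (prev3 q) + 2^-1 * n p * h (succ3 q) (prev3 q).
have Skk p k : S p k k = - 2^-1 * n p * h k k.
  have := Sa p k k => E; apply: (mulfI two0).
  by rewrite mulr_natl mulr2n E; move: (n p) (h k k) => a b; field.
have Skl p k l : S p l k = - S p k l - n p * h k l.
  by have := Sa p k l => E; rewrite -mulNr -E; move: (S p k l) (S p l k) => a b; ring.
have SE p k l : S p k l = eps3 (M p) k l - 2^-1 * n p * h k l.
  rewrite /eps3; case: eqVneq => [->|kl]; first by rewrite Skk sub0r !mulNr.
  case: eqVneq => [<-|kl2]; rewrite /M.
    have -> : succ3 (prev3 k) = k by elim/ord3_ind: k kl.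
    have -> : prev3 (prev3 k) = succ3 k by elim/ord3_ind: k kl.
    by rewrite addrK.
  have -> : succ3 (prev3 l) = l by elim/ord3_ind: l kl kl2.
  have -> : prev3 (prev3 l) = k by move: kl kl2; elim/ord3_ind: l; elim/ord3_ind: k.
  rewrite (Skl p l k) (hsE k l); move: (S p l k) (n p) (h l k) => a b c.
  by field.
have d0 := det3_neq0 Kh.
have RE p k l : det3 (fun i j => h i j) * Rp p k l = \sum_m adj3 (fun i j => h i j) k m * S p m l.
  rewrite /S; under eq_bigr do rewrite mulr_sumr.
  rewrite exchange_big /= (eq_bigr (fun q => (k == q)%:R * det3 (fun i j => h i j) * Rp p q l)); last first.
    move=> q _; rewrite -(adj3_mul (fun i j => h i j)) mulr_suml.
    by apply: eq_bigr => m _; rewrite mulrA.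
  rewrite (bigD1 k) //= eqxx mul1r big1 ?addr0 // => q qk.
  by rewrite eq_sym (negbTE qk) !mul0r.
have Ms : \matrix_(i, j) (M i j + M j i) = 0 :> 'M[F]_3.
  apply: (sym_zero Kh _ hs) => i j.
  apply/eqP; rewrite -subr_eq0; apply/eqP.
  have := ricci_poly M n 2^-1 i j hsE => /=.
  rewrite -!(eq_bigr _ (fun m _ => congr1 (fun s => adj3 _ _ m * s) (SE _ m _))).
  rewrite -!RE -!mulrBr -mulrDr Hc mulr0 => E.
  rewrite [RHS]E; congr (h i j * _ - _); apply: eq_bigr => a _; apply: eq_bigr => b _; by rewrite mxE.
have Manti i j : M j i = - M i j.
  have := congr1 (fun m : 'M[F]_3 => m i j) Ms; rewrite !mxE => /eqP.
  by rewrite addr_eq0 => /eqP ->; rewrite opprK.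
have Mpp p : M p p = 0.
  by apply: (mulfI two0); rewrite mulr0 mulr_natl mulr2n {1}Manti addNr.
have Hb' k : \sum_p S p k p = 0.
  rewrite /S exchange_big /=; rewrite big1 // => m _.
  by rewrite -mulr_sumr Hb mulr0.
have ML p : M (succ3 p) (prev3 p) = 4^-1 * \sum_m h p m * n m.
  have := Hb' p; rewrite (eq_bigr _ (fun q _ => SE q p q)) !sum3E.
  move=> E; apply: (mulfI two0); apply/eqP; rewrite -subr_eq0; apply/eqP.
  have c4 : 2 * (4^-1 : F) = 2^-1.
    by rewrite (_ : 4 = 2 * 2) ?invfM ?mulrA ?divff ?mul1r // -natrM.
  rewrite mulrA c4 -[RHS]E; move: {E} (2^-1) => c.
  rewrite mulr_natl mulr2n.
  elim/ord3_ind: p; rewrite /eps3 /succ3 /prev3 /= ?(Manti ix it) ?(Manti it iy) ?(Manti iy ix); ring.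
move=> p k l; rewrite -/(S p k l) SE.
have E : eps3 (M p) k l = - 4^-1 * ((k == p)%:R * (\sum_m h l m * n m) - (l == p)%:R * (\sum_m h k m * n m)).
  rewrite mulNr mulrBr !(mulrCA 4^-1) -!ML.
  move: p k l; elim/ord3_ind; elim/ord3_ind; elim/ord3_ind;
   rewrite /eps3 /succ3 /prev3 /= ?Mpp ?(Manti ix it) ?(Manti it iy) ?(Manti iy ix); ring.
by rewrite E mulNr mulNr addrC mulNr.
Qed.

End CurvatureAlgebra.

(** Two derivatives of D h = omega h commute. What survives is the action of the curvature on h,
    which is that of d omega up to sign. *)
Lemma lowered_algebra (F : comPzRingType) (gi gj digj djgi h Hi Hj : 'I_3 -> 'I_3 -> F)
    (wi wj diwj djwi : F) k l :
  (forall a b, h a b = h b a) ->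
  (forall a b, Hi a b = wi * h a b + \sum_m gi m a * h m b + \sum_m gi m b * h a m) ->
  (forall a b, Hj a b = wj * h a b + \sum_m gj m a * h m b + \sum_m gj m b * h a m) ->
  diwj * h k l + wj * Hi k l + \sum_m (digj m k * h m l + gj m k * Hi m l)
    + \sum_m (digj m l * h k m + gj m l * Hi k m)
  = djwi * h k l + wi * Hj k l + \sum_m (djgi m k * h m l + gi m k * Hj m l)
    + \sum_m (djgi m l * h k m + gi m l * Hj k m) ->
  \sum_m (h k m * (digj m l - djgi m l + \sum_q (gi m q * gj q l - gj m q * gi q l))
    + h l m * (digj m k - djgi m k + \sum_q (gi m q * gj q k - gj m q * gi q k)))
  = - (diwj - djwi) * h k l.
Proof.
move=> hs Hi_ Hj_; rewrite !sum3E !Hi_ !Hj_ !sum3E => E.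
apply/eqP; rewrite -subr_eq0; apply/eqP; move/eqP: E; rewrite -subr_eq0 => /eqP E.
rewrite -[RHS]E (hs l iy) (hs l ix) (hs l it) ?(hs ix iy) ?(hs it iy) ?(hs it ix); ring.
Qed.

(** Lower an index in the second Bianchi identity and insert the curvature formula [hS]. The
    multiples of h cancel by compatibility and because n is divergence free; what remains is one
    quarter of the claim. *)
Lemma null_closed_algebra (F : fieldType) (g : 'I_3 -> 'I_3 -> 'I_3 -> F) (h : 'I_3 -> 'I_3 -> F)
    (dh rr : 'I_3 -> 'I_3 -> 'I_3 -> F) (dR : 'I_3 -> 'I_3 -> F) (w n dn L : 'I_3 -> F)
    (dL : 'I_3 -> 'I_3 -> F) k l :
  (2 : F) != 0 -> (forall a b, h a b = h b a) -> (forall p m a, g p m a = g a m p) ->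
  (forall p a b, dh p a b = w p * h a b + \sum_m g p m a * h m b + \sum_m g p m b * h a m) ->
  (forall m, \sum_p (dR p m + \sum_q (g p m q * rr p q l - rr p m q * g p q l)) = 0) ->
  (forall p a b, \sum_m h a m * rr p m b =
     - 2^-1 * n p * h a b - 4^-1 * ((a == p)%:R * L b - (b == p)%:R * L a)) ->
  \sum_p dn p = 0 ->
  (forall p, \sum_m (dh p k m * rr p m l + h k m * dR p m) =
     - 2^-1 * (dn p * h k l + n p * dh p k l)
     - 4^-1 * ((k == p)%:R * dL p l - (l == p)%:R * dL p k)) ->
  dL k l - dL l k = (w k + \sum_m g k m m) * L l - (w l + \sum_m g l m m) * L k.
Proof.
move=> two0 hs gs hdh hB hS hn hD.
pose S p a b := \sum_m h a m * rr p m b.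
have E1 : \sum_p (w p * S p k l + \sum_a g p a k * S p a l + \sum_q S p k q * g p q l)
   = \sum_p (- 2^-1 * (dn p * h k l + n p * dh p k l)
     - 4^-1 * ((k == p)%:R * dL p l - (l == p)%:R * dL p k)).
  have hD' p : - 2^-1 * (dn p * h k l + n p * dh p k l)
     - 4^-1 * ((k == p)%:R * dL p l - (l == p)%:R * dL p k) =
     \sum_m ((w p * h k m + \sum_q g p q k * h q m + \sum_q g p q m * h k q) * rr p m l + h k m * dR p m).
    by rewrite -hD; apply: eq_bigr => m _; rewrite hdh.
  rewrite [RHS](eq_bigr _ (fun p _ => hD' p)).
  have B : \sum_m h k m * \sum_p (dR p m + \sum_q (g p m q * rr p q l - rr p m q * g p q l)) = 0.
    by rewrite big1 // => m _; rewrite hB mulr0.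
  rewrite -[RHS]subr0 -[X in _ - X]B /S !sum3E.
  clear; ring.
have E2 : \sum_p (w p * S p k l + \sum_a g p a k * S p a l + \sum_q S p k q * g p q l)
   = \sum_p (w p * (- 2^-1 * n p * h k l - 4^-1 * ((k == p)%:R * L l - (l == p)%:R * L k))
   + \sum_a g p a k * (- 2^-1 * n p * h a l - 4^-1 * ((a == p)%:R * L l - (l == p)%:R * L a))
   + \sum_q (- 2^-1 * n p * h k q - 4^-1 * ((k == p)%:R * L q - (q == p)%:R * L k)) * g p q l).
  have hS' p a b : S p a b = - 2^-1 * n p * h a b - 4^-1 * ((a == p)%:R * L b - (b == p)%:R * L a).
    exact: hS.
  apply: eq_bigr => p _; rewrite hS'; congr (_ + _ + _); first by apply: eq_bigr => a _; rewrite hS'.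
  by apply: eq_bigr => a _; rewrite hS'.
rewrite E2 in E1; clear E2 hS hD hB S.
have c4 : 4^-1 = 2^-1 * 2^-1 :> F by rewrite -invfM -natrM.
have : forall a : F, 4^-1 * a = 0 -> a = 0.
  move=> a /eqP; rewrite mulf_eq0 invr_eq0 (_ : 4 = 2 * 2 :> F) ?mulf_eq0 ?(negbTE two0) //=; first by move/eqP.
  by rewrite -natrM.
move=> four; apply/eqP; rewrite -subr_eq0; apply/eqP; apply: four.
move: E1 hn; rewrite !sum3E !hdh !sum3E c4.
move/eqP; rewrite -subr_eq0 => /eqP E1 hn.
have := f_equal2 (fun a b => a - 2^-1 * h k l * b) E1 hn.
rewrite /= mulr0 subr0 => <-; clear E1 hn hdh c4.
elim/ord3_ind: k; elim/ord3_ind: l; rewrite /= ?mulr1n ?mulr0n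
  ?(hs ix iy) ?(hs it iy) ?(hs it ix) ?(gs ix _ iy) ?(gs it _ iy) ?(gs it _ ix); clear; ring.
Qed.

(** * Bianchi identities, the curvature formula and the null form *)

Section Bianchi.
Context {R : realType}.
Local Notation E := 'rV[R]_3.
Implicit Types (U : set E) (x z : E) (i j k l p q : 'I_3).
Local Opaque partial.

Definition two_form (omega : E -> E) i j x : R :=
  partial i (fun z => omega z 0 j) x - partial j (fun z => omega z 0 i) x.

(* The vector density n dual to [d omega]. *)
Definition form_kernel omega p x : R := two_form omega (succ3 p) (prev3 p) x.

Definition null_form (h : E -> 'M[R]_3) omega k x : R := \sum_m h x k m * form_kernel omega m x.

Definition curvature_dual (G : connection R) p k l x : R := curvature G k l (succ3 p) (prev3 p) x.

Lemma curvature_anti (G : connection R) k l i j x : curvature G k l j i x = - curvature G k l i j x.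
Proof.
rewrite /curvature opprD opprB -sumrN; congr (_ + _).
by apply: eq_bigr => m _; rewrite opprB.
Qed.

Definition ricci_sym0 U (G : connection R) : Prop := forall x i j, U x ->
  \sum_k curvature G k j k i x + \sum_k curvature G k i k j x = 0.

Variables (U : set E) (h : E -> 'M[R]_3) (omega : E -> E) (G : connection R).
Hypothesis W : forall n, weyl_on U h omega G n.
Let oU : open U := weyl_open (W 0%N).

Lemma compatE x i k l : U x -> partial i (fun z => h z k l) x =
  omega x 0 i * h x k l + \sum_m G m i k x * h x m l + \sum_m G m i l x * h x k m.
Proof.
move=> Ux; rewrite -(weyl_compat (W 0%N) Ux i k l).
by move: (partial i _ x) (\sum_m G m i k x * _) (\sum_m G m i l x * _) => a b c; ring.
Qed.

Lemma is_derive_sum3 i x (f : 'I_3 -> E -> R) (d : 'I_3 -> R) :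
  (forall m, is_derive x (delta_mx 0 i) (f m) (d m)) ->
  is_derive x (delta_mx 0 i) (fun z => \sum_m f m z) (\sum_m d m).
Proof.
move=> H; rewrite sum3E; rewrite (_ : (fun z => _) = fun z => f iy z + f ix z + f it z).
  exact: (isdD (isdD (H iy) (H ix)) (H it)).
by apply/funext => z; rewrite sum3E.
Qed.

Lemma compat_partial x i j k l : U x -> partial i (partial j (fun z => h z k l)) x =
  partial i (fun z => omega z 0 j) x * h x k l + omega x 0 j * partial i (fun z => h z k l) x
  + \sum_m (partial i (G m j k) x * h x m l + G m j k x * partial i (fun z => h z m l) x)
  + \sum_m (partial i (G m j l) x * h x k m + G m j l x * partial i (fun z => h z k m) x).
Proof.
move=> Ux; rewrite (@partial_eq_on _ U _ (fun z => omega z 0 j * h z k l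
   + \sum_m G m j k z * h z m l + \sum_m G m j l z * h z k m)) //; last first.
  by move=> z Uz; exact: compatE.
have dh a b : is_derive x (delta_mx 0 i) (fun z => h z a b) (partial i (fun z => h z a b) x).
  exact: Ck_is_derive (weyl_hC (W 0%N) a b) Ux.
have dG m a : is_derive x (delta_mx 0 i) (G m j a) (partial i (G m j a) x).
  exact: Ck_is_derive (weyl_connC (W 0%N) m j a) Ux.
have dw : is_derive x (delta_mx 0 i) (fun z => omega z 0 j) (partial i (fun z => omega z 0 j) x).
  exact: Ck_is_derive (weyl_wC (W 0%N) j) Ux.
apply: is_derive_partial; apply: (isdD (isdD (isdM dw (dh _ _)) _)).
  by apply: is_derive_sum3 => m; exact: isdM.
by apply: is_derive_sum3 => m; exact: isdM.
Qed.

Lemma lowered_curvature x i j k l : U x ->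
  \sum_m (h x k m * curvature G m l i j x + h x l m * curvature G m k i j x)
  = - two_form omega i j x * h x k l.
Proof.
move=> Ux.
apply: (@lowered_algebra _ (fun m a => G m i a x) (fun m a => G m j a x)
  (fun m a => partial i (G m j a) x) (fun m a => partial j (G m i a) x) (fun a b => h x a b)
  (fun a b => partial i (fun z => h z a b) x) (fun a b => partial j (fun z => h z a b) x)
  (omega x 0 i) (omega x 0 j)) => [a b|a b|a b|].
- exact: (weyl_symE (W 0%N) a b Ux).
- exact: compatE.
- exact: compatE.
- exact: etrans (esym (compat_partial i j k l Ux)) (etrans (Schwarz i j oU Ux (weyl_hC (W 0%N) k l)) (compat_partial j i k l Ux)).
Qed.

Lemma bianchi_first x k : U x -> \sum_p curvature_dual G p k p x = 0.
Proof.
move=> Ux; rewrite sum3E /curvature_dual /succ3 /prev3 /=.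
have Gp i m a b : partial i (G m a b) x = partial i (G m b a) x.
  by apply: (partial_eq_on i oU Ux) => z Uz; exact: (weyl_tf (W 0%N) Uz).
have Gs m a b := weyl_tf (W 0%N) Ux m a b.
rewrite /curvature !sum3E (Gp ix k it iy) (Gp it k ix iy) (Gp iy k it ix).
rewrite !(Gs _ ix iy) !(Gs _ it iy) !(Gs _ it ix).
move: (partial ix _ x) (partial it _ x) (partial iy _ x) => a b c.
by ring.
Qed.

(** The second derivatives of [G] cancel by [Schwarz], for which the structure is taken at order 1;
    the rest is a ring identity in the 1-jet of [G]. *)
Lemma bianchi_second x k l : U x ->
  \sum_p (partial p (curvature_dual G p k l) x
    + \sum_m (G k p m x * curvature_dual G p m l x - curvature_dual G p k m x * G m p l x)) = 0.
Proof.
move=> Ux.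
have dG i m a b : is_derive x (delta_mx 0 i) (G m a b) (partial i (G m a b) x).
  exact: Ck_is_derive (weyl_connC (W 0%N) m a b) Ux.
have ddG i j m a b : is_derive x (delta_mx 0 i) (partial j (G m a b)) (partial i (partial j (G m a b)) x).
  exact: Ck_is_derive (Ck_partial j (weyl_connC (W 1%N) m a b)) Ux.
have dR p : partial p (curvature_dual G p k l) x =
   partial p (partial (succ3 p) (G k (prev3 p) l)) x - partial p (partial (prev3 p) (G k (succ3 p) l)) x
   + \sum_m (partial p (G k (succ3 p) m) x * G m (prev3 p) l x + G k (succ3 p) m x * partial p (G m (prev3 p) l) x
     - (partial p (G k (prev3 p) m) x * G m (succ3 p) l x + G k (prev3 p) m x * partial p (G m (succ3 p) l) x)).
  apply: is_derive_partial; apply: (isdD (isdB (ddG _ _ _ _ _) (ddG _ _ _ _ _))).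
  apply: is_derive_sum3 => m; exact: (isdB (isdM (dG _ _ _ _) (dG _ _ _ _)) (isdM (dG _ _ _ _) (dG _ _ _ _))).
have Sw i j m a b : partial i (partial j (G m a b)) x = partial j (partial i (G m a b)) x.
  exact: (Schwarz i j oU Ux (weyl_connC (W 1%N) m a b)).
under eq_bigr do rewrite dR.
rewrite sum3E /curvature_dual /succ3 /prev3 /= (Sw it iy) (Sw ix iy) (Sw it ix).
rewrite /curvature !sum3E.
move: (partial _ (partial _ _) x) => dd1.
move: (partial _ (partial _ _) x) => dd2.
move: (partial _ (partial _ _) x) => dd3.
have [D DE] : exists D : 'I_3 -> 'I_3 -> 'I_3 -> 'I_3 -> R, forall i m a b, partial i (G m a b) x = D i m a b.
  by exists (fun i m a b => partial i (G m a b) x).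
rewrite !DE.
have [g gE] : exists g : 'I_3 -> 'I_3 -> 'I_3 -> R, forall m a b, G m a b x = g m a b.
  by exists (fun m a b => G m a b x).
rewrite !gE; by ring.
Qed.

Hypothesis Ric0 : ricci_sym0 U G.

Lemma curvature_formula x p k l : U x -> \sum_m h x k m * curvature_dual G p m l x =
  - 2^-1 * form_kernel omega p x * h x k l
  - 4^-1 * ((k == p)%:R * null_form h omega l x - (l == p)%:R * null_form h omega k x).
Proof.
move=> Ux; have two0 : (2 : R) != 0 by [].
apply: (@curvature_algebra R two0 (h x) (invmx (h x)) (fun p k l => curvature_dual G p k l x)
   (fun p => form_kernel omega p x)).
- exact: (mulVmx (weyl_unit (W 0%N) Ux)).
- exact: (weyl_sym (W 0%N) Ux).
- by move=> q a b; exact: lowered_curvature.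
- by move=> a; exact: bianchi_first.
(* In dimension three each contraction R^k_{jki} has only two nonzero terms, and these are the dual
   components that occur in [curvature_algebra]. *)
- have key i j : curvature_dual G (succ3 i) (prev3 i) j x - curvature_dual G (prev3 i) (succ3 i) j x
     = \sum_k curvature G k j k i x.
    have A a b c d : curvature G a b c d x = - curvature G a b d c x by exact: curvature_anti.
    have A0 a b c : curvature G a b c c x = 0.
      by rewrite /curvature subrr add0r big1 // => m _; rewrite subrr.
    rewrite sum3E /curvature_dual; elim/ord3_ind: i; rewrite /succ3 /prev3 /= A0.
    + by rewrite add0r (A ix j ix iy) addrC.
    + by rewrite addr0 (A it j it ix).
    + by rewrite addr0 (A iy j iy it) addrC.
  by move=> i j; rewrite !key; exact: Ric0.
Qed.

Lemma curvature_dualE x p k l : U x -> curvature_dual G p k l x =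
  - 2^-1 * form_kernel omega p x * (k == l)%:R
  - 4^-1 * (invmx (h x) k p * null_form h omega l x - (l == p)%:R * form_kernel omega k x).
Proof.
move=> Ux.
have H1 : \sum_a invmx (h x) k a * \sum_m h x a m * curvature_dual G p m l x = curvature_dual G p k l x.
  under eq_bigr do rewrite mulr_sumr.
  rewrite exchange_big /= (eq_bigr (fun m => (k == m)%:R * curvature_dual G p m l x)); last first.
    by move=> m _; rewrite -(weyl_inv (W 0%N) k m Ux) mulr_suml; apply: eq_bigr => a _; rewrite mulrA.
  by rewrite (bigD1 k) //= eqxx mul1r big1 ?addr0 // => m mk; rewrite eq_sym (negbTE mk) mul0r.
have H2 : \sum_a invmx (h x) k a * null_form h omega a x = form_kernel omega k x.
  rewrite /null_form; under eq_bigr do rewrite mulr_sumr.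
  rewrite exchange_big /= (eq_bigr (fun m => (k == m)%:R * form_kernel omega m x)); last first.
    by move=> m _; rewrite -(weyl_inv (W 0%N) k m Ux) mulr_suml; apply: eq_bigr => a _; rewrite mulrA.
  by rewrite (bigD1 k) //= eqxx mul1r big1 ?addr0 // => m mk; rewrite eq_sym (negbTE mk) mul0r.
rewrite -H1 (eq_bigr (fun a => - 2^-1 * form_kernel omega p x * (invmx (h x) k a * h x a l)
  - 4^-1 * ((invmx (h x) k a * (a == p)%:R) * null_form h omega l x
            - (l == p)%:R * (invmx (h x) k a * null_form h omega a x)))); last first.
  move=> a _; rewrite curvature_formula //.
  move: (invmx _ _ _) (form_kernel _ _ _) (null_form _ _ _ _) (null_form _ _ _ _) (h x a l) => *; ring.
rewrite sumrB -!mulr_sumr sumrB -mulr_suml -mulr_sumr H2 (weyl_inv (W 0%N)) //.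
congr (_ - _ * (_ * _ - _)); rewrite (bigD1 p) //= eqxx mulr1 big1 ?addr0 // => a ap.
by rewrite (negbTE ap) mulr0.
Qed.

(** The curvature formula is linear in n, so F = 0 at a point forces zero curvature there. Non-flat
    points are thereby points where F does not vanish. *)
Lemma curvature_flat x : U x -> (forall p, form_kernel omega p x = 0) ->
  forall k l i j, curvature G k l i j x = 0.
Proof.
move=> Ux n0 k l i j.
have R0 p : curvature_dual G p k l x = 0.
  have L0 a : null_form h omega a x = 0 by rewrite /null_form big1 // => m _; rewrite n0 mulr0.
  by rewrite curvature_dualE // !n0 L0 !mulr0 mul0r subrr mulr0 subrr.
have A0 c : curvature G k l c c x = 0.
  by rewrite /curvature subrr add0r big1 // => m _; rewrite subrr.
move: (R0 iy) (R0 ix) (R0 it); rewrite /curvature_dual /succ3 /prev3 /= => r0 r1 r2.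
by elim/ord3_ind: i; elim/ord3_ind: j; rewrite ?A0 // curvature_anti ?r0 ?r1 ?r2 ?oppr0 // -(opprK (curvature _ _ _ _ _ _)) -curvature_anti ?r0 ?r1 ?r2 ?oppr0.
Qed.

(* The trace of the connection, [G m k m], is a connection on densities; the
   null form is closed for the connection [theta] on densities of its weight. *)
Definition theta k x : R := omega x 0 k + \sum_m G m k m x.

Lemma thetaC n k : Ck U n (theta k).
Proof.
apply: Ck_add => //; first exact: Ck_pred (weyl_wC (W n) k).
by apply: Ck_sum => // m _; exact: Ck_pred (weyl_connC (W n) m k m).
Qed.

Lemma form_kernelC n p : Ck U n (form_kernel omega p).
Proof. by apply: Ck_sub2 => //; apply: Ck_partial; exact: weyl_wC (W n) _. Qed.

Lemma null_formC n k : Ck U n (null_form h omega k).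
Proof.
apply: Ck_sum => // m _; apply: Ck_mul => //; last exact: form_kernelC.
exact: Ck_pred (Ck_pred (weyl_hC (W n) k m)).
Qed.

Lemma curvatureC n k l i j : Ck U n (curvature G k l i j).
Proof.
have CG m a b : Ck U n (G m a b) by exact: Ck_pred (weyl_connC (W n) m a b).
apply: Ck_add => //.
  by apply: Ck_sub2 => //; apply: Ck_partial; exact: weyl_connC (W n) _ _ _.
by apply: Ck_sum => // m _; apply: Ck_sub2 => //; apply: Ck_mul.
Qed.

Lemma null_form_closed x k l : U x ->
  partial k (null_form h omega l) x - partial l (null_form h omega k) x =
  theta k x * null_form h omega l x - theta l x * null_form h omega k x.
Proof.
move=> Ux.
have dh p a b : is_derive x (delta_mx 0 p) (fun z => h z a b) (partial p (fun z => h z a b) x).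
  exact: Ck_is_derive (weyl_hC (W 0%N) a b) Ux.
have dR p m : is_derive x (delta_mx 0 p) (curvature_dual G p m l) (partial p (curvature_dual G p m l) x).
  exact: Ck_is_derive (curvatureC 1 m l _ _) Ux.
have dn p : is_derive x (delta_mx 0 p) (form_kernel omega p) (partial p (form_kernel omega p) x).
  exact: Ck_is_derive (form_kernelC 1 p) Ux.
have dL p a : is_derive x (delta_mx 0 p) (null_form h omega a) (partial p (null_form h omega a) x).
  exact: Ck_is_derive (null_formC 1 a) Ux.
apply: (@null_closed_algebra R (fun p m a => G m p a x) (fun a b => h x a b)
  (fun p a b => partial p (fun z => h z a b) x) (fun p m a => curvature_dual G p m a x)
  (fun p m => partial p (curvature_dual G p m l) x) (fun p => omega x 0 p)
  (fun p => form_kernel omega p x) (fun p => partial p (form_kernel omega p) x)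
  (fun a => null_form h omega a x) (fun p a => partial p (null_form h omega a) x)).
- by [].
- by move=> a b; exact: (weyl_symE (W 0%N) a b Ux).
- by move=> p m a; exact: (weyl_tf (W 0%N) Ux).
- by move=> p a b; exact: compatE.
- by move=> m; exact: bianchi_second.
- by move=> p a b; exact: curvature_formula.
(* n is divergence free because it is dual to the exact form d omega. *)
- have ddw i j m : is_derive x (delta_mx 0 i) (partial j (fun z => omega z 0 m)) (partial i (partial j (fun z => omega z 0 m)) x).
    exact: Ck_is_derive (Ck_partial j (weyl_wC (W 1%N) m)) Ux.
  have E p : partial p (form_kernel omega p) x = partial p (partial (succ3 p) (fun z => omega z 0 (prev3 p))) x
      - partial p (partial (prev3 p) (fun z => omega z 0 (succ3 p))) x.
    by apply: is_derive_partial; exact: (isdB (ddw _ _ _) (ddw _ _ _)).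
  have Sw i j m : partial i (partial j (fun z => omega z 0 m)) x = partial j (partial i (fun z => omega z 0 m)) x.
    exact: (Schwarz i j oU Ux (weyl_wC (W 1%N) m)).
  rewrite sum3E !E /succ3 /prev3 /= (Sw it iy) (Sw ix iy) (Sw it ix).
  by move: (partial _ (partial _ _) x) (partial _ (partial _ _) x) (partial _ (partial _ _) x) => *; ring.
- move=> p; transitivity (partial p (fun z => \sum_m h z k m * curvature_dual G p m l z) x).
    symmetry; apply: is_derive_partial; apply: is_derive_sum3 => m; exact: (isdM (dh _ _ _) (dR _ _)).
  rewrite (partial_eq_on p oU Ux (fun z Uz => curvature_formula p k l Uz)).
  apply: is_derive_partial.
  apply: (isd_eq (isdB (isdM (isdZ (- 2^-1) (dn p)) (dh p k l))
    (isdZ 4^-1 (isdB (isdZ (k == p)%:R (dL p l)) (isdZ (l == p)%:R (dL p k)))))).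
  move: (partial _ _ x) (partial _ _ x) (partial _ _ x) (partial _ _ x) => a b c d.
  move: (form_kernel _ _ _) => e; clear; ring.
Qed.

(** The trace of the curvature is - 3 n / 2 and d omega contributes n; the sum is - n / 2. *)
Lemma theta_curl x p : U x ->
  partial (succ3 p) (theta (prev3 p)) x - partial (prev3 p) (theta (succ3 p)) x = - 2^-1 * form_kernel omega p x.
Proof.
move=> Ux.
have tr : \sum_m curvature_dual G p m m x = - 2^-1 * 3 * form_kernel omega p x.
  have H2 : \sum_m invmx (h x) m p * null_form h omega m x = form_kernel omega p x.
    rewrite /null_form; under eq_bigr do rewrite mulr_sumr.
    rewrite exchange_big /= (eq_bigr (fun m => (p == m)%:R * form_kernel omega m x)); last first.
      move=> m _; rewrite -(weyl_inv (W 0%N) p m Ux) mulr_suml; apply: eq_bigr => a _.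
      by rewrite mulrA -{1}(weyl_sym (W 0%N) Ux) -trmx_inv mxE.
    by rewrite (bigD1 p) //= eqxx mul1r big1 ?addr0 // => m mk; rewrite eq_sym (negbTE mk) mul0r.
  rewrite (eq_bigr (fun m => - 2^-1 * form_kernel omega p x
    - 4^-1 * (invmx (h x) m p * null_form h omega m x - (m == p)%:R * form_kernel omega m x))); last first.
    by move=> m _; rewrite curvature_dualE // eqxx mulr1.
  have H3 : \sum_m (m == p)%:R * form_kernel omega m x = form_kernel omega p x.
    by rewrite (bigD1 p) //= eqxx mul1r big1 ?addr0 // => a ap; rewrite (negbTE ap) mul0r.
  rewrite sumrB sumr_const card_ord -[X in _ - X]mulr_sumr sumrB H2 H3 subrr mulr0 subr0.
  by rewrite -[LHS]mulr_natr mulrAC.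
have dw i a : is_derive x (delta_mx 0 i) (fun z => omega z 0 a) (partial i (fun z => omega z 0 a) x).
  exact: Ck_is_derive (weyl_wC (W 0%N) a) Ux.
have dG i m a : is_derive x (delta_mx 0 i) (G m a m) (partial i (G m a m) x).
  exact: Ck_is_derive (weyl_connC (W 0%N) m a m) Ux.
have dt i a : partial i (theta a) x = partial i (fun z => omega z 0 a) x + \sum_m partial i (G m a m) x.
  apply: is_derive_partial; apply: isdD (dw i a) _; apply: is_derive_sum3 => m; exact: dG.
have Fp : form_kernel omega p x = partial (succ3 p) (fun z => omega z 0 (prev3 p)) x - partial (prev3 p) (fun z => omega z 0 (succ3 p)) x by [].
transitivity (form_kernel omega p x + \sum_m curvature_dual G p m m x); last by rewrite tr; move: (form_kernel _ _ _) => a; field.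
rewrite !dt Fp /curvature_dual /curvature !sum3E.
move: (succ3 p) (prev3 p) => q s.
have [D DE] : exists D : 'I_3 -> 'I_3 -> 'I_3 -> 'I_3 -> R, forall i m a b, partial i (G m a b) x = D i m a b.
  by exists (fun i m a b => partial i (G m a b) x).
have [g gE] : exists g : 'I_3 -> 'I_3 -> 'I_3 -> R, forall m a b, G m a b x = g m a b.
  by exists (fun m a b => G m a b x).
rewrite !DE !gE; move: (partial _ _ _) (partial _ _ _) => a b; ring.
Qed.

(* [d(dL) = 0] in [dL = theta /\ L] gives [d theta /\ L = 0], that is [n^p L_p = 0]. *)
Lemma null_form_null x : U x -> \sum_p form_kernel omega p x * null_form h omega p x = 0.
Proof.
move=> Ux; set L := null_form h omega.
have LC n k := null_formC n k.
have ddL i j a : is_derive x (delta_mx 0 i) (partial j (L a)) (partial i (partial j (L a)) x).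
  exact: Ck_is_derive (Ck_partial j (LC 2%N a)) Ux.
have dL i a : is_derive x (delta_mx 0 i) (L a) (partial i (L a) x) by exact: Ck_is_derive (LC 1%N a) Ux.
have dth i a : is_derive x (delta_mx 0 i) (theta a) (partial i (theta a) x) by exact: Ck_is_derive (thetaC 1 a) Ux.
have key i k l : partial i (partial k (L l)) x - partial i (partial l (L k)) x =
   partial i (theta k) x * L l x + theta k x * partial i (L l) x
   - (partial i (theta l) x * L k x + theta l x * partial i (L k) x).
  rewrite -(is_derive_partial (isdB (ddL i k l) (ddL i l k))).
  rewrite (partial_eq_on i oU Ux (fun z Uz => null_form_closed k l Uz)).
  by apply: is_derive_partial; exact: (isdB (isdM (dth _ _) (dL _ _)) (isdM (dth _ _) (dL _ _))).
have Sw i j a : partial i (partial j (L a)) x = partial j (partial i (L a)) x.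
  exact: (Schwarz i j oU Ux (LC 2%N a)).
have := key iy ix it; have := key ix it iy; have := key it iy ix.
have := null_form_closed ix it Ux; have := null_form_closed it iy Ux; have := null_form_closed iy ix Ux.
have := theta_curl iy Ux; have := theta_curl ix Ux; have := theta_curl it Ux.
rewrite /succ3 /prev3 /= -/L (Sw ix iy) (Sw it ix) (Sw it iy) sum3E.
have two0 : (2 : R) != 0 by [].
move: (partial _ (partial _ _) x) (partial _ (partial _ _) x) (partial _ (partial _ _) x) => d1 d2 d3.
move: (partial _ _ x) (partial _ _ x) (partial _ _ x) (partial _ _ x) (partial _ _ x) (partial _ _ x)
 => t1 t2 t3 t4 t5 t6.
have two (a b : R) : a = - 2^-1 * b -> b = - 2 * a by move=> ->; field.
move=> /two -> /two -> /two ->.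
move: (partial _ _ x) (partial _ _ x) (partial _ _ x) (partial _ _ x) (partial _ _ x) (partial _ _ x).
move: (theta _ x) (theta _ x) (theta _ x) (L _ x) (L _ x) (L _ x) => a1 a2 a3 l1 l2 l3 b1 b2 b3 b4 b5 b6.
have add (u v w : R) : u - v = w -> u = v + w by move=> <-; rewrite addrCA subrr addr0.
move=> /add -> /add -> /add -> /esym E1 /esym E2 /esym E3.
(* The cyclic sum of the mixed second derivatives of L vanishes; after substitution of the three
   equations it is the claim up to a factor - 2. *)
have Z : (d3 - d2) + (d2 - d1) + (d1 - d3) = 0 by ring.
rewrite -E1 -E2 -E3 in Z.
by apply: (etrans _ (etrans (f_equal (fun u => -2 * u) Z) (mulr0 _))); ring.
Qed.

End Bianchi.

(** * The metrics dy^2 + 2 dx dt + 2 b dy dt + e dt^2 *)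

Definition sym_form (F : pzRingType) (b e : F) : 'M[F]_3 := \matrix_(i, j)
  match val i, val j with
  | 0, 0 | 1, 2 | 2, 1 => 1
  | 0, 2 | 2, 0 => b
  | 2, 2 => e
  | _, _ => 0
  end.

Section StandardForm.
Variable F : fieldType.
Hypothesis two0 : (2 : F) != 0.
Implicit Types (i j k m a : 'I_3).

(* The Weyl connection of [dy^2 + 2 dx dt + 2 b dy dt + e dt^2], [y dt] in terms of the 1-jets of [b] and [e]. *)
Definition std_conn (y b e : F) (bi ei : 'I_3 -> F) k i j : F :=
  let by_ := bi iy in let bx := bi ix in let bt := bi it in
  let ey := ei iy in let ex := ei ix in let et := ei it in
  match val k, val i, val j with
  | 0, 0, 2 | 0, 2, 0 => 2^-1 * (b * bx - y)
  | 0, 1, 2 | 0, 2, 1 => 2^-1 * bx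
  | 0, 2, 2 => 2^-1 * (b * ex - ey) + bt
  | 1, 0, 0 => 2^-1 * y + by_
  | 1, 0, 1 | 1, 1, 0 => 2^-1 * bx
  | 1, 0, 2 | 1, 2, 0 => 2^-1 * (y * b - b * b * bx + bx * e + ey)
  | 1, 1, 2 | 1, 2, 1 => 2^-1 * (ex - b * bx)
  | 1, 2, 2 => 2^-1 * (y * e + b * ey - b * b * ex + e * ex + et) - b * bt
  | 2, 0, 2 | 2, 2, 0 => - 2^-1 * bx
  | 2, 2, 2 => - 2^-1 * ex - y
  | _, _, _ => 0
  end.

(** [std_conn] differentiated by the Leibniz rule in one direction; [dbi m] and [dei m] stand for
    the derivatives of [bi m] and [ei m]. *)
Definition std_dconn (y b e dy db de : F) (bi ei dbi dei : 'I_3 -> F) k i j : F :=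
  let by_ := bi iy in let bx := bi ix in let bt := bi it in
  let ey := ei iy in let ex := ei ix in let et := ei it in
  let dby := dbi iy in let dbx := dbi ix in let dbt := dbi it in
  let dey := dei iy in let dex := dei ix in let det := dei it in
  match val k, val i, val j with
  | 0, 0, 2 | 0, 2, 0 => 2^-1 * (db * bx + b * dbx - dy)
  | 0, 1, 2 | 0, 2, 1 => 2^-1 * dbx
  | 0, 2, 2 => 2^-1 * (db * ex + b * dex - dey) + dbt
  | 1, 0, 0 => 2^-1 * dy + dby
  | 1, 0, 1 | 1, 1, 0 => 2^-1 * dbx
  | 1, 0, 2 | 1, 2, 0 => 2^-1 * (dy * b + y * db - (db * b + b * db) * bx - b * b * dbx + dbx * e + bx * de + dey)
  | 1, 1, 2 | 1, 2, 1 => 2^-1 * (dex - (db * bx + b * dbx))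
  | 1, 2, 2 => 2^-1 * (dy * e + y * de + (db * ey + b * dey) - (db * b + b * db) * ex - b * b * dex
       + (de * ex + e * dex) + det) - (db * bt + b * dbt)
  | 2, 0, 2 | 2, 2, 0 => - 2^-1 * dbx
  | 2, 2, 2 => - 2^-1 * dex - dy
  | _, _, _ => 0
  end.

Variables (y b e : F) (bi ei : 'I_3 -> F).
Local Notation g := (std_conn y b e bi ei).

Lemma std_conn_sym k i j : g k i j = g k j i.
Proof. by rewrite /std_conn; elim/ord3_ind: k; elim/ord3_ind: i; elim/ord3_ind: j => /=. Qed.

Definition std_metric_jet (i j k : 'I_3) : F :=
  match val j, val k with
  | 0, 2 | 2, 0 => bi i
  | 2, 2 => ei i
  | _, _ => 0
  end.

Lemma std_conn_compat i j k :
  std_metric_jet i j k - \sum_l g l i j * sym_form b e l k - \sum_l g l i k * sym_form b e j l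
  = (y * (i == it)%:R) * sym_form b e j k.
Proof.
have t2 : 2^-1 + 2^-1 = 1 :> F by field.
rewrite !sum3E !mxE; elim/ord3_ind: i; elim/ord3_ind: j; elim/ord3_ind: k;
 rewrite /std_conn /std_metric_jet /=; first [ring | field; exact: two0].
Qed.

(** Only the symmetrised components are recorded, since these are what the hypotheses annihilate.
    The xx component is identically zero, which leaves five equations. *)
Lemma std_ricci (ddb dde : 'I_3 -> 'I_3 -> F) :
  (forall i j, ddb i j = ddb j i) -> (forall i j, dde i j = dde j i) ->
  let dg a := std_dconn y b e (a == iy)%:R (bi a) (ei a) bi ei (ddb a) (dde a) in
  let ric i j := \sum_k (dg k k i j - dg i k k j + \sum_m (g k k m * g m i j - g k i m * g m k j)) in
  [/\ ric iy iy = ddb iy ix - bi ix ^+ 2 / 2,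
      ric iy ix + ric ix iy = ddb ix ix,
      ric ix ix = 0,
      ric ix it + ric it ix = dde ix ix + ddb iy ix - bi ix ^+ 2 - b * ddb ix ix &
      ric iy it + ric it iy = 2^-1 * (y * bi ix + 1) - b * bi ix ^+ 2 + b * ddb iy ix
         - b ^+ 2 * ddb ix ix - ddb ix it + ddb ix ix * e + dde iy ix /\
      ric it it = 4^-1 * (y * ei ix + y ^+ 2) - b * ddb ix it + b * dde iy ix - 2^-1 * (b ^+ 2 * dde ix ix)
         - 2^-1 * (bi ix * ei iy) - 2^-1 * (bi ix ^+ 2 * e) + 2^-1 * (bi iy * ei ix)
         + ddb iy it + 2^-1 * (e * dde ix ix) - 2^-1 * dde iy iy].
Proof.
move=> bs es dg ric; rewrite /ric /dg !sum3E /std_conn /std_dconn /=.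
rewrite ?(bs ix iy) ?(bs it iy) ?(bs it ix) ?(es ix iy) ?(es it iy) ?(es it ix).
have four : (4 : F) = 2 * 2 by rewrite -natrM.
move: (bi iy) (bi ix) (bi it) (ei iy) (ei ix) (ei it) => b0 b1 b2 e0 e1 e2.
rewrite four; split; [..|split]; try first [ring | field; exact: two0].
by field; rewrite ?two0 //= four mulf_neq0.
Qed.
End StandardForm.

Lemma isdXn (R : realType) (V : normedModType R) (f : V -> R) (p v : V) (d : R) n : is_derive p v f d ->
  is_derive p v (fun u => f u ^+ n.+1) (n.+1%:R * f p ^+ n * d).
Proof.
move=> H; elim: n => [|n IH]; first by rewrite mul1r mul1r.
rewrite (_ : (fun u => _) = fun u => f u * f u ^+ n.+1); last by apply/funext => u; rewrite exprS.
by apply: (isd_eq (isdM H IH)); rewrite -(addn1 n.+1) natrD !exprS; ring.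
Qed.

(** The value of the derivative is an existential variable filled in along the way; callers compare
    it with the wanted one by [isd_eq]. Atoms are differentiated by the hypotheses at hand. *)
Ltac is_derive_poly :=
  lazymatch goal with
  | |- is_derive _ _ (fun _ => ?c) _ => notypeclasses refine (isdC _ _ _)
  | |- is_derive _ _ (fun z => fun_of_matrix z _ _) _ => notypeclasses refine (is_derive_coord _ _ _)
  | H : is_derive ?p ?v ?f _ |- is_derive ?p ?v ?f _ => exact H
  | |- is_derive _ _ (fun z => _ + _) _ => notypeclasses refine (isdD _ _); is_derive_poly
  | |- is_derive _ _ (fun z => - _) _ => notypeclasses refine (isdN _); is_derive_poly
  | |- is_derive _ _ (fun z => _ ^+ _) _ => notypeclasses refine (isdXn _ _); is_derive_poly
  | |- is_derive _ _ (fun z => _ * _) _ => notypeclasses refine (isdM _ _); is_derive_poly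
  end.

Ltac Ck_poly oU :=
  lazymatch goal with
  | |- Ck _ _ (fun _ => ?c) => exact (Ck_cst _ _ oU)
  | |- Ck _ _ (fun z => fun_of_matrix z _ _) => exact (Ck_coord _ _ oU)
  | H : Ck ?U ?n ?f |- Ck ?U ?n ?f => exact H
  | |- Ck _ _ (fun z => _ + _) => refine (Ck_add oU _ _); Ck_poly oU
  | |- Ck _ _ (fun z => - _) => refine (Ck_opp oU _); Ck_poly oU
  | |- Ck _ _ (fun z => _ ^+ _) => refine (Ck_pow _ oU _); Ck_poly oU
  | |- Ck _ _ (fun z => _ * _) => refine (Ck_mul oU _ _); Ck_poly oU
  end.

Section StandardGeometry.
Context {R : realType}.
Local Notation E := 'rV[R]_3.
Implicit Types (U : set E) (b e : E -> R) (x z : E) (i j k a : 'I_3).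
Local Opaque partial.

Definition std_connection b e : connection R := fun k i j x =>
  std_conn (x 0 iy) (b x) (e x) (fun a => partial a b x) (fun a => partial a e x) k i j.

Definition std_metric b e x : 'M[R]_3 := sym_form (b x) (e x).

Lemma std_metricC U n b e i j : open U -> Ck U n b -> Ck U n e -> Ck U n (fun x => std_metric b e x i j).
Proof.
move=> oU bC eC; under [X in Ck _ _ X]eq_fun do rewrite mxE.
by elim/ord3_ind: i; elim/ord3_ind: j => /=; first [exact: bC | exact: eC | exact: Ck_cst].
Qed.

Lemma omega_normalE x k : omega_normal x 0 k = x 0 iy * (k == it)%:R :> R.
Proof. by rewrite !mxE eqxx. Qed.

Lemma omega_normalC U n k : open U -> Ck U n (fun x : E => omega_normal x 0 k).
Proof.
move=> oU; under [X in Ck _ _ X]eq_fun do rewrite omega_normalE.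
by apply: Ck_mul => //; [exact: Ck_coord | exact: Ck_cst].
Qed.

Lemma std_metric_sym b e x : (std_metric b e x)^T = std_metric b e x.
Proof. by apply/matrixP => i j; rewrite !mxE; elim/ord3_ind: i; elim/ord3_ind: j. Qed.

Lemma std_metric_signature b e x : has_signature sig_lorentzian (std_metric b e x).
Proof.
(* With this c the vector d_t - b d_y + c d_x is null and orthogonal to d_y. Adding and subtracting
   half of d_x gives vectors of square 1 and -1, the last two rows of [P]; [Q] is the inverse of
   [P]. *)
pose c := 2^-1 * (b x ^+ 2 - e x).
pose P : 'M[R]_3 := \matrix_(i, j)
  match val i, val j with
  | 0, 0 | 1, 2 | 2, 2 => 1 | 1, 0 | 2, 0 => - b x
  | 1, 1 => c + 2^-1 | 2, 1 => c - 2^-1 | _, _ => 0 end.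
pose Q : 'M[R]_3 := \matrix_(i, j)
  match val i, val j with
  | 0, 0 | 1, 1 => 1 | 1, 2 => -1 | 2, 0 => b x
  | 2, 1 => - c + 2^-1 | 2, 2 => c + 2^-1 | _, _ => 0 end.
exists P; split.
  have PQ : P *m Q = 1%:M.
    apply/matrixP => i j; rewrite !mxE !sum3E !mxE /c; move: (b x) (e x) => u v.
    by elim/ord3_ind: i; elim/ord3_ind: j => /=; field.
  by case/mulmx1_unit: PQ.
apply/matrixP => i j; rewrite !mxE !sum3E !mxE !sum3E !mxE /c; move: (b x) (e x) => u v.
by elim/ord3_ind: i; elim/ord3_ind: j => /=; field.
Qed.

Lemma signature_unit (d : 'rV[R]_3) (H : 'M[R]_3) : (forall i, d 0 i != 0) -> has_signature d H -> H \in unitmx.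
Proof.
move=> d0 [P [Pu PH]]; have : P *m H *m P^T \in unitmx.
  rewrite PH unitmxE det_diag unitfE; apply/prodf_neq0 => i _; exact: d0.
by rewrite !unitmx_mul => /andP[/andP[_ ->]].
Qed.

Lemma std_metric_unit b e x : std_metric b e x \in unitmx.
Proof.
apply: signature_unit (std_metric_signature b e x) => i; rewrite mxE.
by case: ifP => _; rewrite ?oppr_eq0 oner_neq0.
Qed.

Lemma std_weyl U n b e : open U -> Ck U n.+2 b -> Ck U n.+2 e ->
  weyl_on U (std_metric b e) omega_normal (std_connection b e) n.
Proof.
move=> oU bC eC; split; first exact: oU.
- by move=> x _; exact: std_metric_sym.
- by move=> x _; exact: std_metric_unit.
- by move=> i j; exact: std_metricC.
- by move=> i; exact: omega_normalC.
- by move=> x _ k i j; exact: std_conn_sym.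
move=> x Ux i j k; have two0 : (2 : R) != 0 by [].
rewrite omega_normalE -(std_conn_compat two0 _ _ _ (fun a => partial a b x) (fun a => partial a e x)) /std_metric.
congr (_ - _ - _); apply: is_derive_partial.
under [X in is_derive _ _ X]eq_fun do rewrite mxE.
have db := Ck_is_derive i bC Ux; have de := Ck_is_derive i eC Ux.
elim/ord3_ind: j; elim/ord3_ind: k; rewrite /std_metric_jet /=; first [exact: db | exact: de | exact: isdC].
Qed.

Lemma is_derive_std_conn (V : normedModType R) (p v : V) (y b e : V -> R) (bi ei : 'I_3 -> V -> R)
    (dy db de : R) (dbi dei : 'I_3 -> R) k i j :
  is_derive p v y dy -> is_derive p v b db -> is_derive p v e de ->
  (forall m, is_derive p v (bi m) (dbi m)) -> (forall m, is_derive p v (ei m) (dei m)) ->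
  is_derive p v (fun u : V => std_conn (y u) (b u) (e u) (fun m => bi m u) (fun m => ei m u) k i j)
   (std_dconn (y p) (b p) (e p) dy db de (fun m => bi m p) (fun m => ei m p) dbi dei k i j).
Proof.
move=> Hy Hb He Hbi Hei.
have b0 := Hbi iy; have b1 := Hbi ix; have b2 := Hbi it.
have e0 := Hei iy; have e1 := Hei ix; have e2 := Hei it.
elim/ord3_ind: k; elim/ord3_ind: i; elim/ord3_ind: j; rewrite /std_conn /std_dconn /=.
all: unshelve notypeclasses refine (isd_eq _ _); [shelve | is_derive_poly | cbv beta; ring].
Qed.

Lemma is_derive_std_connection U b e a k i j x : open U -> U x -> Ck U 2 b -> Ck U 2 e ->
  is_derive x (delta_mx 0 a) (std_connection b e k i j)
   (std_dconn (x 0 iy) (b x) (e x) (a == iy)%:R (partial a b x) (partial a e x)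
     (fun m => partial m b x) (fun m => partial m e x)
     (fun m => partial a (partial m b) x) (fun m => partial a (partial m e) x) k i j).
Proof.
move=> oU Ux bC eC; apply: (@is_derive_std_conn _ x (delta_mx 0 a) (fun z => z 0 iy) b e (fun m z => partial m b z)
  (fun m z => partial m e z)).
- exact: is_derive_coord.
- exact: (Ck_is_derive a bC Ux).
- exact: (Ck_is_derive a eC Ux).
- by move=> m; exact: (Ck_is_derive a (Ck_partial m bC) Ux).
- by move=> m; exact: (Ck_is_derive a (Ck_partial m eC) Ux).
Qed.

Local Opaque std_conn std_dconn.

Lemma std_weyl_ricci U b e x i j : open U -> U x -> Ck U 2 b -> Ck U 2 e ->
  let dg a := std_dconn (x 0 iy) (b x) (e x) (a == iy)%:R (partial a b x) (partial a e x)
     (fun m => partial m b x) (fun m => partial m e x)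
     (fun m => partial a (partial m b) x) (fun m => partial a (partial m e) x) in
  let g := std_conn (x 0 iy) (b x) (e x) (fun a => partial a b x) (fun a => partial a e x) in
  weyl_ricci (std_metric b e) omega_normal i j x =
  \sum_k (dg k k i j - dg i k k j + \sum_m (g k k m * g m i j - g k i m * g m k j)).
Proof.
move=> oU Ux bC eC dg g; rewrite (weyl_ricciE (std_weyl oU bC eC) i j Ux).
apply: eq_bigr => k _; rewrite /curvature.
rewrite (is_derive_partial (is_derive_std_connection k k i j oU Ux bC eC)).
by rewrite (is_derive_partial (is_derive_std_connection i k k j oU Ux bC eC)).
Qed.

(** The equations for b_xx, b_yx and e_xx come first, and these derivatives are already eliminated
    from the last two. *)
Definition std_equations b e x : Prop :=
  [/\ partial ix (partial ix b) x = 0, partial iy (partial ix b) x = partial ix b x ^+ 2 / 2,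
      partial ix (partial ix e) x = partial ix b x ^+ 2 / 2,
      2^-1 * (x 0 iy * partial ix b x + 1) - b x * partial ix b x ^+ 2 / 2
        - partial ix (partial it b) x + partial iy (partial ix e) x = 0 &
      4^-1 * (x 0 iy * partial ix e x + x 0 iy ^+ 2) - b x * partial ix (partial it b) x
        + b x * partial iy (partial ix e) x - b x ^+ 2 * partial ix b x ^+ 2 / 4
        - partial ix b x * partial iy e x / 2 - partial ix b x ^+ 2 * e x / 4
        + partial iy b x * partial ix e x / 2 + partial iy (partial it b) x
        - partial iy (partial iy e) x / 2 = 0].

Lemma std_equations_algebra (r : 'I_3 -> 'I_3 -> R) (y b e bx by_ ex ey bxx byx bxt byt exx eyx eyy : R) :
  r iy iy = byx - bx ^+ 2 / 2 -> r iy ix + r ix iy = bxx -> r ix ix = 0 ->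
  r ix it + r it ix = exx + byx - bx ^+ 2 - b * bxx ->
  r iy it + r it iy = 2^-1 * (y * bx + 1) - b * bx ^+ 2 + b * byx - b ^+ 2 * bxx - bxt + bxx * e + eyx ->
  r it it = 4^-1 * (y * ex + y ^+ 2) - b * bxt + b * eyx - 2^-1 * (b ^+ 2 * exx)
    - 2^-1 * (bx * ey) - 2^-1 * (bx ^+ 2 * e) + 2^-1 * (by_ * ex) + byt + 2^-1 * (e * exx) - 2^-1 * eyy ->
  (forall i j, r i j + r j i = 0) <->
  [/\ bxx = 0, byx = bx ^+ 2 / 2, exx = bx ^+ 2 / 2,
    2^-1 * (y * bx + 1) - b * bx ^+ 2 / 2 - bxt + eyx = 0 &
    4^-1 * (y * ex + y ^+ 2) - b * bxt + b * eyx - b ^+ 2 * bx ^+ 2 / 4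
        - bx * ey / 2 - bx ^+ 2 * e / 4 + by_ * ex / 2 + byt - eyy / 2 = 0].
Proof.
move=> r00 r01 r11 r12 r02 r22; have half (a : R) : a + a = 0 -> a = 0 by lra.
split=> [S|[bxxE byxE exxE H1 H2] i j].
  move/half/eqP: (S iy iy); rewrite r00 subr_eq0 => /eqP byxE.
  have := S iy ix; rewrite r01 => bxxE; have H1 := S ix it; have H2 := S iy it; have /half H3 := S it it.
  rewrite r12 byxE bxxE in H1; rewrite r02 byxE bxxE in H2; rewrite r22 in H3; rewrite byxE bxxE {S}.
  have exxE : exx = bx ^+ 2 / 2 by move: H1; rewrite mulr0; lra.
  by split => //; [rewrite -[RHS]H2 | rewrite -[RHS]H3 exxE]; field.
have z01 : r iy ix + r ix iy = 0 by rewrite r01.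
have z12 : r ix it + r it ix = 0 by rewrite r12 byxE bxxE exxE; field.
have z02 : r iy it + r it iy = 0 by rewrite -[RHS]H1 r02 byxE bxxE; field.
have z00 : r iy iy = 0 by rewrite r00 byxE subrr.
have z22 : r it it = 0 by rewrite -[RHS]H2 r22 exxE; field.
by elim/ord3_ind: i; elim/ord3_ind: j; rewrite ?r11 ?z00 ?z22 ?addr0 ?z01 ?z12 ?z02 // addrC ?z01 ?z12 ?z02.
Qed.

Lemma std_equationsP U b e x : open U -> U x -> Ck U 2 b -> Ck U 2 e ->
  (forall i j, weyl_ricci (std_metric b e) omega_normal i j x
     + weyl_ricci (std_metric b e) omega_normal j i x = 0) <-> std_equations b e x.
Proof.
move=> oU Ux bC eC; have two0 : (2 : R) != 0 by [].
have := @std_ricci R two0 (x 0 iy) (b x) (e x) (fun a => partial a b x) (fun a => partial a e x)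
  (fun a m => partial a (partial m b) x) (fun a m => partial a (partial m e) x)
  (fun a m => Schwarz a m oU Ux bC) (fun a m => Schwarz a m oU Ux eC).
have E i j := std_weyl_ricci i j oU Ux bC eC.
rewrite /= in E *; rewrite -!E => -[H1 H2 H3 H4 [H5 H6]].
exact: (std_equations_algebra (r := fun i j => weyl_ricci (std_metric b e) omega_normal i j x) H1 H2 H3 H4 H5 H6).
Qed.

(** In the converse direction W vanishes because the symmetric inverse metric sees only the
    symmetrised tensor. *)
Lemma ricci_sym0_at (h : E -> 'M[R]_3) (w : E -> E) x : (h x)^T = h x -> h x \in unitmx ->
  (einstein_weyl_at h w x /\ weyl_scalar h w x = 0) <->
  (forall i j, weyl_ricci h w i j x + weyl_ricci h w j i x = 0).
Proof.
move=> hs hu; split=> [[EW W0] i j|S].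
  have := EW i j; rewrite W0 mulr0 mul0r => /eqP; rewrite mulf_eq0 invr_eq0 pnatr_eq0 /=.
  by move/eqP.
have W0 : weyl_scalar h w x = 0.
  have is_ i j : invmx (h x) i j = invmx (h x) j i by rewrite -{1}hs -trmx_inv mxE.
  have half (a : R) : a + a = 0 -> a = 0 by lra.
  apply: half; rewrite /weyl_scalar {2}exchange_big -big_split big1 //= => i _.
  rewrite -big_split big1 //= => j _; rewrite (is_ j i) -mulrDr S mulr0 //.
by split=> // i j; rewrite W0 S !mulr0 mul0r.
Qed.

Lemma std_solution U b e x : open U -> U x -> Ck U 2 b -> Ck U 2 e -> std_equations b e x ->
  solution_at (std_metric b e) omega_normal x.
Proof.
move=> oU Ux bC eC /(std_equationsP oU Ux bC eC) S; split; first exact: std_metric_signature.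
  by case: ((ricci_sym0_at _ (std_metric_sym b e x) (std_metric_unit b e x)).2 S).
by case: ((ricci_sym0_at _ (std_metric_sym b e x) (std_metric_unit b e x)).2 S).
Qed.

End StandardGeometry.

(** * The two explicit families are solutions *)

Section ExplicitSolutions.
Context {R : realType}.
Local Notation E := 'rV[R]_3.
Implicit Types (U : set E) (x z : E) (i j k a : 'I_3).
Local Opaque partial upd.

Lemma isd_coord_fun (r : R -> R) (d : R) x i k : is_derive (x 0 k) 1 r d ->
  is_derive x (delta_mx 0 i) (fun z => r (z 0 k)) ((i == k)%:R * d).
Proof.
move=> H; apply/is_derive_line; case: eqP => [->|/eqP ik].
  rewrite (_ : (fun u => _) = r) ?mul1r //; apply/funext => u; by rewrite upd_same.
rewrite mul0r (_ : (fun u => _) = cst (r (x 0 k))); first exact: isdC.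
by apply/funext => u; rewrite upd_other // eq_sym.
Qed.

Lemma C2_on_isd (J : set R) (r : R -> R) t : C2_on J r -> J t -> is_derive t 1 r (derive1 r t).
Proof. by move=> H Jt; case: (H t Jt) => H1 _ _; rewrite derive1E; exact/derivableP. Qed.

Lemma C2_on_Ck (J : set R) (r : R -> R) k : open J -> C2_on J r ->
  Ck [set z : E | J (z 0 k)] 2 (fun z => r (z 0 k)).
Proof.
move=> oJ rC; have oU : open [set z : E | J (z 0 k)].
  by apply: open_comp oJ => z _; exact: coord_continuous.
apply: (CkS' (df := fun i z => (i == k)%:R * derive1 r (z 0 k))) => // [i z Jz|i].
  by apply: isd_coord_fun; exact: (C2_on_isd rC Jz).
apply: Ck_mul => //; first exact: Ck_cst.
apply: (CkS' (df := fun i z => (i == k)%:R * derive1n 2 r (z 0 k))) => // [j z Jz|j].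
  apply: isd_coord_fun; case: (rC _ Jz) => _ H _; rewrite /= derive1E; exact/derivableP.
apply: Ck_mul => //; first exact: Ck_cst.
split=> // z Jz; case: (rC _ Jz) => _ _ H.
exact: (cont_comp (@coord_continuous _ _ _ 0 k z) H).
Qed.



Definition h1_tt (r s : R -> R) x : R := x 0 ix * (r (x 0 it) - x 0 iy / 2) + x 0 iy ^+ 4 / 48
  + r (x 0 it) * x 0 iy ^+ 3 / 12 + s (x 0 it) * x 0 iy.
(** Half of the coefficient - 4 x / y, since dy dt is a symmetric product. *)
Definition h2_yt x : R := - 2 * x 0 ix / x 0 iy.
Definition h2_tt (r s : R -> R) x : R := (x 0 ix / x 0 iy) ^+ 2 + x 0 ix * x 0 iy / 2 + x 0 iy ^+ 4 / 8
  + r (x 0 it) * x 0 iy ^+ 2 + s (x 0 it) * x 0 iy.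

Lemma h1E r s x : h1 r s x = std_metric (fun _ => 0) (h1_tt r s) x.
Proof.
apply/matrixP => i j; rewrite !mxE !big_ord1 !mxE /h1_tt.
move: (_ + s _ * _) => e; by elim/ord3_ind: i; elim/ord3_ind: j; rewrite /=; field.
Qed.

Lemma h2E r s x : h2 r s x = std_metric h2_yt (h2_tt r s) x.
Proof.
apply/matrixP => i j; rewrite !mxE !big_ord1 !mxE /h2_tt /h2_yt expr_div_n.
move: (_ + s _ * _) => e; move: (x 0 iy)^-1 (x 0 iy ^- 2) => u v.
by elim/ord3_ind: i; elim/ord3_ind: j; rewrite /=; field.
Qed.


Ltac atoms r s := repeat match goal with
  | |- context [derive1 r ?t] => generalize (derive1 r t); intro
  | |- context [derive1 s ?t] => generalize (derive1 s t); intro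
  | |- context [r ?t] => generalize (r t); intro
  | |- context [s ?t] => generalize (s t); intro
  | |- context [(fun_of_matrix ?z ?i ?j)^-1] => generalize (fun_of_matrix z i j)^-1; intro
  | |- context [fun_of_matrix ?z ?i ?j] => generalize (fun_of_matrix z i j); intro
  end.

Ltac isd_by t := apply: is_derive_partial; unshelve notypeclasses refine (isd_eq _ _);
  [shelve | is_derive_poly | cbv beta; rewrite /= ?mulr1n ?mulr0n; t].

Variables (J : set R) (r s : R -> R).
Hypotheses (oJ : open J) (rC : C2_on J r) (sC : C2_on J s).
Let U := [set z : E | J (z 0 it)].
Let oU : open U. Proof. by apply: open_comp oJ => z _; exact: coord_continuous. Qed.
Let RC : Ck U 2 (fun z => r (z 0 it)) := C2_on_Ck it oJ rC.
Let SC : Ck U 2 (fun z => s (z 0 it)) := C2_on_Ck it oJ sC.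

Let dr i z : U z -> is_derive z (delta_mx 0 i) (fun u => r (u 0 it)) ((i == it)%:R * derive1 r (z 0 it)).
Proof. by move=> Uz; apply: isd_coord_fun; exact: (C2_on_isd rC Uz). Qed.

Let ds i z : U z -> is_derive z (delta_mx 0 i) (fun u => s (u 0 it)) ((i == it)%:R * derive1 s (z 0 it)).
Proof. by move=> Uz; apply: isd_coord_fun; exact: (C2_on_isd sC Uz). Qed.

Lemma h1_solution x : U x -> solution_at (h1 r s) omega_normal x.
Proof.
move=> Ux; have eC : Ck U 2 (h1_tt r s) by rewrite /h1_tt; Ck_poly oU.
have -> : h1 r s = std_metric (fun _ => 0) (h1_tt r s) by apply/funext => z; exact: h1E.
apply: (std_solution oU Ux (Ck_cst 2 0 oU) eC).
have p0 i : partial i (fun _ : E => 0 : R) = fun _ => 0.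
  by apply/funext => z; apply: is_derive_partial; exact: isdC.
have ex z : U z -> partial ix (h1_tt r s) z = r (z 0 it) - z 0 iy / 2.
  move=> Uz; have d1 := dr ix Uz; have d2 := ds ix Uz; rewrite /h1_tt.
  isd_by ltac:(atoms r s; by field).
have ey z : U z -> partial iy (h1_tt r s) z = - z 0 ix / 2 + z 0 iy ^+ 3 / 12 + r (z 0 it) * z 0 iy ^+ 2 / 4 + s (z 0 it).
  move=> Uz; have d1 := dr iy Uz; have d2 := ds iy Uz; rewrite /h1_tt.
  isd_by ltac:(atoms r s; by field).
have exx : partial ix (partial ix (h1_tt r s)) x = 0.
  rewrite (partial_eq_on ix oU Ux ex); have d1 := dr ix Ux; have d2 := ds ix Ux.
  isd_by ltac:(atoms r s; by field).
have eyx : partial iy (partial ix (h1_tt r s)) x = - 2^-1.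
  rewrite (partial_eq_on iy oU Ux ex); have d1 := dr iy Ux; have d2 := ds iy Ux.
  isd_by ltac:(atoms r s; by field).
have eyy : partial iy (partial iy (h1_tt r s)) x = x 0 iy ^+ 2 / 4 + r (x 0 it) * x 0 iy / 2.
  rewrite (partial_eq_on iy oU Ux ey); have d1 := dr iy Ux; have d2 := ds iy Ux.
  isd_by ltac:(atoms r s; by field).
rewrite /std_equations !p0 exx eyx eyy (ex x Ux); move: (r _) (h1_tt _ _ _) (partial _ _ _) (x 0 iy) => *.
by split; field.
Qed.

Lemma h2_solution x : U x -> x 0 iy != 0 -> solution_at (h2 r s) omega_normal x.
Proof.
move=> Ux y0; pose V := U `&` [set z | z 0 iy != 0].
have oV : open V.
  apply: openI => //; apply: (@open_comp _ _ (fun z : E => z 0 iy) [set y | y != 0]) => [z _|].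
    exact: coord_continuous.
  exact: open_neq.
have Vx : V x by [].
have RV : Ck V 2 (fun z => r (z 0 it)) by apply: Ck_sub RC => z [].
have SV : Ck V 2 (fun z => s (z 0 it)) by apply: Ck_sub SC => z [].
have YV : Ck V 2 (fun z => (z 0 iy)^-1).
  by apply: (Ck_inv oV _ (Ck_coord 2 iy oV)) => z [].
have eC : Ck V 2 (h2_tt r s) by rewrite /h2_tt; Ck_poly oV.
have bC : Ck V 2 h2_yt by rewrite /h2_yt; Ck_poly oV.
have -> : h2 r s = std_metric h2_yt (h2_tt r s) by apply/funext => z; exact: h2E.
apply: (std_solution oV Vx bC eC).
have dY i z : V z -> is_derive z (delta_mx 0 i) (fun u => (u 0 iy)^-1) ((i == iy)%:R * - ((z 0 iy)^-1 * (z 0 iy)^-1)).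
  by case=> _ z0; apply: (@isd_coord_fun (fun u => u^-1)); exact: isd_inv.
have bx z : V z -> partial ix h2_yt z = - 2 * (z 0 iy)^-1.
  move=> Vz; have d3 := dY ix z Vz; rewrite /h2_yt; isd_by ltac:(atoms r s; by field).
have by_ z : V z -> partial iy h2_yt z = 2 * z 0 ix * (z 0 iy)^-1 ^+ 2.
  move=> Vz; have d3 := dY iy z Vz; rewrite /h2_yt; isd_by ltac:(atoms r s; by field).
have bt z : V z -> partial it h2_yt z = 0.
  move=> Vz; have d3 := dY it z Vz; rewrite /h2_yt; isd_by ltac:(atoms r s; by field).
have ex z : V z -> partial ix (h2_tt r s) z = 2 * z 0 ix * (z 0 iy)^-1 ^+ 2 + z 0 iy / 2.
  move=> Vz; have d1 := dr ix Vz.1; have d2 := ds ix Vz.1; have d3 := dY ix z Vz; rewrite /h2_tt.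
  isd_by ltac:(atoms r s; by field).
have ey z : V z -> partial iy (h2_tt r s) z = - 2 * z 0 ix ^+ 2 * (z 0 iy)^-1 ^+ 3 + z 0 ix / 2
    + z 0 iy ^+ 3 / 2 + 2 * r (z 0 it) * z 0 iy + s (z 0 it).
  move=> Vz; have d1 := dr iy Vz.1; have d2 := ds iy Vz.1; have d3 := dY iy z Vz; rewrite /h2_tt.
  isd_by ltac:(atoms r s; by field).
have bxx : partial ix (partial ix h2_yt) x = 0.
  rewrite (partial_eq_on ix oV Vx bx); have d3 := dY ix x Vx; isd_by ltac:(atoms r s; by field).
have byx : partial iy (partial ix h2_yt) x = 2 * (x 0 iy)^-1 ^+ 2.
  rewrite (partial_eq_on iy oV Vx bx); have d3 := dY iy x Vx; isd_by ltac:(atoms r s; by field).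
have bit i : partial i (partial it h2_yt) x = 0.
  by rewrite (partial_eq_on i oV Vx bt); apply: is_derive_partial; exact: isdC.
have exx : partial ix (partial ix (h2_tt r s)) x = 2 * (x 0 iy)^-1 ^+ 2.
  rewrite (partial_eq_on ix oV Vx ex); have d3 := dY ix x Vx.
  isd_by ltac:(atoms r s; by field).
have eyx : partial iy (partial ix (h2_tt r s)) x = - 4 * x 0 ix * (x 0 iy)^-1 ^+ 3 + 2^-1.
  rewrite (partial_eq_on iy oV Vx ex); have d3 := dY iy x Vx.
  isd_by ltac:(atoms r s; by field).
have eyy : partial iy (partial iy (h2_tt r s)) x = 6 * x 0 ix ^+ 2 * (x 0 iy)^-1 ^+ 4 + 3 * x 0 iy ^+ 2 / 2 + 2 * r (x 0 it).
  rewrite (partial_eq_on iy oV Vx ey); have d1 := dr iy Vx.1; have d2 := ds iy Vx.1; have d3 := dY iy x Vx.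
  isd_by ltac:(atoms r s; by field).
rewrite /std_equations bxx byx !bit exx eyx eyy (ex x Vx) (ey x Vx) (bx x Vx) (by_ x Vx) /h2_yt /h2_tt.
move: (r _) (s _) (x 0 ix) (x 0 iy) y0 => *; by split; field.
Qed.

End ExplicitSolutions.

(** * Changes of coordinates *)

(* The name [jacobian] itself is taken by MathComp-Analysis. *)
Notation jac := Defs.jacobian.

Section Diffeomorphisms.
Context {R : realType}.
Local Notation E := 'rV[R]_3.
Implicit Types (U V W : set E) (x z p u : E) (i j k : 'I_3) (Phi Psi f g : E -> E).
Local Opaque partial upd.

Definition smooth_map U f : Prop := forall n k, Ck U n (fun z => f z 0 k).

(** The inverse is carried as data, since functions are transported to the new coordinates by
    composing with it. *)
Record diffeo U V Phi Psi : Prop := Diffeo {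
  diffeo_open : open U; diffeo_open' : open V;
  diffeo_smooth : smooth_map U Phi; diffeo_smooth' : smooth_map V Psi;
  diffeo_map : forall z, U z -> V (Phi z); diffeo_K : forall z, U z -> Psi (Phi z) = z;
  diffeo_map' : forall u, V u -> U (Psi u); diffeo_K' : forall u, V u -> Phi (Psi u) = u }.

Lemma diffeo_sym U V Phi Psi : diffeo U V Phi Psi -> diffeo V U Psi Phi.
Proof. by case=> *; split. Qed.

Lemma diffeo_id U : open U -> diffeo U U id id.
Proof. by move=> oU; split=> // n k; exact: Ck_coord. Qed.

Lemma smooth_map_cont U f x : smooth_map U f -> U x -> {for x, continuous f}.
Proof. by move=> H Ux; apply: continuous_row => j; exact: Ck_cont (H 0%N j) Ux. Qed.

Lemma open_preimage U V f : open U -> open V -> smooth_map U f -> open (U `&` f @^-1` V).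
Proof.
move=> oU oV fC; rewrite openE => x [Ux Vx]; apply: filterI; first exact: open_nbhs_nbhs.
by apply: (smooth_map_cont fC Ux); exact: open_nbhs_nbhs.
Qed.

Lemma diffeo_sub U V Phi Psi U' : diffeo U V Phi Psi -> open U' -> U' `<=` U ->
  diffeo U' (V `&` Psi @^-1` U') Phi Psi.
Proof.
move=> [oU oV Ps Qs PV PK QU QK] oU' sU; split => //.
- exact: open_preimage.
- by move=> n k; exact: Ck_sub (Ps n k).
- by move=> n k; apply: Ck_sub (Qs n k) => u [].
- by move=> z Uz; split; [exact/PV/sU | rewrite /preimage /= PK //; exact: sU].
- by move=> z Uz; rewrite PK //; exact: sU.
- by move=> u [].
- by move=> u [Vu _]; exact: QK.
Qed.

Lemma smooth_map_comp U V f g : open U -> open V -> smooth_map U f -> smooth_map V g ->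
  (forall z, U z -> V (f z)) -> smooth_map U (fun z => g (f z)).
Proof. by move=> oU oV fC gC fV n k; apply: (Ck_comp oU oV fV (fC n) (gC n k)). Qed.

Lemma diffeo_comp U V W Phi Psi Phi' Psi' : diffeo U V Phi Psi -> diffeo V W Phi' Psi' ->
  diffeo U W (fun z => Phi' (Phi z)) (fun u => Psi (Psi' u)).
Proof.
move=> [oU oV Ps Qs PV PK QU QK] [_ oW Ps' Qs' PV' PK' QU' QK']; split => //.
- exact: (smooth_map_comp oU oV Ps Ps' PV).
- exact: (smooth_map_comp oW oV Qs' Qs QU').
- by move=> z Uz; exact/PV'/PV.
- by move=> z Uz; rewrite PK' ?PK //; exact: PV.
- by move=> z Uz; exact/QU/QU'.
- by move=> z Uz; rewrite QK ?QK' //; exact: QU'.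
Qed.

Lemma diffeo_eq U V Phi Psi f : diffeo U V Phi Psi -> (forall z, U z -> Phi z = f z) -> diffeo U V f Psi.
Proof.
move=> [oU oV Ps Qs PV PK QU QK] e; split => //.
- by move=> n k; apply: Ck_eq oU _ (Ps n k) => z Uz; rewrite e.
- by move=> z Uz; rewrite -e //; exact: PV.
- by move=> z Uz; rewrite -e //; exact: PK.
- by move=> u Vu; rewrite -e ?QK //; exact: QU.
Qed.

Lemma diffeo_linear (B : 'M[R]_3) : B \in unitmx ->
  diffeo setT setT (fun z => z *m B) (fun u => u *m invmx B).
Proof.
have lin (C : 'M[R]_3) : smooth_map setT (fun z => z *m C).
  move=> n k; apply: (Ck_eq (f := fun z => \sum_j z 0 j * C j k) openT) => [z _|]; first by rewrite mxE.
  by apply: Ck_sum (openT) _ => j _; apply: Ck_mul openT _ _; [exact: Ck_coord openT | exact: Ck_cst openT].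
move=> Bu; split; try exact: openT; try exact: lin; try by [].
- by move=> z _; rewrite mulmxK.
- by move=> z _; rewrite mulmxKV.
Qed.

Lemma diffeo_replace U (f : E -> R) k p : open U -> U p -> (forall n, Ck U n f) -> partial k f p != 0 ->
  exists U' V Psi, [/\ U' `<=` U, U' p & diffeo U' V (fun z => upd z k (f z)) Psi].
Proof.
move=> oU Up fC d0; have [r [w [[r0 rU] _ oV wC [wK _]]]] := replace_inverse oU Up fC d0.
set V := [set _ | _ in _] in oV wC.
have wV z : cube p r z -> upd (upd z k (f z)) k (w (upd z k (f z))) = z.
  by move=> Hz; rewrite upd_upd wK // upd_id.
have updC (S : set E) (g : E -> R) : open S -> (forall n, Ck S n g) -> smooth_map S (fun z => upd z k (g z)).
  move=> oS gC n j; have [->|jk] := eqVneq j k.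
    by apply: Ck_eq oS _ (gC n) => z _; rewrite upd_same.
  by apply: Ck_eq oS _ (Ck_coord n j oS) => z _; rewrite upd_other.
exists (cube p r), V, (fun u => upd u k (w u)); split=> //; first exact: cube_center.
split; [exact: cube_open | exact: oV | | | | exact: wV | | ].
- by apply: updC => [|n]; [exact: cube_open | exact: Ck_sub (fC n)].
- exact: updC.
- by move=> z Hz; exists z.
- by move=> _ [z Hz <-]; rewrite wV.
- by move=> _ [z Hz <-]; rewrite wV.
Qed.

Lemma diffeo_upd U V Phi Psi (g : E -> R) k p : diffeo U V Phi Psi -> U p -> (forall n, Ck U n g) ->
  partial k (fun u => g (Psi u)) (Phi p) != 0 ->
  exists U' V' Psi', [/\ U' `<=` U, U' p & diffeo U' V' (fun z => upd (Phi z) k (g z)) Psi'].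
Proof.
move=> D Up gC d0; case: (D) => oU oV Ps Qs PV PK QU QK.
have gC' n : Ck V n (fun u => g (Psi u)) by exact: (Ck_comp oV oU QU (Qs n) (gC n)).
have [V1 [W [Psi1 [V1V V1p D1]]]] := diffeo_replace oV (PV _ Up) gC' d0.
have D2 := diffeo_sym (diffeo_sub (diffeo_sym D) (diffeo_open D1) V1V).
exists (U `&` Phi @^-1` V1), W, (fun u => Psi (Psi1 u)); split=> [z []//|//|].
by apply: diffeo_eq (diffeo_comp D2 D1) _ => z [Uz _] /=; rewrite PK.
Qed.

Lemma jacobianE f x i k : jac f x i k = partial i (fun z => f z 0 k) x.
Proof. by rewrite mxE. Qed.

Lemma partial_comp U V g (f : E -> R) i x : open U -> open V -> U x -> V (g x) ->
  smooth_map U g -> Ck V 1 f ->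
  partial i (fun z => f (g z)) x = \sum_k partial k f (g x) * partial i (fun z => g z 0 k) x.
Proof. by move=> oU oV Ux Vx gC fC; apply: is_derive_partial; exact: is_derive_compE oU oV Ux Vx (gC 1%N) fC. Qed.

Lemma jacobian_comp U V f g x : open U -> open V -> U x -> V (g x) -> smooth_map U g -> smooth_map V f ->
  jac (fun z => f (g z)) x = jac g x *m jac f (g x).
Proof.
move=> oU oV Ux Vx gC fC; apply/matrixP => i k; rewrite mxE (partial_comp i oU oV Ux Vx gC (fC 1%N k)) mxE.
by apply: eq_bigr => l _; rewrite !mxE mulrC.
Qed.

Lemma jacobian_id x : jac (fun z : E => z) x = 1%:M.
Proof. by apply/matrixP => i k; rewrite !mxE partial_coord. Qed.

Lemma jacobian_eq_on U f g x : open U -> U x -> (forall z, U z -> f z = g z) -> jac f x = jac g x.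
Proof. by move=> oU Ux e; apply/matrixP => i k; rewrite !mxE; apply: (partial_eq_on i oU Ux) => z /e ->. Qed.

Lemma diffeo_jacobian U V Phi Psi x : diffeo U V Phi Psi -> U x ->
  jac Phi x *m jac Psi (Phi x) = 1%:M.
Proof.
move=> [oU oV Ps Qs PV PK QU QK] Ux.
rewrite -(jacobian_comp oU oV Ux (PV _ Ux) Ps Qs) -(jacobian_id x).
exact: (jacobian_eq_on oU Ux PK).
Qed.

Lemma diffeo_jacobian_unit U V Phi Psi x : diffeo U V Phi Psi -> U x -> jac Phi x \in unitmx.
Proof. by move=> D Ux; case/mulmx1_unit: (diffeo_jacobian D Ux). Qed.

(** After composition with the inverse Jacobian the derivative at [p] is the identity; then the
    coordinates are replaced one at a time. In the coordinates reached so far the next component has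
    derivative 1 in its own direction at the base point, so [diffeo_upd] applies. *)
Lemma inverse_function U f p : open U -> U p -> smooth_map U f -> jac f p \in unitmx ->
  exists U' V Psi, [/\ U' `<=` U, U' p & diffeo U' V f Psi].
Proof.
move=> oU Up fC Ju; set J := jac f p in Ju.
pose g z := f z *m invmx J.
have L := diffeo_linear (B := invmx J); rewrite unitmx_inv in L.
have gC : smooth_map U g by exact: (smooth_map_comp oU openT fC (diffeo_smooth (L Ju)) (fun _ _ => I)).
have Jg : jac g p = 1%:M.
  rewrite (jacobian_comp oU openT Up I fC (diffeo_smooth (L Ju))) -(mulmxV Ju) -/J; congr (_ *m _).
  apply/matrixP => i k; rewrite mxE.
  apply: is_derive_partial; apply: (is_derive_eq_on (f := fun z => \sum_j z 0 j * invmx J j k) openT I).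
    by move=> z _; rewrite mxE.
  apply: (isd_eq (is_derive_sum3 (fun m => isdM (is_derive_coord (f p) i m) (isdC (invmx J m k) _ _)))).
  rewrite (bigD1 i) //= eqxx mul1r mulr0 addr0 big1 ?addr0 // => m mi.
  by rewrite eq_sym (negbTE mi) mul0r mulr0 addr0.
have step U0 V0 Phi Psi k : diffeo U0 V0 Phi Psi -> U0 `<=` U -> U0 p -> (forall z, U0 z -> Phi z 0 k = z 0 k) ->
  exists U' V' Psi', [/\ U' `<=` U0, U' p & diffeo U' V' (fun z => upd (Phi z) k (g z 0 k)) Psi'].
  move=> D sU U0p Pk; apply: (diffeo_upd D U0p) => [n|]; first exact: Ck_sub (gC n k).
  case: (D) => oU0 oV0 Ps Qs PV PK QU QK.
  have e u : V0 u -> Psi u 0 k = u 0 k by move=> Vu; rewrite -[in RHS](QK u Vu) Pk //; exact: QU.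
  rewrite (partial_comp (f := fun z => g z 0 k) k oV0 oU0 (PV _ U0p) _ Qs (Ck_sub sU (gC 1%N k))) ?PK //.
  rewrite (bigD1 k) //= -(jacobianE g) Jg mxE eqxx mul1r big1; last first.
    by move=> l lk; rewrite -(jacobianE g) Jg mxE (negbTE lk) mul0r.
  by rewrite addr0 (partial_eq_on k oV0 (PV _ U0p) e) partial_coord eqxx oner_neq0.
have [U1 [V1 [Psi1 [s1 U1p D1]]]] := step _ _ _ _ iy (diffeo_id oU) (@subset_refl _ _) Up (fun _ _ => erefl).
have e1 z : U1 z -> upd z iy (g z 0 iy) 0 ix = z 0 ix by move=> _; rewrite upd_other.
have [U2 [V2 [Psi2 [s2 U2p D2]]]] := step _ _ _ _ ix D1 s1 U1p e1.
have e2 z : U2 z -> upd (upd z iy (g z 0 iy)) ix (g z 0 ix) 0 it = z 0 it by move=> _; rewrite !upd_other.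
have [U3 [V3 [Psi3 [s3 U3p D3]]]] := step _ _ _ _ it D2 (subset_trans s2 s1) U2p e2.
have D4 : diffeo U3 V3 g Psi3.
  apply: diffeo_eq D3 _ => z _; apply/rowP => j; elim/ord3_ind: j; rewrite ?upd_same //.
    by rewrite upd_other // upd_other // upd_same.
  by rewrite upd_other // upd_same.
have D5 := diffeo_sub (diffeo_linear Ju) (diffeo_open' D4) (@subsetT _ _).
exists U3, ([set: E] `&` (fun u => u *m invmx J) @^-1` V3), (fun u => Psi3 (u *m invmx J)); split=> //.
  exact: subset_trans s3 (subset_trans s2 s1).
by apply: diffeo_eq (diffeo_comp D4 D5) _ => z _; rewrite /g mulmxKV.
Qed.

End Diffeomorphisms.

(** * Charts of the maximal atlas and local forms of the structure *)

Section Charts.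
Variables (R : realType) (M : topologicalType) (A : set (chart R M)).
Local Notation E := 'rV[R]_3.
Implicit Types (a b c : chart R M) (q : M) (x z u : E) (U V : set E).
Local Opaque partial.

Lemma chart_map_at c q : chart_dom c q -> {for q, continuous (chart_map c)}.
Proof.
move=> cq; have := @chart_map_cont _ _ c; rewrite continuous_open_subspace; last exact: chart_open.
by move/(_ q); apply; rewrite inE.
Qed.

Lemma chart_inv_at c x : chart_img c x -> {for x, continuous (chart_inv c)}.
Proof.
move=> cx; have := @chart_inv_cont _ _ c; rewrite continuous_open_subspace; last exact: chart_img_open.
by move/(_ x); apply; rewrite inE.
Qed.

Lemma chart_K c q : chart_dom c q -> chart_inv c (chart_map c q) = q.
Proof. by move=> cq; apply: (chart_mapK (c := c)); rewrite inE. Qed.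

Lemma chart_inv_dom c x : chart_img c x -> chart_dom c (chart_inv c x).
Proof. by case=> q cq <-; rewrite chart_K. Qed.

Lemma chart_invK c x : chart_img c x -> chart_map c (chart_inv c x) = x.
Proof. by case=> q cq <-; rewrite chart_K. Qed.

Lemma overlap_open a b : open (overlap a b).
Proof.
have -> : overlap a b = chart_img a `&` chart_inv a @^-1` chart_dom b.
  apply/seteqP; split=> [_ [q [aq bq] <-]|x [ax bx]].
    by split; [exists q | rewrite /preimage /= chart_K].
  by exists (chart_inv a x); [split=> //; exact: chart_inv_dom | exact: chart_invK].
rewrite openE => x [ax bx]; apply: filterI.
  by apply: open_nbhs_nbhs; split=> //; exact: chart_img_open.
by apply: (chart_inv_at ax); apply: open_nbhs_nbhs; split=> //; exact: chart_open.
Qed.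

Hypothesis MA : smooth_3manifold A.

Lemma transition_smooth a b : A a -> A b -> smooth_map (overlap a b) (transition a b).
Proof. by move=> Aa Ab n k; case: MA => _ _ /(_ a b Aa Ab) [H _] _; exact: ((smooth_Ck _ _).1 (H k) n). Qed.

Lemma chart_change c U V Phi Psi : A c -> diffeo U V Phi Psi -> U `<=` chart_img c ->
  exists b, [/\ A b, chart_dom b `<=` chart_dom c, chart_img b = V &
    forall z, U z -> overlap c b z /\ transition c b z = Phi z].
Proof.
move=> Ac D sU; case: (D) => oU oV Ps Qs PV PK QU QK.
pose dom := chart_dom c `&` chart_map c @^-1` U.
pose bmap q := Phi (chart_map c q).
pose binv u := chart_inv c (Psi u).
have img : bmap @` dom = V.
  apply/seteqP; split=> [_ [q [_ Uq] <-]|u Vu]; first exact: PV.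
  have cu : chart_img c (Psi u) by exact/sU/QU.
  exists (binv u); last by rewrite /bmap /binv chart_invK // QK.
  by split; [exact: chart_inv_dom | rewrite /preimage /= /binv chart_invK //; exact: QU].
have od : open dom.
  rewrite openE => q [cq Uq]; apply: filterI.
    by apply: open_nbhs_nbhs; split=> //; exact: chart_open.
  by apply: (chart_map_at cq); exact: open_nbhs_nbhs.
have oi : open (bmap @` dom) by rewrite img.
have bK : {in dom, cancel bmap binv}.
  by move=> q; rewrite inE => -[cq Uq]; rewrite /binv /bmap PK // chart_K.
have bc : {within dom, continuous bmap}.
  rewrite continuous_open_subspace // => q; rewrite inE => -[cq Uq].
  exact: (cont_comp (chart_map_at cq) (smooth_map_cont Ps Uq)).
have bic : {within bmap @` dom, continuous binv}.
  rewrite continuous_open_subspace // img => u; rewrite inE => Vu.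
  exact: (cont_comp (smooth_map_cont Qs Vu) (chart_inv_at (sU _ (QU _ Vu)))).
pose b := @Chart R M dom bmap binv od oi bK bc bic.
have ovl z : U z -> overlap c b z /\ transition c b z = Phi z.
  move=> Uz; have cz := sU _ Uz; split; last by rewrite /transition /= /bmap chart_invK.
  exists (chart_inv c z); last by rewrite chart_invK.
  split; first exact: chart_inv_dom.
  by split; [exact: chart_inv_dom | rewrite /preimage /= chart_invK].
exists b; split=> //; last by move=> q [].
case: MA => _ _ cmp; apply => a Aa.
split=> k; apply/smooth_Ck => n.
  have sub : overlap a b `<=` overlap a c by move=> _ [q [aq [cq _]] <-]; exists q.
  have tU z : overlap a b z -> U (transition a c z).
    by move=> [q [aq [cq Uq]] <-]; rewrite /transition /= chart_K.
  have -> : (fun x => transition a b x 0 k) = (fun x => Phi (transition a c x) 0 k) by [].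
  have tC j : Ck (overlap a b) n (fun z => transition a c z 0 j).
    exact: Ck_sub sub (transition_smooth Aa Ac n j).
  exact: (@Ck_comp _ _ n (transition a c) _ (fun z => Phi z 0 k) (@overlap_open a b) oU tU tC (Ps n k)).
have tU z : overlap b a z -> overlap c a (Psi z).
  move=> [q [[cq Uq] aq] <-]; rewrite /= /bmap PK //; by exists q.
have -> : (fun x => transition b a x 0 k) = (fun x => transition c a (Psi x) 0 k) by [].
have PC j : Ck (overlap b a) n (fun z => Psi z 0 j).
  by apply: Ck_sub (Qs n j) => _ [q [[cq Uq] aq] <-]; exact: PV.
exact: (@Ck_comp _ _ n Psi _ (fun z => transition c a z 0 k) (@overlap_open b a) (@overlap_open c a) tU PC (transition_smooth Ac Aa n k)).
Qed.

Variables (h : chart R M -> E -> 'M[R]_3) (omega : chart R M -> E -> E) (D : chart R M -> connection R).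
Hypothesis WS : weyl_structure A h omega D.

(** Writing the factor as an exponential makes it positive and turns 2 d ln phi into 2 d psi. The
    set [O] confines the chart while the base point moves, which is what the density statement
    needs. *)
Definition local_form (O : set M) U (h' : E -> 'M[R]_3) (w' : E -> E) : Prop :=
  exists c psi, [/\ A c, chart_dom c `<=` O, chart_img c = U, forall n, Ck U n psi &
    forall x, U x -> h' x = expR (psi x) ^+ 2 *: h c x /\ w' x = omega c x + 2 *: gradient psi x].

Lemma local_form_open O U h' w' : local_form O U h' w' -> open U.
Proof. by case=> c [psi [_ _ <- _ _]]; exact: chart_img_open. Qed.

(** The normalisations below pass through this lemma: it suffices to exhibit the old pair as the
    pull-back of the new one, and the invertible Jacobian cancels. *)
Lemma local_form_change O U h' w' U' V Phi Psi h2 w2 : local_form O U h' w' ->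
  diffeo U' V Phi Psi -> U' `<=` U ->
  (forall z, U' z -> h' z = jac Phi z *m h2 (Phi z) *m (jac Phi z)^T /\
    w' z = w2 (Phi z) *m (jac Phi z)^T) ->
  local_form O V h2 w2.
Proof.
move=> [c [psi [Ac cO cU pC P]]] Df sU H; case: (Df) => oU' oV Ps Qs PV PK QU QK.
have sc : U' `<=` chart_img c by rewrite cU.
have [b [Ab bc bV bt]] := chart_change Ac Df sc.
have pC' n : Ck V n (fun u => psi (Psi u)).
  by apply: (Ck_comp oV oU' QU (Qs n)); exact: Ck_sub (pC n).
exists b, (fun u => psi (Psi u)); split => //; first exact: subset_trans bc cO.
case: WS => -[_ _ hlaw _] [_ wlaw] _ _.
move=> u Vu; have Uz := QU _ Vu; have [ov _] := bt _ Uz; move: (Psi u) (QK _ Vu) Uz ov => z <- Uz ov.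
have Jt : jac (transition c b) z = jac Phi z.
  by apply: (jacobian_eq_on oU' Uz) => y /bt [].
have Ju := diffeo_jacobian_unit Df Uz.
have tz : transition c b z = Phi z by case: (bt _ Uz).
have [h1z w1z] := H _ Uz; have [h3 w3] := P _ (sU _ Uz).
have hl := hlaw _ _ _ Ac Ab ov; have wl := wlaw _ _ _ Ac Ab ov.
rewrite /= Jt tz in hl; rewrite Jt tz in wl.
have JTu : (jac Phi z)^T \in unitmx by rewrite unitmx_tr.
split.
  have : jac Phi z *m h2 (Phi z) *m (jac Phi z)^T = jac Phi z *m (expR (psi z) ^+ 2 *: h b (Phi z)) *m (jac Phi z)^T.
    by rewrite -h1z h3 hl -scalemxAr -scalemxAl.
  by move/(can_inj (mulmxK JTu))/(can_inj (mulKmx Ju)).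
apply: (can_inj (mulmxK JTu)); rewrite -w1z w3 wl mulmxDl; congr (_ + _).
rewrite -scalemxAl; congr (_ *: _); apply/rowP => i; rewrite !mxE.
rewrite (@partial_eq_on _ U' _ (fun y => psi (Psi (Phi y)))) //; last by move=> y Uy; rewrite PK.
rewrite (partial_comp (f := fun u => psi (Psi u)) i oU' oV Uz (PV _ Uz) Ps (pC' 1%N)).
by apply: eq_bigr => l _; rewrite !mxE.
Qed.

Lemma local_form_sub O U h' w' V : local_form O U h' w' -> open V -> V `<=` U -> local_form O V h' w'.
Proof.
move=> L oV sV; apply: (local_form_change L (diffeo_id oV) sV) => z _.
by rewrite jacobian_id trmx1 mul1mx !mulmx1.
Qed.

Lemma local_form_eq O U h' w' h2 w2 : local_form O U h' w' ->
  (forall z, U z -> h' z = h2 z /\ w' z = w2 z) -> local_form O U h2 w2.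
Proof.
move=> L H; apply: (local_form_change L (diffeo_id (local_form_open L)) (@subset_refl _ _)) => z Uz.
by rewrite jacobian_id trmx1 mul1mx !mulmx1; exact: H.
Qed.

Lemma local_form_gauge O U h' w' psi : local_form O U h' w' -> (forall n, Ck U n psi) ->
  local_form O U (fun x => expR (psi x) ^+ 2 *: h' x) (fun x => w' x + 2 *: gradient psi x).
Proof.
move=> L pC; have oU := local_form_open L; case: L => c [psi0 [Ac cO cU pC0 P]].
exists c, (fun x => psi0 x + psi x); split; [exact: Ac | exact: cO | exact: cU | by move=> n; exact: Ck_add | move=> x Ux].
have [-> ->] := P _ Ux; split; first by rewrite scalerA expRD exprMn mulrC.
rewrite -addrA -scalerDr; congr (_ + _ *: _); apply/rowP => i; rewrite !mxE.
symmetry; apply: is_derive_partial; apply: isdD; [exact: Ck_is_derive (pC0 1%N) Ux | exact: Ck_is_derive (pC 1%N) Ux].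
Qed.

End Charts.

(** * Weyl structures under rescaling and in local forms *)

Section LocalGeometry.
Variables (R : realType) (M : topologicalType) (A : set (chart R M)).
Local Notation E := 'rV[R]_3.
Implicit Types (a b c : chart R M) (x z u : E) (U V : set E).
Local Opaque partial.

(** The connection stays the same: differentiating the factor contributes 2 d psi times the metric,
    which is the change of omega. *)
Lemma weyl_on_gauge U (h : E -> 'M[R]_3) w G psi n : weyl_on U h w G n -> (forall m, Ck U m psi) ->
  weyl_on U (fun x => expR (psi x) ^+ 2 *: h x) (fun x => w x + 2 *: gradient psi x) G n.
Proof.
move=> W pC; have oU := weyl_open W.
have e0 x : expR (psi x) ^+ 2 != 0 :> R by rewrite expf_neq0 // gt_eqF // expR_gt0.
have sC m : Ck U m (fun x => expR (psi x) ^+ 2) by apply: Ck_pow => //; exact: Ck_exp.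
split.
- exact: oU.
- by move=> x Ux; rewrite linearZ /= (weyl_sym W Ux).
- by move=> x Ux; rewrite unitmxZ ?unitfE // (weyl_unit W Ux).
- move=> i j; apply: (Ck_eq (f := fun x => expR (psi x) ^+ 2 * h x i j) oU) => [z _|]; first by rewrite mxE.
  by apply: (Ck_mul oU (sC _)); exact: weyl_hC W i j.
- move=> i; apply: (Ck_eq (f := fun x => w x 0 i + 2 * partial i psi x) oU) => [z _|]; first by rewrite !mxE.
  apply: (Ck_add oU); first exact: weyl_wC W i.
  by apply: (Ck_mul oU (Ck_cst _ _ oU)); exact: Ck_partial (pC _).
- exact: (weyl_tf W).
move=> x Ux i j k; have Wc := weyl_compat W Ux i j k.
have dp : is_derive x (delta_mx 0 i) psi (partial i psi x) by exact: Ck_is_derive (pC 1%N) Ux.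
have dh : is_derive x (delta_mx 0 i) (fun z => h z j k) (partial i (fun z => h z j k) x).
  exact: Ck_is_derive (weyl_hC W j k) Ux.
have ds : is_derive x (delta_mx 0 i) (fun z => expR (psi z) ^+ 2) (2 * partial i psi x * expR (psi x) ^+ 2).
  have de : is_derive x (delta_mx 0 i) (fun z => expR (psi z)) (expR (psi x) * partial i psi x).
    by apply/is_derive_line; apply: isd_comp; [rewrite upd_id; exact: is_derive_expR | exact/is_derive_line].
  by apply: (isd_eq (isdXn 1 de)); rewrite expr1; ring.
have -> : partial i (fun z => (expR (psi z) ^+ 2 *: h z) j k) x =
   2 * partial i psi x * expR (psi x) ^+ 2 * h x j k + expR (psi x) ^+ 2 * partial i (fun z => h z j k) x.
  apply: is_derive_partial; apply: (is_derive_eq_on (f := fun z => expR (psi z) ^+ 2 * h z j k) oU Ux); last exact: isdM.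
  by move=> z _; rewrite mxE.
under eq_bigr => l _ do rewrite mxE; under [X in _ - _ - X]eq_bigr => l _ do rewrite mxE.
rewrite !mxE; move: Wc; rewrite !sum3E.
move=> Wc; rewrite [RHS]mulrDl [X in _ = X + _]mulrCA -Wc {Wc}.
by move: (partial _ _ x) (partial _ _ x) (expR _) => d p e; ring.
Qed.

Variables (h : chart R M -> E -> 'M[R]_3) (omega : chart R M -> E -> E) (D : chart R M -> connection R).
Hypotheses (MA : smooth_3manifold A) (WS : weyl_structure A h omega D).
Hypotheses (EW : einstein_weyl A h omega) (W0 : vanishing_scalar_curvature A h omega).

Lemma lorentzian_neq0 i : sig_lorentzian 0 i != 0 :> R.
Proof. by rewrite mxE; case: ifP => _; rewrite ?oppr_eq0 oner_neq0. Qed.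

Lemma lorentzian_det (H : 'M[R]_3) : has_signature sig_lorentzian H -> \det H < 0.
Proof.
move=> [P [Pu PH]]; have := f_equal determinant PH.
rewrite !det_mulmx det_tr det_diag (big_ord_recr) big_ord_recr big_ord_recr big_ord0 /= !mxE /= => E.
have P0 : 0 < \det P * \det P by rewrite -expr2 exprn_even_gt0 //= -unitfE -unitmxE.
rewrite -(pmulr_rlt0 _ P0); move: E; rewrite mulrAC => ->.
by rewrite !mul1r ltrN10.
Qed.

Lemma chart_weyl a n : A a -> weyl_on (chart_img a) (h a) (omega a) (D a) n.
Proof.
move=> Aa; case: WS => -[hs hC _ sg] [wC _] tf cp; split.
- exact: chart_img_open.
- by move=> x; exact: hs.
- move=> x ax; case: sg => /(_ a x Aa ax); apply: signature_unit => i; last exact: lorentzian_neq0.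
  by rewrite mxE oner_neq0.
- by move=> i j; exact: ((smooth_Ck _ _).1 (hC a i j Aa)).
- by move=> i; exact: ((smooth_Ck _ _).1 (wC a i Aa)).
- by move=> x ax k i j; exact: tf.
- by move=> x; exact: cp.
Qed.

Lemma chart_ricci a : A a -> ricci_sym0 (chart_img a) (D a).
Proof.
move=> Aa x i j ax; have W := chart_weyl 0 Aa.
rewrite -!(weyl_ricciE W) //; apply: (ricci_sym0_at _ (weyl_sym W ax) (weyl_unit W ax)).1.
by split; [exact: EW | exact: W0].
Qed.

Hypothesis sL : metric_of_signature A sig_lorentzian h.

(** D in the chart that carries the local form serves as the connection, being unaffected by the
    rescaling. *)
Lemma local_form_weyl O U h' w' : local_form A h omega O U h' w' ->
  exists G, [/\ forall n, weyl_on U h' w' G n, ricci_sym0 U G & forall x, U x -> \det (h' x) < 0].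
Proof.
move=> [c [psi [Ac cO cU pC P]]]; exists (D c); have oU : open U by rewrite -cU; exact: chart_img_open.
split.
- move=> n; have W := chart_weyl n Ac; rewrite cU in W.
  have [_ gs gu gh gw gt gc] := weyl_on_gauge W pC.
  split; first exact: oU.
  + by move=> x Ux; case: (P _ Ux) => -> _; exact: gs.
  + by move=> x Ux; case: (P _ Ux) => -> _; exact: gu.
  + by move=> i j; apply: Ck_eq oU _ (gh i j) => z Uz; case: (P _ Uz) => ->.
  + by move=> i; apply: Ck_eq oU _ (gw i) => z Uz; case: (P _ Uz) => _ ->.
  + by move=> x Ux; exact: gt.
  move=> x Ux i j k; rewrite (proj1 (P _ Ux)) (proj2 (P _ Ux)) -(gc x Ux i j k).
  by congr (_ - _ - _); apply: (partial_eq_on i oU Ux) => z Uz; case: (P _ Uz) => ->.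
- by rewrite -cU; exact: chart_ricci.
move=> x Ux; case: (P _ Ux) => -> _; rewrite detZ.
by rewrite pmulr_rlt0 ?exprn_gt0 ?expR_gt0 //; apply: lorentzian_det; apply: sL => //; rewrite cU.
Qed.

End LocalGeometry.

(** * The null foliation *)

Section Foliations.
Context {R : realType}.
Local Notation E := 'rV[R]_3.
Implicit Types (U V W : set E) (x z p u : E) (i j k l m : 'I_3) (f g psi : E -> R).
Local Opaque partial upd.

Lemma partial_upd_comp U V f Psi g i k z : diffeo U V (fun z => upd z k (f z)) Psi -> U z ->
  (forall n, Ck U n f) -> Ck V 1 g ->
  partial i (fun z => g (upd z k (f z))) z =
  (if i == k then 0 else partial i g (upd z k (f z))) + partial k g (upd z k (f z)) * partial i f z.
Proof.
move=> [oU oV Ps Qs PV PK QU QK] Uz fC gC.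
rewrite (partial_comp i oU oV Uz (PV _ Uz) Ps gC) (bigD1 k) //= addrC; congr (_ + _ * _); last first.
  by apply: (partial_eq_on i oU Uz) => y _; rewrite upd_same.
have e l : l != k -> partial i (fun z => upd z k (f z) 0 l) z = (i == l)%:R.
  by move=> lk; rewrite -(partial_coord z); apply: (partial_eq_on i oU Uz) => y _; rewrite upd_other.
have [ik|ik] := eqVneq i k.
  by rewrite big1 // => l lk; rewrite e // ik eq_sym (negbTE lk) mulr0.
rewrite (bigD1 i) //= e // eqxx mulr1 big1 ?addr0 // => l /andP[lk li].
by rewrite e // eq_sym (negbTE li) mulr0.
Qed.

(** The Poincare lemma in two of the three variables: integrate [ai] along i, then the defect a_j -
    d_j F along j. By closedness the defect does not depend on x_i, so the correction leaves the
    derivative along i alone. *)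
Lemma closed_primitive p (r : R) i j (ai aj : E -> R) : 0 < r -> i != j ->
  (forall n, Ck (cube p r) n ai) -> (forall n, Ck (cube p r) n aj) ->
  (forall z, cube p r z -> partial i aj z = partial j ai z) ->
  exists (r' : R) psi, [/\ 0 < r', r' <= r, forall n, Ck (cube p r') n psi &
    forall z, cube p r' z -> partial i psi z = ai z /\ partial j psi z = aj z].
Proof.
move=> r0 ij iC jC H.
have [r1 r10 r1r] : exists2 r1 : R, 0 < r1 & r1 < r by exists (r / 2); lra.
have [r2 r20 r2r] : exists2 r2 : R, 0 < r2 & r2 < r1 by exists (r1 / 2); lra.
have [F HF] := exists_primitive i r10 r1r (fun x cx => Ck_cont (iC 0%N) cx).
have s1 : cube p r1 `<=` cube p r by apply: cube_sub; exact: ltW.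
have s2 : cube p r2 `<=` cube p r1 by apply: cube_sub; exact: ltW.
have FC n : Ck (cube p r1) n F by apply: primitive_Ck HF _; exact: Ck_sub s1 (iC n).
have o1 := @cube_open R p r1; have o2 := @cube_open R p r2.
have gC n : Ck (cube p r1) n (fun z => aj z - partial j F z).
  by apply: (Ck_sub2 o1 (Ck_sub s1 (jC n))); exact: Ck_partial (FC n.+1).
have [G HG] := exists_primitive j r20 r2r (fun x cx => Ck_cont (gC 0%N) cx).
have GC n : Ck (cube p r2) n G by apply: primitive_Ck HG _; exact: Ck_sub s2 (gC n).
have HF2 := primitive_sub (ltW r2r) HF.
have [J HJ] := exists_primitive i r10 r1r (fun x cx => Ck_cont (Ck_partial j (iC 1%N)) cx).
have dF z : cube p r2 z -> partial i F z = ai z by move=> cz; apply: is_derive_partial; exact: HF2.2.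
have dG z : cube p r2 z -> partial j G z = aj z - partial j F z by move=> cz; apply: is_derive_partial; exact: HG.2.
have g0 z : cube p r1 z -> partial i (fun z => aj z - partial j F z) z = 0.
  move=> cz; rewrite (is_derive_partial (isdB (Ck_is_derive i (jC 1%N) (s1 _ cz)) (Ck_is_derive i (Ck_partial j (FC 2%N)) cz))).
  rewrite (Schwarz i j o1 cz (FC 2%N)) H; last exact: s1.
  rewrite (@partial_eq_on _ _ (partial i F) ai j z o1 cz) ?subrr // => y cy.
  by apply: is_derive_partial; exact: HF.2.
have dG0 z : cube p r2 z -> partial i G z = 0.
  move=> cz; apply: is_derive_partial.
  have zC n : Ck (cube p r2) n (fun _ : E => 0 : R) by exact: Ck_cst.
  have Z0 : is_primitive p r2 j (fun _ => 0) (fun _ => 0).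
    by split=> // x cx; exact: isdC.
  apply: (primitive_der _ HG Z0 _ _ cz); first by rewrite eq_sym.
    by move=> y cy; rewrite -(g0 y (s2 _ cy)); exact: Ck_is_derive (gC 1%N) (s2 _ cy).
  by move=> y cy; exact: Ck_cont (zC 0%N) cy.
exists r2, (fun z => F z + G z); split=> //.
- by apply: le_trans (ltW r2r) _; exact: ltW.
- by move=> n; apply: (Ck_add o2 (Ck_sub s2 (FC n)) (GC n)).
move=> z cz; have FZ a := Ck_is_derive a (FC 1%N) (s2 _ cz); have GZ a := Ck_is_derive a (GC 1%N) cz.
rewrite (is_derive_partial (isdD (FZ i) (GZ i))) (is_derive_partial (isdD (FZ j) (GZ j))).
by rewrite dF // dG0 // dG // addr0 addrC subrK.
Qed.

Variables (U : set E) (l m k : 'I_3) (gl gm : E -> R).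
Hypotheses (oU : open U) (lm : l != m) (lk : l != k) (mk : m != k).
Hypotheses (lC : forall n, Ck U n gl) (mC : forall n, Ck U n gm).
Hypothesis frobenius : forall z, U z ->
  partial l gm z + gl z * partial k gm z = partial m gl z + gm z * partial k gl z.

(** The bracket of two fields d_l + gl d_k and d_m + gm d_k has only a d_k component, and
    [frobenius] says that it vanishes. *)
Lemma commutator V f z : open V -> V `<=` U -> V z -> Ck V 2 f ->
  let Xl f z := partial l f z + gl z * partial k f z in
  let Xm f z := partial m f z + gm z * partial k f z in
  Xl (Xm f) z = Xm (Xl f) z.
Proof.
move=> oV VU Vz fC Xl Xm; rewrite /Xl /Xm; have Uz := VU _ Vz.
have d a b : is_derive z (delta_mx 0 a) (partial b f) (partial a (partial b f) z).
  exact: Ck_is_derive (Ck_partial b fC) Vz.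
have dl a := Ck_is_derive a (lC 1%N) Uz; have dm a := Ck_is_derive a (mC 1%N) Uz.
have E1 a : partial a (fun z => partial m f z + gm z * partial k f z) z =
   partial a (partial m f) z + (partial a gm z * partial k f z + gm z * partial a (partial k f) z).
  by apply: is_derive_partial; exact: (isdD (d a m) (isdM (dm a) (d a k))).
have E2 a : partial a (fun z => partial l f z + gl z * partial k f z) z =
   partial a (partial l f) z + (partial a gl z * partial k f z + gl z * partial a (partial k f) z).
  by apply: is_derive_partial; exact: (isdD (d a l) (isdM (dl a) (d a k))).
have alg (a b c d' q1 q2 q3 q4 q5 u v : R) : a + u * b = c + v * d' ->
    q1 + (a * q2 + v * q3) + u * (q4 + (b * q2 + v * q5)) = q1 + (c * q2 + u * q4) + v * (q3 + (d' * q2 + u * q5)).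
  by move=> H; have -> : a = c + v * d' - u * b; [rewrite -H; ring | ring].
rewrite !E1 !E2 (Schwarz m l oV Vz fC) (Schwarz m k oV Vz fC) (Schwarz l k oV Vz fC).
exact: (alg _ _ _ _ _ _ _ _ _ _ _ (frobenius Uz)).
Qed.

(* [upd z k (t z)] straightens the leaves to [x_k = cst]: there the two fields become coordinate fields. *)
Lemma foliation p : U p -> exists V t, [/\ open V /\ V p, V `<=` U, forall n, Ck V n t &
  forall z, V z -> [/\ partial l t z + gl z * partial k t z = 0,
    partial m t z + gm z * partial k t z = 0 & partial k t z != 0]].
Proof.
move=> Up; have [V0 [f [[oV0 V0p] V0U fC fE _]]] := flow_box lk oU Up lC.
have fk0 z : V0 z -> partial k f z != 0 by case/fE.
have fl0 z : V0 z -> partial l f z + gl z * partial k f z = 0 by case/fE.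
have [U1 [V1 [Psi [U1V U1p D]]]] := diffeo_replace oV0 V0p fC (fk0 _ V0p).
case: (D) => oU1 oV1 Ps Qs PV PK QU QK.
(* [f] is a first integral of the l-field, and [commutator] makes [c] another one. With x_k replaced
   by [f] the m-field becomes d_m + g d_k with [g] independent of x_l, so the second flow box gives
   a [q] that is independent of x_l as well. *)
pose c z := partial m f z + gm z * partial k f z.
have cC n : Ck V0 n c.
  apply: (Ck_add oV0); first exact: Ck_partial (fC _).
  by apply: (Ck_mul oV0); [exact: Ck_sub V0U (mC n) | exact: Ck_partial (fC _)].
pose g u := c (Psi u).
have f1 n : Ck U1 n f by exact: Ck_sub U1V (fC n).
have gC n : Ck V1 n g by apply: (Ck_comp oV1 oU1 QU (Qs n)); exact: Ck_sub U1V (cC n).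
have Xl (q : E -> R) z : Ck V1 1 q -> U1 z ->
    partial l (fun z => q (upd z k (f z))) z + gl z * partial k (fun z => q (upd z k (f z))) z
    = partial l q (upd z k (f z)).
  move=> qC Uz; rewrite !(partial_upd_comp _ D Uz f1 qC) (negbTE lk) eqxx.
  have E : partial l f z = - (gl z * partial k f z) by apply/eqP; rewrite -addr_eq0 fl0 //; exact: U1V.
  by rewrite E; move: (partial k f z) (partial l q _) (partial k q _) => *; ring.
have gl0 u : V1 u -> partial l g u = 0.
  move=> Vu; rewrite -(QK u Vu) -Xl //; last exact: QU.
  have Uz := QU _ Vu; have V0z := U1V _ Uz.
  rewrite !(@partial_eq_on _ U1 (fun z => g (upd z k (f z))) c) //; last first.
  - by move=> z' Uz'; rewrite /g PK.
  - by move=> z' Uz'; rewrite /g PK.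
  rewrite (commutator oV0 V0U V0z (fC 2%N)).
  rewrite !(@partial_eq_on _ V0 (fun z => partial l f z + gl z * partial k f z) (fun _ => 0)) //.
  by rewrite (is_derive_partial (isdC _ _ _)) (is_derive_partial (isdC _ _ _)) mulr0 addr0.
have [V2 [q [[oV2 V2p] V2V qC qE ql0]]] := flow_box mk oV1 (PV _ U1p) gC.
have sU : U1 `&` (fun z => upd z k (f z)) @^-1` V2 `<=` U1 by move=> z [].
exists (U1 `&` (fun z => upd z k (f z)) @^-1` V2), (fun z => q (upd z k (f z))).
have oW : open (U1 `&` (fun z => upd z k (f z)) @^-1` V2) by exact: open_preimage.
split=> [||n|z [Uz Vz]].
- by [].
- by move=> z [Uz _]; exact/V0U/U1V.
- by apply: (Ck_comp oW oV2 _ (fun a => Ck_sub sU (Ps n a)) (qC n)) => z [].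
have D' := diffeo_sym (diffeo_sub (diffeo_sym D) oV2 V2V).
have Uz' : (U1 `&` (fun z => upd z k (f z)) @^-1` V2) z by [].
have f2 n : Ck (U1 `&` (fun z => upd z k (f z)) @^-1` V2) n f by exact: Ck_sub sU (f1 n).
rewrite !(partial_upd_comp _ D' Uz' f2 (qC 1%N)) (negbTE lk) (negbTE mk) eqxx add0r.
have [qm qk] := qE _ Vz; have ql := ql0 l lm lk gl0 _ Vz.
have Fk := fk0 _ (U1V _ Uz); have Fl := fl0 _ (U1V _ Uz).
split; last by rewrite mulf_neq0.
  by rewrite ql add0r mulrCA -mulrDr Fl mulr0.
rewrite mulrCA -addrA -mulrDr -[RHS]qm; congr (_ + _).
by rewrite mulrC; congr (_ * _); rewrite /g PK.
Qed.

(** With x_k replaced by [t] the two fields become coordinate derivatives, and the hypothesis is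
    closedness in the sense of [closed_primitive]. *)
Lemma foliated_primitive p t (al am : E -> R) : U p -> (forall n, Ck U n t) ->
  (forall z, U z -> [/\ partial l t z + gl z * partial k t z = 0,
    partial m t z + gm z * partial k t z = 0 & partial k t z != 0]) ->
  (forall n, Ck U n al) -> (forall n, Ck U n am) ->
  (forall z, U z -> partial l am z + gl z * partial k am z = partial m al z + gm z * partial k al z) ->
  exists V psi, [/\ open V /\ V p, V `<=` U, forall n, Ck V n psi &
    forall z, V z -> partial l psi z + gl z * partial k psi z = al z /\
      partial m psi z + gm z * partial k psi z = am z].
Proof.
move=> Up tC tE alC amC H; have [_ _ tk] := tE _ Up.
have [U1 [V1 [Psi [U1U U1p D]]]] := diffeo_replace oU Up tC tk.
case: (D) => oU1 oV1 Ps Qs PV PK QU QK.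
have t1 n : Ck U1 n t by exact: Ck_sub U1U (tC n).
have Xg (g q : E -> R) a z : a != k -> U1 z -> partial a t z + g z * partial k t z = 0 -> Ck V1 1 q ->
    partial a (fun z => q (upd z k (t z))) z + g z * partial k (fun z => q (upd z k (t z))) z
    = partial a q (upd z k (t z)).
  move=> ak Uz E qC; rewrite !(partial_upd_comp _ D Uz t1 qC) (negbTE ak) eqxx add0r mulrCA -addrA -mulrDr E.
  by rewrite mulr0 addr0.
have C' (f : E -> R) : (forall n, Ck U n f) -> forall n, Ck V1 n (fun u => f (Psi u)).
  by move=> fC n; apply: (Ck_comp oV1 oU1 QU (Qs n)); exact: Ck_sub U1U (fC n).
have cl u : V1 u -> partial l (fun u => am (Psi u)) u = partial m (fun u => al (Psi u)) u.
  move=> Vu; have Uz := QU _ Vu; have [El Em _] := tE _ (U1U _ Uz).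
  rewrite -(QK u Vu) -(Xg gl _ _ _ lk Uz El (C' _ amC 1%N)) -(Xg gm _ _ _ mk Uz Em (C' _ alC 1%N)).
  rewrite !(@partial_eq_on _ U1 (fun z => am (Psi (upd z k (t z)))) am) //; try by move=> z' Uz'; rewrite PK.
  rewrite !(@partial_eq_on _ U1 (fun z => al (Psi (upd z k (t z)))) al) //; try by move=> z' Uz'; rewrite PK.
  exact: H (U1U _ Uz).
have [r r0 rV] := open_cube oV1 (PV _ U1p).
have [r' [q [r'0 r'r qC qE]]] := closed_primitive r0 lm (fun n => Ck_sub rV (C' _ alC n))
  (fun n => Ck_sub rV (C' _ amC n)) (fun z cz => cl z (rV _ cz)).
have V2V : cube (upd p k (t p)) r' `<=` V1 by apply: subset_trans rV; exact: cube_sub.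
have oV2 := @cube_open R (upd p k (t p)) r'.
have D' := diffeo_sym (diffeo_sub (diffeo_sym D) oV2 V2V).
set W := U1 `&` _ in D'; have WU : W `<=` U1 by move=> z [].
exists W, (fun z => q (upd z k (t z))); split.
- by split; [exact: diffeo_open D' | split=> //; exact: cube_center].
- exact: subset_trans WU U1U.
- move=> n; apply: (Ck_comp (diffeo_open D') oV2 _ (diffeo_smooth D' n) (qC n)) => z [_ //].
move=> z Wz; have Uz := WU _ Wz; have [El Em _] := tE _ (U1U _ Uz).
have t2 n : Ck W n t by exact: Ck_sub WU (t1 n).
have [ql qm] := qE _ Wz.2.
rewrite !(partial_upd_comp _ D' Wz t2 (qC 1%N)) (negbTE lk) (negbTE mk) eqxx add0r.
split; rewrite mulrCA -addrA -mulrDr ?El ?Em mulr0 addr0 ?ql ?qm PK //.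
Qed.
End Foliations.

(** * Coordinates adapted to the null foliation *)

Section NullCoordinates.
Context {R : realType}.
Local Notation E := 'rV[R]_3.
Implicit Types (U V W : set E) (x z p u : E) (i j k l m : 'I_3) (f g psi : E -> R).
Local Opaque partial upd.

Lemma open_neq0 U f : open U -> Ck U 0 f -> open (U `&` [set z | f z != 0]).
Proof.
move=> oU fC; rewrite openE => x [Ux fx]; apply: filterI; first exact: open_nbhs_nbhs.
have nb : nbhs (f x) [set y | y != 0] by apply: open_nbhs_nbhs; split; [exact: open_neq | exact: fx].
exact: (Ck_cont fC Ux nb).
Qed.

Lemma sum3_succ (F : 'I_3 -> R) k : \sum_i F i = F k + F (succ3 k) + F (prev3 k).
Proof. by rewrite sum3E; elim/ord3_ind: k; rewrite /succ3 /prev3 /=; ring. Qed.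

Lemma succ3_ind (P : 'I_3 -> Prop) k : P k -> P (succ3 k) -> P (prev3 k) -> forall i, P i.
Proof. by elim/ord3_ind: k; rewrite /succ3 /prev3 /= => *; exact: ord3_ind. Qed.

Lemma succ3_neq k : [/\ succ3 k != k, prev3 k != k, succ3 k != prev3 k,
  succ3 (succ3 k) = prev3 k /\ succ3 (prev3 k) = k & prev3 (succ3 k) = k /\ prev3 (prev3 k) = succ3 k].
Proof. by elim/ord3_ind: k; split. Qed.

(** The fields d_i - (L_i / L_k) d_k span ker L; in terms of these slopes dL = theta /\ L becomes
    the hypothesis [frobenius]. *)
Lemma quotient_slope_algebra (Ll Lm Lk tl tm tk dlm dml dlk dkl dmk dkm dkk : R) : Lk != 0 ->
  dlm - dml = tl * Lm - tm * Ll -> dlk - dkl = tl * Lk - tk * Ll -> dmk - dkm = tm * Lk - tk * Lm ->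
  - (dlm * Lk - Lm * dlk) / Lk ^+ 2 + (- Ll / Lk) * (- (dkm * Lk - Lm * dkk) / Lk ^+ 2)
  = - (dml * Lk - Ll * dmk) / Lk ^+ 2 + (- Lm / Lk) * (- (dkl * Lk - Ll * dkk) / Lk ^+ 2).
Proof.
move=> k0 /eqP; rewrite subr_eq => /eqP -> /eqP; rewrite subr_eq => /eqP -> /eqP; rewrite subr_eq => /eqP ->.
by field.
Qed.

Lemma isd_exp f x i (d : R) : is_derive x (delta_mx 0 i) f d ->
  is_derive x (delta_mx 0 i) (fun z => expR (f z)) (expR (f x) * d).
Proof.
move=> fd; apply/is_derive_line; apply: isd_comp; last exact/is_derive_line.
by rewrite upd_id; exact: is_derive_expR.
Qed.

Lemma isd_ln f x i (d : R) : 0 < f x -> is_derive x (delta_mx 0 i) f d ->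
  is_derive x (delta_mx 0 i) (fun z => ln (f z)) ((f x)^-1 * d).
Proof.
move=> f0 fd; apply/is_derive_line; apply: isd_comp; last exact/is_derive_line.
by rewrite upd_id; exact: is_derive1_ln.
Qed.

Lemma isd_quotient f g x i (a b : R) : is_derive x (delta_mx 0 i) f a -> is_derive x (delta_mx 0 i) g b ->
  g x != 0 -> is_derive x (delta_mx 0 i) (fun z => - f z / g z) (- (a * g x - f x * b) / g x ^+ 2).
Proof.
move=> fa gb g0.
have gi : is_derive x (delta_mx 0 i) (fun z => (g z)^-1) (- ((g x)^-1 * (g x)^-1) * b).
  by apply/is_derive_line; apply: isd_comp; [rewrite upd_id; exact: isd_inv | exact/is_derive_line].
by apply: (isd_eq (isdM (isdN fa) gi)); move: (f x) (g x) g0 => u w w0; field.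
Qed.

(** t is constant on the leaves of ker L, so L is a multiple of dt. A primitive psi of omega along
    the leaves exists, and omega - d psi, which vanishes on the leaves, is a multiple of dt as
    well. *)
Lemma null_coordinates U (h : E -> 'M[R]_3) (omega : E -> E) (G : connection R) p :
  (forall n, weyl_on U h omega G n) -> ricci_sym0 U G -> U p -> (exists m, form_kernel omega m p != 0) ->
  exists V (t psi y mu : E -> R), [/\ open V /\ V p, V `<=` U,
    [/\ forall n, Ck V n t, forall n, Ck V n psi & forall n, Ck V n y],
    forall z i, V z -> omega z 0 i = partial i psi z + y z * partial i t z &
    forall z i, V z -> null_form h omega i z = mu z * partial i t z].
Proof.
move=> W Ric Up [m0 n0]; have oU := weyl_open (W 0%N).
set L := null_form h omega.
have LC n i := null_formC W n i.
(* L = h n is nonzero because h is invertible. *)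
have [k Lk] : exists k, L k p != 0.
  apply: contrapT => H; move/negP: n0; apply; apply/eqP.
  have L0 k : L k p = 0 by apply/eqP/negPn/negP => Lk; apply: H; exists k.
  have -> : form_kernel omega m0 p = \sum_a invmx (h p) m0 a * L a p.
    under eq_bigr do rewrite mulr_sumr.
    rewrite exchange_big /= (eq_bigr (fun m => (m0 == m)%:R * form_kernel omega m p)); last first.
      by move=> m _; rewrite -(weyl_inv (W 0%N) m0 m Up) mulr_suml; apply: eq_bigr => a _; rewrite mulrA.
    by rewrite (bigD1 m0) //= eqxx mul1r big1 ?addr0 // => m mk; rewrite eq_sym (negbTE mk) mul0r.
  by rewrite big1 // => a _; rewrite L0 mulr0.
have [lk mk lm [sl sm] [pl pm]] := succ3_neq k.
set l := succ3 k in lk lm sl pl; set m := prev3 k in mk lm sm pm.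
pose U1 := U `&` [set z | L k z != 0].
have oU1 : open U1 by apply: open_neq0 => //; exact: LC.
have sU : U1 `<=` U by move=> z [].
have Lk0 z : U1 z -> L k z != 0 by case.
pose g i z := - L i z / L k z.
have gC i n : Ck U1 n (g i).
  apply: (Ck_div oU1 Lk0); last exact: Ck_sub sU (LC n k).
  by apply: (Ck_opp oU1); exact: Ck_sub sU (LC n i).
have dL i a z : U1 z -> is_derive z (delta_mx 0 a) (L i) (partial a (L i) z).
  by move=> Uz; exact: Ck_is_derive (LC 1%N i) (sU _ Uz).
have dg i a z : U1 z -> partial a (g i) z = - (partial a (L i) z * L k z - L i z * partial a (L k) z) / L k z ^+ 2.
  by move=> Uz; apply: is_derive_partial; apply: isd_quotient; [exact: dL | exact: dL | exact: Lk0].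
have closed a b z : U1 z -> partial a (L b) z - partial b (L a) z = theta omega G a z * L b z - theta omega G b z * L a z.
  by move=> Uz; exact: (null_form_closed W Ric a b (sU _ Uz)).
have frob z : U1 z -> partial l (g m) z + g l z * partial k (g m) z = partial m (g l) z + g m z * partial k (g l) z.
  move=> Uz; rewrite !dg // /g.
  exact: (quotient_slope_algebra _ (Lk0 _ Uz) (closed l m z Uz) (closed l k z Uz) (closed m k z Uz)).
have Up1 : U1 p by [].
have [V1 [t [[oV1 V1p] V1U tC tE]]] := foliation oU1 lm lk mk (gC l) (gC m) frob Up1.
have sV : V1 `<=` U by exact: subset_trans V1U sU.
have gC1 i n : Ck V1 n (g i) by exact: Ck_sub V1U (gC i n).
have wC i n : Ck V1 n (fun z => omega z 0 i) by exact: Ck_sub sV (Ck_pred (weyl_wC (W n) i)).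
pose al i z := omega z 0 i + g i z * omega z 0 k.
have alC i n : Ck V1 n (al i) by apply: (Ck_add oV1 (wC i n)); exact: (Ck_mul oV1 (gC1 i n) (wC k n)).
have dw i a z : V1 z -> is_derive z (delta_mx 0 a) (fun z => omega z 0 i) (partial a (fun z => omega z 0 i) z).
  by move=> Vz; exact: Ck_is_derive (wC i 1%N) Vz.
have dal i a z : V1 z -> partial a (al i) z = partial a (fun z => omega z 0 i) z +
    (partial a (g i) z * omega z 0 k + g i z * partial a (fun z => omega z 0 k) z).
  move=> Vz; apply: is_derive_partial; apply: isdD (dw i a z Vz) _; apply: isdM (dw k a z Vz).
  exact: Ck_is_derive (gC1 i 1%N) Vz.
have F z i j : two_form omega i j z = partial i (fun z => omega z 0 j) z - partial j (fun z => omega z 0 i) z by [].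
have Lg i z : V1 z -> L i z = - g i z * L k z.
  by move=> Vz; rewrite /g !mulNr opprK divfK; [by [] | exact: Lk0 (V1U _ Vz)].
(* Closedness of omega along the leaves: up to the factor L_k this is the equation n^p L_p = 0. *)
have alE z : V1 z -> partial l (al m) z + g l z * partial k (al m) z = partial m (al l) z + g m z * partial k (al l) z.
  move=> Vz; rewrite !dal //; have fr := frob _ (V1U _ Vz).
  have := null_form_null W Ric (sV _ Vz); rewrite (sum3_succ _ k) /form_kernel -/l -/m sl sm pl pm !F -/L.
  rewrite (Lg m z Vz) (Lg l z Vz); have := Lk0 _ (V1U _ Vz).
  have alg (q a1 a2 b1 b2 c1 c2 u v w x1 x2 x3 x4 s : R) : q != 0 ->
     x1 + u * x2 = x3 + v * x4 ->
     (a1 - a2) * q + (b1 - b2) * (- u * q) + (c1 - c2) * (- v * q) = 0 ->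
     a1 + (x1 * w + v * c2) + u * (b2 + (x2 * w + v * s)) = a2 + (x3 * w + u * b1) + v * (c1 + (x4 * w + u * s)).
    move=> q0 H H2; apply/eqP; rewrite -subr_eq0; apply/eqP; apply: (mulfI q0); rewrite mulr0 -[RHS]H2.
    have -> : x1 = x3 + v * x4 - u * x2 by rewrite -H; ring.
    by ring.
  by move=> q0; exact: alg q0 fr.
have [V2 [psi [[oV2 V2p] V2V pC pE]]] := foliated_primitive oV1 lm lk mk V1p tC tE (alC l) (alC m) alE.
have tk z : V2 z -> partial k t z != 0 by move=> Vz; case: (tE _ (V2V _ Vz)).
exists V2, t, psi, (fun z => (omega z 0 k - partial k psi z) / partial k t z), (fun z => L k z / partial k t z).
split=> //.
- exact: subset_trans V2V sV.
- split=> // n; first exact: Ck_sub V2V (tC n).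
  apply: (Ck_div oV2 tk); last exact: Ck_partial (Ck_sub V2V (tC _)).
  by apply: (Ck_sub2 oV2); [exact: Ck_sub V2V (wC k n) | exact: Ck_partial (pC _)].
- move=> z i Vz; have [tl tm tk0] := tE _ (V2V _ Vz); have [pl' pm'] := pE _ Vz.
  have side j : partial j t z + g j z * partial k t z = 0 -> partial j psi z + g j z * partial k psi z = al j z ->
    omega z 0 j = partial j psi z + (omega z 0 k - partial k psi z) / partial k t z * partial j t z.
    move=> /eqP; rewrite addr_eq0 => /eqP ->; rewrite /al.
    move: tk0; move: (partial k t z) (partial k psi z) (partial j psi z) (omega z 0 k) (omega z 0 j) => a b c d e a0 H.
    have -> : e = c + g j z * b - g j z * d by rewrite H; ring.
    by field.
  move: i; apply: (succ3_ind (k := k)); [|exact: side|exact: side].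
  by rewrite divfK // addrC subrK.
- move=> z i Vz; have [tl tm tk0] := tE _ (V2V _ Vz).
  have side j : partial j t z + g j z * partial k t z = 0 -> L j z = L k z / partial k t z * partial j t z.
    move=> /eqP; rewrite addr_eq0 => /eqP ->; rewrite (Lg j z (V2V _ Vz)).
    by rewrite mulrN mulrCA divfK // mulNr.
  move: i; apply: (succ3_ind (k := k)); [|exact: side|exact: side].
  by rewrite divfK.
Qed.
End NullCoordinates.

(** * The gauge omega = y dt *)

Section FirstForm.
Context {R : realType}.
Local Notation E := 'rV[R]_3.
Implicit Types (U V W : set E) (x z p u : E) (i j k l m : 'I_3).
Local Opaque partial upd.

Definition mixed_map (y t : E -> R) m : E -> E :=
  fun z => \row_j (match val j with 0 => y z | 1 => z 0 m | _ => t z end).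

Lemma mixed_map_smooth U y t m : open U -> (forall n, Ck U n y) -> (forall n, Ck U n t) ->
  smooth_map U (mixed_map y t m).
Proof.
move=> oU yC tC n j; elim/ord3_ind: j.
- by apply: Ck_eq oU _ (yC n) => z _; rewrite mxE.
- by apply: Ck_eq oU _ (Ck_coord n m oU) => z _; rewrite mxE.
- by apply: Ck_eq oU _ (tC n) => z _; rewrite mxE.
Qed.

Lemma mixed_map_jacobian (y t : E -> R) m z i :
  [/\ jac (mixed_map y t m) z i iy = partial i y z, jac (mixed_map y t m) z i ix = (i == m)%:R
    & jac (mixed_map y t m) z i it = partial i t z].
Proof.
rewrite !mxE; split; [| rewrite -(partial_coord z) |]; congr (partial i _ z);
  by apply/funext => u; rewrite mxE.
Qed.

(** The minor is the determinant up to sign; for omega = d psi + y dt it equals n^m, by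
    [two_form_potential]. *)
Lemma mixed_map_unit (y t : E -> R) m z :
  partial (succ3 m) y z * partial (prev3 m) t z - partial (prev3 m) y z * partial (succ3 m) t z != 0 ->
  jac (mixed_map y t m) z \in unitmx.
Proof.
have [lm km lk _ _] := succ3_neq m.
set l := succ3 m in lm lk *; set k := prev3 m in km lk *; set J := jac _ _.
have [ym xm tm] := mixed_map_jacobian y t m z m; have [yl xl tl] := mixed_map_jacobian y t m z l.
have [yk xk tk] := mixed_map_jacobian y t m z k.
rewrite -/J eqxx (negbTE lm) (negbTE km) in ym xm tm yl xl tl yk xk tk.
clearbody J.
rewrite -yl -yk -tl -tk; set n := _ - _ => n0.
pose B : 'M[R]_3 := \matrix_(i, j)
  match val i with
  | 0 => if j == l then J k it / n else if j == k then - J l it / n else 0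
  | 1 => if j == l then (J k iy * J m it - J m iy * J k it) / n
         else if j == k then (J m iy * J l it - J l iy * J m it) / n else 1
  | _ => if j == l then - J k iy / n else if j == k then J l iy / n else 0
  end.
have BJ : B *m J = 1%:M.
  apply/matrixP => i j; rewrite !mxE (sum3_succ _ m) -/l -/k !mxE eqxx (eq_sym k l) (negbTE lk) (eq_sym m l) (negbTE lm)
    (eq_sym m k) (negbTE km) eqxx.
  have nE : n = J l iy * J k it - J k iy * J l it by [].
  have := n0; move: nE; clearbody n; elim/ord3_ind: j; rewrite ?xm ?xl ?xk;
    move: (J l iy) (J k iy) (J m iy) (J l it) (J k it) (J m it) => yl' yk' ym' tl' tk' tm' -> ?;
    by elim/ord3_ind: i => /=; first [ring | field].
by case/mulmx1_unit: BJ.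
Qed.


Lemma two_form_potential U (omega : E -> E) (t psi y : E -> R) i j x : open U -> U x ->
  Ck U 2 t -> Ck U 2 psi -> Ck U 1 y ->
  (forall z a, U z -> omega z 0 a = partial a psi z + y z * partial a t z) ->
  two_form omega i j x = partial i y x * partial j t x - partial j y x * partial i t x.
Proof.
move=> oU Ux tC pC yC H.
have d a b : partial a (fun z => omega z 0 b) x =
   partial a (partial b psi) x + (partial a y x * partial b t x + y x * partial a (partial b t) x).
  rewrite (partial_eq_on a oU Ux (fun z Uz => H z b Uz)); apply: is_derive_partial.
  exact: (isdD (Ck_is_derive a (Ck_partial b pC) Ux) (isdM (Ck_is_derive a yC Ux) (Ck_is_derive a (Ck_partial b tC) Ux))).
rewrite /two_form !d (Schwarz i j oU Ux pC) (Schwarz i j oU Ux tC).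
move: (partial i y x) (partial j y x) (partial i t x) (partial j t x) (partial j (partial i t) x) (partial j (partial i psi) x).
by move=> *; ring.
Qed.

Variables (M : topologicalType) (A : set (chart R M)).
Variables (h : chart R M -> E -> 'M[R]_3) (omega : chart R M -> E -> E) (D : chart R M -> connection R).
Hypotheses (MA : smooth_3manifold A) (WS : weyl_structure A h omega D).
Local Notation form := (local_form A h omega).

(* With [w' = d psi + y dt] and [null_form] proportional to [dt], the vector dual to [dw'] annihilates both [y] and [t];
   in the coordinates (y, z_m, t) it is therefore proportional to [d/dx], so that [h(d/dx)] is proportional to [dt]. *)
Lemma first_form O U h' w' G p m : form O U h' w' -> (forall n, weyl_on U h' w' G n) -> ricci_sym0 U G ->
  U p -> form_kernel w' m p != 0 ->
  exists V h2 q, [/\ form O V h2 omega_normal, V q & forall u, V u -> h2 u iy ix = 0 /\ h2 u ix ix = 0].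
Proof.
move=> L W Ric Up n0.
have [V1 [t [psi [y [mu [[oV1 V1p] V1U [tC pC yC] wE lE]]]]]] := null_coordinates W Ric Up (ex_intro _ m n0).
pose V2 := V1 `&` [set z | form_kernel w' m z != 0].
have oV2 : open V2 by apply: open_neq0 => //; exact: Ck_sub V1U (form_kernelC W 0 m).
have V2V : V2 `<=` V1 by move=> z [].
have nE i z : V1 z -> form_kernel w' i z =
   partial (succ3 i) y z * partial (prev3 i) t z - partial (prev3 i) y z * partial (succ3 i) t z.
  by move=> Vz; exact: (two_form_potential _ _ oV1 Vz (tC _) (pC _) (yC _) wE).
have fC : smooth_map V2 (mixed_map y t m).
  by apply: mixed_map_smooth => // n; [exact: Ck_sub V2V (yC n) | exact: Ck_sub V2V (tC n)].
have V2p : V2 p by [].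
have Jp : jac (mixed_map y t m) p \in unitmx by apply: mixed_map_unit; rewrite -nE.
have [U3 [V [Psi [U3V U3p Df]]]] := inverse_function oV2 V2p fC Jp.
set Phi := mixed_map y t m in fC Jp Df.
case: (Df) => oU3 oV Ps Qs PV PK QU QK.
have U3U : U3 `<=` U by move=> z /U3V /V2V /V1U.
(* The rescaling adds 2 d ps, which has to cancel d psi. *)
pose ps z := - 2^-1 * psi z.
have psC n : Ck U3 n ps.
  by apply: (Ck_mul oU3 (Ck_cst _ _ oU3)); exact: Ck_sub (subset_trans U3V V2V) (pC n).
have L3 := local_form_gauge (local_form_sub MA WS L oU3 U3U) psC.
have Ju z : U3 z -> jac Phi z \in unitmx by exact: diffeo_jacobian_unit Df.
pose h3 z := expR (ps z) ^+ 2 *: h' z.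
have [h2 h23] : exists h2, forall z, U3 z -> h3 z = jac Phi z *m h2 (Phi z) *m (jac Phi z)^T.
  exists (fun u => invmx (jac Phi (Psi u)) *m h3 (Psi u) *m (invmx (jac Phi (Psi u)))^T) => z Uz.
  rewrite PK // !mulmxA mulmxV ?Ju // mul1mx -!mulmxA -trmx_mul mulmxV ?Ju // trmx1 mulmx1 //.
exists V, h2, (Phi p); split; last 1 first.
- move=> u Vu; have Uz := QU _ Vu; have uz := QK _ Vu; move: (Psi u) Uz uz => z Uz uz; rewrite -{u Vu}uz.
  have V1z := V2V _ (U3V _ Uz); have nz : form_kernel w' m z != 0 by case: (U3V _ Uz).
  pose N : 'cV[R]_3 := \col_i form_kernel w' i z.
  have h'N : h' z *m N = mu z *: col it (jac Phi z).
    apply/colP => i; rewrite !mxE; have [_ _ Jt] := mixed_map_jacobian y t m z i.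
    by rewrite -(jacobianE Phi) Jt -lE //; apply: eq_bigr => a _; rewrite mxE.
  have JN : (jac Phi z)^T *m N = form_kernel w' m z *: delta_mx ix 0.
    have Jy i : jac Phi z i iy = partial i y z by case: (mixed_map_jacobian y t m z i).
    have Jx i : jac Phi z i ix = (i == m)%:R by case: (mixed_map_jacobian y t m z i).
    have Jt i : jac Phi z i it = partial i t z by case: (mixed_map_jacobian y t m z i).
    have z1 : \sum_i partial i y z * form_kernel w' i z = 0.
      by rewrite sum3E !(nE _ _ V1z) /succ3 /prev3 /=; move: (partial iy y z) (partial ix y z) (partial it y z) (partial iy t z) (partial ix t z) (partial it t z) => *; ring.
    have z2 : \sum_i partial i t z * form_kernel w' i z = 0.
      by rewrite sum3E !(nE _ _ V1z) /succ3 /prev3 /=; move: (partial iy y z) (partial ix y z) (partial it y z) (partial iy t z) (partial ix t z) (partial it t z) => *; ring.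
    apply/colP => j; rewrite mxE [RHS]mxE mxE eqxx andbT; elim/ord3_ind: j; rewrite ?mulr0 ?mulr1.
    + by rewrite -[RHS]z1; apply: eq_bigr => i _; rewrite mxE Jy mxE.
    + rewrite (bigD1 m) //= mxE Jx eqxx mul1r mxE big1 ?addr0 // => i im.
      by rewrite mxE Jx (negbTE im) mul0r.
    + by rewrite -[RHS]z2; apply: eq_bigr => i _; rewrite mxE Jt mxE.
  have key : h2 (Phi z) *m (form_kernel w' m z *: delta_mx ix 0) = (expR (ps z) ^+ 2 * mu z) *: delta_mx it 0 :> 'cV_3.
    apply: (can_inj (mulKmx (Ju z Uz))).
    by rewrite -JN !mulmxA -h23 // /h3 -scalemxAl h'N scalerA -scalemxAr -colE.
  have e i : form_kernel w' m z * h2 (Phi z) i ix = expR (ps z) ^+ 2 * mu z * (i == it)%:R.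
    have /colP/(_ i) := key; rewrite -scalemxAr -colE !mxE eqxx andbT => ->; by rewrite mulr_natr.
  split; apply: (mulfI nz); rewrite mulr0 e mulr0 //.
- apply: (local_form_change MA WS L3 Df (@subset_refl _ _)) => z Uz; split; first exact: h23.
  apply/rowP => i; rewrite !mxE sum3E !omega_normalE /= !mulr0 !mul0r !add0r mulr1.
  have [_ _ Jt] := mixed_map_jacobian y t m z i.
  have -> : Phi z 0 iy = y z by rewrite mxE.
  have V1z := V2V _ (U3V _ Uz).
  rewrite mxE Jt wE // (is_derive_partial (isdZ (- 2^-1) (Ck_is_derive i (pC 1%N) V1z))).
  by move: (partial i psi z) (y z * _) => a b; field.
- exact: PV.
Qed.

End FirstForm.

(** * Normalising the metric to the standard form *)

Section SecondForm.
Context {R : realType}.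
Local Notation E := 'rV[R]_3.
Implicit Types (U V W : set E) (x z p q u : E) (i j k l m : 'I_3).
Local Opaque partial upd.

(** [g m l] stands for Gamma^m_{kl} with k tangent to the leaves. The xx and yx compatibility
    equations restrict Gamma^t, and comparing the xt equation with the closure law of L gives a
    trace relation; together they cancel the derivative of h_yy. *)
Lemma leaf_algebra (g : 'I_3 -> 'I_3 -> R) (a b c e da dc : R) : c != 0 ->
  0 = g it ix * c + g it ix * c -> 0 = g it iy * c + (g iy ix * a + g it ix * b) ->
  da = 2 * (g iy iy * a + g it iy * b) -> dc = g iy ix * b + g ix ix * c + g it ix * e + g it it * c ->
  dc = (g iy iy + g ix ix + g it it) * c -> da = 0.
Proof.
move: (g it ix) (g it iy) (g iy ix) (g iy iy) (g ix ix) (g it it) => tx ty yx yy xx tt c0 H1 H2 -> -> H4.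
have tx0 : tx = 0.
  by apply: (mulIf c0); rewrite mul0r; move: H1; move: (tx * c) => v; lra.
rewrite tx0 mul0r addr0 in H2; rewrite tx0 mul0r addr0 in H4.
have E1 : yy * c = yx * b.
  apply/eqP; rewrite -subr_eq0; apply/eqP; rewrite -[RHS](subrr ((yy + xx + tt) * c)) -{2}H4; ring.
apply: (mulIf c0); rewrite mul0r.
have -> : 2 * (yy * a + ty * b) * c = 2 * ((yy * c) * a + (ty * c) * b) by ring.
have E2 : ty * c = - (yx * a) by apply/eqP; rewrite -addr_eq0 -H2.
by rewrite E1 E2; ring.
Qed.

Lemma form_kernel_normal (p : 'I_3) x : form_kernel (@omega_normal R) p x = - (p == ix)%:R.
Proof.
have d i j : partial i (fun z : E => omega_normal z 0 j) x = (i == iy)%:R * (j == it)%:R.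
  rewrite (@partial_eq_on _ setT _ (fun z : E => z 0 iy * (j == it)%:R) i x openT) //; last first.
    by move=> z _; rewrite omega_normalE.
  apply: is_derive_partial; apply: (isd_eq (isdM (is_derive_coord x i iy) (isdC _ _ _))).
  by rewrite mulr0 addr0.
rewrite /form_kernel /two_form !d; elim/ord3_ind: p; rewrite /succ3 /prev3 /=; ring.
Qed.

(** In this gauge n = - d_x, so L = - h_xt dt. Along the leaves omega_k = 0, and the closure law of
    L reads d_k h_xt = (trace of Gamma_k) h_xt, the last hypothesis of [leaf_algebra]. *)
Lemma leaf_metric_constant U (h : E -> 'M[R]_3) G x k : (forall n, weyl_on U h omega_normal G n) ->
  ricci_sym0 U G -> (forall z, U z -> [/\ h z iy ix = 0, h z ix ix = 0 & h z ix it != 0]) -> U x -> k != it ->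
  partial k (fun z => h z iy iy) x = 0.
Proof.
move=> W Ric H Ux kt; have oU := weyl_open (W 0%N).
have hs i j := weyl_symE (W 0%N) i j Ux.
have [yx xx c0] := H _ Ux.
have p0 (f : E -> R) : (forall z, U z -> f z = 0) -> partial k f x = 0.
  by move=> f0; rewrite (partial_eq_on k oU Ux f0); apply: is_derive_partial; exact: isdC.
have w0 : omega_normal x 0 k = 0 :> R by rewrite omega_normalE (negbTE kt) mulr0.
have cE i j := compatE W k i j Ux.
have LE i z : U z -> null_form h omega_normal i z = - h z i ix.
  move=> Uz; rewrite /null_form (bigD1 ix) //= form_kernel_normal eqxx mulrN1 big1 ?addr0 // => m mx.
  by rewrite form_kernel_normal (negbTE mx) oppr0 mulr0.
have := null_form_closed W Ric k it Ux.
have Lk z : U z -> null_form h omega_normal k z = 0.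
  move=> Uz; rewrite LE //; have [zy zx _] := H _ Uz.
  by move: (k) kt; apply: ord3_ind => // _; rewrite ?zy ?zx oppr0.
rewrite (Lk _ Ux) (LE _ _ Ux) mulr0 subr0.
rewrite (partial_eq_on it oU Ux Lk) (is_derive_partial (isdC _ _ _)) subr0.
rewrite (partial_eq_on k oU Ux (LE it)).
rewrite (is_derive_partial (isdN (Ck_is_derive k (weyl_hC (W 0%N) it ix) Ux))) mulrN => /oppr_inj th.
apply: (leaf_algebra (g := fun m l => G m k l x) (a := h x iy iy) (b := h x iy it) (c := h x ix it) (e := h x it it)
   (dc := partial k (fun z => h z it ix) x)) => //.
- by have := cE ix ix; rewrite p0 ?w0 ?mul0r ?add0r ?sum3E ?yx ?xx ?(hs ix iy) ?(hs it ix) ?yx ?mulr0 ?add0r // => z /H[].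
- have := cE iy ix; rewrite p0 ?w0 ?mul0r ?add0r ?sum3E ?yx ?xx ?(hs it ix) ?yx ?mulr0 ?add0r ?addr0 => [->//|z /H[]//].
- by rewrite cE w0 mul0r add0r !sum3E ?(hs ix iy) ?(hs it iy) ?yx !mulr0 !addr0 -mulr2n mulr_natl.
- rewrite cE w0 !sum3E yx xx (hs it iy) (hs it ix) ?yx; move: (G iy k it x) (G ix k it x).
  by move: (G iy k ix x) (G ix k ix x) (G it k ix x) (G it k it x) (h x iy it) (h x ix it) (h x it it) => *; ring.
by rewrite th /theta w0 add0r sum3E (hs it ix).
Qed.

Lemma triangular_unit (J : 'M[R]_3) : J iy iy != 0 -> J ix ix != 0 -> J it it != 0 ->
  J ix iy = 0 -> J iy it = 0 -> J ix it = 0 -> J \in unitmx.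
Proof.
move=> a0 c0 f0 xy yt xt.
pose B : 'M[R]_3 := \matrix_(i, j)
  match val i, val j with
  | 0, 0 => (J iy iy)^-1 | 0, 1 => - J iy ix / (J iy iy * J ix ix) | 1, 1 => (J ix ix)^-1
  | 2, 0 => - J it iy / (J it it * J iy iy)
  | 2, 1 => (J it iy * J iy ix / J iy iy - J it ix) / (J it it * J ix ix)
  | 2, 2 => (J it it)^-1 | _, _ => 0 end.
have BJ : B *m J = 1%:M.
  apply/matrixP => i j; rewrite !mxE !sum3E !mxE; elim/ord3_ind: j; rewrite ?xy ?yt ?xt;
    move: (J iy iy) (J ix ix) (J it it) (J iy ix) (J it iy) (J it ix) a0 c0 f0 => a c f b d e a0 c0 f0;
    by elim/ord3_ind: i => /=; first [ring | field; rewrite ?a0 ?c0 ?f0].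
by case/mulmx1_unit: BJ.
Qed.

(** If h_yy were negative, - H would be congruent to the standard Lorentzian form, so det(- H) < 0
    and, in dimension three, det H > 0. In the degenerate cases a kernel vector is written down. *)
Lemma lorentzian_first_form (H : 'M[R]_3) : H^T = H -> H iy ix = 0 -> H ix ix = 0 -> \det H < 0 ->
  0 < H iy iy /\ H ix it != 0.
Proof.
move=> Hs yx xx d0; have s i j : H i j = H j i by rewrite -[in LHS]Hs mxE.
have Hu : H \in unitmx by rewrite unitmxE unitfE lt_eqF.
have ker (v : 'rV[R]_3) : v *m H = 0 -> v = 0 by move=> v0; rewrite -(mulmxK Hu v) v0 mul0mx.
have c0 : H ix it != 0.
  apply/eqP => c0; have : (delta_mx 0 ix : 'rV[R]_3) *m H = 0.
    by rewrite -rowE; apply/rowP => j; rewrite !mxE; elim/ord3_ind: j; rewrite // s.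
  by move/ker/rowP/(_ ix); rewrite !mxE !eqxx => /eqP; rewrite oner_eq0.
split=> //; rewrite ltNge; apply/negP => a0.
have [a0' | a1] := eqVneq (H iy iy) 0.
  have : (H ix it *: delta_mx 0 iy - H iy it *: delta_mx 0 ix : 'rV[R]_3) *m H = 0.
    rewrite mulmxBl -!scalemxAl -!rowE; apply/rowP => j; rewrite !mxE.
    elim/ord3_ind: j; rewrite ?a0' ?yx ?xx ?(s ix iy) ?yx ?mulr0 ?subrr //.
    by rewrite mulrC subrr.
  move/ker/rowP/(_ iy); rewrite !mxE !eqxx /= mulr1 mulr0 subr0 => c1; by move/eqP: c0; apply.
pose k := Num.sqrt (- H iy iy).
have kk : k * k = - H iy iy by rewrite -expr2 sqr_sqrtr // oppr_ge0.
clearbody k.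
pose J : 'M[R]_3 := \matrix_(i, j) match val i, val j with
  | 0, 0 => k | 0, 1 => - H iy it | 1, 1 => - H ix it | 2, 1 => - H it it / 2 | 2, 2 => 1 | _, _ => 0 end.
have HJ : - H = J *m sym_form 0 0 *m J^T.
  apply/matrixP => i j; rewrite !mxE !sum3E !mxE !sum3E !mxE; elim/ord3_ind: i; elim/ord3_ind: j => /=;
    rewrite ?(s ix iy) ?(s it iy) ?(s it ix) ?yx ?xx -?kk; first [by ring | by field].
have Jd : \det J != 0.
  have kn : k != 0 by apply/eqP => k0; move/eqP: kk; rewrite k0 mul0r eq_sym oppr_eq0 (negbTE a1).
  rewrite -unitfE -unitmxE; apply: triangular_unit; rewrite ?mxE //= ?oppr_eq0 //; exact: oner_neq0.
have := f_equal determinant HJ; rewrite -scaleN1r detZ !det_mulmx det_tr => E.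
have S0 := lorentzian_det (@std_metric_signature R (fun _ => 0) (fun _ => 0) 0).
have : 0 < \det H.
  rewrite -oppr_lt0; have -> : - \det H = \det J * \det (sym_form 0 0) * \det J.
    by rewrite -E -[X in _ ^+ X]/(2.+1) exprS -signr_odd /= expr0 mulr1 mulN1r.
  by rewrite mulrAC -expr2 pmulr_rlt0 // exprn_even_gt0.
by move/(lt_trans d0); rewrite ltxx.
Qed.

Lemma zero_primitive p r i : is_primitive p r i (fun _ => 0) (fun _ => 0 : R).
Proof. by split=> // x cx; exact: isdC. Qed.

Lemma isd_coordinv (f : E -> R) x i (d : R) : f x != 0 -> is_derive x (delta_mx 0 i) f d ->
  is_derive x (delta_mx 0 i) (fun z => (f z)^-1) (- ((f x)^-1 * (f x)^-1) * d).
Proof.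
move=> f0 fd; apply/is_derive_line; apply: isd_comp; last exact/is_derive_line.
by rewrite upd_id; exact: isd_inv.
Qed.

Variables (M : topologicalType) (A : set (chart R M)).
Variables (h : chart R M -> E -> 'M[R]_3) (omega : chart R M -> E -> E) (D : chart R M -> connection R).
Hypotheses (MA : smooth_3manifold A) (WS : weyl_structure A h omega D).
Local Notation form := (local_form A h omega).

Lemma change_to_std O U h' w' Phi (B C : E -> R) p : form O U h' w' -> U p -> smooth_map U Phi ->
  jac Phi p \in unitmx ->
  (forall z, U z -> h' z = jac Phi z *m sym_form (B z) (C z) *m (jac Phi z)^T /\
     w' z = omega_normal (Phi z) *m (jac Phi z)^T) ->
  exists U' V Psi b e, [/\ U' `<=` U, U' p, diffeo U' V Phi Psi,
    form O V (std_metric b e) omega_normal & forall z, U' z -> b (Phi z) = B z /\ e (Phi z) = C z].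
Proof.
move=> L Up PC Ju H; have oU := local_form_open L.
have [U' [V [Psi [sU U'p Df]]]] := inverse_function oU Up PC Ju.
exists U', V, Psi, (fun u => B (Psi u)), (fun u => C (Psi u)); split=> //; last first.
  by move=> z Uz; rewrite (diffeo_K Df).
apply: (local_form_change MA WS L Df sU) => z Uz.
by have [-> ->] := H _ (sU _ Uz); rewrite /std_metric (diffeo_K Df).
Qed.

Hypotheses (EW : einstein_weyl A h omega) (W0 : vanishing_scalar_curvature A h omega).
Hypothesis sL : metric_of_signature A sig_lorentzian h.

Lemma std_form_equations O U b e : form O U (std_metric b e) omega_normal ->
  [/\ open U, forall n, Ck U n b, forall n, Ck U n e & forall x, U x -> std_equations b e x].
Proof.
move=> L; have [G [W Ric _]] := local_form_weyl WS EW W0 sL L; have oU := local_form_open L.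
have bC n : Ck U n b.
  by apply: Ck_eq oU _ (Ck_pred (Ck_pred (weyl_hC (W n) iy it))) => z _; rewrite mxE.
have eC n : Ck U n e.
  by apply: Ck_eq oU _ (Ck_pred (Ck_pred (weyl_hC (W n) it it))) => z _; rewrite mxE.
split=> // x Ux; apply: ((std_equationsP oU Ux (bC 2%N) (eC 2%N)).1) => i j.
by rewrite !(weyl_ricciE (W 0%N)) //; exact: Ric.
Qed.

(** With k = sqrt(h_yy), a function of t alone, the new coordinates are k y, the integral of k h_xt
    along x, and the integral of 1 / k along t. The product of k y and dt / k is still y dt, and
    both h_yy and h_xt become 1. *)
Lemma second_form O U h' p : form O U h' omega_normal -> U p ->
  (forall u, U u -> h' u iy ix = 0 /\ h' u ix ix = 0) ->
  exists V b e q, form O V (std_metric b e) omega_normal /\ V q.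
Proof.
move=> L Up H; have [G [W Ric dt]] := local_form_weyl WS EW W0 sL L; have oU := local_form_open L.
have hC n i j := Ck_pred (Ck_pred (weyl_hC (W n) i j)).
have hs z i j : U z -> h' z i j = h' z j i by move=> Uz; exact: (weyl_symE (W 0%N) i j Uz).
have pos z : U z -> 0 < h' z iy iy /\ h' z ix it != 0.
  by move=> Uz; have [yx xx] := H _ Uz; exact: (lorentzian_first_form (weyl_sym (W 0%N) Uz) yx xx (dt _ Uz)).
have [r r0 rU] := open_cube oU Up.
pose k z := expR (2^-1 * ln (h' z iy iy)).
have k0 z : 0 < k z by exact: expR_gt0.
have lnC n : Ck U n (fun z => ln (h' z iy iy)) by apply: (Ck_ln oU) => // z /pos [].
have kC n : Ck U n k by apply: (Ck_exp oU); apply: (Ck_mul oU (Ck_cst _ _ oU) (lnC n)).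
have k2 z : U z -> k z * k z = h' z iy iy.
  move=> Uz; rewrite /k -expRD -mulrDl (_ : 2^-1 + 2^-1 = 1) ?mul1r ?lnK //; last by field.
  by rewrite posrE; case: (pos _ Uz).
have s1 : cube p r `<=` U by [].
have [r1 r10 r1r] : exists2 r1 : R, 0 < r1 & r1 < r by exists (r / 2); lra.
have cr1 : cube p r1 `<=` cube p r by apply: cube_sub; exact: ltW.
have o1 := @cube_open R p r1.
have s2 : cube p r1 `<=` U by exact: subset_trans cr1 s1.
have kiC n : Ck U n (fun z => (k z)^-1) by apply: (Ck_inv oU _ (kC n)) => z _; rewrite gt_eqF.
have ckC n : Ck U n (fun z => k z * h' z ix it) by apply: (Ck_mul oU (kC n) (hC n _ _)).
have [T TE] := exists_primitive it r10 r1r (fun x cx => Ck_cont (kiC 0%N) (s1 _ cx)).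
have [f fE] := exists_primitive ix r10 r1r (fun x cx => Ck_cont (ckC 0%N) (s1 _ cx)).
have TC n : Ck (cube p r1) n T by apply: primitive_Ck TE _; exact: Ck_sub s2 (kiC n).
have fC n : Ck (cube p r1) n f by apply: primitive_Ck fE _; exact: Ck_sub s2 (ckC n).
have da i z : i != it -> U z -> partial i (fun z => h' z iy iy) z = 0.
  move=> it_ Uz; apply: (leaf_metric_constant W Ric _ Uz it_) => y Uy.
  by case: (H _ Uy) => -> ->; case: (pos _ Uy).
have dk i z : i != it -> U z -> is_derive z (delta_mx 0 i) k 0.
  move=> it_ Uz; have dh : is_derive z (delta_mx 0 i) (fun z => h' z iy iy) 0.
    by rewrite -(da i z it_ Uz); exact: Ck_is_derive (hC 1%N _ _) Uz.
  apply: (isd_eq (isd_exp (isdZ 2^-1 (isd_ln (proj1 (pos _ Uz)) dh)))).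
  by rewrite !mulr0.
have Tt z : cube p r1 z -> partial it T z = (k z)^-1 by move=> cz; apply: is_derive_partial; exact: TE.2.
have fx z : cube p r1 z -> partial ix f z = k z * h' z ix it by move=> cz; apply: is_derive_partial; exact: fE.2.
have Tn i z : i != it -> cube p r1 z -> partial i T z = 0.
  move=> it_ cz; apply: is_derive_partial; apply: (primitive_der _ TE (zero_primitive _ _ _) _ _ cz); first by rewrite eq_sym.
    move=> y cy; have Uy := s2 _ cy.
    apply: (isd_eq (isd_coordinv (lt0r_neq0 (k0 y)) (dk i y it_ Uy))); by rewrite mulr0.
  by move=> y cy; exact: contC.
pose Phi (z : E) : E := \row_j (match val j with 0 => k z * z 0 iy | 1 => f z | _ => T z end).
have PC : smooth_map (cube p r1) Phi.
  move=> n j; elim/ord3_ind: j.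
  - apply: (Ck_eq (f := fun z => k z * z 0 iy) o1) => [z _|]; first by rewrite mxE.
    by apply: (Ck_mul o1 (Ck_sub s2 (kC n)) (Ck_coord n iy o1)).
  - by apply: Ck_eq o1 _ (fC n) => z _; rewrite mxE.
  - by apply: Ck_eq o1 _ (TC n) => z _; rewrite mxE.
have Jy i z : cube p r1 z -> jac Phi z i iy = partial i k z * z 0 iy + k z * (i == iy)%:R.
  move=> cz; rewrite jacobianE (_ : (fun u => Phi u 0 iy) = fun u => k u * u 0 iy); last by apply/funext => u; rewrite mxE.
  by apply: is_derive_partial; exact: (isdM (Ck_is_derive i (kC 1%N) (s2 _ cz)) (is_derive_coord z i iy)).
have Jx i z : jac Phi z i ix = partial i f z by rewrite jacobianE; congr partial; apply/funext => u; rewrite mxE.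
have Jt i z : jac Phi z i it = partial i T z by rewrite jacobianE; congr partial; apply/funext => u; rewrite mxE.
have dk0 i z : i != it -> cube p r1 z -> partial i k z = 0.
  by move=> it_ cz; apply: is_derive_partial; exact: dk it_ (s2 _ cz).
have fy0 z : cube p r1 z -> partial ix f z != 0.
  by move=> cz; rewrite fx //; apply: mulf_neq0; [rewrite gt_eqF | case: (pos _ (s2 _ cz))].
have pc : cube p r1 p by exact: cube_center.
have Ju : jac Phi p \in unitmx.
  apply: triangular_unit; [| by rewrite Jx; exact: fy0 | by rewrite Jt Tt // invr_eq0 gt_eqF | | by rewrite Jt Tn | by rewrite Jt Tn].
    by rewrite Jy // dk0 // mul0r add0r mulr1 gt_eqF.
  by rewrite Jy // dk0 // mul0r add0r mulr0.
(* [B] and [C] solve h' = J S J^T for the two free entries of the standard form S. *)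
pose B z := h' z iy it - k z * partial it k z * z 0 iy - partial iy f z / k z.
pose C z := k z ^+ 2 * (h' z it it - (partial it k z * z 0 iy) ^+ 2 - 2 * B z * (partial it k z * z 0 iy) / k z
   - 2 * partial it f z / k z).
have [|U' [V [Psi [b [e [sU U'p Df F _]]]]]] :=
   @change_to_std O (cube p r1) h' omega_normal Phi B C p (local_form_sub MA WS L o1 s2) pc PC Ju.
  move=> z cz; have Uz := s2 _ cz; have [yx xx] := H _ Uz.
  have kn : k z != 0 by rewrite gt_eqF.
  split.
    apply/matrixP => i j; rewrite !mxE !sum3E !mxE !sum3E !mxE.
    rewrite -!(jacobianE Phi) !Jx !Jt !(Jy _ _ cz).
    have T0 := Tn iy z isT cz; have T1 := Tn ix z isT cz; have T2 := Tt z cz.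
    have K0 := dk0 iy z isT cz; have K1 := dk0 ix z isT cz; have F1 := fx z cz; have K2 := k2 z Uz.
    elim/ord3_ind: i; elim/ord3_ind: j; rewrite /= ?T0 ?T1 ?T2 ?K0 ?K1 ?F1 ?(hs z ix iy Uz) ?(hs z it iy Uz)
      ?(hs z it ix Uz) ?yx ?xx -?K2 /C /B; move: (k z) kn (h' z iy it) (h' z it it) (h' z ix it) (partial it k z)
      (partial iy f z) (partial it f z) (z 0 iy) => *; first [by ring | by field].
  apply/rowP => i; rewrite [RHS]mxE sum3E !omega_normalE !mxE -!(jacobianE Phi) Jt /= !mulr0 !mul0r !add0r mulr1.
  have T0 := Tn iy z isT cz; have T1 := Tn ix z isT cz; have T2 := Tt z cz.
  elim/ord3_ind: i; rewrite /= ?T0 ?T1 ?T2 ?mulr0 ?mulr1 //.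
  by rewrite mulrAC mulfV // mul1r.
by exists V, b, e, (Phi p); split=> //; exact: (diffeo_map Df).
Qed.

End SecondForm.

(** * Normal forms *)

Section Shear.
Context {R : realType}.
Local Notation E := 'rV[R]_3.
Implicit Types (U V W : set E) (x z p q u : E) (i j k l m : 'I_3) (f g : E -> R) (r t : R).
Local Opaque partial upd.

Lemma const_line p r f z i s : (forall n, Ck (cube p r) n f) -> (forall y, cube p r y -> partial i f y = 0) ->
  cube p r z -> `|s - p 0 i| < r -> f (upd z i s) = f z.
Proof.
move=> fC f0 cz sr.
have cu (u : R) : between (z 0 i) s u -> cube p r (upd z i u).
  by move=> bu; apply: cube_upd => //; exact: between_le bu (cz i) sr.
have [|c cb E] := @mvt_line R f z i s; first by move=> u bu; exact: Ck_der (fC 1%N) (cu u bu).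
by apply/eqP; rewrite -subr_eq0 E f0 ?mul0r //; exact: cu.
Qed.

Lemma t_only p r f z : (forall n, Ck (cube p r) n f) -> (forall i y, i != it -> cube p r y -> partial i f y = 0) ->
  cube p r z -> f z = f (upd p it (z 0 it)).
Proof.
move=> fC f0 cz; have r0 : 0 < r by apply: le_lt_trans (cz iy); exact: normr_ge0.
have pr i : `|p 0 i - p 0 i| < r by rewrite subrr normr0.
rewrite -(const_line fC (fun y => f0 iy y isT) cz (pr iy)).
rewrite -(const_line fC (fun y => f0 ix y isT) (cube_upd cz (pr iy)) (pr ix)).
by congr f; apply/rowP => j; rewrite !updE; elim/ord3_ind: j.
Qed.

Lemma line_isd p r f t : (forall n, Ck (cube p r) n f) -> `|t - p 0 it| < r ->
  is_derive t 1 (fun s => f (upd p it s)) (partial it f (upd p it t)).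
Proof.
move=> fC tr; have r0 : 0 < r by apply: le_lt_trans tr; exact: normr_ge0.
apply/is_derive_upd; apply: Ck_is_derive (fC 1%N) _.
by apply: cube_upd => //; exact: cube_center.
Qed.

Lemma line_C2 p r f : (forall n, Ck (cube p r) n f) ->
  C2_on [set t | `|t - p 0 it| < r] (fun t => f (upd p it t)).
Proof.
move=> fC t tr; have ft n : Ck (cube p r) n (partial it f) by exact: Ck_partial (fC n.+1).
have ftt n : Ck (cube p r) n (partial it (partial it f)) by exact: Ck_partial (ft n.+1).
have oI : open [set t | `|t - p 0 it| < r].
  rewrite (_ : [set _ | _] = ball (p 0 it) r); first exact: ball_open.
  by apply/seteqP; split=> u; rewrite /ball /= distrC.
have d1 (u : R) : `|u - p 0 it| < r -> derive1 (fun t => f (upd p it t)) u = partial it f (upd p it u).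
  by move=> ur; rewrite derive1E; have H := line_isd fC ur; exact: derive_val.
have D2 (u : R) : `|u - p 0 it| < r -> is_derive u 1 (derive1 (fun t => f (upd p it t))) (partial it (partial it f) (upd p it u)).
  move=> ur; apply: (near_eq_is_derive _ (line_isd ft ur)).
  by near=> v; rewrite d1 //; near: v; exact: open_nbhs_nbhs.
split.
- by have H := line_isd fC tr; exact: ex_derive.
- by have H := D2 _ tr; exact: ex_derive.
have c : {for t, continuous (fun s => partial it (partial it f) (upd p it s))}.
  have r0 : 0 < r by apply: le_lt_trans tr; exact: normr_ge0.
  have cu : cube p r (upd p it t) by apply: cube_upd => //; exact: cube_center.
  exact: (cont_comp (@upd_continuous _ p it t) (Ck_cont (ftt 0%N) cu)).
have e (u : R) : `|u - p 0 it| < r -> derive1n 2 (fun t => f (upd p it t)) u = partial it (partial it f) (upd p it u).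
  by move=> ur; rewrite /= derive1E; have H := D2 _ ur; exact: derive_val.
rewrite /prop_for /continuous_at (e _ tr) => B /c; apply: (filterS2 _ _ (open_nbhs_nbhs (conj oI tr))) => v vr.
by move=> Bv; suff : B (derive1n 2 (fun s => f (upd p it s)) v) by []; rewrite (e v vr).
Unshelve. all: by end_near.
Qed.

Definition shear_map g : E -> E := fun z => upd z ix (z 0 ix + g z).

Variables (M : topologicalType) (A : set (chart R M)).
Variables (h : chart R M -> E -> 'M[R]_3) (omega : chart R M -> E -> E) (D : chart R M -> connection R).
Hypotheses (MA : smooth_3manifold A) (WS : weyl_structure A h omega D).
Local Notation form := (local_form A h omega).

(** Substitute x = x' - g in 2 dx dt; g must not depend on x for the coefficient of dx dt to stay
    1. *)
Lemma shear O U b e g p : form O U (std_metric b e) omega_normal -> U p -> (forall n, Ck U n g) ->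
  (forall z, U z -> partial ix g z = 0) ->
  exists U' V Psi b' e', [/\ U' `<=` U, U' p, diffeo U' V (shear_map g) Psi,
    form O V (std_metric b' e') omega_normal &
    forall z, U' z -> b' (shear_map g z) = b z - partial iy g z /\
                      e' (shear_map g z) = e z - 2 * partial it g z].
Proof.
move=> L Up gC gx; have oU := local_form_open L.
have SC : smooth_map U (shear_map g).
  move=> n j; have [->|jx] := eqVneq j ix.
    apply: (Ck_eq (f := fun z => z 0 ix + g z) oU) => [z _|]; first by rewrite upd_same.
    exact: (Ck_add oU (Ck_coord n ix oU) (gC n)).
  by apply: Ck_eq oU _ (Ck_coord n j oU) => z _; rewrite upd_other.
have Jx z i : U z -> jac (shear_map g) z i ix = (i == ix)%:R + partial i g z.
  move=> Uz; rewrite jacobianE (_ : (fun u => _) = fun u => u 0 ix + g u); last by apply/funext => u; rewrite upd_same.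
  by apply: is_derive_partial; exact: (isdD (is_derive_coord z i ix) (Ck_is_derive i (gC 1%N) Uz)).
have Jn z i j : j != ix -> jac (shear_map g) z i j = (i == j)%:R.
  move=> jx; rewrite jacobianE -(partial_coord z) (_ : (fun u => _) = fun u => u 0 j) //.
  by apply/funext => u; rewrite upd_other.
have Ju : jac (shear_map g) p \in unitmx.
  by apply: triangular_unit; rewrite ?Jx ?Jn ?gx //= ?addr0 ?oner_neq0.
apply: (change_to_std MA WS L Up SC Ju) => z Uz; split.
  apply/matrixP => i j; rewrite !mxE !sum3E !mxE !sum3E !mxE -!(jacobianE (shear_map g)) !(Jx _ _ Uz) !Jn //.
  have g1 := gx z Uz; elim/ord3_ind: i; elim/ord3_ind: j; rewrite /= ?g1;
    move: (partial iy g z) (partial it g z) (b z) (e z) => *; by ring.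
have yE : shear_map g z 0 iy = z 0 iy by rewrite /shear_map upd_other.
apply/rowP => i; rewrite [RHS]mxE sum3E !omega_normalE yE; set J := jac _ _.
have -> : J^T it i = (i == it)%:R by rewrite mxE /J Jn.
by rewrite /= !mulr0 !mul0r !add0r mulr1.
Qed.
End Shear.

Ltac partial_by t := apply: is_derive_partial; unshelve notypeclasses refine (isd_eq _ _);
  [shelve | is_derive_poly | cbv beta; rewrite /= ?mulr1n ?mulr0n; t].

Ltac gen_coords := repeat match goal with
  | |- context [fun_of_matrix ?z ?i ?j] => generalize (fun_of_matrix z i j); intro
  end.

(** * The case b_x = 0: the family h1 *)

Section FirstFamily.
Context {R : realType}.
Local Notation E := 'rV[R]_3.
Implicit Types (U V W : set E) (x z p q u : E) (i j k l m : 'I_3) (f g b e : E -> R) (r t : R).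
Local Opaque partial upd.

Definition depends_on_t U f : Prop :=
  (forall n, Ck U n f) /\ forall i z, i != it -> U z -> partial i f z = 0.

Lemma depends_on_t_isd U f i z : depends_on_t U f -> i != it -> U z -> is_derive z (delta_mx 0 i) f 0.
Proof. by move=> [fC f0] ii Uz; rewrite -(f0 i z ii Uz); exact: Ck_is_derive (fC 1%N) Uz. Qed.

Lemma depends_on_t_sub U V f : V `<=` U -> depends_on_t U f -> depends_on_t V f.
Proof. by move=> sV [fC f0]; split=> [n|i z ii /sV]; [exact: Ck_sub sV (fC n) | exact: f0]. Qed.

Lemma depends_on_t_primitive p r f g : depends_on_t (cube p r) f -> is_primitive p r it f g ->
  depends_on_t (cube p r) g.
Proof.
move=> [fC f0] fg; split=> [n|i z ii cz]; first exact: primitive_Ck fg (fC n).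
apply: is_derive_partial; apply: (primitive_der _ fg (zero_primitive _ _ _) _ _ cz); first by rewrite eq_sym.
  by move=> y cy; exact: (depends_on_t_isd (conj fC f0) ii cy).
by move=> y cy; exact: contC.
Qed.

Lemma depends_on_t_partial U f i z : open U -> depends_on_t U f -> U z -> i != it -> partial i (partial it f) z = 0.
Proof.
move=> oU [fC f0] Uz ii; rewrite (Schwarz i it oU Uz (fC 2%N)).
by rewrite (partial_eq_on it oU Uz (fun y Uy => f0 i y ii Uy)); apply: is_derive_partial; exact: isdC.
Qed.

(** By the first two equations e is affine in x with slope R - y / 2. The third then gives e_yy, and
    integrating it in y yields the quartic and cubic terms and leaves S y + K. *)
Lemma first_family_structure p r e : (forall n, Ck (cube p r) n e) ->
  (forall z, cube p r z -> [/\ partial ix (partial ix e) z = 0, partial iy (partial ix e) z = - 2^-1 &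
     4^-1 * (z 0 iy * partial ix e z + z 0 iy ^+ 2) - partial iy (partial iy e) z / 2 = 0]) ->
  exists R0 S0 K0, [/\ depends_on_t (cube p r) R0, depends_on_t (cube p r) S0, depends_on_t (cube p r) K0 &
    forall z, cube p r z -> e z = z 0 ix * (R0 z - z 0 iy / 2) + z 0 iy ^+ 4 / 48 + R0 z * z 0 iy ^+ 3 / 12
      + S0 z * z 0 iy + K0 z].
Proof.
move=> eC H; have oU := @cube_open R p r; set U := cube p r in oU eC H *.
have exC n : Ck U n (partial ix e) := Ck_partial ix (eC n.+1).
pose r0 z := partial ix e z + z 0 iy / 2.
have r0C n : Ck U n r0 by have ex := exC n; rewrite /r0; Ck_poly oU.
have xyE i : i != it -> i = iy \/ i = ix by elim/ord3_ind: i => // _; [left | right].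
have r0t : depends_on_t U r0.
  split=> // i z ii Uz; have [exx eyx _] := H z Uz.
  have d : is_derive z (delta_mx 0 i) (fun u => partial ix e u) (partial i (partial ix e) z).
    exact: (Ck_is_derive i (exC 1%N) Uz).
  have dE : partial i (partial ix e) z = - (i == iy)%:R / 2.
    by case: (xyE i ii) => ->; rewrite ?exx ?eyx /= ?mulN1r // oppr0 mul0r.
  rewrite dE in d; rewrite /r0; partial_by ltac:(by field).
pose s1 z := e z - z 0 ix * (r0 z - z 0 iy / 2) - z 0 iy ^+ 4 / 48 - r0 z * z 0 iy ^+ 3 / 12.
have s1C n : Ck U n s1.
  by have eC' : Ck U n (fun z => e z) := eC n; have rC : Ck U n (fun z => r0 z) := r0C n; rewrite /s1; Ck_poly oU.
have de i z : U z -> is_derive z (delta_mx 0 i) (fun u => e u) (partial i e z).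
  by move=> Uz; exact: (Ck_is_derive i (eC 1%N) Uz).
have dr i z : i != it -> U z -> is_derive z (delta_mx 0 i) (fun u => r0 u) 0 by exact: depends_on_t_isd.
have s1x z : U z -> partial ix s1 z = 0.
  move=> Uz; have d1 := de ix z Uz; have d2 := dr ix z isT Uz; rewrite /s1.
  by partial_by ltac:(rewrite /r0; move: (partial ix e z) => v; gen_coords; by field).
have s1y z : U z -> partial iy s1 z = partial iy e z + z 0 ix / 2 - z 0 iy ^+ 3 / 12 - r0 z * z 0 iy ^+ 2 / 4.
  move=> Uz; have d1 := de iy z Uz; have d2 := dr iy z isT Uz; rewrite /s1.
  by partial_by ltac:(move: (partial iy e z) (r0 z) => v w; gen_coords; by field).
pose s0 := partial iy s1.
have s0C n : Ck U n s0 := Ck_partial iy (s1C n.+1).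
have s0t : depends_on_t U s0.
  split=> // i z ii Uz; case: (xyE i ii) => ->.
    rewrite (partial_eq_on iy oU Uz s1y); have [_ _ H3] := H z Uz.
    have d1 : is_derive z (delta_mx 0 iy) (fun u => partial iy e u) (partial iy (partial iy e) z).
      exact: (Ck_is_derive iy (Ck_partial iy (eC 2%N)) Uz).
    have d2 := dr iy z isT Uz.
    have eyy : partial iy (partial iy e) z = 2^-1 * (z 0 iy * partial ix e z + z 0 iy ^+ 2).
      by move: H3; move: (partial iy (partial iy e) z) (z 0 iy * partial ix e z + z 0 iy ^+ 2) => v w; lra.
    rewrite eyy in d1; partial_by ltac:(rewrite /r0; move: (partial ix e z) => v; gen_coords; by field).
  rewrite /s0 (Schwarz ix iy oU Uz (s1C 2%N)) (partial_eq_on iy oU Uz s1x).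
  by apply: is_derive_partial; exact: isdC.
pose k0 z := s1 z - s0 z * z 0 iy.
have k0C n : Ck U n k0.
  have a : Ck U n (fun z => s1 z) := s1C n; have c : Ck U n (fun z => s0 z) := s0C n; rewrite /k0; Ck_poly oU.
exists r0, s0, k0; split=> // [|z Uz].
  split=> // i z ii Uz.
  have d1 : is_derive z (delta_mx 0 i) (fun u => s1 u) (partial i s1 z) by exact: (Ck_is_derive i (s1C 1%N) Uz).
  have d2 : is_derive z (delta_mx 0 i) (fun u => s0 u) 0 by exact: (depends_on_t_isd s0t ii Uz).
  have dE : partial i s1 z = s0 z * (i == iy)%:R by case: (xyE i ii) => ->; rewrite /= ?mulr1 ?mulr0 ?s1x.
  rewrite dE in d1; rewrite /k0; partial_by ltac:(move: (s0 z) (_%:R) => v w; gen_coords; by ring).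
rewrite /k0 /s1; move: (s0 z) (r0 z) (e z) => *; gen_coords; by ring.
Qed.

Variables (M : topologicalType) (A : set (chart R M)).
Variables (h : chart R M -> E -> 'M[R]_3) (omega : chart R M -> E -> E) (D : chart R M -> connection R).
Hypotheses (MA : smooth_3manifold A) (WS : weyl_structure A h omega D).
Hypotheses (EW : einstein_weyl A h omega) (W0 : vanishing_scalar_curvature A h omega).
Hypothesis sL : metric_of_signature A sig_lorentzian h.
Local Notation form := (local_form A h omega).

Lemma local_form_std_eq O U b e b' e' : form O U (std_metric b e) omega_normal ->
  (forall z, U z -> b z = b' z /\ e z = e' z) -> form O U (std_metric b' e') omega_normal.
Proof.
by move=> L H; apply: (local_form_eq MA WS L) => z /H [bz ez]; rewrite /std_metric bz ez.
Qed.

(** Shear by a primitive of b in y; because b_x = 0 it does not depend on x. *)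
Lemma eliminate_b O p r b e : form O (cube p r) (std_metric b e) omega_normal -> 0 < r ->
  (forall z, cube p r z -> partial ix b z = 0) ->
  exists p' r' e', 0 < r' /\ form O (cube p' r') (std_metric (fun _ => 0) e') omega_normal.
Proof.
move=> L r0 bx; have [oU bC eC _] := std_form_equations WS EW W0 sL L.
have [r1 r10 r1r] : exists2 r1 : R, 0 < r1 & r1 < r by exists (r / 2); lra.
have s1 : cube p r1 `<=` cube p r by apply: cube_sub; exact: ltW.
have [g gE] := exists_primitive iy r10 r1r (fun x cx => Ck_cont (bC 0%N) cx).
have gC n : Ck (cube p r1) n g by apply: primitive_Ck gE _; exact: Ck_sub s1 (bC n).
have gx z : cube p r1 z -> partial ix g z = 0.
  move=> cz; apply: is_derive_partial; apply: (primitive_der _ gE (zero_primitive _ _ _) _ _ cz) => //.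
    by move=> y cy; rewrite -(bx y (s1 _ cy)); exact: Ck_is_derive (bC 1%N) (s1 _ cy).
  by move=> y cy; exact: contC.
have o1 := @cube_open R p r1.
have [U' [V [Psi [b' [e' [sU U'p Df F HE]]]]]] := shear MA WS (local_form_sub MA WS L o1 s1) (cube_center _ r10) gC gx.
have [r' r'0 rV] := open_cube (diffeo_open' Df) (diffeo_map Df U'p).
exists (shear_map g p), r', e'; split=> //.
have F' := local_form_sub MA WS F (@cube_open R _ r') rV.
apply: (local_form_std_eq F') => w cw; split=> //; have Uz := diffeo_map' Df (rV _ cw).
rewrite -(diffeo_K' Df (rV _ cw)); have [-> _] := HE _ Uz.
by rewrite (is_derive_partial (gE.2 _ (sU _ Uz))) subrr.
Qed.

(** A shear by f(t) removes the term K. Replacing x by x - f adds - f R + f y / 2 to e, and the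
    shear itself - 2 f'; so f has to solve 2 f' = K - R f, and f / 2 is absorbed into S. *)
Lemma first_family O p r e : form O (cube p r) (std_metric (fun _ => 0) e) omega_normal -> 0 < r ->
  exists p' r' rf sf, [/\ 0 < r', form O (cube p' r') (std_metric (fun _ => 0) (h1_tt rf sf)) omega_normal,
    C2_on (t_range (cube p' r')) rf & C2_on (t_range (cube p' r')) sf].
Proof.
move=> L r0; have [oU _ eC eq] := std_form_equations WS EW W0 sL L.
have p0 i : partial i (fun _ : E => 0 : R) = fun _ => 0.
  by apply/funext => z; apply: is_derive_partial; exact: isdC.
have [|R0 [S0 [K0 [Rt St Kt eE]]]] := first_family_structure eC.
  move=> z cz; case: (eq z cz); rewrite !p0 => _ _ exx eyx eyy; split.
  - by rewrite exx expr0n mul0r.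
  - rewrite mulr0 add0r mulr1 !mul0r !subr0 in eyx.
    by apply/eqP; rewrite -addr_eq0 addrC; apply/eqP.
  - rewrite -[RHS]eyy; move: (partial iy (partial iy e) z) (partial iy (partial ix e) z) (partial ix e z) (partial iy e z) (e z) => *.
    by gen_coords; field.
have [r1 r10 r1r] : exists2 r1 : R, 0 < r1 & r1 < r by exists (r / 2); lra.
have [r2 r20 r2r] : exists2 r2 : R, 0 < r2 & r2 < r1 by exists (r1 / 2); lra.
have s1 : cube p r1 `<=` cube p r by apply: cube_sub; exact: ltW.
have s2 : cube p r2 `<=` cube p r1 by apply: cube_sub; exact: ltW.
have [P PE] := exists_primitive it r10 r1r (fun x cx => Ck_cont (Rt.1 0%N) cx).
have o1 := @cube_open R p r1; have o2 := @cube_open R p r2.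
have Pt := depends_on_t_primitive (depends_on_t_sub s1 Rt) PE.
(* Integrating factor for f: u is the exponential of half a primitive of R, and f = Q / u with Q' =
   K u / 2. *)
pose u z := expR (2^-1 * P z).
have u0 z : u z != 0 by rewrite gt_eqF // expR_gt0.
have uC n : Ck (cube p r1) n u by apply: (Ck_exp o1); apply: (Ck_mul o1 (Ck_cst _ _ o1) (Pt.1 n)).
have du i z (d : R) : is_derive z (delta_mx 0 i) P d -> is_derive z (delta_mx 0 i) (fun z => u z) (u z * (2^-1 * d)).
  by move=> H; exact: (isd_exp (isdZ 2^-1 H)).
pose k z := 2^-1 * K0 z * u z.
have K1 := depends_on_t_sub s1 Kt.
have kt : depends_on_t (cube p r1) k.
  split=> [n|i z ii cz].
    by apply: (Ck_mul o1 _ (uC n)); apply: (Ck_mul o1 (Ck_cst _ _ o1) (K1.1 n)).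
  apply: is_derive_partial.
  apply: (isd_eq (isdM (isdZ 2^-1 (depends_on_t_isd K1 ii cz)) (du i z 0 (depends_on_t_isd Pt ii cz)))).
  by rewrite !mulr0 mul0r addr0.
have [Q QE] := exists_primitive it r20 r2r (fun x cx => Ck_cont (kt.1 0%N) cx).
have Qt := depends_on_t_primitive (depends_on_t_sub s2 kt) QE.
pose f z := Q z * (u z)^-1.
have uiC n : Ck (cube p r2) n (fun z => (u z)^-1) by apply: (Ck_inv o2) => //; exact: Ck_sub s2 (uC n).
have df i z (a d : R) : is_derive z (delta_mx 0 i) P a -> is_derive z (delta_mx 0 i) Q d ->
    partial i f z = d * (u z)^-1 + Q z * (- ((u z)^-1 * (u z)^-1) * (u z * (2^-1 * a))).
  by move=> Ha Hd; apply: is_derive_partial; exact: (isdM Hd (isd_coordinv (u0 z) (du i z a Ha))).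
have ft : depends_on_t (cube p r2) f.
  split=> [n|i z ii cz]; first exact: (Ck_mul o2 (Qt.1 n) (uiC n)).
  rewrite (df i z 0 0 (depends_on_t_isd Pt ii (s2 _ cz)) (depends_on_t_isd Qt ii cz)).
  by rewrite !mulr0 mul0r addr0.
have ftE z : cube p r2 z -> 2 * partial it f z = K0 z - R0 z * f z.
  move=> cz; rewrite (df it z _ _ (PE.2 _ (s2 _ cz)) (QE.2 _ cz)) /k /f; move: (u0 z).
  by move: (u z) (Q z) (K0 z) (R0 z) => *; field.
have s3 : cube p r2 `<=` cube p r by exact: subset_trans s2 s1.
have [U' [V [Psi [b' [e' [sU U'p Df F HE]]]]]] :=
  shear MA WS (local_form_sub MA WS L o2 s3) (cube_center _ r20) ft.1 (fun z => ft.2 ix z isT).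
have [r' r'0 rV] := open_cube (diffeo_open' Df) (diffeo_map Df U'p).
pose r3 := Num.min r' r2.
have r30 : 0 < r3 by rewrite lt_min r'0.
have s4 : cube (shear_map f p) r3 `<=` V by apply: subset_trans rV; apply: cube_sub; rewrite ge_min lexx.
pose St' z := S0 z + 2^-1 * f z.
have S't : depends_on_t (cube p r2) St'.
  have S1 := depends_on_t_sub s3 St.
  split=> [n|i z ii cz]; first by apply: (Ck_add o2 (S1.1 n)); apply: (Ck_mul o2 (Ck_cst _ _ o2) (ft.1 n)).
  apply: is_derive_partial; apply: (isd_eq (isdD (depends_on_t_isd S1 ii cz) (isdZ 2^-1 (depends_on_t_isd ft ii cz)))).
  by rewrite mulr0 addr0.
have R3 := depends_on_t_sub s3 Rt.
have tE z : shear_map f z 0 it = z 0 it by rewrite /shear_map upd_other.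
exists (shear_map f p), r3, (fun t => R0 (upd p it t)), (fun t => St' (upd p it t)).
have range : t_range (cube (shear_map f p) r3) `<=` [set t | `|t - p 0 it| < r2].
  move=> _ [w cw <-]; rewrite /= -(tE p); apply: lt_le_trans (cw it) _.
  by rewrite ge_min lexx orbT.
split=> //.
- have F' := local_form_sub MA WS F (@cube_open R _ r3) s4.
  apply: (local_form_std_eq F') => w cw; have Uz := diffeo_map' Df (s4 _ cw).
  rewrite -(diffeo_K' Df (s4 _ cw)); move: (Psi w) Uz => z Uz {w cw}.
  have cz := sU _ Uz; have [-> ->] := HE _ Uz.
  rewrite (ft.2 iy z isT cz) subrr; split=> //.
  rewrite (ftE _ cz) eE; last exact: s3.
  have yE : shear_map f z 0 iy = z 0 iy by rewrite /shear_map upd_other.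
  have xE : shear_map f z 0 ix = z 0 ix + f z by rewrite /shear_map upd_same.
  rewrite /h1_tt tE yE xE -(t_only R3.1 R3.2 cz) -(t_only S't.1 S't.2 cz) /St'.
  by move: (R0 z) (S0 z) (K0 z) (f z) => *; gen_coords; field.
- by move=> t /range; exact: line_C2 R3.1 t.
- by move=> t /range; exact: line_C2 S't.1 t.
Qed.
End FirstFamily.

(** * The case of nonzero b_x: the family h2 *)

Section SecondFamily.
Context {R : realType}.
Local Notation E := 'rV[R]_3.
Implicit Types (U V W : set E) (x z p q u : E) (i j k l m : 'I_3) (f g b e : E -> R) (r t : R).
Local Opaque partial upd.
Variables (M : topologicalType) (A : set (chart R M)).
Variables (h : chart R M -> E -> 'M[R]_3) (omega : chart R M -> E -> E) (D : chart R M -> connection R).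
Hypotheses (MA : smooth_3manifold A) (WS : weyl_structure A h omega D).
Hypotheses (EW : einstein_weyl A h omega) (W0 : vanishing_scalar_curvature A h omega).
Hypothesis sL : metric_of_signature A sig_lorentzian h.
Local Notation form := (local_form A h omega).

(* Here [b_x = -2 / (y + mu(t))]; the rescaling by [k = exp (int mu / 2)] turns [y + mu] into the new [y]. *)
Lemma rescale O p r b e : form O (cube p r) (std_metric b e) omega_normal -> 0 < r ->
  (forall z, cube p r z -> partial ix b z != 0) ->
  exists p' r' b' e', [/\ 0 < r', form O (cube p' r') (std_metric b' e') omega_normal &
    forall w, cube p' r' w -> w 0 iy != 0 /\ partial ix b' w = - 2 / w 0 iy].
Proof.
move=> L r0 b0; have [oU bC eC eq] := std_form_equations WS EW W0 sL L.
have bxC n := Ck_partial ix (bC n.+1).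
have [r1 r10 r1r] : exists2 r1 : R, 0 < r1 & r1 < r by exists (r / 2); lra.
have [r2 r20 r2r] : exists2 r2 : R, 0 < r2 & r2 < r1 by exists (r1 / 2); lra.
have s1 : cube p r1 `<=` cube p r by apply: cube_sub; exact: ltW.
have s2 : cube p r2 `<=` cube p r1 by apply: cube_sub; exact: ltW.
have s3 := subset_trans s2 s1.
have o1 := @cube_open R p r1; have o2 := @cube_open R p r2.
have xyE i : i != it -> i = iy \/ i = ix by elim/ord3_ind: i => // _; [left | right].
(* Solves b_x = - 2 / (y + mu) for mu. Since 1 / b_x has y-derivative - 1 / 2 and no x-derivative,
   mu depends on t only. *)
pose mu z := - 2 * (partial ix b z)^-1 - z 0 iy.
have mut : depends_on_t (cube p r) mu.
  split=> [n|i z ii cz].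
    apply: (Ck_sub2 oU _ (Ck_coord n iy oU)); apply: (Ck_mul oU (Ck_cst _ _ oU)).
    exact: (Ck_inv oU b0 (bxC n)).
  have db := Ck_is_derive i (bxC 1%N) cz.
  have := isdB (isdZ (- 2) (isd_coordinv (b0 z cz) db)) (is_derive_coord z i iy).
  move=> /is_derive_partial ->; have [bxx byx _ _ _] := eq z cz; have := b0 z cz.
  case: (xyE i ii) => ->; rewrite ?bxx ?byx /=; move: (partial ix b z) => c c0; by field.
have [P PE] := exists_primitive it r10 r1r (fun x cx => Ck_cont (mut.1 0%N) cx).
have mu1 := depends_on_t_sub s1 mut.
have Pt := depends_on_t_primitive mu1 PE.
pose m z := 2^-1 * P z.
have mC n : Ck (cube p r1) n m by exact: (Ck_mul o1 (Ck_cst _ _ o1) (Pt.1 n)).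
pose k z := expR (m z).
have k0 z : k z != 0 by rewrite gt_eqF // expR_gt0.
have kC n : Ck (cube p r1) n k by exact: (Ck_exp o1 (mC n)).
have dm i z (d : R) : is_derive z (delta_mx 0 i) P d -> is_derive z (delta_mx 0 i) m (2^-1 * d).
  by move=> H; exact: isdZ.
have dk i z (d : R) : is_derive z (delta_mx 0 i) P d -> is_derive z (delta_mx 0 i) k (k z * (2^-1 * d)).
  by move=> H; exact: (isd_exp (dm i z d H)).
have dk0 i z : i != it -> cube p r1 z -> is_derive z (delta_mx 0 i) k 0.
  by move=> ii cz; apply: (isd_eq (dk i z 0 (depends_on_t_isd Pt ii cz))); rewrite !mulr0.
have dkt z : cube p r1 z -> is_derive z (delta_mx 0 it) k (k z * (2^-1 * mu z)).
  by move=> cz; apply: dk; exact: PE.2.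
have kit : depends_on_t (cube p r1) (fun z => (k z)^-1).
  split=> [n|i z ii cz]; first exact: (Ck_inv o1 (fun z _ => k0 z) (kC n)).
  by apply: is_derive_partial; apply: (isd_eq (isd_coordinv (k0 z) (dk0 i z ii cz))); rewrite mulr0.
have [T TE] := exists_primitive it r20 r2r (fun x cx => Ck_cont (kit.1 0%N) cx).
have Tt := depends_on_t_primitive (depends_on_t_sub s2 kit) TE.
pose dmu := partial it mu.
have dmu0 i z : i != it -> cube p r z -> is_derive z (delta_mx 0 i) dmu 0.
  move=> ii cz; rewrite -(depends_on_t_partial oU mut cz ii).
  exact: (Ck_is_derive i (Ck_partial it (mut.1 2%N)) cz).
pose a z := k z * (2^-1 * mu z) * (z 0 iy + mu z) + k z * dmu z.
pose B z := k z ^+ 2 * b z - k z * a z.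
pose c z := 3 * k z ^+ 3 * (2^-1 * mu z) * z 0 ix.
pose C z := k z ^+ 2 * (k z ^+ 2 * e z - a z ^+ 2 - 2 * c z / k z - 2 * B z * a z / k z).
(* With the metric multiplied by k^2, the powers k, k^3 and 1 / k on y + mu, x and dt keep dy^2 and
   2 dx dt normalised. The gauge term 2 d ln k = mu dt turns y dt into (y + mu) dt. *)
pose Phi (z : E) : E := \row_j (match val j with 0 => k z * (z 0 iy + mu z) | 1 => k z ^+ 3 * z 0 ix | _ => T z end).
have PC : smooth_map (cube p r2) Phi.
  move=> n j; have kC2 := Ck_sub s2 (kC n); elim/ord3_ind: j.
  - apply: (Ck_eq (f := fun z => k z * (z 0 iy + mu z)) o2) => [z _|]; first by rewrite mxE.
    by apply: (Ck_mul o2 kC2); apply: (Ck_add o2 (Ck_coord n iy o2)); exact: Ck_sub s3 (mut.1 n).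
  - apply: (Ck_eq (f := fun z => k z ^+ 3 * z 0 ix) o2) => [z _|]; first by rewrite mxE.
    exact: (Ck_mul o2 (Ck_pow 3 o2 kC2) (Ck_coord n ix o2)).
  - by apply: Ck_eq o2 _ (Tt.1 n) => z _; rewrite mxE.
have dPhi i z (d dm' : R) : is_derive z (delta_mx 0 i) k d -> is_derive z (delta_mx 0 i) mu dm' ->
   jac Phi z i iy = d * (z 0 iy + mu z) + k z * ((i == iy)%:R + dm') /\
   jac Phi z i ix = 3 * k z ^+ 2 * d * z 0 ix + k z ^+ 3 * (i == ix)%:R.
  move=> Hd Hm; rewrite !jacobianE; split.
    rewrite (_ : (fun u => Phi u 0 iy) = fun u => k u * (u 0 iy + mu u)); last by apply/funext => u; rewrite mxE.
    by apply: is_derive_partial; exact: (isdM Hd (isdD (is_derive_coord z i iy) Hm)).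
  rewrite (_ : (fun u => Phi u 0 ix) = fun u => k u ^+ 3 * u 0 ix); last by apply/funext => u; rewrite mxE.
  by apply: is_derive_partial; exact: (isdM (isdXn 2 Hd) (is_derive_coord z i ix)).
have Jt i z : jac Phi z i it = partial i T z by rewrite jacobianE; congr partial; apply/funext => u; rewrite mxE.
have J z : cube p r2 z -> [/\ [/\ jac Phi z iy iy = k z, jac Phi z iy ix = 0 & jac Phi z iy it = 0],
   [/\ jac Phi z ix iy = 0, jac Phi z ix ix = k z ^+ 3 & jac Phi z ix it = 0] &
   [/\ jac Phi z it iy = a z, jac Phi z it ix = c z & jac Phi z it it = (k z)^-1]].
  move=> cz; have cz1 := s2 _ cz; have cz0 := s1 _ cz1.
  have [y1 y2] := dPhi iy z _ _ (dk0 iy z isT cz1) (depends_on_t_isd (i := iy) mut isT cz0).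
  have [x1 x2] := dPhi ix z _ _ (dk0 ix z isT cz1) (depends_on_t_isd (i := ix) mut isT cz0).
  have [t1 t2] := dPhi it z _ _ (dkt z cz1) (Ck_is_derive it (mut.1 1%N) cz0).
  rewrite y1 y2 x1 x2 t1 t2 !Jt (Tt.2 iy z isT cz) (Tt.2 ix z isT cz) (is_derive_partial (TE.2 _ cz)) /=.
  by split; split => //; rewrite /a /c /dmu; move: (k z) (mu z) (partial it mu z) => *; gen_coords; ring.
have pc : cube p r2 p by exact: cube_center.
have Ju : jac Phi p \in unitmx.
  have [[y1 y2 y3] [x1 x2 x3] [t1 t2 t3]] := J p pc.
  by apply: triangular_unit; rewrite ?y1 ?x2 ?t3 // ?invr_eq0 // expf_neq0.
have L1 := local_form_gauge (local_form_sub MA WS L o2 s3) (fun n => Ck_sub s2 (mC n)).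
have [|U' [V [Psi [b' [e' [sU U'p Df F HE]]]]]] := @change_to_std R M A h omega D MA WS O (cube p r2) _ _ Phi B C p L1 pc PC Ju.
  move=> z cz; have [[y1 y2 y3] [x1 x2 x3] [t1 t2 t3]] := J z cz; have cz1 := s2 _ cz.
  have Py : Phi z 0 iy = k z * (z 0 iy + mu z) by rewrite mxE.
  move: y1 y2 y3 x1 x2 x3 t1 t2 t3; move: (jac Phi z) => Jz y1 y2 y3 x1 x2 x3 t1 t2 t3; split.
    apply/matrixP => i j; rewrite !mxE !sum3E !mxE !sum3E !mxE -/(k z).
    elim/ord3_ind: i; elim/ord3_ind: j; rewrite /= ?y1 ?y2 ?y3 ?x1 ?x2 ?x3 ?t1 ?t2 ?t3 /C /B;
      move: (k z) (k0 z) (a z) (c z) (b z) (e z) => *; first [by ring | by field].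
  apply/rowP => i; rewrite mxE [RHS]mxE sum3E !omega_normalE Py !mxE /=.
  have -> : partial i m z = (i == it)%:R * (2^-1 * mu z).
    apply: is_derive_partial; have [->|ii] := eqVneq i it; first by rewrite mul1r; apply: dm; exact: PE.2.
    by rewrite mul0r; apply: (isd_eq (dm i z 0 (depends_on_t_isd Pt ii cz1))); rewrite mulr0.
  elim/ord3_ind: i; rewrite /= ?y3 ?x3 ?t3; move: (k z) (k0 z) (mu z) => *; gen_coords; by field.
have [r' r'0 rV] := open_cube (diffeo_open' Df) (diffeo_map Df U'p).
have F' := local_form_sub MA WS F (@cube_open R _ r') rV.
exists (Phi p), r', b', e'; split; [exact: r'0 | exact: F' | ].
move=> w cw; have Vw := rV _ cw; have Uz := diffeo_map' Df Vw; have wE := diffeo_K' Df Vw.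
move: (Psi w) Uz wE => z Uz wE; rewrite -wE {w cw Vw wE}.
have cz := sU _ Uz; have [[y1 y2 y3] [x1 x2 x3] [t1 t2 t3]] := J z cz; have cz1 := s2 _ cz; have cz0 := s1 _ cz1.
have Py : Phi z 0 iy = - 2 * k z * (partial ix b z)^-1.
  by rewrite mxE /= /mu; move: (k z) (_^-1) => *; gen_coords; ring.
have bz := b0 z cz0; split.
  by rewrite Py !mulf_neq0 ?invr_eq0 ?oppr_eq0 ?pnatr_eq0.
have [_ bC' _ _] := std_form_equations WS EW W0 sL F.
have := partial_comp ix (diffeo_open Df) (diffeo_open' Df) Uz (diffeo_map Df Uz) (diffeo_smooth Df) (bC' 1%N).
rewrite sum3E -!(jacobianE Phi) x1 x2 x3 !mulr0 add0r addr0.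
rewrite (partial_eq_on ix (diffeo_open Df) Uz (fun y Uy => proj1 (HE y Uy))).
have -> : partial ix B z = k z ^+ 2 * partial ix b z.
  have d1 : is_derive z (delta_mx 0 ix) (fun u => k u) 0 by exact: dk0.
  have d2 : is_derive z (delta_mx 0 ix) (fun u => mu u) 0 by exact: (depends_on_t_isd (i := ix) mut isT cz0).
  have d3 : is_derive z (delta_mx 0 ix) (fun u => dmu u) 0 by exact: dmu0.
  have d4 : is_derive z (delta_mx 0 ix) (fun u => b u) (partial ix b z) by exact: (Ck_is_derive ix (bC 1%N) cz0).
  rewrite /B /a; partial_by ltac:(move: (k z) (mu z) (dmu z) (partial ix b z) (b z) => *; gen_coords; by ring).
rewrite Py; move: (partial ix b' _) (partial ix b z) bz (k z) (k0 z) => v w w0 s s0 H.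
have -> : v = w / s.
  by apply: (mulIf (expf_neq0 3 s0)); rewrite -H; field.
by field; rewrite w0 s0.
Qed.

Lemma isd_Y i z : z 0 iy != 0 -> is_derive z (delta_mx 0 i) (fun u => (u 0 iy)^-1) ((i == iy)%:R * - ((z 0 iy)^-1 * (z 0 iy)^-1)).
Proof. by move=> z0; apply: (isd_eq (isd_coordinv z0 (is_derive_coord z i iy))); rewrite mulrC. Qed.

Lemma partial_h2_yt i z : z 0 iy != 0 ->
  partial i (@h2_yt R) z = - 2 * (i == ix)%:R * (z 0 iy)^-1 + 2 * z 0 ix * (i == iy)%:R * (z 0 iy)^-1 ^+ 2.
Proof.
move=> z0; have d := isd_Y i z0; rewrite /h2_yt.
partial_by ltac:(move: (_%:R) (_%:R) (_^-1) => *; gen_coords; by ring).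
Qed.

(** Here b = - 2 x / y + c(y, t). To remove c a shear by g must satisfy g_y - 2 g / y = c; with g =
    y^2 G this is G_y = c / y^2. *)
Lemma normalise_b O p r b e : form O (cube p r) (std_metric b e) omega_normal -> 0 < r ->
  (forall z, cube p r z -> z 0 iy != 0 /\ partial ix b z = - 2 / z 0 iy) ->
  exists p' r' e', [/\ 0 < r', form O (cube p' r') (std_metric h2_yt e') omega_normal &
    forall w, cube p' r' w -> w 0 iy != 0].
Proof.
move=> L r0 H; have [oU bC eC _] := std_form_equations WS EW W0 sL L.
have [r1 r10 r1r] : exists2 r1 : R, 0 < r1 & r1 < r by exists (r / 2); lra.
have s1 : cube p r1 `<=` cube p r by apply: cube_sub; exact: ltW.
have o1 := @cube_open R p r1.
have YC n : Ck (cube p r) n (fun z => (z 0 iy)^-1) by apply: (Ck_inv oU _ (Ck_coord n iy oU)) => z /H [].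
pose c z := b z + 2 * z 0 ix * (z 0 iy)^-1.
pose q z := c z * (z 0 iy)^-1 ^+ 2.
have qC n : Ck (cube p r) n q.
  by have bn : Ck (cube p r) n (fun z => b z) := bC n; have yn := YC n; rewrite /q /c; Ck_poly oU.
have qx z : cube p r z -> is_derive z (delta_mx 0 ix) q 0.
  move=> cz; have [z0 bx] := H z cz; have d1 := isd_Y ix z0.
  have d2 : is_derive z (delta_mx 0 ix) (fun u => b u) (- 2 / z 0 iy) by rewrite -bx; exact: (Ck_is_derive ix (bC 1%N) cz).
  rewrite /q /c; unshelve notypeclasses refine (isd_eq _ _); [shelve | is_derive_poly | cbv beta; rewrite /=].
  by move: (b z) (z 0 iy)^-1 => *; gen_coords; ring.
have [G GE] := exists_primitive iy r10 r1r (fun x cx => Ck_cont (qC 0%N) cx).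
have GC n : Ck (cube p r1) n G by apply: primitive_Ck GE _; exact: Ck_sub s1 (qC n).
have Gx z : cube p r1 z -> is_derive z (delta_mx 0 ix) G 0.
  move=> cz; apply: (primitive_der _ GE (zero_primitive _ _ _) _ _ cz) => //.
    by move=> y cy; exact: qx (s1 _ cy).
  by move=> y cy; exact: contC.
pose g z := z 0 iy ^+ 2 * G z.
have gC n : Ck (cube p r1) n g.
  by have Gn : Ck (cube p r1) n (fun z => G z) := GC n; rewrite /g; Ck_poly o1.
have gx z : cube p r1 z -> partial ix g z = 0.
  move=> cz; have d1 : is_derive z (delta_mx 0 ix) (fun u => G u) 0 by exact: Gx.
  by rewrite /g; partial_by ltac:(gen_coords; ring).
have gy z : cube p r1 z -> partial iy g z = 2 * z 0 iy * G z + c z.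
  move=> cz; have d1 : is_derive z (delta_mx 0 iy) (fun u => G u) (q z) by exact: GE.2.
  have [z0 _] := H z (s1 _ cz).
  by rewrite /g; partial_by ltac:(rewrite /q; move: (c z) (G z) z0 => ? ?; gen_coords; move=> ?; field).
have [U' [V [Psi [b' [e' [sU U'p Df F HE]]]]]] := shear MA WS (local_form_sub MA WS L o1 s1) (cube_center _ r10) gC gx.
have [r' r'0 rV] := open_cube (diffeo_open' Df) (diffeo_map Df U'p).
have F' := local_form_sub MA WS F (@cube_open R _ r') rV.
have yE z : shear_map g z 0 iy = z 0 iy by rewrite /shear_map upd_other.
have xE z : shear_map g z 0 ix = z 0 ix + g z by rewrite /shear_map upd_same.
exists (shear_map g p), r', e'; split=> // [|w cw]; last first.
  have Uz := diffeo_map' Df (rV _ cw); rewrite -(diffeo_K' Df (rV _ cw)) yE.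
  by have [] := H _ (s1 _ (sU _ Uz)).
apply: (local_form_std_eq MA WS F') => w cw; split=> //; have Uz := diffeo_map' Df (rV _ cw).
rewrite -(diffeo_K' Df (rV _ cw)); move: (Psi w) Uz => z Uz; have [-> _] := HE _ Uz.
have [z0 _] := H _ (s1 _ (sU _ Uz)).
rewrite (gy z (sU _ Uz)) /h2_yt xE yE /g /c; move: (b z) (G z) z0 => ? ?; gen_coords; move=> ?; by field.
Qed.

(** e_x differs from its normal value by a function P(t). The shears that preserve b satisfy g_y = 2
    g / y, and g = P y^2 / 2 shifts 2 x / y^2 by exactly P. *)
Lemma normalise_ex O p r e : form O (cube p r) (std_metric h2_yt e) omega_normal -> 0 < r ->
  (forall z, cube p r z -> z 0 iy != 0) ->
  exists p' r' e', [/\ 0 < r', form O (cube p' r') (std_metric h2_yt e') omega_normal &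
    forall w, cube p' r' w -> w 0 iy != 0 /\
      partial ix e' w = 2 * w 0 ix * (w 0 iy)^-1 ^+ 2 + w 0 iy / 2].
Proof.
move=> L r0 H; have [oU _ eC eq] := std_form_equations WS EW W0 sL L.
have YC n : Ck (cube p r) n (fun z => (z 0 iy)^-1) by apply: (Ck_inv oU _ (Ck_coord n iy oU)) => z /H.
pose P z := partial ix e z - 2 * z 0 ix * (z 0 iy)^-1 ^+ 2 - z 0 iy / 2.
have Pt : depends_on_t (cube p r) P.
  split=> [n|i z ii cz].
    have en : Ck (cube p r) n (fun z => partial ix e z) := Ck_partial ix (eC n.+1).
    by have yn := YC n; rewrite /P; Ck_poly oU.
  have z0 := H z cz; have d1 := isd_Y i z0.
  have d2 : is_derive z (delta_mx 0 i) (fun u => partial ix e u) (partial i (partial ix e) z).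
    exact: (Ck_is_derive i (Ck_partial ix (eC 2%N)) cz).
  have [_ _ exx eyx _] := eq z cz.
  have b2t : partial ix (partial it h2_yt) z = 0.
    rewrite (partial_eq_on ix oU cz (fun y cy => partial_h2_yt it (H y cy))) /=.
    have d3 := isd_Y ix z0; partial_by ltac:(gen_coords; by ring).
  rewrite b2t !partial_h2_yt // in exx eyx; move: exx eyx; rewrite /= !mulr0 !mul0r !addr0 mulr1 => exx eyx.
  have eyx' : partial iy (partial ix e) z = 2^-1 - 4 * z 0 ix * (z 0 iy)^-1 ^+ 3.
    by apply/eqP; rewrite -subr_eq0 -[X in _ == X]eyx /h2_yt; apply/eqP; move: (partial iy _ z) z0 => ?; gen_coords; move=> ?; field.
  have xyE : i = iy \/ i = ix by move: (i) ii; apply: ord3_ind => // _; [left | right].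
  rewrite /P; case: xyE d1 d2 => ->; rewrite ?exx ?eyx' => d1 d2.
    partial_by ltac:(move: ((z 0 iy)^-1) => *; gen_coords; by field).
  partial_by ltac:(move: ((z 0 iy)^-1) => *; gen_coords; by field).
pose g z := 2^-1 * P z * z 0 iy ^+ 2.
have gC n : Ck (cube p r) n g.
  by have Pn : Ck (cube p r) n (fun z => P z) := Pt.1 n; rewrite /g; Ck_poly oU.
have gx z : cube p r z -> partial ix g z = 0.
  move=> cz; have d1 : is_derive z (delta_mx 0 ix) (fun u => P u) 0 by exact: (depends_on_t_isd (i := ix) Pt isT cz).
  by rewrite /g; partial_by ltac:(gen_coords; ring).
have gy z : cube p r z -> partial iy g z = P z * z 0 iy.
  move=> cz; have d1 : is_derive z (delta_mx 0 iy) (fun u => P u) 0 by exact: (depends_on_t_isd (i := iy) Pt isT cz).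
  by rewrite /g; partial_by ltac:(move: (P z) => ?; gen_coords; field).
have gt z : cube p r z -> partial it g z = 2^-1 * partial it P z * z 0 iy ^+ 2.
  move=> cz; have d1 : is_derive z (delta_mx 0 it) (fun u => P u) (partial it P z) by exact: (Ck_is_derive it (Pt.1 1%N) cz).
  by rewrite /g; partial_by ltac:(move: (P z) (partial it P z) => ? ?; gen_coords; field).
have [U' [V [Psi [b' [e' [sU U'p Df F HE]]]]]] := shear MA WS L (cube_center _ r0) gC gx.
have [r' r'0 rV] := open_cube (diffeo_open' Df) (diffeo_map Df U'p).
have F' := local_form_sub MA WS F (@cube_open R _ r') rV.
have yE z : shear_map g z 0 iy = z 0 iy by rewrite /shear_map upd_other.
have xE z : shear_map g z 0 ix = z 0 ix + g z by rewrite /shear_map upd_same.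
have [_ _ eC' _] := std_form_equations WS EW W0 sL F.
exists (shear_map g p), r', e'; split=> // [|w cw].
  apply: (local_form_std_eq MA WS F') => w cw; split=> //; have Uz := diffeo_map' Df (rV _ cw).
  rewrite -(diffeo_K' Df (rV _ cw)); move: (Psi w) Uz => z Uz; have [-> _] := HE _ Uz.
  have z0 := H _ (sU _ Uz).
  rewrite (gy z (sU _ Uz)) /h2_yt xE yE /g; move: (P z) z0 => ?; gen_coords; move=> ?; by field.
have Uz := diffeo_map' Df (rV _ cw); rewrite -(diffeo_K' Df (rV _ cw)); move: (Psi w) Uz => z Uz {w cw}.
have cz := sU _ Uz; have z0 := H _ cz; rewrite yE xE; split=> //.
have := partial_comp ix (diffeo_open Df) (diffeo_open' Df) Uz (diffeo_map Df Uz) (diffeo_smooth Df) (eC' 1%N).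
have cst j : j != ix -> partial ix (fun z => shear_map g z 0 j) z = 0.
  move=> jx; rewrite (_ : (fun u => _) = fun u => u 0 j); last by apply/funext => u; rewrite /shear_map upd_other.
  by rewrite partial_coord eq_sym (negbTE jx).
have xx1 : partial ix (fun z => shear_map g z 0 ix) z = 1.
  rewrite (_ : (fun u => _) = fun u => u 0 ix + g u); last by apply/funext => u; exact: xE.
  rewrite (is_derive_partial (isdD (is_derive_coord z ix ix) (Ck_is_derive ix (gC 1%N) cz))) gx // addr0 //.
rewrite sum3E (cst iy isT) (cst it isT) xx1 !mulr0 mulr1 add0r addr0 => <-.
rewrite (partial_eq_on ix (diffeo_open Df) Uz (fun y Uy => proj2 (HE y Uy))).
have d1 := Ck_is_derive ix (eC 1%N) cz.
have d2 : is_derive z (delta_mx 0 ix) (partial it g) 0.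
  have -> : 0 = partial ix (partial it g) z.
    rewrite (Schwarz ix it oU cz (gC 2%N)) (partial_eq_on it oU cz gx).
    by symmetry; apply: is_derive_partial; exact: isdC.
  exact: (Ck_is_derive ix (Ck_partial it (gC 2%N)) cz).
rewrite (is_derive_partial (isdB d1 (isdZ 2 d2))) mulr0 subr0 /g /P.
by move: (partial ix e z) z0 => ?; gen_coords; move=> ?; field.
Qed.

(** [w] is what e contains besides the prescribed terms, divided by y. The last of the five
    equations reduces to w_yy = 0, so w = R y + S. *)
Lemma second_family_structure p r e : (forall n, Ck (cube p r) n e) ->
  (forall z, cube p r z -> z 0 iy != 0 /\ partial ix e z = 2 * z 0 ix * (z 0 iy)^-1 ^+ 2 + z 0 iy / 2) ->
  (forall z, cube p r z -> std_equations h2_yt e z) ->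
  exists R0 S0, [/\ depends_on_t (cube p r) R0, depends_on_t (cube p r) S0 &
    forall z, cube p r z -> e z = (z 0 ix / z 0 iy) ^+ 2 + z 0 ix * z 0 iy / 2 + z 0 iy ^+ 4 / 8
      + R0 z * z 0 iy ^+ 2 + S0 z * z 0 iy].
Proof.
move=> eC H eq; have oU := @cube_open R p r; set U := cube p r in oU eC H eq *.
have YC n : Ck U n (fun z => (z 0 iy)^-1) by apply: (Ck_inv oU _ (Ck_coord n iy oU)) => z /H [].
have xyE i : i != it -> i = iy \/ i = ix by elim/ord3_ind: i => // _; [left | right].
pose w z := (e z - (z 0 ix * (z 0 iy)^-1) ^+ 2 - z 0 ix * z 0 iy / 2) * (z 0 iy)^-1 - z 0 iy ^+ 3 / 8.
have wC n : Ck U n w.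
  by have en : Ck U n (fun z => e z) := eC n; have yn := YC n; rewrite /w; Ck_poly oU.
have wx z : U z -> partial ix w z = 0.
  move=> Uz; have [z0 ex] := H z Uz; have d1 := isd_Y ix z0.
  have d2 : is_derive z (delta_mx 0 ix) (fun u => e u) (partial ix e z) by exact: (Ck_is_derive ix (eC 1%N) Uz).
  rewrite ex in d2; rewrite /w; partial_by ltac:(move: (e z) z0 => ?; gen_coords; move=> ?; by field).
have dw i z : U z -> is_derive z (delta_mx 0 i) (fun u => w u) (partial i w z).
  by move=> Uz; exact: (Ck_is_derive i (wC 1%N) Uz).
have eE z : U z -> e z = (z 0 ix * (z 0 iy)^-1) ^+ 2 + z 0 ix * z 0 iy / 2 + z 0 iy ^+ 4 / 8 + w z * z 0 iy.
  by move=> /H [z0 _]; rewrite /w; move: (e z) z0 => ?; gen_coords; move=> ?; field.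
pose r0 := partial iy w.
have dr i z : U z -> is_derive z (delta_mx 0 i) (fun u => r0 u) (partial i r0 z).
  by move=> Uz; exact: (Ck_is_derive i (Ck_partial iy (wC 2%N)) Uz).
have ey z : U z -> partial iy e z = - 2 * z 0 ix ^+ 2 * (z 0 iy)^-1 ^+ 3 + z 0 ix / 2 + z 0 iy ^+ 3 / 2
    + r0 z * z 0 iy + w z.
  move=> Uz; have [z0 _] := H z Uz; rewrite (partial_eq_on iy oU Uz eE).
  have d1 := isd_Y iy z0; have d2 := dw iy z Uz.
  by partial_by ltac:(rewrite /r0; move: (w z) (partial iy w z) ((z 0 iy)^-1) => *; gen_coords; field).
have eyy z : U z -> partial iy (partial iy e) z = 6 * z 0 ix ^+ 2 * (z 0 iy)^-1 ^+ 4 + 3 * z 0 iy ^+ 2 / 2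
    + partial iy r0 z * z 0 iy + 2 * r0 z.
  move=> Uz; have [z0 _] := H z Uz; rewrite (partial_eq_on iy oU Uz ey).
  have d1 := isd_Y iy z0; have d3 := dr iy z Uz.
  have d2 : is_derive z (delta_mx 0 iy) (fun u => w u) (r0 z) by exact: dw.
  by partial_by ltac:(move: (w z) (r0 z) (partial iy r0 z) ((z 0 iy)^-1) => *; gen_coords; field).
have eyx z : U z -> partial iy (partial ix e) z = - 4 * z 0 ix * (z 0 iy)^-1 ^+ 3 + 2^-1.
  move=> Uz; have [z0 _] := H z Uz; rewrite (partial_eq_on iy oU Uz (fun y Uy => proj2 (H y Uy))).
  have d1 := isd_Y iy z0; partial_by ltac:(move: ((z 0 iy)^-1) => *; gen_coords; by field).
have b2t i z : U z -> i != it -> partial i (partial it h2_yt) z = 0.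
  move=> Uz ii; have [z0 _] := H z Uz.
  rewrite (partial_eq_on i oU Uz (fun y Uy => partial_h2_yt it (proj1 (H y Uy)))) /=.
  by have d3 := isd_Y i z0; partial_by ltac:(move: (_%:R) => ?; gen_coords; ring).
have ryy z : U z -> partial iy r0 z = 0.
  move=> Uz; have [z0 ex] := H z Uz; have [_ _ _ _] := eq z Uz.
  rewrite (eyy z Uz) (eyx z Uz) (ey z Uz) ex (b2t ix z Uz isT) (b2t iy z Uz isT) !partial_h2_yt //= (eE z Uz) /h2_yt.
  move: (w z) (r0 z) (partial iy r0 z) z0 => ? ? ?; gen_coords; move=> z0 E.
  by apply: (mulfI z0); rewrite mulr0 -[RHS](mulr0 (- 2)) -[in RHS]E; field.
have r0t : depends_on_t U r0.
  split=> [n|i z ii Uz]; first exact: Ck_partial (wC n.+1).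
  case: (xyE i ii) => ->; first exact: ryy.
  rewrite /r0 (Schwarz ix iy oU Uz (wC 2%N)) (partial_eq_on iy oU Uz wx).
  by apply: is_derive_partial; exact: isdC.
pose s0 z := w z - r0 z * z 0 iy.
exists r0, s0; split=> // [|z Uz].
  split=> [n|i z ii Uz].
    by apply: (Ck_sub2 oU (wC n)); exact: (Ck_mul oU (r0t.1 n) (Ck_coord n iy oU)).
  have d1 := dw i z Uz; have d2 : is_derive z (delta_mx 0 i) (fun u => r0 u) 0 by exact: (depends_on_t_isd r0t ii Uz).
  have dE : partial i w z = r0 z * (i == iy)%:R by case: (xyE i ii) => ->; rewrite /= ?mulr1 ?mulr0 ?wx.
  rewrite dE in d1; rewrite /s0; partial_by ltac:(move: (r0 z) (_%:R) => *; gen_coords; by ring).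
by rewrite (eE z Uz) /s0; move: (w z) (r0 z) ((z 0 iy)^-1) => *; gen_coords; ring.
Qed.

Lemma second_family O p r e : form O (cube p r) (std_metric h2_yt e) omega_normal -> 0 < r ->
  (forall z, cube p r z -> z 0 iy != 0) ->
  exists p' r' rf sf, [/\ 0 < r', form O (cube p' r') (std_metric h2_yt (h2_tt rf sf)) omega_normal,
    C2_on (t_range (cube p' r')) rf, C2_on (t_range (cube p' r')) sf & forall w, cube p' r' w -> w 0 iy != 0].
Proof.
move=> L0 r00 H0; have [p' [r' [e' [r0 L H]]]] := normalise_ex L0 r00 H0.
have [oU _ eC eq] := std_form_equations WS EW W0 sL L.
have [R0 [S0 [Rt St eE]]] := second_family_structure eC H eq.
exists p', r', (fun t => R0 (upd p' it t)), (fun t => S0 (upd p' it t)).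
have range : t_range (cube p' r') `<=` [set t | `|t - p' 0 it| < r'].
  by move=> _ [w cw <-]; exact: cw it.
split=> //.
- apply: (local_form_std_eq MA WS L) => z cz; split=> //.
  by rewrite eE // /h2_tt -(t_only Rt.1 Rt.2 cz) -(t_only St.1 St.2 cz).
- by move=> t /range; exact: line_C2 Rt.1 t.
- by move=> t /range; exact: line_C2 St.1 t.
- by move=> w /H [].
Qed.

End SecondFamily.

(** * Normal forms near a point where F does not vanish *)

Section LocalClassification.
Context {R : realType}.
Local Notation E := 'rV[R]_3.
Implicit Types (U V W : set E) (x z p q u : E) (i j k l m : 'I_3) (f g b e : E -> R) (r t : R).
Local Opaque partial upd.
Variables (M : topologicalType) (A : set (chart R M)).
Variables (h : chart R M -> E -> 'M[R]_3) (omega : chart R M -> E -> E) (D : chart R M -> connection R).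
Hypotheses (MA : smooth_3manifold A) (WS : weyl_structure A h omega D).
Hypotheses (EW : einstein_weyl A h omega) (W0 : vanishing_scalar_curvature A h omega).
Local Notation form := (local_form A h omega).

Lemma form_in_normal_form O p r b e rf sf : form O (cube p r) (std_metric b e) omega_normal -> 0 < r ->
  C2_on (t_range (cube p r)) rf -> C2_on (t_range (cube p r)) sf ->
  (forall q, cube p r q -> std_metric b e q = h1 rf sf q) \/
  (forall q, cube p r q -> q 0 iy != 0 /\ std_metric b e q = h2 rf sf q) ->
  exists c (v : M), [/\ A c, chart_dom c `<=` O, chart_dom c v & in_normal_form h omega c].
Proof.
move=> [c [psi [Ac cO cU pC P]]] r0 rC sC H; exists c.
have [x cx xp] : chart_img c p by rewrite cU; exact: cube_center.
exists x; split=> //; exists (fun z => expR (psi z)), rf, sf; rewrite cU; split=> //.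
- split=> [|q _]; last exact: expR_gt0.
  by apply/smooth_Ck => n; apply: Ck_exp => //; exact: cube_open.
- move=> q cq; rewrite (_ : (fun z => ln (expR (psi z))) = psi); first by case: (P _ cq) => _ ->.
  by apply/funext => z; rewrite expRK.
case: H => H; [left | right] => q cq; have [<- _] := P _ cq; first exact: H.
exact: H.
Qed.

Hypothesis sL : metric_of_signature A sig_lorentzian h.

(** Either b_x vanishes on a whole cube, or it is nonzero at some point of it. In the second case
    the construction moves to that point, so the chart found lies in [O] but need not contain the
    original point. *)
Lemma normal_form_near O U h' w' p m : form O U h' w' -> U p -> form_kernel w' m p != 0 ->
  exists c (v : M), [/\ A c, chart_dom c `<=` O, chart_dom c v & in_normal_form h omega c].
Proof.
move=> L Up n0; have [G [W Ric _]] := local_form_weyl WS EW W0 sL L.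
have [V1 [h1' [q1 [L1 V1q H1]]]] := first_form MA WS L W Ric Up n0.
have [V2 [b [e [q [L2 V2q]]]]] := second_form MA WS EW W0 sL L1 V1q H1.
have [oU bC _ _] := std_form_equations WS EW W0 sL L2.
have [r r0 rV] := open_cube oU V2q.
have [H|/contrapT H] := pselect (~ forall z, cube q r z -> partial ix b z = 0).
  have [z [cz bz]] : exists z, cube q r z /\ partial ix b z != 0.
    apply: contrapT => N; apply: H => z cz; apply/eqP/negPn/negP => bz; by apply: N; exists z.
  have bxC := Ck_partial ix (bC 1%N).
  have [r2 r20 H2] := open_cube (open_neq0 oU bxC) (conj (rV _ cz) bz).
  have s2 : cube z r2 `<=` V2 by move=> y /H2 [].
  have L3 := local_form_sub MA WS L2 (@cube_open R z r2) s2.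
  have [p3 [r3 [b3 [e3 [r30 L4 H4]]]]] := rescale MA WS EW W0 sL L3 r20 (fun y cy => proj2 (H2 y cy)).
  have [p4 [r4 [e4 [r40 L5 H5]]]] := normalise_b MA WS EW W0 sL L4 r30 H4.
  have [p5 [r5 [rf [sf [r50 L6 rC sC H6]]]]] := second_family MA WS EW W0 sL L5 r40 H5.
  apply: (form_in_normal_form L6 r50 rC sC); right => y cy; split; first exact: H6.
  by rewrite h2E.
have L3 := local_form_sub MA WS L2 (@cube_open R q r) rV.
have [p4 [r4 [e4 [r40 L5]]]] := eliminate_b MA WS EW W0 sL L3 r0 H.
have [p5 [r5 [rf [sf [r50 L6 rC sC]]]]] := first_family MA WS EW W0 sL L5 r40.
by apply: (form_in_normal_form L6 r50 rC sC); left => y cy; rewrite h1E.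
Qed.

End LocalClassification.

(** * From local normal forms to the alternative on the manifold *)

Section Global.
Variables (R : realType) (M : topologicalType) (A : set (chart R M)).
Local Notation E := 'rV[R]_3.
Variables (h : chart R M -> E -> 'M[R]_3) (omega : chart R M -> E -> E) (D : chart R M -> connection R).
Hypotheses (MA : smooth_3manifold A) (WS : weyl_structure A h omega D).
Hypotheses (EW : einstein_weyl A h omega) (W0 : vanishing_scalar_curvature A h omega).
Local Opaque partial upd.

(** Restricting a chart to [O] stays within the atlas: this is [chart_change] for the identity
    map. *)
Lemma chart_local_form (O : set M) a : A a -> open O ->
  local_form A h omega O (chart_img a `&` chart_inv a @^-1` O) (h a) (omega a).
Proof.
move=> Aa oO; set U := _ `&` _.
have oU : open U.
  rewrite openE => x [ax Ox]; apply: filterI.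
    by apply: open_nbhs_nbhs; split=> //; exact: chart_img_open.
  by apply: (chart_inv_at ax); exact: open_nbhs_nbhs.
have sU : U `<=` chart_img a by move=> x [].
have [b [Ab bd bU bt]] := chart_change MA Aa (diffeo_id oU) sU.
case: (WS) => -[_ _ hlaw _] [_ wlaw] _ _.
exists b, (fun=> 0); split=> //.
- move=> q bq; have Uq : U (chart_map b q) by rewrite -bU; exists q.
  have [[q' [aq' bq'] q'E] tE] := bt _ Uq.
  have : chart_map b q' = chart_map b q by rewrite -[RHS]tE /transition /= -q'E chart_K.
  move=> /(congr1 (chart_inv b)); rewrite !chart_K // => qE.
  by case: Uq => _; rewrite /preimage /= -q'E chart_K // qE.
- by move=> n; exact: Ck_cst.
move=> x Ux; have [ov tE] := bt _ Ux.
have Jt : jac (transition a b) x = 1%:M.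
  by rewrite -(jacobian_id x); apply: (jacobian_eq_on oU Ux) => y /bt [].
have := hlaw _ _ _ Aa Ab ov; have := wlaw _ _ _ Aa Ab ov.
rewrite /= Jt tE trmx1 mul1mx !mulmx1 expR0 expr1n scale1r => -> ->; split=> //.
have -> : gradient (fun _ : E => 0 : R) x = 0.
  by apply/rowP => i; rewrite !mxE; apply: is_derive_partial; exact: isdC.
by rewrite scaler0 addr0.
Qed.

(** In an orthonormal frame n^p L_p = 0 says that a sum of squares of the components of n is
    zero. *)
Lemma riemannian_flat : metric_of_signature A sig_riemannian h -> flat A D.
Proof.
move=> sR p a Aa ap k l i j; have Ux : chart_img a (chart_map a p) by exists p.
set x := chart_map a p in Ux *.
have W n := chart_weyl WS n Aa; have Ric := chart_ricci WS EW W0 Aa.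
apply: (curvature_flat W Ric Ux) => m.
have [P [Pu PH]] := sR a x Aa Ux.
pose N : E := \row_i form_kernel (omega a) i x.
have [v NE] : exists v, N = v *m P by exists (N *m invmx P); rewrite mulmxKV.
have NH : N *m h a x *m N^T = 0.
  apply/matrixP => i0 j0; rewrite !ord1 [RHS]mxE -[RHS](null_form_null W Ric Ux) mxE.
  rewrite (eq_bigr (fun k => \sum_i form_kernel (omega a) i x * h a x i k * form_kernel (omega a) k x)); last first.
    by move=> b _; rewrite !mxE mulr_suml; apply: eq_bigr => c _; rewrite !mxE.
  rewrite exchange_big; apply: eq_bigr => b _; rewrite /null_form mulr_sumr.
  by apply: eq_bigr => c _; rewrite mulrA.
have vv : v *m v^T = 0.
  rewrite -NH NE.
  have I1 : P *m h a x *m P^T = 1%:M.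
    by rewrite PH; apply/matrixP => a0 b0; rewrite !mxE.
  by rewrite trmx_mul !mulmxA -(mulmxA v P) -(mulmxA v (P *m _)) I1 mulmx1.
have v0 : v = 0.
  have := congr1 (fun B : 'M[R]_1 => B 0 0) vv; rewrite !mxE => s0.
  have sq : \sum_c v 0 c ^+ 2 = 0 by rewrite -[RHS]s0; apply: eq_bigr => c _; rewrite mxE expr2.
  apply/rowP => c; rewrite mxE; apply/eqP; rewrite -(sqrf_eq0 (v 0 c)).
  by move/eqP: sq; rewrite psumr_eq0 => [/allP/(_ c (mem_index_enum _))|d _]; rewrite ?sqr_ge0.
have : N = 0 by rewrite NE v0 mul0mx.
by move/rowP/(_ m); rewrite !mxE.
Qed.

Lemma classification : flat A D \/
  (metric_of_signature A sig_lorentzian h /\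
   exists V : set M,
     [/\ open V,
         [set p | ~ flat_at A D p] `<=` closure V &
         forall p, V p -> exists c : chart R M,
           [/\ A c, chart_dom c p & in_normal_form h omega c]]).
Proof.
have [F|nF] := pselect (flat A D); [by left | right].
have sL : metric_of_signature A sig_lorentzian h.
  by case: (WS) => -[_ _ _ [sR|//]] _ _ _; case: nF; exact: riemannian_flat.
(* As a union of chart domains this set is open; the work is in the density. *)
split=> //; exists [set p | exists c : chart R M, [/\ A c, chart_dom c p & in_normal_form h omega c]].
split=> //.
  rewrite openE => p [c [Ac cp nf]].
  have oc : open_nbhs p (chart_dom c) by split; [exact: chart_open | exact: cp].
  by apply: filterS (open_nbhs_nbhs oc) => q cq; exists c.
(* Nonzero curvature at p makes F nonzero in a chart at p, and [normal_form_near] is applied inside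
   the given neighbourhood. *)
move=> p nfp B; rewrite nbhsE => -[Q [oO Op] OB].
have [a [Aa ap [k [l [i [j c0]]]]]] : exists a, [/\ A a, chart_dom a p &
    exists k l i j, curvature (D a) k l i j (chart_map a p) <> 0].
  apply: contrapT => N; apply: nfp => a Aa ap k l i j; apply: contrapT => c0.
  by apply: N; exists a; split=> //; exists k, l, i, j.
have Ux : chart_img a (chart_map a p) by exists p.
have W n := chart_weyl WS n Aa; have Ric := chart_ricci WS EW W0 Aa.
have [m n0] : exists m, form_kernel (omega a) m (chart_map a p) != 0.
  apply: contrapT => N; apply: c0; apply: (curvature_flat W Ric Ux) => m.
  by apply/eqP/negPn/negP => n0; apply: N; exists m.
have L := chart_local_form Aa oO.
have UO : (chart_img a `&` chart_inv a @^-1` Q) (chart_map a p).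
  by split=> //; rewrite /preimage /= chart_K.
have [c [q [Ac cO cq nf]]] := normal_form_near MA WS EW W0 sL L UO n0.
by exists q; split; [exists c | exact/OB/cO].
Qed.

End Global.

Theorem proposition2 (R : realType) :
  (forall (M : topologicalType) (A : set (chart R M))
      (h : chart R M -> 'rV[R]_3 -> 'M[R]_3)
      (omega : chart R M -> 'rV[R]_3 -> 'rV[R]_3)
      (D : chart R M -> connection R),
    smooth_3manifold A ->
    weyl_structure A h omega D ->
    einstein_weyl A h omega ->
    vanishing_scalar_curvature A h omega ->
    flat A D \/
    (metric_of_signature A sig_lorentzian h /\
     exists V : set M,
       [/\ open V,
           [set p | ~ flat_at A D p] `<=` closure V &
           forall p, V p -> exists c : chart R M,
             [/\ A c, chart_dom c p & in_normal_form h omega c]])) /\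
  (forall (J : set R) (r s : R -> R),
    open J -> C2_on J r -> C2_on J s ->
    forall q : 'rV[R]_3, J (q 0 it) ->
      solution_at (h1 r s) omega_normal q /\
      (q 0 iy != 0 -> solution_at (h2 r s) omega_normal q)).
Proof.
split=> [M A h omega D MA WS EW W0|J r s oJ rC sC q Jq]; first exact: (classification MA WS EW W0).
by split=> [|y0]; [exact: (h1_solution oJ rC sC Jq) | exact: (h2_solution oJ rC sC Jq y0)].
Qed.
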